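(* Let $a_u,b_u,c_u,a_v,b_v,c_v$ be constants and let $N>\frac52$. Consider the Cauchy problem, with initial data prescribed at $t=0$, for the system of unknowns $u,v$ depending on $(t,x)\in[0,\infty)\times\mathbb{R}^3$, written in Fourier variables as $$\begin{cases} \partial_t \widehat{u}+i|\xi|\,\widehat{v}=a_u \widehat{u^2}+b_u\widehat{v^2}+c_u\widehat{uv},\\ \partial_t \widehat{v}+i|\xi|\,\widehat{u}+\widehat{v}=a_v \widehat{u^2}+b_v\widehat{v^2}+c_v\widehat{uv}. \end{cases}$$ There exist $\varepsilon>0$ small enough and a constant $C>0$ such that, for all initial data $(u(0),v(0))$ belonging to $H^N(\mathbb{R}^3)$ for which $$E_N:=\max\left\{\|u(0)\|_{L^1}+\|v(0)\|_{L^1},\ \|u(0)\|_{H^N}+\|v(0)\|_{H^N}\right\}$$ satisfies $E_N\le\varepsilon$, there exists a unique global in time solution $$(u,v)\in C([0,\infty);H^N(\mathbb{R}^3))\cap C^1([0,\infty);H^{N-1}(\mathbb{R}^3)),$$ and it satisfies, for all $t>0$, $$\|u(t)\|_{H^N}\le C\,t^{-\frac34}E_N,\qquad \|v(t)\|_{H^N}\le C\,t^{-\frac54}E_N.$$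
   Context: $\widehat{\cdot}$ denotes the Fourier transform in $x\in\mathbb{R}^3$ (factors of $2\pi$ are not tracked); $|\xi|$ is the Euclidean norm of $\xi\in\mathbb{R}^3$. The constants $\varepsilon$ and $C$ are independent of time and of the initial data. *)

(* Defs.v *)
From HB Require Import structures.
From mathcomp Require Import all_boot all_order all_algebra.
From mathcomp Require Import complex.
From mathcomp Require Import all_classical all_reals all_analysis.

Set Implicit Arguments.
Unset Strict Implicit.
Unset Printing Implicit Defensive.

Import Order.TTheory GRing.Theory Num.Theory.
Import numFieldNormedType.Exports.

Local Open Scope classical_set_scope.
Local Open Scope complex_scope.
Local Open Scope ring_scope.

Notation R3 R := (measurableTypeR R * measurableTypeR R * measurableTypeR R)%type.

Section Euclidean.
Context {R : realType}.
Implicit Types x y : R3 R.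

Definition dot3 x y : R := x.1.1 * y.1.1 + x.1.2 * y.1.2 + x.2 * y.2.

(* The library's norm on a product is the sup norm, hence this definition. *)
Definition norm3 x : R := Num.sqrt (dot3 x x).

End Euclidean.

Definition lebesgue3 (R : realType) : {measure set (R3 R) -> \bar R} :=
  ((@lebesgue_measure R \x @lebesgue_measure R) \x @lebesgue_measure R)%E.
Arguments lebesgue3 : clear implicits.

(* Elements of L^1, L^2 and H^s are represented by functions; equality of such
   elements is equality almost everywhere. Functions are complex-valued: the
   multiplier i|xi| does not preserve real-valued functions. *)
Section FunctionSpaces.
Context {R : realType}.
Implicit Types (f g : R3 R -> R[i]) (s : R).

Definition measurable_complex f : Prop :=
  measurable_fun setT (fun x => complex.Re (f x)) /\
  measurable_fun setT (fun x => complex.Im (f x)).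

Definition LnormC (p : \bar R) f : \bar R :=
  ('N[lebesgue3 R]_p [ (fun x => (ComplexField.Normc.normc (f x))%:E) ])%E.

Definition in_L2 f : Prop := measurable_complex f /\ (LnormC 2%:E f < +oo)%E.

Definition integralC f : R[i] :=
  (\int[lebesgue3 R]_x complex.Re (f x)) +i* (\int[lebesgue3 R]_x complex.Im (f x)).

(* Normalization: kernel exp(-i x.xi), without factors of 2 pi, so that |xi| is
   the symbol of sqrt(-Laplacian). *)
Definition fourier_integral f (xi : R3 R) : R[i] :=
  integralC (fun x => (cos (dot3 x xi) -i* sin (dot3 x xi)) * f x).

Definition truncate (n : nat) f (x : R3 R) : R[i] :=
  if norm3 x <= n%:R then f x else 0.

(* Plancherel: g is the L^2-limit of the Fourier integrals of f 1_{|x| <= n}. *)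
Definition is_fourier f g : Prop :=
  [/\ in_L2 f, in_L2 g &
    (fun n => LnormC 2%:E (fourier_integral (truncate n f) \- g)) @ \oo --> 0%E].

(* The Fourier transform on L^2 (determined almost everywhere); the default
   value 0 is only taken outside L^2. On L^1 `&` L^2 it agrees almost everywhere
   with fourier_integral. *)
Definition fourier f : R3 R -> R[i] := xget (fun=> 0) (is_fourier f).

Definition sobolev_norm s f : \bar R :=
  LnormC 2%:E (fun xi => ((1 + norm3 xi ^+ 2) `^ (s / 2))%:C * fourier f xi).

(* H^s for s >= 0, in which case it is a subspace of L^2. *)
Definition in_sobolev s f : Prop := in_L2 f /\ (sobolev_norm s f < +oo)%E.

End FunctionSpaces.

(* Functions of time with values in H^s: only their values on [0, +oo[ matter. *)
Section TimeRegularity.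
Context {R : realType}.
Implicit Types (u du : R -> R3 R -> R[i]) (s : R).

Definition continuous_in_sobolev s u : Prop :=
  forall t, 0 <= t -> in_sobolev s (u t) /\
    (fun t' => sobolev_norm s (u t' \- u t)) @ within [set t' | 0 <= t'] (nbhs t)
      --> 0%E.

(* At t = 0 the derivative is one-sided. *)
Definition derivative_in_sobolev s u du : Prop :=
  forall t, 0 <= t ->
    (fun h => sobolev_norm s (fun x => (h^-1)%:C * (u (t + h) x - u t x) - du t x))
      @ within [set h | 0 <= t + h] 0^' --> 0%E.

Definition C1_in_sobolev s u du : Prop :=
  [/\ continuous_in_sobolev s u, continuous_in_sobolev s du
    & derivative_in_sobolev s u du].

End TimeRegularity.

Section CauchyProblem.
Context {R : realType}.
Implicit Types (a b c : R[i]) (N : R) (u v du dv : R -> R3 R -> R[i]).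

(* For f, g in H^N with N > 3/2 the products are in L^2, as H^N is contained in
   L^2 and in L^infinity. *)
Definition fourier_quadratic a b c (f g : R3 R -> R[i]) (xi : R3 R) : R[i] :=
  a * fourier (f \* f) xi + b * fourier (g \* g) xi + c * fourier (f \* g) xi.

(* The H^(N-1)-derivatives du, dv commute with the Fourier transform, so that
   fourier (du t) is the time derivative of fourier (u t). *)
Definition solves_system au bu cu av bv cv u v du dv : Prop :=
  forall t, 0 <= t -> {ae lebesgue3 R, forall xi,
    fourier (du t) xi + 'i%C * (norm3 xi)%:C * fourier (v t) xi
      = fourier_quadratic au bu cu (u t) (v t) xi /\
    fourier (dv t) xi + 'i%C * (norm3 xi)%:C * fourier (u t) xi + fourier (v t) xi
      = fourier_quadratic av bv cv (u t) (v t) xi}.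

Definition cauchy_solution au bu cu av bv cv N (u0 v0 : R3 R -> R[i]) u v : Prop :=
  [/\ continuous_in_sobolev N u, continuous_in_sobolev N v,
      {ae lebesgue3 R, forall x, u 0 x = u0 x /\ v 0 x = v0 x}
    & exists du dv, [/\ C1_in_sobolev (N - 1) u du, C1_in_sobolev (N - 1) v dv
                      & solves_system au bu cu av bv cv u v du dv]].

Definition data_size N (u0 v0 : R3 R -> R[i]) : \bar R :=
  maxe (LnormC 1%:E u0 + LnormC 1%:E v0)%E
       (sobolev_norm N u0 + sobolev_norm N v0)%E.

End CauchyProblem.

(* Main.v *)
(* At the frequency k = |xi| the linear part has matrix [[0, -ik], [-ik, -1]].
   Only v is damped, but the coupling makes the energy decay like
   exp(-c t k^2 / (1 + k^2)), as a Lyapunov functional with a small cross term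
   shows, and v gains a factor k at low frequencies. High frequencies thus decay
   exponentially, while at low ones the transform of L^1 data is bounded, and
   exp(-c t k^2) has L^2 norm t^(-3/4) in dimension 3, the factor k giving
   t^(-5/4) for v. Products become convolutions, bounded on H^N by Peetre's
   inequality for the weight and by integrability of transforms of H^N functions;
   by Cauchy-Schwarz they are also bounded pointwise. The quadratic
   terms are therefore O((1+t)^(-3/2)) in both norms. Since this is integrable,
   Duhamel's formula preserves the rates and Picard iteration converges for small
   data. Uniqueness, for arbitrary solutions, comes from Gronwall's inequality for
   the L^2 norm of the difference, the H^N bound of the solutions on [0, T]
   controlling the quadratic terms.

   Plancherel and inversion rest on Abel summation: the transform of
   exp(-e (|x_1| + |x_2| + |x_3|)) is a product of Poisson kernels, which gives
   the upper bound |F f|_2 <= (2 pi)^(3/2) |f|_2, and the inversion formula on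
   boxes, hence everywhere by a Dynkin-class argument. *)

Require Import Defs.
From HB Require Import structures.
From mathcomp Require Import all_boot all_order all_algebra.
From mathcomp Require Import complex.
From mathcomp Require Import all_classical all_reals all_analysis.
From mathcomp Require Import measurable_realfun ring lra.

Set Implicit Arguments.
Unset Strict Implicit.
Unset Printing Implicit Defensive.

Import Order.TTheory GRing.Theory Num.Theory.
Import numFieldNormedType.Exports.

Local Open Scope classical_set_scope.
Local Open Scope complex_scope.
Local Open Scope ring_scope.

(** The problem is solved on the Fourier side, for transforms that are jointly measurable functions
    of (t, xi). Duhamel's integral is then an ordinary time integral at each frequency, and
    Minkowski's integral inequality turns bounds on its integrand into bounds in H^N, without
    integrals of Hilbert-valued functions. The equation loses one derivative, so it cannot give
    continuity in H^N: that comes from continuity at each frequency and a dominating function in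
    H^N. For the derivative in H^(N-1), the mild formulation is first turned, at each frequency,
    into an integrated differential equation by means of the primitives of the propagator. Decay is
    counted in powers of [phi t], which is (1 + |t|)^(-1/4): 3 and 5 are the two rates, 6 is that of
    the quadratic terms, and the fifth power is integrable. The same function in each space variable
    makes the inverse Sobolev weight square integrable. The iteration contracts at the rate 3 for
    both unknowns, and the propagator restores the rate 5 of v at every step. The transform is
    unnormalized, so the constant [K3] appears in the inversion formula and its inverse in the
    transform of a product. *)

Local Notation nc := (@ComplexField.Normc.normc _).

(** * Complex-valued integrals and bounds in L^2 *)

Section Modulus.
Context {R : realType}.
Implicit Types z w : R[i].

Lemma nc_ge0 z : 0 <= nc z.
Proof. by case: z => a b; exact: sqrtr_ge0. Qed.

Lemma nc_sqr z : nc z ^+ 2 = complex.Re z ^+ 2 + complex.Im z ^+ 2.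
Proof. by case: z => a b; rewrite /= sqr_sqrtr// addr_ge0 ?sqr_ge0. Qed.

Lemma ncD z w : nc (z + w) <= nc z + nc w.
Proof. exact: le_normcD. Qed.

Lemma ncM z w : nc (z * w) = nc z * nc w.
Proof. exact: ComplexField.Normc.normcM. Qed.

Lemma nc0 : nc (0 : R[i]) = 0.
Proof. exact: ComplexField.Normc.normc0. Qed.

Lemma ncN z : nc (- z) = nc z.
Proof. exact: normcN. Qed.

Lemma ncB z w : nc (z - w) <= nc z + nc w.
Proof. by rewrite -[in leRHS](ncN w) ncD. Qed.

Lemma nc_distC z w : nc (z - w) = nc (w - z).
Proof. by rewrite -ncN opprB. Qed.

Lemma nc_conj z : nc z^*%C = nc z.
Proof. by case: z => a b /=; rewrite sqrrN. Qed.

Lemma nc_real (x : R) : nc x%:C = `|x|.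
Proof. by rewrite /= expr0n/= addr0 sqrtr_sqr. Qed.

Lemma nc_real_ge0 (x : R) : 0 <= x -> nc x%:C = x.
Proof. by move=> x0; rewrite nc_real ger0_norm. Qed.

Lemma nc_i : nc ('i%C : R[i]) = 1.
Proof. by rewrite /= expr0n/= add0r expr1n sqrtr1. Qed.

Lemma nc_eq0 z : nc z = 0 -> z = 0.
Proof. exact: ComplexField.Normc.eq0_normc. Qed.

Lemma Re_le_nc z : `|complex.Re z| <= nc z.
Proof.
rewrite -(@ler_pXn2r _ 2)// ?nnegrE ?nc_ge0//.
by rewrite nc_sqr real_normK ?num_real// lerDl sqr_ge0.
Qed.

Lemma Im_le_nc z : `|complex.Im z| <= nc z.
Proof.
rewrite -(@ler_pXn2r _ 2)// ?nnegrE ?nc_ge0//.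
by rewrite nc_sqr real_normK ?num_real// lerDr sqr_ge0.
Qed.

Lemma nc_le_ReIm z : nc z <= `|complex.Re z| + `|complex.Im z|.
Proof.
rewrite -(@ler_pXn2r _ 2)// ?nnegrE ?nc_ge0 ?addr_ge0//.
rewrite nc_sqr sqrrD !real_normK ?num_real//.
by rewrite lerD2r lerDl mulrn_wge0// mulr_ge0.
Qed.

Lemma mul_conjC z : z^*%C * z = (nc z ^+ 2)%:C.
Proof. by rewrite nc_sqr; case: z => a b; congr (_ +i* _) => /=; ring. Qed.

Lemma nc_dist z w : `|nc z - nc w| <= nc (z - w).
Proof.
have h (u v : R[i]) : nc u <= nc (u - v) + nc v.
  by rewrite -[in leLHS](subrK v u) ncD.
have := h z w; have := h w z; rewrite (nc_distC w) ler_norml; lra.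
Qed.

Lemma cReM z w : complex.Re (z * w) =
  complex.Re z * complex.Re w - complex.Im z * complex.Im w.
Proof. by case: z; case: w. Qed.

Lemma cImM z w : complex.Im (z * w) =
  complex.Re z * complex.Im w + complex.Im z * complex.Re w.
Proof. by case: z => a b; case: w => c d /=. Qed.

Lemma cReD z w : complex.Re (z + w) = complex.Re z + complex.Re w.
Proof. by case: z; case: w. Qed.

Lemma cImD z w : complex.Im (z + w) = complex.Im z + complex.Im w.
Proof. by case: z; case: w. Qed.

Lemma cReN z : complex.Re (- z) = - complex.Re z.
Proof. by case: z. Qed.

Lemma cImN z : complex.Im (- z) = - complex.Im z.
Proof. by case: z. Qed.

Lemma cRe_conj z : complex.Re z^*%C = complex.Re z.
Proof. by case: z. Qed.

Lemma cIm_conj z : complex.Im z^*%C = - complex.Im z.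
Proof. by case: z. Qed.

Lemma conjM z w : (z * w)^*%C = z^*%C * w^*%C.
Proof. exact: (rmorphM conjc). Qed.

Lemma conj_rc (x : R) : (x%:C)^*%C = x%:C.
Proof. by congr (_ +i* _); rewrite oppr0. Qed.

Lemma rcM (x y : R) : (x * y)%:C = x%:C * y%:C.
Proof. exact: (rmorphM (real_complex R)). Qed.

Lemma rcD (x y : R) : (x + y)%:C = x%:C + y%:C.
Proof. exact: (rmorphD (real_complex R)). Qed.

Lemma rcB (x y : R) : (x - y)%:C = x%:C - y%:C.
Proof. exact: (rmorphB (real_complex R)). Qed.

Lemma complexP z w :
  complex.Re z = complex.Re w -> complex.Im z = complex.Im w -> z = w.
Proof. by case: z => a b; case: w => c d /= -> ->. Qed.

End Modulus.

Section Measurable.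
Context {R : realType} d (T : measurableType d).
Implicit Types f g : T -> R[i].

Definition cmeas f : Prop :=
  measurable_fun setT (fun x => complex.Re (f x)) /\
  measurable_fun setT (fun x => complex.Im (f x)).

Lemma cmeas_cst z : cmeas (fun=> z).
Proof. by split; exact: measurable_cst. Qed.

Lemma cmeas_real (h : T -> R) : measurable_fun setT h -> cmeas (fun x => (h x)%:C).
Proof. by move=> mh; split => //=; exact: measurable_cst. Qed.

Lemma cmeasD f g : cmeas f -> cmeas g -> cmeas (fun x => f x + g x).
Proof.
move=> [f1 f2] [g1 g2]; split.
  by under eq_fun do rewrite cReD; exact: measurable_funD.
by under eq_fun do rewrite cImD; exact: measurable_funD.
Qed.

Lemma cmeasN f : cmeas f -> cmeas (fun x => - f x).
Proof.
move=> [f1 f2]; split.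
  by under eq_fun do rewrite cReN; exact: measurableT_comp.
by under eq_fun do rewrite cImN; exact: measurableT_comp.
Qed.

Lemma cmeasB f g : cmeas f -> cmeas g -> cmeas (fun x => f x - g x).
Proof. by move=> mf mg; apply: cmeasD => //; exact: cmeasN. Qed.

Lemma cmeasM f g : cmeas f -> cmeas g -> cmeas (fun x => f x * g x).
Proof.
move=> [f1 f2] [g1 g2]; split.
  by under eq_fun do rewrite cReM; apply: measurable_funB; exact: measurable_funM.
by under eq_fun do rewrite cImM; apply: measurable_funD; exact: measurable_funM.
Qed.

Lemma cmeas_conj f : cmeas f -> cmeas (fun x => (f x)^*%C).
Proof.
move=> [f1 f2]; split.
  by under eq_fun do rewrite cRe_conj.
by under eq_fun do rewrite cIm_conj; exact: measurableT_comp.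
Qed.

Lemma cmeas_nc f : cmeas f -> measurable_fun setT (fun x => nc (f x)).
Proof.
move=> [f1 f2].
rewrite (_ : (fun _ => _) =
    Num.sqrt \o (fun x => complex.Re (f x) ^+ 2 + complex.Im (f x) ^+ 2)).
  apply: measurableT_comp.
    by apply: continuous_measurable_fun; exact: sqrt_continuous.
  by apply: measurable_funD; exact: measurable_funX.
by apply/funext => x /=; case: (f x).
Qed.

Lemma cmeas_if (b : T -> bool) f g : measurable_fun setT b ->
  cmeas f -> cmeas g -> cmeas (fun x => if b x then f x else g x).
Proof.
move=> mb [f1 f2] [g1 g2]; split.
  rewrite (_ : (fun _ => _) =
    fun x => if b x then complex.Re (f x) else complex.Re (g x)).
    exact: measurable_fun_ifT.
  by apply/funext => x; case: ifP.
rewrite (_ : (fun _ => _) =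
  fun x => if b x then complex.Im (f x) else complex.Im (g x)).
  exact: measurable_fun_ifT.
by apply/funext => x; case: ifP.
Qed.

End Measurable.

Lemma cmeas_comp {R : realType} d1 d2 (T1 : measurableType d1)
    (T2 : measurableType d2) (h : T1 -> T2) (f : T2 -> R[i]) :
  measurable_fun setT h -> cmeas f -> cmeas (fun x => f (h x)).
Proof.
move=> mh [f1 f2]; split.
  exact: (measurableT_comp (f := fun x => complex.Re (f x)) f1 mh).
exact: (measurableT_comp (f := fun x => complex.Im (f x)) f2 mh).
Qed.

Section Integral.
Context {R : realType} d (T : measurableType d) (mu : {measure set T -> \bar R}).
Implicit Types (f g : T -> R[i]) (a b : R).

Definition IC f : R[i] :=
  (\int[mu]_x complex.Re (f x)) +i* (\int[mu]_x complex.Im (f x)).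

(* Norm bounds are predicates with an explicit real bound, which keeps extended
   reals out of the estimates. *)
Definition L1b f a := cmeas f /\ (\int[mu]_x (nc (f x))%:E <= a%:E)%E.

Definition cint f := cmeas f /\ (\int[mu]_x (nc (f x))%:E < +oo)%E.

Lemma L1b_cint f a : L1b f a -> cint f.
Proof. by move=> [mf fa]; split => //; exact: (le_lt_trans fa (ltry _)). Qed.

Lemma mnc f : cmeas f -> measurable_fun setT (fun x => (nc (f x))%:E).
Proof. by move=> mf; apply/measurable_EFinP; exact: cmeas_nc. Qed.

Lemma cint_L1b f : cint f -> exists a, L1b f a.
Proof.
move=> [mf fo]; exists (fine (\int[mu]_x (nc (f x))%:E)); split => //.
rewrite fineK// ge0_fin_numE//.
by apply: integral_ge0 => x _; rewrite lee_fin nc_ge0.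
Qed.

Lemma cint_integrable f : cint f -> mu.-integrable setT (fun x => (nc (f x))%:E).
Proof.
move=> [mf fo]; apply/integrableP; split; first exact: mnc.
by under eq_integral => x _ do rewrite gee0_abs ?lee_fin ?nc_ge0//.
Qed.

Lemma cint_Re f : cint f -> mu.-integrable setT (fun x => (complex.Re (f x))%:E).
Proof.
move=> fi; apply: (le_integrable measurableT _ _ (cint_integrable fi)).
  by apply/measurable_EFinP; case: fi => -[].
by move=> x _ /=; rewrite lee_fin (ger0_norm (nc_ge0 _)) Re_le_nc.
Qed.

Lemma cint_Im f : cint f -> mu.-integrable setT (fun x => (complex.Im (f x))%:E).
Proof.
move=> fi; apply: (le_integrable measurableT _ _ (cint_integrable fi)).
  by apply/measurable_EFinP; case: fi => -[].
by move=> x _ /=; rewrite lee_fin (ger0_norm (nc_ge0 _)) Im_le_nc.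
Qed.

Lemma cint_dom f (h : T -> R) : cmeas f ->
  measurable_fun setT h -> (\int[mu]_x (h x)%:E < +oo)%E ->
  (forall x, nc (f x) <= h x) -> cint f.
Proof.
move=> mf mh hoo fh; split => //; apply: le_lt_trans hoo.
apply: ge0_le_integral => //.
- by move=> x _; rewrite lee_fin nc_ge0.
- exact: mnc.
- exact/measurable_EFinP.
- by move=> x _; rewrite lee_fin.
Qed.

Lemma eq_IC f g : (forall x, f x = g x) -> IC f = IC g.
Proof. by move=> fg; congr IC; apply/funext. Qed.

Lemma ae_eq_IC f g : cmeas f -> cmeas g -> {ae mu, forall x, f x = g x} ->
  IC f = IC g.
Proof.
move=> [f1 f2] [g1 g2] fg; congr (_ +i* _); rewrite /Rintegral; congr fine.
  apply: ae_eq_integral => //; [exact/measurable_EFinP|exact/measurable_EFinP|].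
  by apply: filterS fg => x -> _.
apply: ae_eq_integral => //; [exact/measurable_EFinP|exact/measurable_EFinP|].
by apply: filterS fg => x -> _.
Qed.

Lemma cintD f g : cint f -> cint g -> cint (fun x => f x + g x).
Proof.
move=> [mf fo] [mg go].
apply: (@cint_dom _ (fun x => nc (f x) + nc (g x))) => //.
- exact: cmeasD.
- by apply: measurable_funD; exact: cmeas_nc.
- under eq_integral do rewrite EFinD.
  rewrite ge0_integralD//; try exact: mnc.
  + exact: lte_add_pinfty.
  + by move=> x _; rewrite lee_fin nc_ge0.
  + by move=> x _; rewrite lee_fin nc_ge0.
- by move=> x; exact: ncD.
Qed.

Lemma int_ncZ z f : cmeas f ->
  (\int[mu]_x (nc (z * f x))%:E = (nc z)%:E * \int[mu]_x (nc (f x))%:E)%E.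
Proof.
move=> mf; under eq_integral do rewrite ncM EFinM.
rewrite ge0_integralZl//; first exact: mnc.
  by move=> x _; rewrite lee_fin nc_ge0.
by rewrite lee_fin nc_ge0.
Qed.

Lemma cintZ z f : cint f -> cint (fun x => z * f x).
Proof.
move=> [mf fo]; split; first by apply: cmeasM => //; exact: cmeas_cst.
by rewrite int_ncZ// lte_mul_pinfty// lee_fin nc_ge0.
Qed.

Lemma cintN f : cint f -> cint (fun x => - f x).
Proof.
move=> [mf fo]; split; first exact: cmeasN.
by under eq_integral do rewrite ncN.
Qed.

Lemma cint_conj f : cint f -> cint (fun x => (f x)^*%C).
Proof.
move=> [mf fo]; split; first exact: cmeas_conj.
by under eq_integral do rewrite nc_conj.
Qed.

Lemma cint_boundM f g b : cint f -> cmeas g -> (forall x, nc (g x) <= b) ->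
  cint (fun x => g x * f x).
Proof.
move=> [mf fo] mg gb.
apply: (@cint_dom _ (fun x => b * nc (f x))) => //.
- exact: cmeasM.
- by apply: measurable_funM => //; exact: cmeas_nc.
- under eq_integral do rewrite EFinM.
  have [b0|b0] := leP 0 b.
    rewrite ge0_integralZl//; first by rewrite lte_mul_pinfty.
      exact: mnc.
    by move=> x _; rewrite lee_fin nc_ge0.
  suff /eq_integral -> : {in setT, forall x, (b%:E * (nc (f x))%:E = cst 0 x)%E}.
    by rewrite integral0.
  by move=> x _ /=; move: (le_lt_trans (le_trans (nc_ge0 _) (gb x)) b0); rewrite ltxx.
- by move=> x; rewrite ncM ler_wpM2r// nc_ge0.
Qed.

Lemma ICD f g : cint f -> cint g -> IC (fun x => f x + g x) = IC f + IC g.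
Proof.
move=> fi gi; rewrite /IC /GRing.add/=; congr (_ +i* _).
  under eq_Rintegral do rewrite cReD.
  by rewrite RintegralD//; exact: cint_Re.
under eq_Rintegral do rewrite cImD.
by rewrite RintegralD//; exact: cint_Im.
Qed.

Lemma IC0 : IC (fun=> 0) = 0.
Proof. by rewrite /IC/= !Rintegral_cst//= mul0r. Qed.

Lemma ICZ z f : cint f -> IC (fun x => z * f x) = z * IC f.
Proof.
move=> fi; have f1 := cint_Re fi; have f2 := cint_Im fi.
apply: complexP; rewrite ?cReM ?cImM/=.
  under eq_Rintegral do rewrite cReM.
  rewrite RintegralB//= ?RintegralZl//.
    exact: (integrableZl measurableT (complex.Re z) f1).
  exact: (integrableZl measurableT (complex.Im z) f2).
under eq_Rintegral do rewrite cImM.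
rewrite RintegralD//= ?RintegralZl//.
  exact: (integrableZl measurableT (complex.Re z) f2).
exact: (integrableZl measurableT (complex.Im z) f1).
Qed.

Lemma ICN f : cint f -> IC (fun x => - f x) = - IC f.
Proof.
move=> fi; rewrite -mulN1r -ICZ//.
by apply: eq_IC => x; rewrite mulN1r.
Qed.

Lemma ICB f g : cint f -> cint g -> IC (fun x => f x - g x) = IC f - IC g.
Proof. by move=> fi gi; rewrite ICD ?ICN//; exact: cintN. Qed.

Lemma IC_conj f : cint f -> IC (fun x => (f x)^*%C) = (IC f)^*%C.
Proof.
move=> fi; apply: complexP; rewrite ?cRe_conj ?cIm_conj /=.
  by under eq_Rintegral do rewrite cRe_conj.
under eq_Rintegral do rewrite cIm_conj -mulN1r.
by rewrite RintegralZl ?mulN1r//; exact: cint_Im.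
Qed.

(* Multiplying by the conjugate of the value of the integral reduces the
   triangle inequality to the real part. *)
Lemma IC_le f : cint f -> ((nc (IC f))%:E <= \int[mu]_x (nc (f x))%:E)%E.
Proof.
move=> fi; set z := IC f.
have [z0|z0] := eqVneq (nc z) 0.
  by rewrite z0 integral_ge0// => x _; rewrite lee_fin nc_ge0.
have zp : 0 < nc z by rewrite lt_neqAle eq_sym z0 nc_ge0.
have h : complex.Re (IC (fun x => z^*%C * f x)) = nc z ^+ 2.
  by rewrite ICZ// mul_conjC.
rewrite -(@lee_pmul2l _ (nc z)%:E)//.
rewrite -EFinM -expr2 -h -[in leRHS](nc_conj z) -int_ncZ; last by case: fi.
have gi := @cintZ z^*%C _ fi.
rewrite /IC /= /Rintegral fineK; last first.
  by apply: integrable_fin_num => //; exact: cint_Re.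
apply: le_integral => //; [exact: cint_Re|exact: cint_integrable|].
by move=> x _; rewrite lee_fin (le_trans (ler_norm _))// Re_le_nc.
Qed.

Lemma L1b_IC f a : L1b f a -> nc (IC f) <= a.
Proof.
move=> fa; rewrite -lee_fin (le_trans (IC_le (L1b_cint fa)))//.
by case: fa.
Qed.

End Integral.

Section LTwo.
Context {R : realType} d (T : measurableType d) (mu : {measure set T -> \bar R}).
Implicit Types (f g : T -> R[i]) (h k : T -> R) (a b : R).

Lemma Lnorm2_le h a : measurable_fun setT h -> 0 <= a ->
  (('N[mu]_2%:E[EFin \o h] <= a%:E) = (\int[mu]_x (h x ^+ 2)%:E <= (a ^+ 2)%:E))%E.
Proof.
move=> mh a0.
have -> : (\int[mu]_x (h x ^+ 2)%:E = 'N[mu]_2%:E[EFin \o h] `^ 2)%E.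
  rewrite powR_Lnorm//; apply: eq_integral => x _ /=.
  by rewrite powR_mulrn// real_normK// num_real.
have := Lnorm_ge0 mu 2%:E (EFin \o h).
case: ('N[mu]_2%:E[EFin \o h])%E => [r| |]//=.
  rewrite !lee_fin => r0; rewrite powR_mulrn// ler_pXn2r// nnegrE.
by move=> _; rewrite pnatr_eq0 leye_eq.
Qed.

(** The number [a] is any upper bound, not the norm itself; its sign is recorded so that squares can
    be compared. *)
Definition L2b f a :=
  [/\ cmeas f, 0 <= a & (\int[mu]_x (nc (f x) ^+ 2)%:E <= (a ^+ 2)%:E)%E].

Lemma L2b_N2 f a : L2b f a <->
  [/\ cmeas f, 0 <= a & ('N[mu]_2%:E[(fun x => (nc (f x))%:E)] <= a%:E)%E].
Proof.
split=> -[mf a0 fa]; split => //.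
  by rewrite (@Lnorm2_le (fun x => nc (f x)))//; exact: cmeas_nc.
by rewrite -(@Lnorm2_le (fun x => nc (f x)))//; exact: cmeas_nc.
Qed.

Lemma mnc2 f : cmeas f -> measurable_fun setT (fun x => (nc (f x) ^+ 2)%:E).
Proof.
by move=> mf; apply/measurable_EFinP; apply: measurable_funX; exact: cmeas_nc.
Qed.

Lemma L2b_cmeas f a : L2b f a -> cmeas f. Proof. by case. Qed.

Lemma L2b_ge0 f a : L2b f a -> 0 <= a. Proof. by case. Qed.

Lemma L2b_le f a b : L2b f a -> a <= b -> L2b f b.
Proof.
move=> [mf a0 fa] ab; split => //; first exact: le_trans ab.
by rewrite (le_trans fa)// lee_fin ler_pXn2r// ?nnegrE// (le_trans a0).
Qed.

Lemma L2b0 : L2b (fun=> 0) 0.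
Proof.
split => //.
by under eq_integral do rewrite nc0 expr0n/=; rewrite integral0 expr0n.
Qed.

Lemma L2b_ae f g a : L2b f a -> cmeas g ->
  {ae mu, forall x, nc (g x) <= nc (f x)} -> L2b g a.
Proof.
move=> [mf a0 fa] mg gf; split => //; apply: le_trans fa.
apply: ae_ge0_le_integral => //; try exact: mnc2.
- by move=> x _; rewrite lee_fin sqr_ge0.
- by move=> x _; rewrite lee_fin sqr_ge0.
- by apply: filterS gf => x gf _; rewrite lee_fin ler_pXn2r// ?nnegrE// nc_ge0.
Qed.

Lemma L2b_dom f g a : L2b f a -> cmeas g ->
  (forall x, nc (g x) <= nc (f x)) -> L2b g a.
Proof. by move=> fa mg gf; apply: L2b_ae fa mg _; exact: aeW. Qed.

Lemma L2b_ae_eq f g a : L2b f a -> cmeas g ->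
  {ae mu, forall x, g x = f x} -> L2b g a.
Proof. by move=> fa mg gf; apply: L2b_ae fa mg _; apply: filterS gf => x ->. Qed.

Lemma L2bD f g a b : L2b f a -> L2b g b -> L2b (fun x => f x + g x) (a + b).
Proof.
move=> /L2b_N2[mf a0 fa] /L2b_N2[mg b0 gb].
have mfg : measurable_fun setT ((fun x => nc (f x)) \+ (fun x => nc (g x))).
  by apply: measurable_funD; exact: cmeas_nc.
apply: (@L2b_dom (fun x => (nc (f x) + nc (g x))%:C)).
- apply/L2b_N2; split; [exact: cmeas_real|exact: addr_ge0|].
  rewrite (_ : (fun _ => _) =
      EFin \o ((fun x => nc (f x)) \+ (fun x => nc (g x)))); last first.
    by apply/funext => x; rewrite nc_real_ge0// addr_ge0 ?nc_ge0.
  rewrite EFinD; apply: le_trans (leeD fa gb).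
  apply: (@minkowski_EFin _ _ _ mu _ _ 2) => //; try exact: cmeas_nc.
  by rewrite ler1n.
- exact: cmeasD.
- move=> x; rewrite nc_real ger0_norm ?ncD// addr_ge0 ?nc_ge0//.
Qed.

Lemma L2bZ f z a : L2b f a -> L2b (fun x => z * f x) (nc z * a).
Proof.
move=> [mf a0 fa]; split; first by apply: cmeasM => //; exact: cmeas_cst.
  by rewrite mulr_ge0// nc_ge0.
under eq_integral do rewrite ncM exprMn EFinM.
rewrite ge0_integralZl//.
- by rewrite exprMn [leRHS]EFinM lee_pmul// ?lee_fin ?sqr_ge0// integral_ge0// => x _; rewrite lee_fin sqr_ge0.
- exact: mnc2.
- by move=> x _; rewrite lee_fin sqr_ge0.
- by rewrite lee_fin sqr_ge0.
Qed.

Lemma L2bN f a : L2b f a -> L2b (fun x => - f x) a.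
Proof.
move=> fa; apply: (L2b_dom fa); first by apply: cmeasN; case: fa.
by move=> x; rewrite ncN.
Qed.

Lemma L2bB f g a b : L2b f a -> L2b g b -> L2b (fun x => f x - g x) (a + b).
Proof. by move=> fa /L2bN; exact: L2bD. Qed.

Lemma L2b_conj f a : L2b f a -> L2b (fun x => (f x)^*%C) a.
Proof.
move=> fa; apply: (L2b_dom fa); first by apply: cmeas_conj; case: fa.
by move=> x; rewrite nc_conj.
Qed.

Lemma CS f g a b : L2b f a -> L2b g b -> L1b mu (fun x => f x * g x) (a * b).
Proof.
move=> /L2b_N2[mf a0 fa] /L2b_N2[mg b0 gb]; split; first exact: cmeasM.
have := @hoelder _ _ _ mu (fun x => nc (f x)) (fun x => nc (g x)) 2 2
  (cmeas_nc mf) (cmeas_nc mg) (ltr0Sn _ _) (ltr0Sn _ _) _.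
move=> /(_ ltac:(lra)).
rewrite Lnorm1; under eq_integral.
  move=> x _; rewrite /= ger0_norm ?mulr_ge0 ?nc_ge0// -ncM; over.
move=> /le_trans; apply.
by rewrite EFinM lee_pmul// ?Lnorm_ge0.
Qed.

Lemma L2b_eq0 f : L2b f 0 -> {ae mu, forall x, f x = 0}.
Proof.
move=> [mf _]; rewrite expr0n/= => f0.
have /(ae_eq_integral_abs _ measurableT (mnc2 mf)) :
    (\int[mu]_x `|(nc (f x) ^+ 2)%:E| = 0)%E.
  apply/eqP; rewrite eq_le integral_ge0// andbT.
  by under eq_integral do rewrite gee0_abs ?lee_fin ?sqr_ge0//.
apply: filterS => x /(_ I)/= [] /eqP.
by rewrite sqrf_eq0 => /eqP /nc_eq0.
Qed.

Lemma L2b_inf f : cmeas f -> (forall e, 0 < e -> L2b f e) -> L2b f 0.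
Proof.
move=> mf fe; split => //; rewrite expr0n/=; apply/lee_addgt0Pr => e e0.
have [_ _] := fe (Num.sqrt e) ltac:(by rewrite sqrtr_gt0).
by rewrite sqr_sqrtr ?(ltW e0)// => h; rewrite add0e.
Qed.

End LTwo.

(** * Fubini's theorem and Minkowski's integral inequality *)

Section ParametricIntegral.
Context {R : realType} d1 d2 (S : measurableType d1) (T : measurableType d2).
Implicit Types F : S * T -> R[i].

(** No integrability is assumed: Tonelli makes the integrals of the positive and negative parts
    measurable, and where they are infinite [fine] returns a default value, which keeps
    measurability. *)
Lemma cmeas_IC2 (nu : {sigma_finite_measure set T -> \bar R}) F : cmeas F -> cmeas (fun s => IC nu (fun t => F (s, t))).
Proof.
have key (H : S * T -> R) : measurable_fun setT H ->
    measurable_fun setT (fun s => \int[nu]_t H (s, t)).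
  move=> mH; apply: (measurableT_comp (fine_measurable measurableT)).
  have mE : measurable_fun setT (EFin \o H) by exact/measurable_EFinP.
  under eq_fun do rewrite integralE.
  apply: emeasurable_funB.
    have h := @measurable_fun_fubini_tonelli_F _ _ _ _ _ nu _ (measurable_funepos mE).
    rewrite (_ : (fun _ => _) = fubini_F nu (EFin \o H)^\+%E).
      by apply: h => x; exact: funepos_ge0.
    by apply/funext => x; apply: eq_integral => y _; rewrite !funeposE.
  have h := @measurable_fun_fubini_tonelli_F _ _ _ _ _ nu _ (measurable_funeneg mE).
  rewrite (_ : (fun _ => _) = fubini_F nu (EFin \o H)^\-%E).
      by apply: h => x; exact: funeneg_ge0.
    by apply/funext => x; apply: eq_integral => y _; rewrite !funenegE.
move=> [F1 F2]; split.
  exact: (key (fun x => complex.Re (F x))).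
exact: (key (fun x => complex.Im (F x))).
Qed.

Lemma cmeas_pair2 F s : cmeas F -> cmeas (fun t => F (s, t)).
Proof. by move=> mF; apply: (cmeas_comp _ mF); exact: pair1_measurable. Qed.

Lemma cmeas_pair1 F t : cmeas F -> cmeas (fun s => F (s, t)).
Proof. by move=> mF; apply: (cmeas_comp _ mF); exact: pair2_measurable. Qed.

End ParametricIntegral.

Section FubiniC.
Context {R : realType} d1 d2 (S : measurableType d1) (T : measurableType d2).
Variables (mu : {sigma_finite_measure set S -> \bar R})
  (nu : {sigma_finite_measure set T -> \bar R}).
Implicit Types F : S * T -> R[i].

Lemma cmeas_IC1 F : cmeas F -> cmeas (fun t => IC mu (fun s => F (s, t))).
Proof.
move=> mF; apply: (@cmeas_IC2 _ _ _ _ _ mu (fun x => F (x.2, x.1))).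
by apply: (cmeas_comp _ mF); exact: measurable_fun_pair.
Qed.

Lemma tonelli_nc F : cmeas F ->
  (\int[mu]_s \int[nu]_t (nc (F (s, t)))%:E =
   \int[nu]_t \int[mu]_s (nc (F (s, t)))%:E)%E.
Proof.
move=> mF; apply: (fubini_tonelli (fun x => (nc (F x))%:E)); first exact: mnc.
by move=> x; rewrite lee_fin nc_ge0.
Qed.

Lemma ae_cint F : cmeas F ->
  (\int[nu]_t \int[mu]_s (nc (F (s, t)))%:E < +oo)%E ->
  {ae mu, forall s, cint nu (fun t => F (s, t))}.
Proof.
move=> mF Foo.
have : (mu \x nu)%E.-integrable setT (fun x => (nc (F x))%:E).
  apply/integrable21ltyP; first exact: mnc.
  under eq_integral do under eq_integral do rewrite gee0_abs ?lee_fin ?nc_ge0//.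
  exact: Foo.
move=> /ae_integrable1; apply: filterS => s /integrableP[_ h].
split; first exact: cmeas_pair2.
congr (_ < _)%E: h.
by apply: eq_integral => x _; rewrite gee0_abs ?lee_fin ?nc_ge0.
Qed.

(** The inner integrals are real numbers obtained through [fine]; they agree with the extended ones
    only almost everywhere, where the slice is integrable, and this is enough for the outer
    integral. *)
Lemma IC_swap F : cmeas F ->
  (\int[nu]_t \int[mu]_s (nc (F (s, t)))%:E < +oo)%E ->
  IC mu (fun s => IC nu (fun t => F (s, t))) =
  IC nu (fun t => IC mu (fun s => F (s, t))).
Proof.
move=> mF Foo.
have key (H : S * T -> R) : measurable_fun setT H ->
    (forall x, `|H x| <= nc (F x)) ->
    \int[mu]_s \int[nu]_t H (s, t) = \int[nu]_t \int[mu]_s H (s, t).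
  move=> mH HF.
  have iH : (mu \x nu)%E.-integrable setT (EFin \o H).
    apply: (@le_integrable _ _ _ _ _ _ _ (fun x => (nc (F x))%:E)) => //.
    - exact/measurable_EFinP.
    - by move=> x _; rewrite /= lee_fin (ger0_norm (nc_ge0 _)).
    - apply/integrable21ltyP; first exact: mnc.
      by under eq_integral do under eq_integral do rewrite gee0_abs ?lee_fin ?nc_ge0//.
  rewrite /Rintegral; congr fine.
  transitivity (\int[mu]_s \int[nu]_t (H (s, t))%:E)%E.
    apply: ae_eq_integral => //.
    - apply: measurableT_comp => //; apply: measurableT_comp.
        exact: fine_measurable.
      exact: measurable_fubini_F iH.
    - exact: measurable_fubini_F iH.
    - apply: filterS (ae_integrable1 iH) => s hs _.
      by rewrite fineK//; exact: integrable_fin_num hs.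
  rewrite (Fubini iH).
  apply: ae_eq_integral => //.
  - exact: measurable_fubini_G iH.
  - apply: measurableT_comp => //; apply: measurableT_comp.
      exact: fine_measurable.
    exact: measurable_fubini_G iH.
  - apply: filterS (ae_integrable2 iH) => t ht _.
    by rewrite fineK//; exact: integrable_fin_num ht.
case: mF => F1 F2; apply: complexP => /=.
  by apply: (key (fun x => complex.Re (F x))) => // x; exact: Re_le_nc.
by apply: (key (fun x => complex.Im (F x))) => // x; exact: Im_le_nc.
Qed.

(** Minkowski's integral inequality, without duality: the square of the integral of |F(s, t)| in s
    is a double integral over s and s', and Cauchy-Schwarz in t bounds each pair by [n s * n s'].
    This lemma carries every norm estimate of an integral that is defined pointwise. *)
Lemma minkowski_int F (n : S -> R) c : cmeas F ->
  measurable_fun setT n -> (forall s, L2b nu (fun t => F (s, t)) (n s)) ->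
  (\int[mu]_s (n s)%:E <= c%:E)%E ->
  {ae nu, forall t, cint mu (fun s => F (s, t))} /\
  L2b nu (fun t => IC mu (fun s => F (s, t))) c.
Proof.
move=> mF mn Fn nc_.
have n0 s : 0 <= n s by exact: L2b_ge0 (Fn s).
have c0 : 0 <= c.
  by rewrite -lee_fin (le_trans _ nc_)// integral_ge0// => s _; rewrite lee_fin.
have m1 t : measurable_fun setT (fun s => (nc (F (s, t)))%:E).
  exact/mnc/cmeas_pair1.
have m2 s : measurable_fun setT (fun t => (nc (F (s, t)))%:E).
  exact/mnc/cmeas_pair2.
have F0 x : (0 <= (nc (F x))%:E)%E by rewrite lee_fin nc_ge0.
pose h t := (\int[mu]_s (nc (F (s, t)))%:E)%E.
have h0 t : (0 <= h t)%E by rewrite integral_ge0.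
have mh : measurable_fun setT h.
  by apply: (measurable_fun_fubini_tonelli_G (fun x => (nc (F x))%:E)) => //; exact: mnc.
(* One of the two factors [h] is expanded, with s held fixed; the other is expanded in [hh]. *)
have inner s : (\int[nu]_t ((nc (F (s, t)))%:E * h t) <= (n s)%:E * c%:E)%E.
  rewrite [leLHS](_ : _ =
    \int[nu]_t \int[mu]_s' (nc (F (s, t) * F (s', t)))%:E)%E; last first.
    apply: eq_integral => t _; rewrite -ge0_integralZl//.
    by apply: eq_integral => s' _; rewrite ncM.
  have mFF : cmeas (fun x : S * T => F (s, x.2) * F x).
    apply: cmeasM => //; apply: (cmeas_comp (h := snd) (f := fun t => F (s, t))) => //.
    exact: cmeas_pair2.
  rewrite -(@tonelli_nc (fun x => F (s, x.2) * F x))//=.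
  apply: (@le_trans _ _ (\int[mu]_s' ((n s)%:E * (n s')%:E))%E).
    apply: ge0_le_integral => //.
    - by move=> s' _; rewrite integral_ge0// => t _; rewrite lee_fin nc_ge0.
    - apply: (measurable_fun_fubini_tonelli_F
        (fun x => (nc (F (s, x.2) * F x))%:E)); first exact: mnc.
      by move=> x; rewrite lee_fin nc_ge0.
    - by apply/measurable_EFinP; exact: measurable_funM.
    - by move=> s' _; rewrite -EFinM; case: (CS (Fn s) (Fn s')).
  rewrite ge0_integralZl//; last 3 first.
  - exact/measurable_EFinP.
  - by move=> x _; rewrite lee_fin.
  - by rewrite lee_fin.
  by rewrite lee_wpmul2l// lee_fin.
have hh : (\int[nu]_t (h t * h t) <= (c ^+ 2)%:E)%E.
  rewrite [leLHS](_ : _ = \int[nu]_t \int[mu]_s ((nc (F (s, t)))%:E * h t))%E; last first.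
    by apply: eq_integral => t _; rewrite -ge0_integralZr.
  have mFh : measurable_fun setT (fun x : S * T => (nc (F x))%:E * h x.2)%E.
    by apply: emeasurable_funM; [exact: mnc|exact: measurableT_comp].
  have Fh0 x : (0 <= (nc (F x))%:E * h x.2)%E by rewrite mule_ge0.
  rewrite -(fubini_tonelli (fun x => (nc (F x))%:E * h x.2)%E)//=.
  apply: (@le_trans _ _ (\int[mu]_s ((n s)%:E * c%:E))%E).
    apply: ge0_le_integral => //.
    - by move=> s _; rewrite integral_ge0// => t _; exact: (Fh0 (s, t)).
    - exact: (measurable_fun_fubini_tonelli_F (fun x => (nc (F x))%:E * h x.2)%E).
    - by apply/measurable_EFinP; exact: measurable_funM.
  rewrite ge0_integralZr//; last 2 first.
  - exact/measurable_EFinP.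
  - by move=> x _; rewrite lee_fin.
  by rewrite expr2 EFinM lee_wpmul2r// lee_fin.
have mhh : measurable_fun setT (fun t => h t * h t)%E by exact: emeasurable_funM.
(* Square integrability of [h] makes it finite almost everywhere, hence almost every slice
   integrable. *)
have hfin : {ae nu, forall t, (h t < +oo)%E}.
  have : nu.-integrable setT (fun t => h t * h t)%E.
    apply/integrableP; split => //.
    under eq_integral do rewrite gee0_abs ?mule_ge0//.
    exact: le_lt_trans hh (ltry _).
  move=> /(integrable_ae measurableT); apply: filterS => t /(_ I).
  by move: (h0 t); case: (h t) => [r| |]//=; rewrite ?ltry ?mulyy.
have Fae : {ae nu, forall t, cint mu (fun s => F (s, t))}.
  apply: filterS hfin => t ht; split; last exact: ht.
  exact: cmeas_pair1.
split => //; split => //; first exact: cmeas_IC1.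
apply: le_trans hh; apply: ae_ge0_le_integral => //.
- by move=> x _; rewrite lee_fin sqr_ge0.
- by apply: mnc2; exact: cmeas_IC1.
- by move=> x _; rewrite mule_ge0.
- apply: filterS Fae => t ht _; rewrite expr2 EFinM.
  by apply: lee_pmul; rewrite ?lee_fin ?nc_ge0//; exact: IC_le.
Qed.

End FubiniC.

(** * Limit theorems and completeness of L^2 *)

Section Convergence.
Context {R : realType} d (T : measurableType d) (mu : {measure set T -> \bar R}).
Implicit Types (f : nat -> T -> R[i]) (g : T -> R[i]) (a e : R).

Definition ccvg (z : nat -> R[i]) (l : R[i]) : Prop :=
  (fun n => nc (z n - l)) @ \oo --> (0 : R).

Lemma ccvg_le (z : nat -> R[i]) l (e : nat -> R) :
  (forall n, nc (z n - l) <= e n) -> e @ \oo --> (0 : R) -> ccvg z l.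
Proof.
move=> ze e0; apply: (squeeze_cvgr _ (cvg_cst 0) e0).
by near=> n; rewrite nc_ge0 ze.
Unshelve. all: by end_near. Qed.

Lemma ccvg_nc (z : nat -> R[i]) l : ccvg z l -> (fun n => nc (z n)) @ \oo --> nc l.
Proof.
move=> zl; apply/cvgrPdist_lt => e e0; move/cvgrPdist_lt/(_ _ e0) : zl.
apply: filterS => n; rewrite sub0r normrN ger0_norm ?nc_ge0// => h.
by rewrite distrC (le_lt_trans (nc_dist _ _)).
Qed.

Lemma ccvg_Re (z : nat -> R[i]) l : ccvg z l ->
  (fun n => complex.Re (z n)) @ \oo --> complex.Re l.
Proof.
move=> zl; apply/cvgrPdist_lt => e e0; move/cvgrPdist_lt/(_ _ e0) : zl.
apply: filterS => n; rewrite sub0r normrN ger0_norm ?nc_ge0// => h.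
by rewrite distrC (le_lt_trans _ h)// -cReN -cReD Re_le_nc.
Qed.

Lemma ccvg_Im (z : nat -> R[i]) l : ccvg z l ->
  (fun n => complex.Im (z n)) @ \oo --> complex.Im l.
Proof.
move=> zl; apply/cvgrPdist_lt => e e0; move/cvgrPdist_lt/(_ _ e0) : zl.
apply: filterS => n; rewrite sub0r normrN ger0_norm ?nc_ge0// => h.
by rewrite distrC (le_lt_trans _ h)// -cImN -cImD Im_le_nc.
Qed.

Lemma ccvg_ReIm (z : nat -> R[i]) l :
  (fun n => complex.Re (z n)) @ \oo --> complex.Re l ->
  (fun n => complex.Im (z n)) @ \oo --> complex.Im l -> ccvg z l.
Proof.
move=> zr zi; apply: (@ccvg_le _ _
  (fun n => `|complex.Re (z n) - complex.Re l| + `|complex.Im (z n) - complex.Im l|)).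
  by move=> n; rewrite -!cReN -!cImN -cReD -cImD nc_le_ReIm.
rewrite -[0 in X in _ --> X]addr0; apply: cvgD.
  by apply/norm_cvg0P/subr_cvg0.
by apply/norm_cvg0P/subr_cvg0.
Qed.

Lemma L2b_fatou f g a : (forall n, cmeas (f n)) -> cmeas g ->
  (\forall n \near \oo, L2b mu (f n) a) ->
  {ae mu, forall x, ccvg (f ^~ x) (g x)} -> L2b mu g a.
Proof.
move=> mf mg [N _ fa] fg; split => //.
  by have [] := fa N (leqnn N).
pose F n x := (nc (f n x) ^+ 2)%:E.
have mF n : measurable_fun setT (F n) by exact: mnc2.
have F0 n x : (0 <= F n x)%E by rewrite lee_fin sqr_ge0.
apply: (@le_trans _ _ (\int[mu]_x limn_einf (F ^~ x))%E).
  apply: ae_ge0_le_integral => //.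
  - by move=> x _; rewrite lee_fin sqr_ge0.
  - exact: mnc2.
  - move=> x _; rewrite limn_einf_lim; apply: lime_ge; first exact: is_cvg_einfs.
    by near=> n; apply: le_ereal_inf_tmp => _ [m _ <-].
  - rewrite (_ : (fun _ => _) = fun x => (- limn_esup (fun n => - F n x))%E).
      apply: measurableT_comp => //.
      by apply: measurable_fun_limn_esup => n; exact: measurableT_comp.
    by apply/funext => x; rewrite -limn_einfN; congr limn_einf; apply/funext => n; exact: (esym (oppeK _)).
  - apply: filterS fg => x fx _.
    have : F ^~ x @ \oo --> (nc (g x) ^+ 2)%:E.
      by apply/fine_cvgP; split; [exact: nearW|apply: cvgM; exact: ccvg_nc].
    by move=> /cvg_limn_einf_sup[-> _].
apply: le_trans (fatou mu measurableT mF (fun n x _ => F0 n x)) _.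
rewrite limn_einf_lim; apply: lime_le; first exact: is_cvg_einfs.
near=> n.
apply: le_trans (_ : (\int[mu]_x F (maxn n N) x <= _)%E).
  by apply: ereal_inf_lbound; exists (maxn n N) => //=; exact: leq_maxl.
by have [] := fa (maxn n N) (leq_maxr n N).
Unshelve. all: by end_near. Qed.

Lemma L2_dct f g h a : (forall n, cmeas (f n)) -> cmeas g -> L2b mu h a ->
  {ae mu, forall x, ccvg (f ^~ x) (g x)} ->
  (forall n x, nc (f n x) <= nc (h x)) ->
  forall e, 0 < e -> \forall n \near \oo, L2b mu (fun x => f n x - g x) e.
Proof.
move=> mf mg ha fg fh e e0.
have mh : cmeas h by case: ha.
have gh : {ae mu, forall x, nc (g x) <= nc (h x)}.
  apply: filterS fg => x /ccvg_nc fx.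
  apply: (@ler_cvg_to _ _ _ _ (fun n => nc (f n x)) (fun=> nc (h x))) fx (cvg_cst _) _.
  exact: nearW.
pose G x := ((2 * nc (h x)) ^+ 2)%:E.
have iG : mu.-integrable setT G.
  have /(@L2bZ _ _ _ _ _ 2%:C)[mh2 _ h2] := ha.
  apply/integrableP; split.
    apply/measurable_EFinP; apply: measurable_funX; apply: measurable_funM => //.
    exact: cmeas_nc.
  apply: le_lt_trans (ltry ((nc (2%:C : R[i]) * a) ^+ 2)); apply: le_trans h2.
  apply: ge0_le_integral => //.
  - apply/measurable_EFinP; apply: measurableT_comp => //.
    apply: measurable_funX; apply: measurable_funM => //; exact: cmeas_nc.
  - exact: mnc2.
  - move=> x _; rewrite /G gee0_abs ?lee_fin ?sqr_ge0// ncM nc_real_ge0//.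
have [] := @dominated_convergence _ _ _ mu setT measurableT
   (fun n x => (nc (f n x - g x) ^+ 2)%:E) (cst 0%E) G.
- by move=> n; apply: mnc2; exact: cmeasB.
- exact: measurable_cst.
- apply: filterS fg => x fx _; apply/fine_cvgP; split; first exact: nearW.
  rewrite -[0 in X in _ --> X](mulr0 0).
  by rewrite [X in X @ _](_ : _ = fun k => nc (f k x - g x) * nc (f k x - g x))//; exact: cvgM.
- exact: iG.
- apply: filterS gh => x gx n _.
  rewrite gee0_abs ?lee_fin ?sqr_ge0// ler_pXn2r// ?nnegrE ?mulr_ge0 ?nc_ge0//.
  by rewrite (le_trans (ncB _ _))// mulr2n mulrDl !mul1r lerD.
move=> _ _; rewrite integral0 => /fine_cvgP[fin] /cvgrPdist_lt/(_ (e ^+ 2)).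
rewrite exprn_gt0// => /(_ isT) lt.
near=> n; split; [exact: cmeasB|exact: ltW|].
have fn : (\int[mu]_x (nc (f n x - g x) ^+ 2)%:E)%E \is a fin_num by near: n.
rewrite -(fineK fn) lee_fin ltW//; near: n; apply: filterS lt => n.
rewrite sub0r normrN; exact: le_lt_trans (ler_norm _).
Unshelve. all: by end_near. Qed.

Lemma IC_dct f g (h : T -> R) : (forall n, cmeas (f n)) -> cmeas g ->
  measurable_fun setT h -> (\int[mu]_x (h x)%:E < +oo)%E ->
  {ae mu, forall x, ccvg (f ^~ x) (g x)} ->
  (forall n x, nc (f n x) <= h x) ->
  ccvg (fun n => IC mu (f n)) (IC mu g).
Proof.
move=> mf mg mh hoo fg fh.
have ih : mu.-integrable setT (EFin \o h).
  apply/integrableP; split; first exact/measurable_EFinP.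
  under eq_integral => x _ do
    rewrite gee0_abs ?lee_fin ?(le_trans (nc_ge0 _) (fh 0%N x))//.
  exact: hoo.
have key (p : R[i] -> R) : (forall z, `|p z| <= nc z) ->
    (forall n, measurable_fun setT (fun x => p (f n x))) ->
    measurable_fun setT (fun x => p (g x)) ->
    {ae mu, forall x, (fun n => p (f n x)) @ \oo --> p (g x)} ->
    (fun n => \int[mu]_x p (f n x)) @ \oo --> \int[mu]_x p (g x).
  move=> pz mpf mpg pfg.
  have [] := @dominated_convergence _ _ _ mu setT measurableT
    (fun n x => (p (f n x))%:E) (fun x => (p (g x))%:E) (EFin \o h).
  - by move=> n; exact/measurable_EFinP.
  - exact/measurable_EFinP.
  - by apply: filterS pfg => x fx _; apply/fine_cvgP; split; [exact: nearW|].
  - exact: ih.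
  - by apply: aeW => x n _; rewrite lee_fin (le_trans (pz _)).
  move=> ig _; have fi := integrable_fin_num measurableT ig.
  by rewrite -[X in _ --> X]fineK// => /fine_cvgP[].
apply: ccvg_ReIm; apply: key.
- exact: Re_le_nc.
- by move=> n; case: (mf n).
- by case: mg.
- by apply: filterS fg => x /ccvg_Re.
- exact: Im_le_nc.
- by move=> n; case: (mf n).
- by case: mg.
- by apply: filterS fg => x /ccvg_Im.
Qed.

(* A total, measurable choice of pointwise limit: an upper limit in each
   component. *)
Definition clim f (x : T) : R[i] :=
  fine (limn_esup (fun n => (complex.Re (f n x))%:E)) +i*
  fine (limn_esup (fun n => (complex.Im (f n x))%:E)).

Lemma clim_cvg f x l : ccvg (f ^~ x) l -> clim f x = l.
Proof.
have key (h : nat -> R) (b : R) : h @ \oo --> b ->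
    fine (limn_esup (EFin \o h)) = b.
  move=> hb; have : (EFin \o h) @ \oo --> b%:E by apply/fine_cvgP; split; [exact: nearW|].
  by move=> /cvg_limn_einf_sup[_ ->].
by move=> fl; apply: complexP; apply: key; [exact: ccvg_Re|exact: ccvg_Im].
Qed.

Lemma cmeas_clim f : (forall n, cmeas (f n)) -> cmeas (clim f).
Proof.
move=> mf; split; apply: (measurableT_comp (fine_measurable measurableT)).
  by apply: measurable_fun_limn_esup => n; apply/measurable_EFinP; case: (mf n).
by apply: measurable_fun_limn_esup => n; apply/measurable_EFinP; case: (mf n).
Qed.

Lemma cauchy_ccvg (z : nat -> R[i]) (D : nat -> R) :
  (forall n, nc (z n.+1 - z n) <= D n) ->
  cvgn (series D) -> exists l, ccvg z l.
Proof.
move=> zD cD.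
have key (p : R[i] -> R) : (forall u v, p (u - v) = p u - p v) ->
    (forall u, `|p u| <= nc u) -> exists b : R, (fun n => p (z n)) @ \oo --> b.
  move=> pB pn.
  have : cvgn (series (fun n => p (z n.+1) - p (z n))).
    apply: normed_cvg; apply: series_le_cvg cD => n //=.
      exact: le_trans (nc_ge0 _) (zD n).
    by rewrite -pB; exact: le_trans (pn _) (zD n).
  rewrite (_ : series _ = fun n => p (z n) - p (z 0%N)); last first.
    by apply/funext => n; rewrite /series/= telescope_sumr.
  move=> /cvg_ex[b hb]; exists (b + p (z 0%N)).
  rewrite (_ : (fun n => p (z n)) = fun n => p (z n) - p (z 0%N) + p (z 0%N)).
    by apply: cvgD => //; exact: cvg_cst.
  by apply/funext => n; rewrite subrK.
have [b hb] := key (@complex.Re R) (fun u v => ltac:(by rewrite cReD cReN)) (@Re_le_nc R).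
have [c hc] := key (@complex.Im R) (fun u v => ltac:(by rewrite cImD cImN)) (@Im_le_nc R).
by exists (b +i* c); exact: ccvg_ReIm.
Qed.

Lemma cmeas_telescope f : cmeas (f 0%N) ->
  (forall n, cmeas (fun x => f n.+1 x - f n x)) -> forall n, cmeas (f n).
Proof.
move=> f0 fS; elim=> [//|n mn].
rewrite (_ : f n.+1 = fun x => f n.+1 x - f n x + f n x); first exact: cmeasD.
by apply/funext => x; rewrite subrK.
Qed.

Lemma L2b_telescope f (e : nat -> R) : (forall n, cmeas (f n)) ->
  (forall n, L2b mu (fun x => f n.+1 x - f n x) (e n)) ->
  forall n m, L2b mu (fun x => f (n + m)%N x - f n x) (\sum_(n <= k < n + m) e k).
Proof.
move=> mf fe n; elim=> [|m IH].
  rewrite addn0 big_geq//; apply: (L2b_dom (L2b0 mu)); first exact: cmeasB.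
  by move=> x; rewrite subrr.
rewrite addnS big_nat_recr ?leq_addr//= addrC.
apply: L2b_dom (L2bD (fe _) IH) _ _ => [|x]; first exact: cmeasB.
by rewrite addrA subrK.
Qed.

(** The partial sums of the moduli of the increments are bounded in L^2, so by monotone convergence
    they stay bounded at almost every point and the telescoping series converges absolutely there.
    Fatou's lemma carries the geometric tail bound to the limit. The explicit rate is what the
    Picard iteration needs. *)
Lemma riesz_fischer f c : cmeas (f 0%N) ->
  (forall n, L2b mu (fun x => f n.+1 x - f n x) (c / 2 ^+ n)) ->
  {ae mu, forall x, ccvg (f ^~ x) (clim f x)} /\
  forall n, L2b mu (fun x => clim f x - f n x) (2 * c / 2 ^+ n).
Proof.
move=> mf0 fc.
have mf : forall n, cmeas (f n) by apply: cmeas_telescope => // n; case: (fc n).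
have c0 : 0 <= c by have := L2b_ge0 (fc 0%N); rewrite expr0 divr1.
have p2 n : 0 < 2 ^+ n :> R by rewrite exprn_gt0.
have geo n m : \sum_(n <= k < n + m) c / 2 ^+ k <= 2 * c / 2 ^+ n.
  have -> : \sum_(n <= k < n + m) c / 2 ^+ k = 2 * c / 2 ^+ n - 2 * c / 2 ^+ (n + m).
    elim: m => [|m IH]; first by rewrite addn0 big_geq// subrr.
    rewrite addnS big_nat_recr ?leq_addr//= IH exprS.
    by field; rewrite !gt_eqF.
  by rewrite gerBl divr_ge0 ?mulr_ge0// ltW.
pose D k x := nc (f k.+1 x - f k x).
pose P m x := \sum_(0 <= k < m) D k x.
have D0 k x : 0 <= D k x by exact: nc_ge0.
have P0 m x : 0 <= P m x by apply: sumr_ge0.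
have LP m : L2b mu (fun x => (P m x)%:C) (2 * c).
  have h : L2b mu (fun x => (P m x)%:C) (\sum_(0 <= k < m) c / 2 ^+ k).
    elim: m => [|m IH].
      by rewrite big_geq//; under eq_fun do rewrite /P big_geq//; exact: L2b0.
    rewrite big_nat_recr//=; have mD : cmeas (fun x => (D m x)%:C).
      by apply/cmeas_real/cmeas_nc; case: (fc m).
    have /(L2bD IH) : L2b mu (fun x => (D m x)%:C) (c / 2 ^+ m).
      by apply: L2b_dom (fc m) _ _ => // x; rewrite nc_real_ge0.
    congr L2b; apply/funext => x; rewrite /P big_nat_recr//=.
    by rewrite rmorphD.
  by apply: L2b_le h _; have := geo 0%N m; rewrite add0n expr0 divr1.
have Pae : {ae mu, forall x, cvgn (series (D ^~ x))}.
  pose g m x := ((P m x) ^+ 2)%:E.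
  have gE m : g m = fun x => (nc (P m x)%:C ^+ 2)%:E.
    by apply/funext => x; rewrite nc_real_ge0.
  have mg m : measurable_fun setT (g m) by rewrite gE; apply: mnc2; case: (LP m).
  have g0 m x : (0 <= g m x)%E by rewrite lee_fin sqr_ge0.
  have ndP x : nondecreasing_seq (P ^~ x).
    apply/nondecreasing_seqP => m; rewrite /P big_nat_recr//= lerDl//.
  have ndg x : nondecreasing_seq (g ^~ x).
    by move=> m n mn; rewrite lee_fin ler_pXn2r ?nnegrE//; exact: ndP.
  have gle : (\int[mu]_x limn (g ^~ x) <= ((2 * c) ^+ 2)%:E)%E.
    rewrite monotone_convergence//.
    apply: lime_le; last first.
      by apply: nearW => m; rewrite gE; case: (LP m).
    apply: ereal_nondecreasing_is_cvgn => m n mn.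
    by apply: ge0_le_integral => // x _; exact: ndg.
  have lg0 x : (0 <= limn (g ^~ x))%E.
    by apply: lime_ge; [exact: ereal_nondecreasing_is_cvgn|exact: nearW].
  have : mu.-integrable setT (fun x => limn (g ^~ x)).
    apply/integrableP; split.
      apply: (emeasurable_fun_cvg g) => // x _.
      exact: ereal_nondecreasing_is_cvgn.
    under eq_integral do rewrite gee0_abs//.
    exact: le_lt_trans gle (ltry _).
  move=> /(integrable_ae measurableT); apply: filterS => x /(_ I) fx.
  apply: nondecreasing_is_cvgn; first exact: ndP.
  (* A bound on the square bounds the partial sum itself, since p <= 1 + p^2. *)
  exists (1 + fine (limn (g ^~ x))) => _ [m _ <-].
  have : ((P m x ^+ 2)%:E <= limn (g ^~ x))%E.
    apply: lime_ge; first exact: ereal_nondecreasing_is_cvgn.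
    by exists m => // n /= mn; exact: ndg.
  rewrite -(fineK fx) lee_fin => h.
  rewrite -[series _ m]/(P m x); nra.
have cae : {ae mu, forall x, ccvg (f ^~ x) (clim f x)}.
  apply: filterS Pae => x cx.
  have [l fl] := @cauchy_ccvg (f ^~ x) (D ^~ x) (fun n => lexx _) cx.
  by rewrite (clim_cvg fl).
split => // n; apply: (@L2b_fatou (fun m x => f (n + m)%N x - f n x)).
- by move=> m; exact: cmeasB.
- by apply: cmeasB => //; exact: cmeas_clim.
- by apply: nearW => m; exact: L2b_le (L2b_telescope mf fc n m) (geo n m).
- apply: filterS cae => x fx; rewrite /ccvg.
  under eq_fun do rewrite opprB addrA subrK.
  apply/cvgrPdist_lt => e e0; move/cvgrPdist_lt : fx => /(_ _ e0)[N _ h].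
  by exists N => // m /= Nm; apply: h => /=; rewrite (leq_trans Nm)// leq_addl.
Qed.

(** A subsequence with geometric increments converges by [riesz_fischer]; the Cauchy property then
    carries the whole sequence along. *)
Lemma L2_complete f : (forall n, cmeas (f n)) ->
  (forall e, 0 < e -> exists N, forall n m, (N <= n)%N -> (N <= m)%N ->
     L2b mu (fun x => f n x - f m x) e) ->
  exists2 g, cmeas g & forall e, 0 < e ->
    \forall n \near \oo, L2b mu (fun x => f n x - g x) e.
Proof.
move=> mf fe.
have e0 j : 0 < 1 / 2 ^+ j :> R by rewrite divr_gt0// exprn_gt0.
have /choice[N hN] : forall j, exists N, forall n m, (N <= n)%N -> (N <= m)%N ->
     L2b mu (fun x => f n x - f m x) (1 / 2 ^+ j).
  by move=> j; exact: fe (e0 j).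
(* Summing the ranks makes [k] nondecreasing while it still dominates every [N j]. *)
pose k j := (\sum_(0 <= i < j.+1) N i)%N.
have kN j : (N j <= k j)%N by rewrite /k big_nat_recr//= leq_addl.
have kS j : (k j <= k j.+1)%N by rewrite /k [leqRHS]big_nat_recr//= leq_addr.
have [_ hg] := @riesz_fischer (fun j => f (k j)) 1 (mf _)
  (fun j => hN j _ _ (leq_trans (kN j) (kS j)) (kN j)).
set g := clim _ in hg.
have mg : cmeas g by exact: cmeas_clim.
exists g => // e e_gt0.
have [j hj] : exists j, 3 / 2 ^+ j < e.
  have : (fun j => (3 : R) * (2^-1) ^+ j) @ \oo --> (3 * 0 : R).
    by apply: cvgMr; apply: cvg_expr; rewrite ger0_norm ?invf_lt1// ltr1n.
  rewrite mulr0 => /cvgrPdist_lt/(_ _ e_gt0)[j _ /(_ j (leqnn j))] /=.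
  rewrite sub0r normrN => h; exists j.
  by rewrite -exprVn (le_lt_trans (ler_norm _)).
exists (N j) => // n /= Nn.
have := L2bB (hN j n (k j) Nn (kN j)) (hg j).
rewrite (_ : 1 / 2 ^+ j + _ = 3 / 2 ^+ j); last by ring.
move=> h; apply: L2b_le (ltW hj); apply: L2b_dom h _ _; first exact: cmeasB.
by move=> x; rewrite opprB addrA subrK.
Qed.

End Convergence.

(** * Lebesgue measure on R^3 *)

Section MeasurePreserving.
Context {R : realType} d (T : measurableType d).
Variable mu : {measure set T -> \bar R}.

Definition mpres (phi : T -> T) : Prop := measurable_fun setT phi /\
  forall A, measurable A -> mu (phi @^-1` A) = mu A.

Lemma mpres_comp phi psi : mpres phi -> mpres psi -> mpres (psi \o phi).
Proof.
move=> [mphi hphi] [mpsi hpsi]; split; first exact: measurableT_comp.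
move=> A mA; rewrite comp_preimage hphi ?hpsi//.
by rewrite -[_ @^-1` _]setTI; exact: mpsi.
Qed.

Lemma mpres_int phi (f : T -> \bar R) : mpres phi -> measurable_fun setT f ->
  (forall x, (0 <= f x)%E) -> (\int[mu]_x f (phi x) = \int[mu]_x f x)%E.
Proof.
move=> [mphi hphi] mf f0.
transitivity (\int[pushforward mu phi]_x f x)%E.
  by rewrite ge0_integral_pushforward// preimage_setT.
by apply: eq_measure_integral => A mA _; exact: hphi.
Qed.

Lemma mpres_cint phi (f : T -> R[i]) : mpres phi -> cint mu f ->
  cint mu (fun x => f (phi x)).
Proof.
move=> hphi [mf fo]; split; first by apply: cmeas_comp mf; case: hphi.
rewrite (@mpres_int _ (fun x => (nc (f x))%:E))//; first exact: mnc.
by move=> x; rewrite lee_fin nc_ge0.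
Qed.

Lemma mpres_IC phi (f : T -> R[i]) : mpres phi -> cmeas f ->
  IC mu (fun x => f (phi x)) = IC mu f.
Proof.
move=> hphi [m1 m2].
have key (p : T -> R) : measurable_fun setT p ->
    \int[mu]_x p (phi x) = \int[mu]_x p x.
  move=> mp; rewrite /Rintegral; congr fine.
  have mE : measurable_fun setT (EFin \o p) by exact/measurable_EFinP.
  rewrite [LHS]integralE [RHS]integralE; congr (_ - _)%E.
    have := @mpres_int phi (EFin \o p)^\+%E hphi (measurable_funepos mE) (fun=> funepos_ge0 _ _).
    by move=> <-; apply: eq_integral => x _; rewrite !funeposE.
  have := @mpres_int phi (EFin \o p)^\-%E hphi (measurable_funeneg mE) (fun=> funeneg_ge0 _ _).
  by move=> <-; apply: eq_integral => x _; rewrite !funenegE.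
by apply: complexP => /=; [exact: (key (fun x => complex.Re (f x)))|
  exact: (key (fun x => complex.Im (f x)))].
Qed.

Lemma mpres_L2b phi (f : T -> R[i]) a : mpres phi -> L2b mu f a ->
  L2b mu (fun x => f (phi x)) a.
Proof.
move=> hphi [mf a0 fa]; split => //; first by apply: cmeas_comp mf; case: hphi.
rewrite (@mpres_int _ (fun x => (nc (f x) ^+ 2)%:E))//; first exact: mnc2.
by move=> x; rewrite lee_fin sqr_ge0.
Qed.

End MeasurePreserving.

Section ProductMeasure.
Context {R : realType} d1 d2 (T1 : measurableType d1) (T2 : measurableType d2).
Variables (m1 : {sigma_finite_measure set T1 -> \bar R})
  (m2 : {sigma_finite_measure set T2 -> \bar R}).

Lemma product_sigma_finite : sigma_finite setT (m1 \x m2)%E.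
Proof.
have /sigma_finiteP[F [TF ndF F_fin]] := sigma_finiteT m1.
have /sigma_finiteP[G [TG ndG G_fin]] := sigma_finiteT m2.
exists (fun n => F n `*` G n).
  apply/seteqP; split => [[x y] _|//].
  have [i _ Fi] : (\bigcup_n F n) x by rewrite -TF.
  have [j _ Gj] : (\bigcup_n G n) y by rewrite -TG.
  exists (maxn i j) => //; split => /=.
    by move: Fi; exact/subsetPset/ndF/leq_maxl.
  by move: Gj; exact/subsetPset/ndG/leq_maxr.
move=> n; have [mF Foo] := F_fin n; have [mG Goo] := G_fin n; split.
  exact: measurableX.
by rewrite product_measure1E// lte_mul_pinfty// ge0_fin_numE.
Qed.

Definition sfprod : {sigma_finite_measure set (T1 * T2)%type -> \bar R} :=
  HB.pack (m1 \x m2)%E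
    (Measure_isSigmaFinite.Build _ _ _ (m1 \x m2)%E product_sigma_finite).

Lemma mpres_prod phi psi : mpres m1 phi -> mpres m2 psi ->
  mpres sfprod (fun x => (phi x.1, psi x.2)).
Proof.
move=> [mphi hphi] [mpsi hpsi].
have mpp : measurable_fun setT (fun x : T1 * T2 => (phi x.1, psi x.2)).
  by apply: measurable_fun_pair; exact: measurableT_comp.
split => // A mA.
rewrite -[LHS]/(pushforward (m1 \x m2)%E (fun x => (phi x.1, psi x.2)) A).
apply/esym; apply: (@product_measure_unique _ _ _ _ _ _ _
  (pushforward (m1 \x m2)%E (fun x => (phi x.1, psi x.2)))) => //.
move=> B C mB mC; rewrite /pushforward.
rewrite -[LHS]/((m1 \x m2)%E ((phi @^-1` B) `*` (psi @^-1` C))).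
rewrite product_measure1E ?hphi ?hpsi//.
  by rewrite -[_ @^-1` _]setTI; exact: mphi.
by rewrite -[_ @^-1` _]setTI; exact: mpsi.
Qed.

End ProductMeasure.

Section Lebesgue3.
Context {R : realType}.

(** Convertible to [lebesgue3], but with the sigma-finite structure on which the Fubini lemmas
    rest. *)
Definition leb3 : {sigma_finite_measure set (R3 R) -> \bar R} :=
  sfprod (sfprod (@lebesgue_measure R) (@lebesgue_measure R)) (@lebesgue_measure R).

(** The image measure agrees with Lebesgue measure on half-open intervals, and these determine
    it. *)
Lemma mpres_shift1 (a : R) :
  @mpres R _ (measurableTypeR R) lebesgue_measure (fun x => x + a).
Proof.
have ma : measurable_fun setT (fun x : measurableTypeR R => x + a : measurableTypeR R).
  exact: measurable_funD.
split=> // A mA.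
apply/esym.
rewrite -[RHS]/(pushforward lebesgue_measure
  (fun x : measurableTypeR R => x + a : measurableTypeR R) A).
apply: lebesgue_measure_unique => // X.
case=> -[b c] /= bc <-; rewrite /pushforward.
have -> : (fun x => x + a) @^-1` `]b, c] = `]b - a, c - a]%classic.
  by apply/seteqP; split => x /=; rewrite !in_itv/= ltrBlDr lerBrDr.
rewrite !lebesgue_measure_itv/= !lte_fin ltrD2r; case: ifPn => // _.
by rewrite -!EFinB opprB addrA subrK.
Qed.

Lemma mpres_opp1 : @mpres R _ (measurableTypeR R) lebesgue_measure (fun x => - x).
Proof.
have ma : measurable_fun setT (fun x : measurableTypeR R => - x : measurableTypeR R).
  exact: measurableT_comp.
split=> // A mA.
apply/esym.
rewrite -[RHS]/(pushforward lebesgue_measure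
  (fun x : measurableTypeR R => - x : measurableTypeR R) A).
apply: lebesgue_measure_unique => // X.
case=> -[b c] /= bc <-; rewrite /pushforward.
have -> : (fun x => - x) @^-1` `]b, c] = `[- c, - b[%classic.
  by apply/seteqP; split => x /=; rewrite !in_itv/= lerNl ltrNr andbC.
rewrite !lebesgue_measure_itv/= !lte_fin ltrN2; case: ifPn => // _.
by rewrite -!EFinB opprK addrC.
Qed.

Definition sub3 (x y : R3 R) : R3 R :=
  ((x.1.1 - y.1.1, x.1.2 - y.1.2), x.2 - y.2).

Lemma mpres_subr (a : R3 R) : mpres leb3 (sub3^~ a).
Proof.
exact: (mpres_prod (mpres_prod (mpres_shift1 (- a.1.1)) (mpres_shift1 (- a.1.2)))
  (mpres_shift1 (- a.2))).
Qed.

Lemma mpres_subl (a : R3 R) : mpres leb3 (sub3 a).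
Proof.
have key (b : R) : @mpres R _ (measurableTypeR R) lebesgue_measure (fun x => b - x).
  have := mpres_comp mpres_opp1 (mpres_shift1 b).
  by congr mpres; apply/funext => x /=; rewrite addrC.
exact: (mpres_prod (mpres_prod (key a.1.1) (key a.1.2)) (key a.2)).
Qed.

Lemma measurable_sub3 d (T : measurableType d) (f g : T -> R3 R) :
  measurable_fun setT f -> measurable_fun setT g ->
  measurable_fun setT (fun x => sub3 (f x) (g x)).
Proof.
move=> mf mg; apply: measurable_fun_pair.
  apply: measurable_fun_pair.
    by apply: measurable_funB; do 2 apply: measurableT_comp => //.
  by apply: measurable_funB; do 2 apply: measurableT_comp => //.
by apply: measurable_funB; apply: measurableT_comp.
Qed.

End Lebesgue3.

(** * Explicit one-dimensional integrals *)

Section Calculus.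
Context {R : realType}.
Implicit Types (F f g : R -> R) (a b c e t x l : R).

Lemma is_derive_continuous F f : (forall x, is_derive x 1 F (f x)) -> continuous F.
Proof.
move=> Ff x; apply: differentiable_continuous; apply/derivable1_diffP.
by have [] := Ff x.
Qed.

Lemma contM f g : continuous f -> continuous g -> continuous (fun x => f x * g x).
Proof. by move=> cf cg x; exact: cvgM (cf x) (cg x). Qed.

Lemma contD f g : continuous f -> continuous g -> continuous (fun x => f x + g x).
Proof. by move=> cf cg x; exact: cvgD (cf x) (cg x). Qed.

Lemma cont_cst c : continuous (fun _ : R => c).
Proof. by move=> x; exact: cvg_cst. Qed.

Lemma cont_expn e : continuous (fun x : R => expR (- e * `|x|)).
Proof.
move=> x; apply: (@continuous_comp _ _ _ (fun x => - e * `|x|) expR).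
  by apply: (contM (@cont_cst _)); exact: norm_continuous.
exact: continuous_expR.
Qed.

Lemma FTC_itv F f a b : a <= b -> continuous f ->
  (forall x, is_derive x 1 F (f x)) ->
  (\int[lebesgue_measure]_(x in `[a, b]) (f x)%:E = (F b - F a)%:E)%E.
Proof.
rewrite le_eqVlt => /predU1P[->|ab] cf Ff.
  by rewrite set_itv1 integral_set1 subrr.
rewrite (continuous_FTC2 (F := F))//.
- exact: continuous_subspaceT.
- have cF := is_derive_continuous Ff; split.
  + by move=> x _; have [] := Ff x.
  + exact/cvg_at_right_filter/cF.
  + exact/cvg_at_left_filter/cF.
- by move=> x _; have := @derive_val _ _ _ _ _ _ _ (Ff x); rewrite derive1E.
Qed.

Lemma FTC_y F f a l : continuous f -> (forall x, a <= x -> 0 <= f x) ->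
  (forall x, is_derive x 1 F (f x)) -> F x @[x --> +oo] --> l ->
  (\int[lebesgue_measure]_(x in `[a, +oo[) (f x)%:E = (l - F a)%:E)%E.
Proof.
move=> cf f0 Ff Fl; rewrite (ge0_continuous_FTC2y (F := F) (l := l))//.
- exact: continuous_subspaceT.
- exact/cvg_at_right_filter/(is_derive_continuous Ff).
- by move=> x _; have := @derive_val _ _ _ _ _ _ _ (Ff x); rewrite derive1E.
Qed.

Lemma int_even f : (forall x, 0 <= f x) -> continuous f -> (forall x, f (- x) = f x) ->
  (\int[lebesgue_measure]_x (f x)%:E =
   2%:E * \int[lebesgue_measure]_(x in `[0%R, +oo[) (f x)%:E)%E.
Proof.
move=> f0 cf fN; rewrite ge0_symfun_integralT//.
  by congr (_ * integral _ _ _)%E; apply/seteqP; split => x /=; rewrite in_itv/= andbT.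
by move=> x /=; rewrite fN.
Qed.

Lemma is_derive_mull c x : is_derive x 1 (fun y : R => c * y) c.
Proof.
have := @is_deriveZ _ _ _ id c x 1 1 _.
by rewrite /GRing.scale/= mulr1; apply.
Qed.

Lemma is_derive_expM c x : is_derive x 1 (fun y => expR (c * y)) (c * expR (c * x)).
Proof.
rewrite mulrC.
exact: (is_derive1_comp (is_derive_expR (c * x)) (is_derive_mull c x)).
Qed.

Lemma is_derive_sinM c x : is_derive x 1 (fun y => sin (c * y)) (c * cos (c * x)).
Proof.
rewrite mulrC.
exact: (is_derive1_comp (is_derive_sin (c * x)) (is_derive_mull c x)).
Qed.

Lemma is_derive_cosM c x : is_derive x 1 (fun y => cos (c * y)) (- (c * sin (c * x))).
Proof.
rewrite mulrC -mulNr.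
exact: (is_derive1_comp (is_derive_cos (c * x)) (is_derive_mull c x)).
Qed.

Lemma is_derive_prod F g x a b : is_derive x 1 F a -> is_derive x 1 g b ->
  is_derive x 1 (fun y => F y * g y) (a * g x + F x * b).
Proof.
move=> Fa gb; have := is_deriveM Fa gb.
by rewrite /GRing.scale/= addrC (mulrC (g x)).
Qed.

Lemma is_derive_add F g x a b : is_derive x 1 F a -> is_derive x 1 g b ->
  is_derive x 1 (fun y => F y + g y) (a + b).
Proof. by move=> Fa gb; exact: is_deriveD. Qed.

Lemma is_derive_scal c F x a : is_derive x 1 F a ->
  is_derive x 1 (fun y => c * F y) (c * a).
Proof. by move=> Fa; exact: is_deriveZ. Qed.

Lemma cvgy_exp e : 0 < e -> expR (- e * x) @[x --> +oo] --> (0 : R).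
Proof.
move=> e0; under eq_fun do rewrite mulNr.
have h : e * x @[x --> +oo] --> +oo.
  by under eq_fun do rewrite mulrC; apply: (gt0_cvgMly e0); exact: cvg_id.
exact: (cvg_comp (fun x => e * x) (fun y => expR (- y)) h (@cvgr_expR R)).
Qed.

Lemma int_exp e : 0 < e ->
  (\int[lebesgue_measure]_x (expR (- e * `|x|))%:E = (2 / e)%:E)%E.
Proof.
move=> e0; have cn := @cont_expn e.
rewrite int_even//; first last.
- by move=> x; rewrite normrN.
rewrite [X in (_ * X)%E](_ : _ =
    \int[lebesgue_measure]_(x in `[0%R, +oo[) (expR (- e * x))%:E)%E; last first.
  by apply: eq_integral => x; rewrite inE/= in_itv/= andbT => x0; rewrite ger0_norm.
have h1 := is_derive_continuous (@is_derive_expM (- e)).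
have h2 x : is_derive x 1 (fun x => - e^-1 * expR (- e * x)) (expR (- e * x)).
  have := is_derive_scal (- e^-1) (is_derive_expM (- e) x).
  by rewrite mulrA mulrNN mulVf ?gt_eqF// mul1r.
have h3 : - e^-1 * expR (- e * x) @[x --> +oo] --> (0 : R).
  by rewrite -[X in _ --> X](mulr0 (- e^-1)); apply: cvgMr; exact: cvgy_exp.
rewrite (FTC_y h1 (fun x _ => expR_ge0 _) h2 h3).
by rewrite mulr0 expR0 -EFinM; congr (_%:E); field; rewrite gt_eqF.
Qed.

(** Adding 1 to the cosine keeps the integrand nonnegative, as the fundamental theorem on a
    half-line requires here; the contribution of the 1 is subtracted in [IC_gam1]. *)
Lemma int_exp_cos e t : 0 < e ->
  (\int[lebesgue_measure]_x (expR (- e * `|x|) * (1 + cos (t * x)))%:E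
   = (2 / e + 2 * e / (e ^+ 2 + t ^+ 2))%:E)%E.
Proof.
move=> e0; have et : 0 < e ^+ 2 + t ^+ 2 by rewrite ltr_wpDr ?sqr_ge0// exprn_gt0.
have cc : continuous (fun x : R => 1 + cos (t * x)).
  apply: (contD (@cont_cst _)).
  exact: is_derive_continuous (is_derive_cosM t).
have cn : continuous (fun x : R => expR (- e * `|x|) * (1 + cos (t * x))).
  exact: (contM (@cont_expn e) cc).
have c1 x : 0 <= 1 + cos (t * x) by rewrite -lerBlDl sub0r cos_geN1.
rewrite int_even//; first last.
- by move=> x; rewrite normrN mulrN cosN.
rewrite [X in (_ * X)%E](_ : _ = \int[lebesgue_measure]_(x in `[0%R, +oo[)
    (expR (- e * x) * (1 + cos (t * x)))%:E)%E; last first.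
  by apply: eq_integral => x; rewrite inE/= in_itv/= andbT => x0; rewrite ger0_norm.
pose k := (e ^+ 2 + t ^+ 2)^-1.
have h1 : continuous (fun x => expR (- e * x) * (1 + cos (t * x))).
  by apply: contM cc; exact: is_derive_continuous (is_derive_expM _).
have h2 x : is_derive x 1 (fun x => expR (- e * x) *
    (- e^-1 + k * (t * sin (t * x) + - e * cos (t * x))))
    (expR (- e * x) * (1 + cos (t * x))).
  have := is_derive_prod (is_derive_expM (- e) x) (is_derive_add (is_derive_cst (- e^-1) x 1)
    (is_derive_scal k (is_derive_add (is_derive_scal t (is_derive_sinM t x))
      (is_derive_scal (- e) (is_derive_cosM t x))))).
  by congr is_derive; rewrite /k/=; field; rewrite !gt_eqF.
have h3 : expR (- e * x) * (- e^-1 + k * (t * sin (t * x) + - e * cos (t * x)))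
    @[x --> +oo] --> (0 : R).
  pose M := e^-1 + k * (`|t| + e).
  have k0 : 0 <= k by rewrite invr_ge0 ltW.
  apply/norm_cvg0P; apply: (@squeeze_cvgr _ _ _ _ (cst 0) (fun x => expR (- e * x) * M)).
  - near=> x; rewrite normr_ge0/= normrM (ger0_norm (expR_ge0 _)) ler_wpM2l ?expR_ge0//.
    have ei : 0 <= e^-1 by rewrite invr_ge0 ltW.
    apply: le_trans (ler_normD _ _) _; rewrite normrN (ger0_norm ei) /M lerD2l.
    rewrite normrM (ger0_norm k0) ler_wpM2l// (le_trans (ler_normD _ _))//.
    rewrite !normrM normrN (gtr0_norm e0).
    have sc (y : R) : `|sin y| <= 1 /\ `|cos y| <= 1.
      by rewrite !ler_norml sin_geN1 sin_le1 cos_geN1 cos_le1.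
    have [s1 c2] := sc (t * x).
    by rewrite lerD// ler_piMr// ltW.
  - exact: cvg_cst.
  - by rewrite -[X in _ --> X](mul0r M); apply: cvgMl; exact: cvgy_exp.
have h0 x : 0 <= x -> 0 <= expR (- e * x) * (1 + cos (t * x)).
  by move=> _; rewrite mulr_ge0// expR_ge0.
rewrite (FTC_y h1 h0 h2 h3).
rewrite !mulr0 expR0 sin0 cos0 -EFinM; congr (_%:E); rewrite /k.
by field; rewrite !gt_eqF.
Unshelve. all: by end_near. Qed.

Lemma continuous_poisson e c : 0 < e ->
  continuous (fun x : R => 2 * e / (e ^+ 2 + (x - c) ^+ 2)).
Proof.
move=> e0; apply: (contM (@cont_cst _)) => x; apply: cvgV.
  by rewrite gt_eqF// ltr_wpDr ?sqr_ge0// exprn_gt0.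
have h : continuous (fun x : R => x - c).
  by apply: contD; [move=> y; exact: cvg_id|exact: cont_cst].
exact: (contD (@cont_cst _) (contM h h)).
Qed.

Lemma is_derive_poisson e c x : 0 < e ->
  is_derive x 1 (fun y => 2 * atan (e^-1 * (y - c))) (2 * e / (e ^+ 2 + (x - c) ^+ 2)).
Proof.
move=> e0.
have h1 : is_derive x 1 (fun y => y - c) 1.
  have := is_derive_add (is_derive_id x 1) (is_derive_cst (- c) x 1).
  by rewrite addr0.
have := is_derive_scal 2 (is_derive1_comp (is_derive1_atan _) (is_derive_scal e^-1 h1)).
congr is_derive.
by field; rewrite !gt_eqF//= ltr_wpDr ?sqr_ge0// exprn_gt0.
Qed.

Lemma int_poisson e : 0 < e ->
  (\int[lebesgue_measure]_x (2 * e / (e ^+ 2 + x ^+ 2))%:E = (2 * pi)%:E)%E.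
Proof.
move=> e0.
have fE : (fun x => 2 * e / (e ^+ 2 + x ^+ 2)) = fun x => 2 * e / (e ^+ 2 + (x - 0) ^+ 2).
  by apply/funext => x; rewrite subr0.
have f0 x : 0 <= 2 * e / (e ^+ 2 + x ^+ 2).
  by rewrite divr_ge0 ?addr_ge0 ?sqr_ge0// mulr_ge0// ltW.
rewrite int_even//; first last.
- by move=> x; rewrite sqrrN.
- by rewrite fE; exact: continuous_poisson.
have h2 x : is_derive x 1 (fun y => 2 * atan (e^-1 * (y - 0))) (2 * e / (e ^+ 2 + x ^+ 2)).
  by rewrite -[x in X in is_derive _ _ _ X]subr0; exact: is_derive_poisson.
have h3 : 2 * atan (e^-1 * (x - 0)) @[x --> +oo] --> (pi : R).
  rewrite [X in _ --> X](_ : _ = 2 * (pi / 2)); last by field.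
  apply: cvgMr.
  have h : e^-1 * (x - 0) @[x --> +oo] --> +oo.
    have ei : 0 < e^-1 by rewrite invr_gt0.
    under eq_fun do rewrite subr0 mulrC.
    by apply: (gt0_cvgMly ei); exact: cvg_id.
  exact: (cvg_comp (fun x => e^-1 * (x - 0)) atan h (@cvgy_atan R)).
have h1 : continuous (fun x => 2 * e / (e ^+ 2 + x ^+ 2)).
  by rewrite fE; exact: continuous_poisson.
rewrite (FTC_y h1 (fun x _ => f0 x) h2 h3).
by rewrite subr0 mulr0 atan0 mulr0 subr0 -EFinM.
Qed.

Lemma int_poisson_itv e x a b : 0 < e -> a <= b ->
  (\int[lebesgue_measure]_(y in `[a, b]) (2 * e / (e ^+ 2 + (x - y) ^+ 2))%:E
   = (2 * atan (e^-1 * (b - x)) - 2 * atan (e^-1 * (a - x)))%:E)%E.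
Proof.
move=> e0 ab.
have h2 (y : R) : is_derive y 1 (fun y => 2 * atan (e^-1 * (y - x)))
    (2 * e / (e ^+ 2 + (x - y) ^+ 2)).
  by rewrite -[(x - y) ^+ 2]sqrrN opprB; exact: is_derive_poisson.
rewrite (FTC_itv ab _ h2)//.
rewrite (_ : (fun _ => _) = fun y => 2 * e / (e ^+ 2 + (y - x) ^+ 2)).
  exact: continuous_poisson.
by apply/funext => y; rewrite -[(x - y) ^+ 2]sqrrN opprB.
Qed.

End Calculus.

(** * Bounded kernels and products of functions *)

Section KernelSwap.
Context {R : realType} d1 d2 (S : measurableType d1) (T : measurableType d2).
Variables (mu : {sigma_finite_measure set S -> \bar R})
  (nu : {sigma_finite_measure set T -> \bar R}).

Lemma int_kernel (f : S -> R[i]) (g : T -> R[i]) (m : S * T -> R[i]) b :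
  cint mu f -> cint nu g -> cmeas m -> (forall x, nc (m x) <= b) ->
  (\int[nu]_t \int[mu]_s (nc (f s * (m (s, t) * g t)))%:E < +oo)%E.
Proof.
move=> [mf fo] [mg go] mm mb.
have b0 x : 0 <= nc (m x) <= b by rewrite nc_ge0 mb.
have I0 : (0 <= \int[mu]_s (nc (f s))%:E)%E.
  by apply: integral_ge0 => s _; rewrite lee_fin nc_ge0.
apply: (@le_lt_trans _ _
  (\int[nu]_t ((nc (g t))%:E * (`|b|%:E * \int[mu]_s (nc (f s))%:E)))%E).
  apply: ge0_le_integral => //.
  - by move=> t _; apply: integral_ge0 => s _; rewrite lee_fin nc_ge0.
  - apply: (measurable_fun_fubini_tonelli_G
      (fun x => (nc (f x.1 * (m x * g x.2)))%:E)) => [|x]; last by rewrite lee_fin nc_ge0.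
    apply: mnc; apply: cmeasM; first exact: (cmeas_comp (h := fst)).
    by apply: cmeasM => //; exact: (cmeas_comp (h := snd)).
  - by apply: emeasurable_funM => //; exact: mnc.
  - move=> t _; rewrite muleA -EFinM -ge0_integralZl//; last 3 first.
    + exact: mnc.
    + by move=> s _; rewrite lee_fin nc_ge0.
    + by rewrite lee_fin mulr_ge0// nc_ge0.
    apply: ge0_le_integral => //.
    + by move=> s _; rewrite lee_fin nc_ge0.
    + apply: mnc; apply: cmeasM => //; apply: cmeasM; last exact: cmeas_cst.
      exact: cmeas_pair1.
    + by apply/measurable_EFinP; apply: measurable_funM => //; exact: cmeas_nc.
    + move=> s _; rewrite lee_fin !ncM.
      rewrite mulrC ler_wpM2r ?nc_ge0// mulrC ler_wpM2l ?nc_ge0//.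
      by rewrite (le_trans (mb _))// ler_norm.
rewrite ge0_integralZr//; last 3 first.
- exact: mnc.
- by move=> s _; rewrite lee_fin nc_ge0.
- by rewrite mule_ge0.
rewrite lte_mul_pinfty//.
- by apply: integral_ge0 => s _; rewrite lee_fin nc_ge0.
- by rewrite ge0_fin_numE//; apply: integral_ge0 => s _; rewrite lee_fin nc_ge0.
- by rewrite lte_mul_pinfty.
Qed.

(** Fubini in the form suited to Fourier integrals: a bounded kernel between two integrable
    functions. The Fourier kernel gives [FI_adjoint], its conjugate gives [FI_gam_cnv]. *)
Lemma kernel_swap (f : S -> R[i]) (g : T -> R[i]) (m : S * T -> R[i]) b :
  cint mu f -> cint nu g -> cmeas m -> (forall x, nc (m x) <= b) ->
  IC mu (fun s => f s * IC nu (fun t => m (s, t) * g t)) =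
  IC nu (fun t => g t * IC mu (fun s => m (s, t) * f s)).
Proof.
move=> fi gi mm mb.
transitivity (IC mu (fun s => IC nu (fun t => f s * (m (s, t) * g t)))).
  apply: eq_IC => s; rewrite ICZ//; apply: (@cint_boundM _ _ _ _ _ _ b) => //.
  exact: cmeas_pair2.
rewrite (@IC_swap _ _ _ _ _ mu nu (fun x => f x.1 * (m x * g x.2)))/=; first last.
- exact: (int_kernel fi gi mm mb).
- apply: cmeasM; first by apply: (cmeas_comp (h := fst)) => //; case: fi.
  by apply: cmeasM => //; apply: (cmeas_comp (h := snd)) => //; case: gi.
apply: eq_IC => t; rewrite -ICZ; last first.
  by apply: (@cint_boundM _ _ _ _ _ _ b) => //; exact: cmeas_pair1.
by apply: eq_IC => s; ring.
Qed.

Lemma IC_prod F : cmeas F ->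
  (\int[nu]_t \int[mu]_s (nc (F (s, t)))%:E < +oo)%E ->
  IC (sfprod mu nu) F = IC mu (fun s => IC nu (fun t => F (s, t))).
Proof.
move=> mF Foo.
have key (H : S * T -> R) : measurable_fun setT H ->
    (forall x, `|H x| <= nc (F x)) ->
    \int[sfprod mu nu]_x H x = \int[mu]_s \int[nu]_t H (s, t).
  move=> mH HF.
  have iH : (mu \x nu)%E.-integrable setT (EFin \o H).
    apply: (@le_integrable _ _ _ _ _ _ _ (fun x => (nc (F x))%:E)) => //.
    - exact/measurable_EFinP.
    - by move=> x _; rewrite /= lee_fin (ger0_norm (nc_ge0 _)).
    - apply/integrable21ltyP; first exact: mnc.
      by under eq_integral do under eq_integral do rewrite gee0_abs ?lee_fin ?nc_ge0//.
  rewrite /Rintegral; congr fine.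
  transitivity (\int[mu]_s \int[nu]_t (H (s, t))%:E)%E.
    by rewrite -[LHS](integral12_prod_meas1 iH).
  apply: ae_eq_integral => //.
  - exact: measurable_fubini_F iH.
  - apply: measurableT_comp => //; apply: measurableT_comp.
      exact: fine_measurable.
    exact: measurable_fubini_F iH.
  - apply: filterS (ae_integrable1 iH) => s hs _.
    by rewrite fineK//; exact: integrable_fin_num hs.
case: mF => F1 F2; apply: complexP => /=.
  by apply: (key (fun x => complex.Re (F x))) => // x; exact: Re_le_nc.
by apply: (key (fun x => complex.Im (F x))) => // x; exact: Im_le_nc.
Qed.

Lemma int_prod (f : S -> R) (g : T -> R) : measurable_fun setT f ->
  measurable_fun setT g -> (forall x, 0 <= f x) -> (forall x, 0 <= g x) ->
  (\int[sfprod mu nu]_x (f x.1 * g x.2)%:E =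
   \int[mu]_s (f s)%:E * \int[nu]_t (g t)%:E)%E.
Proof.
move=> mf mg f0 g0.
have mE : measurable_fun setT (fun x : S * T => (f x.1 * g x.2)%:E).
  apply/measurable_EFinP; apply: measurable_funM.
    exact: (measurableT_comp (f := f)).
  exact: (measurableT_comp (f := g)).
transitivity (\int[mu]_s \int[nu]_t (f s * g t)%:E)%E.
  by rewrite -(fubini_tonelli1 (fun x => (f x.1 * g x.2)%:E))// => x;
    rewrite lee_fin mulr_ge0.
under eq_integral => s _.
  under eq_integral do rewrite EFinM.
  rewrite ge0_integralZl//; last 3 first.
  - exact/measurable_EFinP.
  - by move=> t _; rewrite lee_fin.
  - by rewrite lee_fin.
  over.
rewrite ge0_integralZr//.
- exact/measurable_EFinP.
- by move=> s _; rewrite lee_fin.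
- by apply: integral_ge0 => t _; rewrite lee_fin.
Qed.

Lemma IC_prodM (f : S -> R[i]) (g : T -> R[i]) : cint mu f -> cint nu g ->
  cint (sfprod mu nu) (fun x => f x.1 * g x.2) /\
  IC (sfprod mu nu) (fun x => f x.1 * g x.2) = IC mu f * IC nu g.
Proof.
move=> fi gi; have [mf fo] := fi; have [mg go] := gi.
have mfg : cmeas (fun x : S * T => f x.1 * g x.2).
  apply: cmeasM; first exact: (cmeas_comp (h := fst)).
  exact: (cmeas_comp (h := snd)).
have h : (\int[nu]_t \int[mu]_s (nc (f s * g t))%:E < +oo)%E.
  have n1 (x : S * T) : nc (1 : R[i]) <= 1 by rewrite ComplexField.Normc.normc1.
  have := @int_kernel f g (fun=> 1) 1 fi gi (cmeas_cst _ _) n1.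
  by under eq_integral do under eq_integral do rewrite mul1r.
split.
  split => //; under eq_integral do rewrite ncM.
  rewrite (int_prod (cmeas_nc mf) (cmeas_nc mg)); last 2 first.
  - by move=> x; exact: nc_ge0.
  - by move=> x; exact: nc_ge0.
  have I0 d (X : measurableType d) (m : {measure set X -> \bar R}) (k : X -> R[i]) :
      (0 <= \int[m]_x (nc (k x))%:E)%E.
    by apply: integral_ge0 => x _; rewrite lee_fin nc_ge0.
  by rewrite lte_mul_pinfty// ge0_fin_numE.
rewrite IC_prod//=.
transitivity (IC mu (fun s => IC nu g * f s)).
  by apply: eq_IC => s; rewrite ICZ// mulrC.
by rewrite ICZ// mulrC.
Qed.

End KernelSwap.

(** * The Fourier transform: Plancherel, inversion, products *)

Section FourierIntegral.
Context {R : realType}.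
Notation leb := (@leb3 R).
Notation leb1 := (@lebesgue_measure R).
Implicit Types (x y xi : R3 R) (f g U V : R3 R -> R[i]) (a b e : R).

(** This is exp(-it), with the sign of the Fourier kernel. *)
Definition cis (t : R) : R[i] := cos t -i* sin t.

Definition ker x xi : R[i] := cis (dot3 x xi).

Definition FI f xi : R[i] := IC leb (fun x => ker x xi * f x).

Arguments cis : simpl never.
Arguments ker : simpl never.

Lemma cisD s t : cis (s + t) = cis s * cis t.
Proof. by rewrite /cis cosD sinD; apply: complexP => /=; ring. Qed.

Lemma cisN t : cis (- t) = (cis t)^*%C.
Proof. by rewrite /cis cosN sinN. Qed.

Lemma nc_cis t : nc (cis t) = 1.
Proof.
apply/eqP; rewrite -(@eqrXn2 _ 2)// ?nc_ge0// expr1n nc_sqr /= sqrrN.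
by rewrite cos2Dsin2.
Qed.

Lemma nc_ker x xi : nc (ker x xi) = 1.
Proof. exact: nc_cis. Qed.

Lemma kerC x xi : ker x xi = ker xi x.
Proof. by rewrite /ker /dot3; congr cis; ring. Qed.

Lemma ker_sub x y xi : ker xi (sub3 x y) = ker xi x * (ker xi y)^*%C.
Proof. by rewrite /ker -cisN -cisD; congr cis; rewrite /dot3 /sub3/=; ring. Qed.

Lemma sub3K x y : sub3 x (sub3 x y) = y.
Proof.
by case: x => -[a b] c; case: y => -[a' b'] c'; rewrite /sub3/= !opprB !(addrC _ (_ - _)) !subrK.
Qed.

Lemma measurable_coord d (T : measurableType d) (p : T -> R3 R) :
  measurable_fun setT p ->
  [/\ measurable_fun setT (fun t => (p t).1.1 : R),
      measurable_fun setT (fun t => (p t).1.2 : R) &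
      measurable_fun setT (fun t => (p t).2 : R)].
Proof.
move=> mp; have m1 : measurable_fun setT (fun t => (p t).1) by exact: measurableT_comp.
by split; [exact: (measurableT_comp measurable_fst)|
  exact: (measurableT_comp measurable_snd)|exact: measurableT_comp].
Qed.

Lemma measurable_dot3 d (T : measurableType d) (p q : T -> R3 R) :
  measurable_fun setT p -> measurable_fun setT q ->
  measurable_fun setT (fun t => dot3 (p t) (q t)).
Proof.
move=> /measurable_coord[p1 p2 p3] /measurable_coord[q1 q2 q3].
by apply: measurable_funD; [apply: measurable_funD|]; exact: measurable_funM.
Qed.

Lemma cmeas_cis d (T : measurableType d) (p : T -> R) :
  measurable_fun setT p -> cmeas (fun t => cis (p t)).
Proof.
move=> mp; have mc : measurable_fun setT (@cos R).
  by apply: continuous_measurable_fun; exact: continuous_cos.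
have ms : measurable_fun setT (@sin R).
  by apply: continuous_measurable_fun; exact: continuous_sin.
split => /=; first exact: (measurableT_comp mc mp).
by apply: measurableT_comp => //; exact: (measurableT_comp ms mp).
Qed.

Lemma cmeas_ker d (T : measurableType d) (p q : T -> R3 R) :
  measurable_fun setT p -> measurable_fun setT q ->
  cmeas (fun t => ker (p t) (q t)).
Proof. by move=> mp mq; apply: cmeas_cis; exact: measurable_dot3. Qed.

Lemma cint_ker xi f : cint leb f -> cint leb (fun x => ker x xi * f x).
Proof.
move=> fi; apply: (cint_boundM (b := 1) fi); first exact: cmeas_ker.
by move=> x; rewrite nc_ker.
Qed.

Lemma cmeas_FI f : cmeas f -> cmeas (FI f).
Proof.
move=> mf; apply: (@cmeas_IC2 _ _ _ _ _ leb (fun p => ker p.2 p.1 * f p.2)).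
by apply: cmeasM; [exact: cmeas_ker|exact: (cmeas_comp (h := snd))].
Qed.

Lemma FI_le f a xi : L1b leb f a -> nc (FI f xi) <= a.
Proof.
move=> fa; apply: (@L1b_IC _ _ _ leb); split.
  by have [] := cint_ker xi (L1b_cint fa).
by under eq_integral do rewrite ncM nc_ker mul1r; case: fa.
Qed.

Lemma FI_D f g xi : cint leb f -> cint leb g ->
  FI (fun x => f x + g x) xi = FI f xi + FI g xi.
Proof.
move=> fi gi; rewrite /FI -ICD; [|exact: cint_ker|exact: cint_ker].
by apply: eq_IC => x; rewrite mulrDr.
Qed.

Lemma FI_Z z f xi : cint leb f -> FI (fun x => z * f x) xi = z * FI f xi.
Proof.
move=> fi; rewrite /FI -ICZ; last exact: cint_ker.
by apply: eq_IC => x; rewrite mulrCA.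
Qed.

Lemma FI_B f g xi : cint leb f -> cint leb g ->
  FI (fun x => f x - g x) xi = FI f xi - FI g xi.
Proof.
move=> fi gi; rewrite (_ : (fun x => _) = fun x => f x + (-1) * g x).
  by rewrite FI_D ?FI_Z ?mulN1r//; exact: cintZ.
by apply/funext => x; rewrite mulN1r.
Qed.

Lemma FI_adjoint f g : cint leb f -> cint leb g ->
  IC leb (fun xi => g xi * FI f xi) = IC leb (fun x => f x * FI g x).
Proof.
move=> fi gi.
have mk : cmeas (fun p : R3 R * R3 R => ker p.2 p.1).
  exact: (cmeas_ker measurable_snd measurable_fst).
have bk (p : R3 R * R3 R) : nc (ker p.2 p.1) <= 1 by rewrite nc_ker.
etransitivity; first exact: (kernel_swap gi fi mk bk).
by apply: eq_IC => x; congr (_ * _); apply: eq_IC => y; rewrite kerC.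
Qed.

Definition cnv U V x : R[i] := IC leb (fun y => U (sub3 x y) * V y).

Lemma cnv_flip U V x : cmeas U -> cmeas V ->
  IC leb (fun z => U z * V (sub3 x z)) = cnv U V x.
Proof.
move=> mU mV.
rewrite /cnv -(mpres_IC (mpres_subl x) (f := fun y => U (sub3 x y) * V y)).
  by apply: eq_IC => z; rewrite sub3K.
apply: cmeasM => //; apply: (cmeas_comp (h := sub3 x)) => //.
exact: measurable_sub3.
Qed.

Lemma cmeas_cnv U V : cmeas U -> cmeas V -> cmeas (cnv U V).
Proof.
move=> mU mV.
apply: (@cmeas_IC2 _ _ _ _ _ leb (fun p => U (sub3 p.1 p.2) * V p.2)).
apply: cmeasM; last exact: (cmeas_comp (h := snd)).
by apply: (cmeas_comp (h := fun p : R3 R * R3 R => sub3 p.1 p.2)) => //; exact: measurable_sub3.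
Qed.

(** The convolution is an average of translates of V weighted by U, and translates keep their L^2
    bound, so Minkowski's integral inequality applies. *)
Lemma young U V a b : L1b leb U a -> L2b leb V b -> L2b leb (cnv U V) (a * b).
Proof.
move=> [mU Ua] Vb; have [mV b0 _] := Vb.
have mF : cmeas (fun p : R3 R * R3 R => U p.1 * V (sub3 p.2 p.1)).
  apply: cmeasM; first exact: (cmeas_comp (h := fst)).
  by apply: (cmeas_comp (h := fun p : R3 R * R3 R => sub3 p.2 p.1)) => //; exact: measurable_sub3.
have [] := @minkowski_int _ _ _ _ _ leb leb _ (fun z => nc (U z) * b) (a * b) mF.
- by apply: measurable_funM => //; exact: cmeas_nc.
- by move=> z /=; apply: (@L2bZ _ _ _ leb (fun x => V (sub3 x z))); exact: mpres_L2b (mpres_subr z) Vb.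
- under eq_integral do rewrite EFinM.
  rewrite ge0_integralZr//; last 2 first.
  + exact: mnc.
  + by move=> z _; rewrite lee_fin nc_ge0.
  by rewrite EFinM lee_wpmul2r// lee_fin.
move=> _ /=; congr L2b; apply/funext => x; exact: cnv_flip.
Qed.

Lemma cnv_cint U V a b x : L2b leb U a -> L2b leb V b ->
  L1b leb (fun y => U (sub3 x y) * V y) (a * b).
Proof. by move=> Ua Vb; apply: CS Vb; exact: mpres_L2b (mpres_subl x) Ua. Qed.

Lemma cnv_bound U V a b x : L2b leb U a -> L2b leb V b -> nc (cnv U V x) <= a * b.
Proof. by move=> Ua Vb; apply: L1b_IC; exact: cnv_cint. Qed.

(* The Abel kernel [gam e] has the Poisson kernel [poi e] as its transform. *)
Definition gam1 e (t : R) : R := expR (- e * `|t|).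

Definition poi1 e (t : R) : R := 2 * e / (e ^+ 2 + t ^+ 2).

Definition gam e xi : R := gam1 e xi.1.1 * gam1 e xi.1.2 * gam1 e xi.2.

Definition poi e x : R := poi1 e x.1.1 * poi1 e x.1.2 * poi1 e x.2.

Lemma gam1_ge0 e t : 0 <= gam1 e t. Proof. exact: expR_ge0. Qed.

Lemma gam1_le1 e t : 0 < e -> gam1 e t <= 1.
Proof. by move=> e0; rewrite -expR0 ler_expR mulNr oppr_le0 mulr_ge0// ltW. Qed.

Lemma gam_ge0 e xi : 0 <= gam e xi.
Proof. by rewrite !mulr_ge0// gam1_ge0. Qed.

Lemma gam_le1 e xi : 0 < e -> gam e xi <= 1.
Proof. by move=> e0; rewrite !mulr_ile1 ?mulr_ge0 ?gam1_ge0 ?gam1_le1. Qed.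

Lemma gam_sqr e xi : gam (2 * e) xi = gam e xi ^+ 2.
Proof.
have h t : gam1 (2 * e) t = gam1 e t ^+ 2.
  by rewrite /gam1 expr2 -expRD; congr expR; ring.
by rewrite /gam !h; ring.
Qed.

Lemma poi1_ge0 e t : 0 < e -> 0 <= poi1 e t.
Proof. by move=> e0; rewrite divr_ge0 ?mulr_ge0 ?addr_ge0 ?sqr_ge0// ltW. Qed.

Lemma poi_ge0 e x : 0 < e -> 0 <= poi e x.
Proof. by move=> e0; apply: mulr_ge0; [apply: mulr_ge0|]; exact: poi1_ge0. Qed.

Lemma measurable_gam1 e : measurable_fun setT (gam1 e).
Proof. by apply: continuous_measurable_fun; exact: cont_expn. Qed.

Lemma measurable_poi1 e : 0 < e -> measurable_fun setT (poi1 e).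
Proof.
move=> e0; apply: continuous_measurable_fun.
by have := continuous_poisson (c := 0) e0; under eq_fun do rewrite subr0.
Qed.

Lemma cint_gam1 e : 0 < e -> cint leb1 (fun t => (gam1 e t)%:C).
Proof.
move=> e0; split; first by apply: cmeas_real; exact: measurable_gam1.
under eq_integral do rewrite nc_real_ge0 ?gam1_ge0//.
by rewrite int_exp// ltry.
Qed.

Lemma cint_cis_gam1 e c : 0 < e -> cint leb1 (fun t => cis (c * t) * (gam1 e t)%:C).
Proof.
move=> e0; apply: (cint_boundM (b := 1) (cint_gam1 e0)).
  by apply: cmeas_cis; exact: measurable_funM.
by move=> x; rewrite nc_cis.
Qed.

(** Reflection of t conjugates the integrand, so the imaginary part vanishes; the real part is the
    difference of two known integrals. *)
Lemma IC_gam1 e c : 0 < e ->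
  IC leb1 (fun t => cis (c * t) * (gam1 e t)%:C) = (poi1 e c)%:C.
Proof.
move=> e0; have hi := cint_cis_gam1 c e0; set h := fun t => _ in hi *.
have hN t : h (- t) = (h t)^*%C.
  by rewrite /h conjM conj_rc mulrN cisN /gam1 normrN.
have Im0 : complex.Im (IC leb1 h) = 0.
  have : IC leb1 h = (IC leb1 h)^*%C.
    rewrite -IC_conj// -[LHS](mpres_IC (@mpres_opp1 R)); last by case: hi.
    by apply: eq_IC => t; rewrite hN.
  move/(congr1 (@complex.Im R)); rewrite cIm_conj => /eqP.
  by rewrite -addr_eq0 -mulr2n mulrn_eq0/= => /eqP.
apply: complexP; last by rewrite Im0.
have gi := cint_Re (cint_gam1 e0); have hr := cint_Re hi.
have : \int[leb1]_t (complex.Re (gam1 e t)%:C + complex.Re (h t)) =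
    2 / e + poi1 e c.
  rewrite /Rintegral (eq_integral (fun x : measurableTypeR R =>
    (expR (- e * `|x|) * (1 + cos (c * x)))%:E)); last first.
    by move=> t _; rewrite /h cReM/= /gam1; congr (_%:E); ring.
  by rewrite int_exp_cos.
rewrite RintegralD// -[complex.Re (IC _ _)]/(\int[leb1]_t complex.Re (h t)).
move=> /(canRL (addKr _)) ->.
have -> : \int[leb1]_x complex.Re (gam1 e x)%:C = 2 / e.
  by rewrite /Rintegral /= int_exp.
by rewrite addKr.
Qed.

Lemma gam_factor e x xi : ker xi x * (gam e xi)%:C =
  (cis (x.1.1 * xi.1.1) * (gam1 e xi.1.1)%:C) *
  (cis (x.1.2 * xi.1.2) * (gam1 e xi.1.2)%:C) *
  (cis (x.2 * xi.2) * (gam1 e xi.2)%:C).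
Proof.
rewrite /ker /gam !rcM (_ : dot3 xi x =
  x.1.1 * xi.1.1 + x.1.2 * xi.1.2 + x.2 * xi.2); last by rewrite /dot3; ring.
by rewrite !cisD; ring.
Qed.

Lemma FI_gam_cint e x : 0 < e -> cint leb (fun xi => ker xi x * (gam e xi)%:C) /\
  FI (fun xi => (gam e xi)%:C) x = (poi e x)%:C.
Proof.
move=> e0; rewrite /FI; under eq_fun do rewrite gam_factor.
have [i12 E12] := IC_prodM (cint_cis_gam1 x.1.1 e0) (cint_cis_gam1 x.1.2 e0).
have [i3 E3] := IC_prodM i12 (cint_cis_gam1 x.2 e0).
split; first exact: i3.
by rewrite /poi rcM rcM -!(IC_gam1 _ e0) -E12 -E3.
Qed.

Lemma measurable_gam e : measurable_fun setT (gam e).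
Proof.
have m := measurable_gam1 e; have [p1 p2 p3] := measurable_coord (@measurable_id _ (R3 R) setT).
by apply: measurable_funM; [apply: measurable_funM|]; exact: (measurableT_comp m).
Qed.

Lemma cint_gam e : 0 < e -> cint leb (fun xi => (gam e xi)%:C).
Proof.
move=> e0; have [+ _] := FI_gam_cint ((0, 0), 0) e0.
move=> [_ h]; split; first by apply: cmeas_real; exact: measurable_gam.
by move: h; under eq_integral do rewrite ncM nc_ker mul1r.
Qed.

(** The total mass of the Poisson kernel [poi], and for that reason the constant of Plancherel and
    of inversion for the unnormalized transform. *)
Definition K3 : R := (2 * pi) ^+ 3.

Lemma K3_gt0 : 0 < K3.
Proof. by rewrite exprn_gt0// mulr_gt0// pi_gt0. Qed.

Lemma poi_L1 e : 0 < e -> L1b leb (fun x => (poi e x)%:C) K3.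
Proof.
move=> e0; have m := measurable_poi1 e0.
have p0 t : 0 <= poi1 e t by exact: poi1_ge0.
have m12 : measurable_fun setT (fun x : measurableTypeR R * measurableTypeR R =>
    poi1 e x.1 * poi1 e x.2).
  by apply: measurable_funM; exact: (measurableT_comp m).
split.
  apply: cmeas_real; apply: measurable_funM.
    exact: (measurableT_comp (f := fun x : measurableTypeR R * measurableTypeR R =>
      poi1 e x.1 * poi1 e x.2)).
  exact: (measurableT_comp m).
under eq_integral do rewrite nc_real_ge0 ?poi_ge0//.
have p12 (x : measurableTypeR R * measurableTypeR R) : 0 <= poi1 e x.1 * poi1 e x.2.
  exact: mulr_ge0.
have E12 := @int_prod _ _ _ _ _ leb1 leb1 _ _ m m p0 p0.
have E3 : (\int[leb]_x (poi e x)%:E = _)%E := @int_prod _ _ _ _ _ _ leb1 _ _ m12 m p12 p0.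
by rewrite E3 E12 int_poisson// -!EFinM lee_fin /K3 !exprS expr0 mulr1 mulrA.
Qed.

(** Abel-regularized inversion. The conjugation turns the second forward transform into an inverse
    one, since it makes the product of the two kernels depend on x - y; what remains is the
    transform of [gam] at that point. *)
Lemma FI_gam_cnv e f x : 0 < e -> cint leb f ->
  FI (fun xi => (gam e xi)%:C * (FI f xi)^*%C) x =
  cnv (fun x => (poi e x)%:C) (fun y => (f y)^*%C) x.
Proof.
move=> e0 fi; have [gi _] := FI_gam_cint x e0.
have ci := cint_conj fi.
transitivity (IC leb (fun xi => (ker xi x * (gam e xi)%:C) *
    IC leb (fun y => (ker y xi)^*%C * (f y)^*%C))).
  apply: eq_IC => xi; rewrite mulrA; congr (_ * _).
  by rewrite /FI -IC_conj; [apply: eq_IC => y; rewrite conjM|exact: cint_ker].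
have mk : cmeas (fun p : R3 R * R3 R => (ker p.2 p.1)^*%C).
  by apply: cmeas_conj; exact: (cmeas_ker measurable_snd measurable_fst).
have bk (p : R3 R * R3 R) : nc (ker p.2 p.1)^*%C <= 1 by rewrite nc_conj nc_ker.
etransitivity; first exact: (kernel_swap gi ci mk bk).
apply: eq_IC => y; rewrite mulrC; congr (_ * _).
have [_ <-] := FI_gam_cint (sub3 x y) e0.
apply: eq_IC => xi; rewrite ker_sub.
have -> : ker (xi, y).2 (xi, y).1 = ker xi y by exact: kerC.
by ring.
Qed.

(** The square of the norm is a pairing of [FI f] with [H]. Moving the transform onto [H] by the
    adjoint formula leaves f paired with a Poisson average of its conjugate, and Young's inequality
    bounds this by [K3 * b ^+ 2]. *)
Lemma FI_gam_bound e f b : 0 < e -> cint leb f -> L2b leb f b ->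
  L2b leb (fun xi => (gam e xi)%:C * FI f xi) (Num.sqrt K3 * b).
Proof.
move=> e0 fi fb; have b0 := L2b_ge0 fb.
have e20 : 0 < 2 * e by rewrite mulr_gt0.
have [a fa] := cint_L1b fi; have mf := L2b_cmeas fb.
(* The parameter is doubled because [gam (2 * e)] is the square of [gam e]: the pairing of [H] with
   [FI f] is then exactly the squared modulus to be integrated. *)
pose H xi := (gam (2 * e) xi)%:C * (FI f xi)^*%C.
have iH : cint leb H.
  rewrite /H; under eq_fun do rewrite mulrC.
  apply: (cint_boundM (b := a) (cint_gam e20)); first exact/cmeas_conj/cmeas_FI.
  by move=> x; rewrite nc_conj FI_le.
have iHF : cint leb (fun xi => FI f xi * H xi).
  by apply: (cint_boundM (b := a) iH) => [|x]; [exact: cmeas_FI|exact: FI_le].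
have E xi : FI f xi * H xi = ((nc ((gam e xi)%:C * FI f xi)) ^+ 2)%:C.
  rewrite ncM (nc_real_ge0 (gam_ge0 _ _)) exprMn -gam_sqr rcM -mul_conjC /H.
  by ring.
have A : nc (IC leb (fun xi => FI f xi * H xi)) <= (Num.sqrt K3 * b) ^+ 2.
  rewrite (_ : IC _ _ = IC leb (fun x => f x * FI H x)); last first.
    by rewrite -FI_adjoint//; apply: eq_IC => xi; rewrite mulrC.
  rewrite exprMn sqr_sqrtr ?(ltW K3_gt0)// (_ : K3 * b ^+ 2 = b * (K3 * b)); last by ring.
  apply: (@L1b_IC _ _ _ leb); apply: CS => //.
  rewrite (_ : FI H = cnv (fun x => (poi (2 * e) x)%:C) (fun y => (f y)^*%C)).
    by apply: young; [exact: poi_L1|exact: L2b_conj].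
  by apply/funext => x; exact: FI_gam_cnv.
split.
- by apply: cmeasM; [by apply: cmeas_real; exact: measurable_gam|exact: cmeas_FI].
- by rewrite mulr_ge0// sqrtr_ge0.
have iR := cint_Re iHF.
have -> : (\int[leb]_x (nc ((gam e x)%:C * FI f x) ^+ 2)%:E =
    \int[leb]_x (complex.Re (FI f x * H x))%:E)%E.
  by apply: eq_integral => x _; rewrite E.
rewrite -[leLHS]fineK; last exact: integrable_fin_num.
rewrite lee_fin; apply: le_trans A.
apply: le_trans (Re_le_nc _); exact: ler_norm.
Qed.

Lemma gam_cvg1 xi : (fun n => gam (n.+1%:R^-1) xi) @ \oo --> (1 : R).
Proof.
have h (t : R) : (fun n => gam1 (n.+1%:R^-1) t) @ \oo --> (1 : R).
  have h : (fun n => - n.+1%:R^-1 * `|t|) @ \oo --> (0 : R).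
    rewrite -[X in _ --> X](mul0r `|t|) -oppr0; apply: cvgMl; apply: cvgN.
    exact: cvg_harmonic.
  have := cvg_comp (fun n => - n.+1%:R^-1 * `|t|) expR h (@continuous_expR R 0).
  by rewrite expR0.
have E := cvgM (cvgM (h xi.1.1) (h xi.1.2)) (h xi.2).
by rewrite !mulr1 in E; exact: E.
Qed.

(** The regularized bound does not depend on the parameter, so Fatou's lemma removes the Abel
    weight. *)
Lemma FI_bound f b : cint leb f -> L2b leb f b ->
  L2b leb (FI f) (Num.sqrt K3 * b).
Proof.
move=> fi fb; have mf := L2b_cmeas fb.
apply: (@L2b_fatou _ _ _ leb (fun n xi => (gam (n.+1%:R^-1) xi)%:C * FI f xi)).
- move=> n; apply: cmeasM; first by apply: cmeas_real; exact: measurable_gam.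
  exact: cmeas_FI.
- exact: cmeas_FI.
- by apply: nearW => n; apply: FI_gam_bound.
- apply: aeW => xi; apply: (@ccvg_le _ _ _
    (fun n => `|1 - gam (n.+1%:R^-1) xi| * nc (FI f xi))).
    move=> n; rewrite (_ : _ - _ = (gam (n.+1%:R^-1) xi - 1)%:C * FI f xi).
      by rewrite ncM nc_real distrC.
    by rewrite rcB mulrBl mul1r.
  rewrite -[X in _ --> X](mul0r (nc (FI f xi))); apply: cvgMl.
  apply/norm_cvg0P; rewrite -[X in _ --> X](subrr 1); apply: cvgB; first exact: cvg_cst.
  exact: gam_cvg1.
Qed.

End FourierIntegral.

(** * The Fourier transform on L^2 *)

Section FourierL2.
Context {R : realType}.
Notation leb := (@leb3 R).
Notation leb1 := (@lebesgue_measure R).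
Implicit Types (x y xi : R3 R) (f g h : R3 R -> R[i]) (a b e : R).

Notation K := (Num.sqrt (@K3 R)).

Lemma L2b_close d (T : measurableType d) (mu : {measure set T -> \bar R})
    (f : T -> R[i]) a : 0 <= a -> (forall e, 0 < e -> L2b mu f (a + e)) -> L2b mu f a.
Proof.
move=> a0 fe; have mf : cmeas f by case: (fe 1 ltr01).
apply/L2b_N2; split => //; apply/lee_addgt0Pr => e e0.
by have /L2b_N2[_ _] := fe e e0; rewrite EFinD.
Qed.

Lemma LnormC2_le f a : cmeas f -> 0 <= a ->
  (LnormC 2%:E f <= a%:E)%E <-> L2b leb f a.
Proof. by move=> mf a0; split => [h|/L2b_N2[]//]; apply/L2b_N2. Qed.

Lemma LnormC2_ge0 f : (0 <= LnormC 2%:E f)%E.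
Proof. exact: Lnorm_ge0. Qed.

Lemma in_L2P f : in_L2 f <-> exists a, L2b leb f a.
Proof.
split=> [[mf foo]|[a fa]].
  have f0 := LnormC2_ge0 f.
  have ff : (LnormC 2%:E f \is a fin_num)%E by rewrite ge0_fin_numE.
  exists (fine (LnormC 2%:E f)); apply/LnormC2_le => //.
    exact: fine_ge0.
  by rewrite fineK.
have [mf a0 _] := fa; split; first exact: mf.
by apply: le_lt_trans (ltry a); apply/LnormC2_le.
Qed.

(** Translates the limits of extended-real norms found in the definitions into estimates with an
    arbitrary positive real. *)
Lemma LnormC2_cvg0 (I : Type) (F : set_system I) (FF : Filter F) (h : I -> R3 R -> R[i]) :
  (\forall i \near F, cmeas (h i)) ->
  (LnormC 2%:E (h i) @[i --> F] --> 0%E) <->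
  (forall e, 0 < e -> \forall i \near F, L2b leb (h i) e).
Proof.
move=> mh; split=> [/fine_cvgP[fn /cvgrPdist_le hc] e e0|H].
  have hce := hc e e0.
  near=> i; apply/LnormC2_le; [by near: i|exact: ltW|].
  have fi : LnormC 2%:E (h i) \is a fin_num by near: i.
  rewrite -(fineK fi) lee_fin (le_trans (ler_norm _))//.
  by rewrite -normrN -sub0r; near: i.
apply/fine_cvgP; split.
  have H1 := H 1 ltr01.
  near=> i; rewrite ge0_fin_numE ?LnormC2_ge0//.
  have h1 : L2b leb (h i) 1 by near: i.
  apply: le_lt_trans (ltry 1); apply/LnormC2_le => //; by case: h1.
apply/cvgrPdist_le => e e0; have He := H e e0; near=> i.
have hi : L2b leb (h i) e by near: i.
rewrite sub0r normrN /= ger0_norm ?fine_ge0 ?LnormC2_ge0//.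
have le : (LnormC 2%:E (h i) <= e%:E)%E.
  by apply/LnormC2_le => //; [case: hi|exact: ltW].
by rewrite -lee_fin fineK// ge0_fin_numE ?LnormC2_ge0// (le_lt_trans le (ltry _)).
Unshelve. all: by end_near. Qed.

Definition cvgL2 (u : nat -> R3 R -> R[i]) f : Prop :=
  forall e, 0 < e -> \forall n \near \oo, L2b leb (fun x => u n x - f x) e.

Lemma cvgL2_uniq u f g : cmeas f -> cmeas g -> cvgL2 u f -> cvgL2 u g ->
  {ae leb, forall x, f x = g x}.
Proof.
move=> mf mg uf ug.
have : L2b leb (fun x => f x - g x) 0.
  apply: L2b_inf; first exact: cmeasB.
  move=> e e0; have e2 : 0 < e / 2 by rewrite divr_gt0.
  have [n [h1 h2]] : exists n, L2b leb (fun x => u n x - f x) (e / 2) /\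
      L2b leb (fun x => u n x - g x) (e / 2).
    have := filterI (uf _ e2) (ug _ e2) => -[N _ hN].
    by exists N; exact: (hN N (leqnn N)).
  have := L2bB h2 h1; rewrite -splitr; congr L2b.
  by apply/funext => x; ring.
by move=> /L2b_eq0; apply: filterS => x /eqP; rewrite subr_eq0 => /eqP.
Qed.

Lemma cvgL2_bound u f a : cmeas f -> 0 <= a -> cvgL2 u f ->
  (\forall n \near \oo, L2b leb (u n) a) -> L2b leb f a.
Proof.
move=> mf a0 uf ua; apply: L2b_close => // e e0.
have := filterI (uf _ e0) ua => -[N _ hN].
have [h1 h2] := hN N (leqnn N).
have := L2bB h2 h1; congr L2b.
by apply/funext => x; ring.
Qed.

Lemma truncate_le n f x : nc (truncate n f x) <= nc (f x).
Proof. by rewrite /truncate; case: ifP => // _; rewrite nc0 nc_ge0. Qed.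

Lemma measurable_norm3 d (T : measurableType d) (p : T -> R3 R) :
  measurable_fun setT p -> measurable_fun setT (fun t => norm3 (p t)).
Proof.
move=> mp; have ms : measurable_fun setT (@Num.sqrt R).
  by apply: continuous_measurable_fun; exact: sqrt_continuous.
exact: (measurableT_comp ms (measurable_dot3 mp mp)).
Qed.

Lemma cmeas_truncate n f : cmeas f -> cmeas (truncate n f).
Proof.
move=> mf; apply: (cmeas_if _ mf (cmeas_cst _ 0)).
apply: measurable_fun_ler; last exact: measurable_cst.
exact: (measurable_norm3 (p := id)).
Qed.

Lemma truncate_cvg f x : ccvg (fun n => truncate n f x) (f x).
Proof.
apply: cvg_near_cst; near=> n; apply/eqP.
rewrite /truncate ifT ?subrr ?nc0//.
near: n; exact: nbhs_infty_ger.
Unshelve. all: by end_near. Qed.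

Lemma truncate_cvgL2 f a : L2b leb f a -> cvgL2 (fun n => truncate n f) f.
Proof.
move=> fa e e0; have mf := L2b_cmeas fa.
apply: (L2_dct (mu := leb) (h := f) (a := a)) => //.
- by move=> n; exact: cmeas_truncate.
- by apply: aeW => x; exact: truncate_cvg.
- by move=> n x; exact: truncate_le.
Qed.

Lemma L2b_truncate n f a : L2b leb f a -> L2b leb (truncate n f) a.
Proof.
move=> fa; apply: (L2b_dom fa); first by apply: cmeas_truncate; case: fa.
exact: truncate_le.
Qed.

Lemma L2b_gam e : 0 < e -> exists c, L2b leb (fun x => (gam e x)%:C) c.
Proof.
move=> e0; have e20 : 0 < 2 * e by rewrite mulr_gt0.
have [a [mg ga]] := cint_L1b (cint_gam e20).
have a0 : 0 <= a.
  by rewrite -lee_fin (le_trans _ ga)// integral_ge0// => x _; rewrite lee_fin nc_ge0.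
exists (Num.sqrt a); split; [|exact: sqrtr_ge0|].
  by apply: cmeas_real; exact: measurable_gam.
rewrite sqr_sqrtr//; apply: le_trans ga.
rewrite le_eqVlt; apply/orP; left; apply/eqP; apply: eq_integral => x _.
by rewrite !nc_real_ge0 ?gam_ge0// gam_sqr.
Qed.

Lemma norm3_coord x : [/\ `|x.1.1| <= norm3 x, `|x.1.2| <= norm3 x & `|x.2| <= norm3 x].
Proof.
have h (c : R) : c ^+ 2 <= dot3 x x -> `|c| <= norm3 x.
  by move=> cx; rewrite -sqrtr_sqr ler_wsqrtr.
have p1 := sqr_ge0 x.1.1; have p2 := sqr_ge0 x.1.2; have p3 := sqr_ge0 x.2.
by split; apply: h; rewrite /dot3 -!expr2; lra.
Qed.

(** On the ball of radius n each coordinate is at most n, so the Abel weight [gam 1] is at least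
    exp(-3n) there. The truncation is thus dominated by a multiple of the product of two L^2
    functions, and no volume of a ball has to be computed. *)
Lemma cint_truncate n f a : L2b leb f a -> cint leb (truncate n f).
Proof.
move=> fa; have mf := L2b_cmeas fa; have [c gc] := L2b_gam (@ltr01 R).
have h := CS gc fa.
apply: (@cint_dom _ _ _ _ _ (fun x => expR (3 * n%:R) * nc ((gam 1 x)%:C * f x))).
- exact: cmeas_truncate.
- apply: measurable_funM; first exact: measurable_cst.
  by apply: cmeas_nc; case: h.
- under eq_integral do rewrite EFinM.
  rewrite ge0_integralZl//.
  + by rewrite lte_mul_pinfty ?lee_fin ?expR_ge0//; case: (L1b_cint h).
  + by apply: mnc; case: h.
  + by move=> x _; rewrite lee_fin nc_ge0.
- move=> x; rewrite /truncate; case: ifPn => [xn|_]; last first.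
    by rewrite nc0 mulr_ge0 ?expR_ge0 ?nc_ge0.
  rewrite ncM (nc_real_ge0 (gam_ge0 _ _)) mulrA ler_peMl ?nc_ge0//.
  rewrite /gam /gam1 -!expRD -[leLHS]expR0 ler_expR.
  have [h1 h2 h3] := norm3_coord x; lra.
Qed.

Lemma FI_sub_bound f g e : cint leb f -> cint leb g ->
  L2b leb (fun x => f x - g x) e -> L2b leb (fun xi => FI f xi - FI g xi) (K * e).
Proof.
move=> fi gi fge; have := FI_bound (cintD fi (cintN gi)) fge.
by congr L2b; apply/funext => xi; rewrite -FI_B.
Qed.

Definition Flim f g : Prop := cmeas g /\ cvgL2 (fun n => FI (truncate n f)) g.

Lemma K_gt0 : 0 < K. Proof. by rewrite sqrtr_gt0 K3_gt0. Qed.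

Lemma Flim_norm f g a : L2b leb f a -> Flim f g -> L2b leb g (K * a).
Proof.
move=> fa [mg fg]; apply: (cvgL2_bound mg _ fg).
  by rewrite mulr_ge0 ?(ltW K_gt0)//; exact: L2b_ge0 fa.
apply: nearW => n; apply: FI_bound; first exact: cint_truncate fa.
exact: L2b_truncate.
Qed.

Lemma Flim_ex f a : L2b leb f a -> exists g, Flim f g.
Proof.
move=> fa; have [||g mg fg] := @L2_complete _ _ _ leb (fun n => FI (truncate n f)).
- by move=> n; apply: cmeas_FI; apply: cmeas_truncate; case: fa.
- move=> e e0; have e1 : 0 < e / K / 2 by rewrite !divr_gt0// K_gt0.
  have [N _ hN] := truncate_cvgL2 fa e1; exists N => n m Nn Nm.
  have -> : e = K * (e / K / 2 + e / K / 2) by field; rewrite gt_eqF// K_gt0.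
  apply: FI_sub_bound; [exact: cint_truncate fa|exact: cint_truncate fa|].
  have := L2bB (hN n Nn) (hN m Nm); congr L2b.
  by apply/funext => x; ring.
by exists g.
Qed.

Lemma is_fourierP f g a : L2b leb f a -> is_fourier f g <-> Flim f g.
Proof.
move=> fa.
have mFI g' : cmeas g' -> \forall n \near \oo, cmeas (fourier_integral (truncate n f) \- g').
  move=> mg; apply: nearW => n; apply: (cmeasB _ mg); apply: cmeas_FI.
  by apply: cmeas_truncate; case: fa.
split=> [[_ [mg _] h]|h].
  split; first exact: mg.
  by move/(LnormC2_cvg0 _ (mFI _ mg)): h.
have [mg fg] := h; split.
- by apply/in_L2P; exists a.
- by apply/in_L2P; exists (K * a); exact: Flim_norm fa h.
- by apply/(LnormC2_cvg0 _ (mFI _ mg)).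
Qed.

(** Existence of a limit ([Flim_ex]) rules out the default value in the definition of [fourier]. *)
Lemma fourierP f a : L2b leb f a -> Flim f (fourier f).
Proof.
move=> fa; apply/(is_fourierP _ fa); rewrite /fourier.
have [g /(is_fourierP _ fa) fg] := Flim_ex fa.
by apply: xgetPex; exists g.
Qed.

Lemma F_norm f a : L2b leb f a -> L2b leb (fourier f) (K * a).
Proof. by move=> fa; exact: Flim_norm fa (fourierP fa). Qed.

Lemma F_uniq f g a : L2b leb f a -> Flim f g -> {ae leb, forall x, fourier f x = g x}.
Proof.
move=> fa [mg fg]; have [mF fF] := fourierP fa.
exact: cvgL2_uniq mF mg fF fg.
Qed.

Lemma F_D f g a b : L2b leb f a -> L2b leb g b ->
  {ae leb, forall xi, fourier (fun x => f x + g x) xi = fourier f xi + fourier g xi}.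
Proof.
move=> fa gb; have [mf fF] := fourierP fa; have [mg gF] := fourierP gb.
apply: (F_uniq (L2bD fa gb)); split; first exact: cmeasD.
move=> e e0; have e2 : 0 < e / 2 by rewrite divr_gt0.
apply: filterS (filterI (fF _ e2) (gF _ e2)) => n [h1 h2].
have := L2bD h1 h2; rewrite -splitr; congr L2b; apply/funext => xi.
rewrite (_ : truncate n (fun x => f x + g x) =
    fun x => truncate n f x + truncate n g x).
  rewrite (FI_D _ (cint_truncate n fa) (cint_truncate n gb)).
  by rewrite opprD addrACA.
by apply/funext => x; rewrite /truncate; case: ifP; rewrite ?addr0.
Qed.

Lemma F_Z z f a : L2b leb f a ->
  {ae leb, forall xi, fourier (fun x => z * f x) xi = z * fourier f xi}.
Proof.
move=> fa; have [mf fF] := fourierP fa.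
apply: (F_uniq (L2bZ z fa)); split; first by apply: cmeasM => //; exact: cmeas_cst.
move=> e e0; have z1 : 0 < nc z + 1 by rewrite ltr_wpDl ?nc_ge0.
have e1 : 0 < e / (nc z + 1) by rewrite divr_gt0.
apply: filterS (fF _ e1) => n h.
have ze : nc z * (e / (nc z + 1)) <= e.
  by rewrite mulrCA ler_piMr ?(ltW e0)// ler_pdivrMr// mul1r lerDl.
have := L2b_le (L2bZ z h) ze; congr L2b; apply/funext => xi.
rewrite (_ : truncate n (fun x => z * f x) = fun x => z * truncate n f x).
  by rewrite (FI_Z _ _ (cint_truncate n fa)) mulrBr.
by apply/funext => x; rewrite /truncate; case: ifP; rewrite ?mulr0.
Qed.

Lemma F_B f g a b : L2b leb f a -> L2b leb g b ->
  {ae leb, forall xi, fourier (fun x => f x - g x) xi = fourier f xi - fourier g xi}.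
Proof.
move=> fa gb; have h1 := F_D fa (L2bZ (-1) gb); have h2 := F_Z (-1) gb.
apply: filterS (filterI h1 h2) => xi [] + E2; rewrite E2 mulN1r => <-.
by congr (fourier _ xi); apply/funext => x; rewrite mulN1r.
Qed.

Lemma F_sub f g a b e : L2b leb f a -> L2b leb g b ->
  L2b leb (fun x => f x - g x) e ->
  L2b leb (fun xi => fourier f xi - fourier g xi) (K * e).
Proof.
move=> fa gb fge; apply: L2b_ae_eq (F_norm fge) _ _.
  by apply: cmeasB; [case: (F_norm fa)|case: (F_norm gb)].
by apply: filterS (F_B fa gb) => x ->.
Qed.

Lemma F_ext f g a : L2b leb f a -> cmeas g -> {ae leb, forall x, f x = g x} ->
  {ae leb, forall xi, fourier f xi = fourier g xi}.
Proof.
move=> fa mg fg; have ga : L2b leb g a.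
  by apply: L2b_ae_eq fa mg _; apply: filterS fg => x ->.
have : L2b leb (fun x => f x - g x) 0.
  apply: L2b_ae_eq (L2b0 _) _ _; first by apply: cmeasB => //; case: fa.
  by apply: filterS fg => x ->; rewrite subrr.
move=> /(F_sub fa ga); rewrite mulr0 => /L2b_eq0.
by apply: filterS => xi /eqP; rewrite subr_eq0 => /eqP.
Qed.

Lemma F_L1 f a : cint leb f -> L2b leb f a ->
  {ae leb, forall xi, fourier f xi = FI f xi}.
Proof.
move=> fi fa; apply: (F_uniq fa); split; first by apply: cmeas_FI; case: fi.
move=> e e0; have e1 : 0 < e / K by rewrite divr_gt0 ?K_gt0.
apply: filterS (truncate_cvgL2 fa e1) => n h.
have := FI_sub_bound (cint_truncate n fa) fi h.
by rewrite mulrC divfK// gt_eqF ?K_gt0.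
Qed.

Lemma ccvg_uniq (z : nat -> R[i]) l l' : ccvg z l -> ccvg z l' -> l = l'.
Proof.
move=> zl zl'; apply/eqP; rewrite -subr_eq0; apply/eqP/nc_eq0/eqP.
rewrite eq_le nc_ge0 andbT; apply/ler_addgt0Pr => e e0; rewrite add0r.
have e2 : 0 < e / 2 by rewrite divr_gt0.
move: zl zl' => /cvgrPdist_lt/(_ _ e2) h /cvgrPdist_lt/(_ _ e2) h'.
have [N _ hN] := filterI h h'; have := hN N (leqnn N) => -[].
rewrite !sub0r !normrN !ger0_norm ?nc_ge0// => h1 h2.
rewrite (_ : l - l' = (z N - l') - (z N - l)); last by ring.
by rewrite (le_trans (ncB _ _))// [leRHS]splitr lerD// ltW.
Qed.

Lemma IC_lim (u v : nat -> R3 R -> R[i]) f g a b : L2b leb f a -> L2b leb g b ->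
  (forall n, cmeas (u n)) -> (forall n, cmeas (v n)) ->
  cvgL2 u f -> cvgL2 v g ->
  ccvg (fun n => IC leb (fun x => u n x * v n x)) (IC leb (fun x => f x * g x)).
Proof.
move=> fa gb mu mv uf vg; apply/cvgrPdist_lt => e e0.
have a0 := L2b_ge0 fa; have b0 := L2b_ge0 gb.
have ab : 0 < a + b + 1 by rewrite ltr_wpDl ?addr_ge0.
(* The two error terms sum to at most d(d + b) + ad; with d <= 1 this is at most d(a + b + 1), hence
   at most e/2. *)
pose d := Num.min 1 (e / (a + b + 1) / 2).
have d0 : 0 < d by rewrite lt_min ltr01 !divr_gt0.
apply: filterS (filterI (uf _ d0) (vg _ d0)) => n [h1 h2].
rewrite sub0r normrN ger0_norm ?nc_ge0//.
have vn : L2b leb (v n) (d + b).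
  have := L2bD h2 gb; congr L2b; apply/funext => x; exact: subrK.
have i1 := CS h1 vn; have i2 := CS fa h2; have fgi := CS fa gb.
rewrite (_ : IC _ _ - _ = IC leb (fun x => (u n x - f x) * v n x) +
    IC leb (fun x => f x * (v n x - g x))); last first.
  have un : L2b leb (u n) (d + a).
    have := L2bD h1 fa; congr L2b; apply/funext => x; exact: subrK.
  have uvi := CS un vn.
  rewrite -(ICD (L1b_cint i1) (L1b_cint i2)) -(ICB (L1b_cint uvi) (L1b_cint fgi)).
  by apply: eq_IC => x; ring.
apply: le_lt_trans (ncD _ _) _.
apply: le_lt_trans (lerD (L1b_IC i1) (L1b_IC i2)) _.
have d1 : d <= 1 by rewrite ge_min lexx.
have de : d <= e / (a + b + 1) / 2 by rewrite ge_min lexx orbT.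
have : d * (a + b + 1) <= e / 2.
  by rewrite -ler_pdivlMr// mulrAC.
by nra.
Qed.

Lemma F_adjoint f g a b : L2b leb f a -> L2b leb g b ->
  IC leb (fun x => fourier f x * g x) = IC leb (fun x => f x * fourier g x).
Proof.
move=> fa gb; have [mf fF] := fourierP fa; have [mg gF] := fourierP gb.
have mtf n := cmeas_truncate n (L2b_cmeas fa).
have mtg n := cmeas_truncate n (L2b_cmeas gb).
have c1 := IC_lim (F_norm fa) gb (fun n => cmeas_FI (mtf n)) mtg fF (truncate_cvgL2 gb).
have c2 := IC_lim fa (F_norm gb) mtf (fun n => cmeas_FI (mtg n)) (truncate_cvgL2 fa) gF.
apply: ccvg_uniq c1 _; move: c2; congr ccvg; apply/funext => n.
rewrite -(FI_adjoint (cint_truncate n fa) (cint_truncate n gb)).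
by apply: eq_IC => x; rewrite mulrC.
Qed.

(** The transform with kernel exp(+i x.xi), written with two conjugations so that it inherits the
    properties of [fourier]. Divided by [K3] it is the inverse transform. *)
Definition Fb f xi : R[i] := (fourier (fun x => (f x)^*%C) xi)^*%C.

Lemma Fb_norm f a : L2b leb f a -> L2b leb (Fb f) (K * a).
Proof. by move=> fa; apply: L2b_conj; apply: F_norm; exact: L2b_conj. Qed.

Lemma Fb_adjoint f g a b : L2b leb f a -> L2b leb g b ->
  IC leb (fun x => Fb f x * g x) = IC leb (fun x => f x * Fb g x).
Proof.
move=> fa gb; have fc := L2b_conj fa; have gc := L2b_conj gb.
have := congr1 (@conjc R) (F_adjoint fc gc).
rewrite -(IC_conj (L1b_cint (CS (F_norm fc) gc))) -(IC_conj (L1b_cint (CS fc (F_norm gc)))).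
move=> E; transitivity (IC leb (fun x => (fourier (fun x => (f x)^*%C) x * (g x)^*%C)^*%C)).
  by apply: eq_IC => x; rewrite conjM conjcK.
by rewrite E; apply: eq_IC => x; rewrite conjM conjcK.
Qed.

End FourierL2.

(** * Functions with vanishing integrals over a generating class *)

Section DynkinZero.
Context {R : realType} d1 d2 (T : measurableType d1) (S : measurableType d2).
Variable mu : {measure set T -> \bar R}.

Lemma cint_indic (phi : T -> S) (h : T -> R[i]) (A : set S) :
  measurable_fun setT phi -> measurable A -> cint mu h ->
  cint mu (fun x => (\1_A (phi x) : R)%:C * h x).
Proof.
move=> mphi mA hi; apply: (cint_boundM (b := 1) hi) => [|x].
  by apply: cmeas_real; exact: (measurableT_comp (f := \1_A : S -> R)).
by rewrite nc_real_ge0 indicE ?ler0n// lern1 leq_b1.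
Qed.

(** The sets over which the integral vanishes form a Dynkin class: complements use the vanishing
    total integral, disjoint unions use dominated convergence. The map [phi] allows one coordinate
    to be treated at a time, the indicators in the others being absorbed in h. *)
Lemma dynkin_zero (phi : T -> S) (h : T -> R[i]) (G : set (set S)) :
  measurable_fun setT phi -> cint mu h ->
  @measurable _ S = <<s G >> -> setI_closed G -> IC mu h = 0 ->
  (forall A, G A -> IC mu (fun x => (\1_A (phi x) : R)%:C * h x) = 0) ->
  forall A, measurable A -> IC mu (fun x => (\1_A (phi x) : R)%:C * h x) = 0.
Proof.
move=> mphi hi mG GI h0 hG A; rewrite mG => sA.
have [mh hoo] := hi.
pose P := [set A : set S | IC mu (fun x => (\1_A (phi x) : R)%:C * h x) = 0].
apply: (@dynkin_induction _ _ G P) sA => //.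
- by rewrite /P/= -[RHS]h0; apply: eq_IC => x; rewrite indicT mul1r.
- move=> B mB PB; rewrite /P/=.
  rewrite (_ : IC _ _ = IC mu h - IC mu (fun x => (\1_B (phi x) : R)%:C * h x)).
    by rewrite h0 PB subrr.
  rewrite -ICB//; last exact: cint_indic.
  apply: eq_IC => x; rewrite !indicE in_setC.
  by case: (phi x \in B); rewrite /= ?mul1r ?mul0r ?subrr ?subr0.
- move=> F mF tF PF; rewrite /P/=.
  (* Finite unions, on which additivity suffices; dominated convergence then reaches the countable
     union. *)
  pose B n := \bigcup_(i in `I_n) F i.
  have mB n : measurable (B n) by apply: bigcup_measurable => i _; exact: mF.
  have PB n : IC mu (fun x => (\1_(B n) (phi x) : R)%:C * h x) = 0.
    elim: n => [|n IH].
      rewrite -[RHS](IC0 mu); apply: eq_IC => x.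
      by rewrite indicE memNset ?mul0r// => -[].
    transitivity (IC mu (fun x => (\1_(B n) (phi x) : R)%:C * h x) +
        IC mu (fun x => (\1_(F n) (phi x) : R)%:C * h x)); last by rewrite IH PF addr0.
    rewrite -ICD; [|exact: cint_indic|exact: cint_indic].
    apply: eq_IC => x; rewrite -mulrDl -rcD; congr (_%:C * _).
    rewrite !indicE -natrD; congr (_%:R).
    have [xn|xn] := pselect (F n (phi x)).
      rewrite (mem_set xn) [_ \in B n]memNset ?mem_set//.
        by exists n => /=.
      move=> [i /= ilt Fi]; have := tF i n I I (ex_intro _ _ (conj Fi xn)).
      by move=> ein; rewrite ein ltnn in ilt.
    rewrite [_ \in F n]memNset// addn0; congr nat_of_bool.
    apply/idP/idP; rewrite !inE => -[i /= ilt Fi].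
      move: ilt; rewrite ltnS leq_eqVlt => /predU1P[ein|ilt]; last by exists i.
      by rewrite ein in Fi.
    by exists i => //=; rewrite ltnS ltnW.
  apply: (@ccvg_uniq _ (fun n => IC mu (fun x => (\1_(B n) (phi x) : R)%:C * h x))).
    apply: (IC_dct (h := fun x => nc (h x))) => //.
    + by move=> n; case: (cint_indic mphi (mB n) hi).
    + have mU : measurable (\bigcup_k F k) by exact: bigcup_measurable.
      by case: (cint_indic mphi mU hi).
    + exact: cmeas_nc.
    + apply: aeW => x; apply: cvg_near_cst.
      have [[i _ Fi]|nF] := pselect ((\bigcup_k F k) (phi x)).
        near=> n; have iltn : (i < n)%N by near: n; exact: nbhs_infty_gt.
        by rewrite !indicE !mem_set ?subrr ?nc0//; exists i.
      near=> n; rewrite !indicE !memNset ?mul0r ?subrr ?nc0// => -[j _ Fj].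
      by apply: nF; exists j.
    + move=> n x; rewrite ncM nc_real_ge0 indicE ?ler0n// ler_piMl ?nc_ge0//.
      by rewrite lern1 leq_b1.
  apply: cvg_near_cst; near=> n; by rewrite PB subrr nc0.
Unshelve. all: by end_near. Qed.

End DynkinZero.

Section IndicZero.
Context {R : realType} d (T : measurableType d).
Variable mu : {measure set T -> \bar R}.

Lemma ae0_of_indic (h : T -> R[i]) : cint mu h ->
  (forall A, measurable A -> IC mu (fun x => (\1_A x : R)%:C * h x) = 0) ->
  {ae mu, forall x, h x = 0}.
Proof.
move=> hi hA; have [[m1 m2] _] := hi.
have key (p : T -> R) : mu.-integrable setT (EFin \o p) ->
    (forall A, measurable A -> \int[mu]_x (\1_A x * p x) = 0) ->
    {ae mu, forall x, p x = 0}.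
  move=> re_inner pA; have mp : measurable_fun setT p.
    by apply/measurable_EFinP; case/integrableP: re_inner.
  have := @integral_ae_eq _ _ _ mu setT measurableT (cst 0%E) (EFin \o p) re_inner.
  move=> /(_ (measurable_cst _)) H.
  have : ae_eq mu setT (EFin \o p) (cst 0%E).
    apply: H => E _ mE; rewrite integral0.
    have iE : mu.-integrable E (EFin \o p) by apply: integrableS re_inner.
    rewrite -[LHS]fineK; last exact: integrable_fin_num.
    congr (_%:E); rewrite -[RHS](pA _ mE) -[LHS]/(\int[mu]_(x in E) p x) Rintegral_mkcond.
    by apply: eq_Rintegral => x _; rewrite patchE indicE; case: ifP; rewrite ?mul1r ?mul0r.
  by apply: filterS => x /(_ I) [].
have a1 : {ae mu, forall x, complex.Re (h x) = 0}.
  apply: key; first exact: cint_Re.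
  move=> A /hA/(congr1 (@complex.Re R)) /=; rewrite -[X in _ = X]/0 => <-.
  by apply: eq_Rintegral => x _; rewrite cReM/= mul0r subr0.
have a2 : {ae mu, forall x, complex.Im (h x) = 0}.
  apply: key; first exact: cint_Im.
  move=> A /hA/(congr1 (@complex.Im R)) /=; rewrite -[X in _ = X]/0 => <-.
  by apply: eq_Rintegral => x _; rewrite cImM/= mul0r addr0.
by apply: filterS (filterI a1 a2) => x [E1 E2]; exact: complexP.
Qed.

Lemma IC_ge0 (h : T -> R) (r : R) : measurable_fun setT h -> (forall x, 0 <= h x) ->
  (\int[mu]_x (h x)%:E = r%:E)%E ->
  cint mu (fun x => (h x)%:C) /\ IC mu (fun x => (h x)%:C) = r%:C.
Proof.
move=> mh h0 hr; split.
  split; first exact: cmeas_real.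
  by under eq_integral do rewrite nc_real_ge0//; rewrite hr ltry.
apply: complexP => /=; first by rewrite /Rintegral hr.
by rewrite Rintegral_cst// mul0r.
Qed.

End IndicZero.

(** * Poisson averages of boxes *)

Section Boxes.
Context {R : realType}.
Notation leb := (@leb3 R).
Notation leb1 := (@lebesgue_measure R).
Implicit Types (x y xi p q : R3 R) (f g h k : R3 R -> R[i]) (a b c e t : R).

Definition ind a b : R -> R := \1_(`]a, b]%classic).

Definition bx p q x : R := ind p.1.1 q.1.1 x.1.1 * ind p.1.2 q.1.2 x.1.2 * ind p.2 q.2 x.2.

Lemma ind_ge0 a b t : 0 <= ind a b t. Proof. by rewrite /ind indicE ler0n. Qed.

Lemma ind_le1 a b t : ind a b t <= 1. Proof. by rewrite /ind indicE lern1 leq_b1. Qed.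

Lemma indE a b t : ind a b t = ((a < t) && (t <= b))%:R.
Proof.
rewrite /ind indicE; congr (nat_of_bool _)%:R.
by apply/idP/idP; rewrite in_setE/= in_itv.
Qed.

Lemma ind_I a b c e t : ind a b t * ind c e t = ind (Num.max a c) (Num.min b e) t.
Proof.
rewrite !indE gt_max le_min -natrM mulnb; congr (nat_of_bool _)%:R.
by rewrite !andbA; congr (_ && _); rewrite -!andbA; congr (_ && _); rewrite andbC.
Qed.

Lemma measurable_ind a b : measurable_fun setT (ind a b : measurableTypeR R -> R).
Proof. exact: measurable_indic. Qed.

Definition atq e a b t := 2 * atan (e^-1 * (b - t)) - 2 * atan (e^-1 * (a - t)).

(** Boxes serve as test functions because their Poisson averages are explicit products of
    differences of arctangents. *)
Lemma poi1_ind e a b t : 0 < e -> a <= b ->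
  cint leb1 (fun s => (poi1 e (t - s) * ind a b s)%:C) /\
  IC leb1 (fun s => (poi1 e (t - s) * ind a b s)%:C) = (atq e a b t)%:C.
Proof.
move=> e0 ab; have mpt : measurable_fun setT (fun s : measurableTypeR R => poi1 e (t - s)).
  by apply: (measurableT_comp (measurable_poi1 e0)); exact: measurable_funB.
apply: IC_ge0.
- by apply: measurable_funM => //; exact: measurable_ind.
- by move=> s; rewrite mulr_ge0 ?poi1_ge0 ?ind_ge0.
- rewrite -(int_poisson_itv t e0 ab) -integral_itv_obnd_cbnd; last first.
    by apply/measurable_EFinP; exact: measurable_funTS.
  rewrite [RHS]integral_mkcond; apply: eq_integral => s _.
  by rewrite patchE /ind indicE; case: ifP; rewrite ?mulr1 ?mulr0.
Qed.

Lemma bx_ge0 p q x : 0 <= bx p q x.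
Proof. by apply: mulr_ge0; [apply: mulr_ge0|]; exact: ind_ge0. Qed.

Lemma bx_le1 p q x : bx p q x <= 1.
Proof. by rewrite /bx !mulr_ile1 ?mulr_ge0 ?ind_ge0 ?ind_le1. Qed.

Definition le3 p q := [/\ p.1.1 <= q.1.1, p.1.2 <= q.1.2 & p.2 <= q.2].

Lemma cnv_poi_bx e p q x : 0 < e -> le3 p q ->
  cnv (fun x => (poi e x)%:C) (fun y => (bx p q y)%:C) x =
  (atq e p.1.1 q.1.1 x.1.1 * atq e p.1.2 q.1.2 x.1.2 * atq e p.2 q.2 x.2)%:C.
Proof.
move=> e0 [h1 h2 h3].
have [i1 E1] := poi1_ind x.1.1 e0 h1; have [i2 E2] := poi1_ind x.1.2 e0 h2.
have [i3 E3] := poi1_ind x.2 e0 h3.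
have [i12 E12] := IC_prodM i1 i2; have [i123 E123] := IC_prodM i12 i3.
rewrite rcM rcM -E1 -E2 -E3 -E12 -E123; apply: eq_IC => y.
by rewrite -!rcM; congr (_%:C); rewrite /poi /bx /=; ring.
Qed.

Lemma measurable_bx p q : measurable_fun setT (bx p q).
Proof.
have [p1 p2 p3] := measurable_coord (@measurable_id _ (R3 R) setT).
by apply: measurable_funM; [apply: measurable_funM|];
  exact: (measurableT_comp (@measurable_ind _ _)).
Qed.

Lemma cint_bx p q : cint leb (fun x => (bx p q x)%:C).
Proof.
split; first by apply: cmeas_real; exact: measurable_bx.
have m a b : measurable_fun setT (ind a b : measurableTypeR R -> R) := measurable_ind a b.
have m12 : measurable_fun setT (fun x : measurableTypeR R * measurableTypeR R =>
    ind p.1.1 q.1.1 x.1 * ind p.1.2 q.1.2 x.2).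
  by apply: measurable_funM; exact: (measurableT_comp (m _ _)).
have p12 (x : measurableTypeR R * measurableTypeR R) :
    0 <= ind p.1.1 q.1.1 x.1 * ind p.1.2 q.1.2 x.2.
  by rewrite mulr_ge0// ind_ge0.
have E12 := @int_prod _ _ _ _ _ leb1 leb1 _ _ (m _ _) (m _ _) (ind_ge0 p.1.1 q.1.1) (ind_ge0 p.1.2 q.1.2).
have E3 : (\int[leb]_x (bx p q x)%:E = _)%E :=
  @int_prod _ _ _ _ _ _ leb1 _ _ m12 (m _ _) p12 (ind_ge0 p.2 q.2).
under eq_integral do rewrite nc_real_ge0 ?bx_ge0//.
have fin a b : exists2 r : R, (\int[leb1]_s (ind a b s)%:E = r%:E)%E & 0 <= r.
  have -> : (\int[leb1]_s (ind a b s)%:E = leb1 `]a, b]%classic)%E.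
    by rewrite /ind integral_indic// setIT.
  rewrite lebesgue_measure_itv/=; case: ifP => ab.
    by exists (b - a) => //; rewrite subr_ge0 ltW.
  by exists 0.
have [r1 F1 r10] := fin p.1.1 q.1.1; have [r2 F2 r20] := fin p.1.2 q.1.2.
have [r3 F3 r30] := fin p.2 q.2.
by rewrite E3 E12 F1 F2 F3 -!EFinM ltry.
Qed.

Lemma L2b_bx p q : exists a, L2b leb (fun x => (bx p q x)%:C) a.
Proof.
have [a [mb ba]] := cint_L1b (cint_bx p q).
have a0 : 0 <= a.
  by rewrite -lee_fin (le_trans _ ba)// integral_ge0// => x _; rewrite lee_fin nc_ge0.
exists (Num.sqrt a); split; [exact: mb|exact: sqrtr_ge0|].
rewrite sqr_sqrtr//; apply: le_trans ba.
apply: ge0_le_integral => //.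
- by move=> x _; rewrite lee_fin sqr_ge0.
- exact: mnc2.
- exact: mnc.
- move=> x _; rewrite lee_fin nc_real_ge0 ?bx_ge0// expr2 ler_piMl ?bx_ge0//.
  exact: bx_le1.
Qed.

Lemma atan_cvg c : c != 0 ->
  (fun n => atan (n.+1%:R^-1^-1 * c)) @ \oo --> (if 0 < c then pi / 2 else - (pi / 2) : R).
Proof.
have key (d : R) : 0 < d -> (fun n => atan (n.+1%:R^-1^-1 * d)) @ \oo --> (pi / 2 : R).
  move=> d0; have h : (fun n => n.+1%:R^-1^-1 * d) @ \oo --> +oo.
    have h1 : (fun n => n.+1%:R : R) @ \oo --> +oo.
      by rewrite (cvg_shiftS (fun n => n%:R : R)); exact: cvgr_idn.
    have h2 : r * d @[r --> +oo] --> +oo by apply: (gt0_cvgMly d0); exact: cvg_id.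
    under eq_fun do rewrite invrK.
    exact: (cvg_comp (fun n => n.+1%:R : R) (fun r => r * d) h1 h2).
  exact: (cvg_comp (fun n => n.+1%:R^-1^-1 * d) atan h (@cvgy_atan R)).
move=> c0; case: ltP => [|c_le0]; first exact: key.
have cn : 0 < - c by rewrite oppr_gt0 lt_neqAle c0.
rewrite (_ : (fun n => _) = fun n => - atan (n.+1%:R^-1^-1 * - c)).
  by apply: cvgN; exact: key.
by apply/funext => n; rewrite mulrN atanN opprK.
Qed.

(** Each arctangent tends to pi/2 with the sign of its argument. At an endpoint of a nondegenerate
    interval the limit is half the jump, whence the exclusion; by [ae_ne] it costs only a null
    set. *)
Lemma atq_cvg a b t : a <= b -> t != a -> t != b ->
  (fun n => atq (n.+1%:R^-1) a b t) @ \oo --> (2 * pi * ind a b t : R).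
Proof.
move=> ab ta tb.
have h1 := @atan_cvg (b - t); rewrite subr_eq0 eq_sym in h1.
have h2 := @atan_cvg (a - t); rewrite subr_eq0 eq_sym in h2.
have c1 : (fun n => 2 * atan (n.+1%:R^-1^-1 * (b - t))) @ \oo -->
    (2 * (if 0 < b - t then pi / 2 else - (pi / 2)) : R) by apply: cvgMr; exact: h1.
have c2 : (fun n => 2 * atan (n.+1%:R^-1^-1 * (a - t))) @ \oo -->
    (2 * (if 0 < a - t then pi / 2 else - (pi / 2)) : R) by apply: cvgMr; exact: h2.
rewrite [X in _ --> X](_ : _ = 2 * (if 0 < b - t then pi / 2 else - (pi / 2)) -
  2 * (if 0 < a - t then pi / 2 else - (pi / 2))); first exact: cvgB c1 c2.
rewrite indE !subr_gt0.
case: (ltgtP t a) ta => // [lta|gta] _.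
  by rewrite (lt_le_trans lta ab) /=; ring.
by case: (ltgtP t b) tb => // _ _ /=; field.
Qed.

Lemma leb_coord_ae (N : set (measurableTypeR R)) : measurable N -> leb1 N = 0%E ->
  {ae leb, forall x, [/\ ~ N x.1.1, ~ N x.1.2 & ~ N x.2]}.
Proof.
move=> mN N0.
have h1 : leb.-negligible ((N `*` setT) `*` setT).
  exists ((N `*` setT) `*` setT); split => //.
    by apply: measurableX => //; exact: measurableX.
  have E : leb ((N `*` setT) `*` setT) =
      ((leb1 \x leb1)%E (N `*` setT) * leb1 setT)%E.
    by apply: product_measure1E => //; exact: measurableX.
  have E2 : (leb1 \x leb1)%E (N `*` setT) = (leb1 N * leb1 setT)%E.
    exact: product_measure1E.
  by rewrite E E2 N0 !mul0e.
have h2 : leb.-negligible ((setT `*` N) `*` setT).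
  exists ((setT `*` N) `*` setT); split => //.
    by apply: measurableX => //; exact: measurableX.
  have E : leb ((setT `*` N) `*` setT) =
      ((leb1 \x leb1)%E (setT `*` N) * leb1 setT)%E.
    by apply: product_measure1E => //; exact: measurableX.
  have E2 : (leb1 \x leb1)%E (setT `*` N) = (leb1 setT * leb1 N)%E.
    exact: product_measure1E.
  by rewrite E E2 N0 mule0 mul0e.
have h3 : leb.-negligible (setT `*` N).
  exists (setT `*` N); split => //; first exact: measurableX.
  have E : leb (setT `*` N) = ((leb1 \x leb1)%E setT * leb1 N)%E.
    exact: product_measure1E.
  by rewrite E N0 mule0.
have := negligibleU (negligibleU h1 h2) h3.
apply: negligibleS => x /=; apply: contra_notP => nx.
by split => Nx; apply: nx; [left; left|left; right|right].
Qed.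

Lemma ae_ne a : {ae leb, forall x, [/\ x.1.1 != a, x.1.2 != a & x.2 != a]}.
Proof.
have := @leb_coord_ae [set a] (measurable_set1 a) (lebesgue_measure_set1 a).
by apply: filterS => x [h1 h2 h3]; split; apply/eqP.
Qed.

Lemma cnv_poi_bx_cvg p q : le3 p q -> {ae leb, forall x,
  ccvg (fun n => cnv (fun x => (poi (n.+1%:R^-1) x)%:C) (fun y => (bx p q y)%:C) x)
       (K3 * bx p q x)%:C}.
Proof.
move=> pq; have [h1 h2 h3] := pq.
apply: filterS (filterI (filterI (ae_ne p.1.1) (ae_ne q.1.1))
  (filterI (filterI (ae_ne p.1.2) (ae_ne q.1.2))
  (filterI (ae_ne p.2) (ae_ne q.2)))) => x [[[a1 _ _] [b1 _ _]] [[[_ a2 _] [_ b2 _]] [[_ _ a3] [_ _ b3]]]].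
rewrite /ccvg; under eq_fun do rewrite cnv_poi_bx// -rcB nc_real.
apply/norm_cvg0P/subr_cvg0.
have c := cvgM (cvgM (atq_cvg h1 a1 b1) (atq_cvg h2 a2 b2)) (atq_cvg h3 a3 b3).
rewrite [X in _ --> X](_ : _ = 2 * pi * ind p.1.1 q.1.1 x.1.1 * (2 * pi * ind p.1.2 q.1.2 x.1.2) *
  (2 * pi * ind p.2 q.2 x.2)); first exact: c.
by rewrite /K3 /bx !exprS expr0; ring.
Qed.

End Boxes.

(** * Fourier inversion *)

Section Inversion.
Context {R : realType}.
Notation leb := (@leb3 R).
Notation leb1 := (@lebesgue_measure R).
Notation K := (Num.sqrt (@K3 R)).
Implicit Types (x y xi p q : R3 R) (f g h k U V : R3 R -> R[i]) (a b c e t : R).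

Notation bxC p q := (fun x : R3 R => (bx p q x)%:C).

Lemma gam_ccvg xi (z : R[i]) : ccvg (fun n => (gam (n.+1%:R^-1) xi)%:C * z) z.
Proof.
apply: (@ccvg_le _ _ _ (fun n => `|1 - gam (n.+1%:R^-1) xi| * nc z)).
  move=> n; rewrite (_ : _ - _ = (gam (n.+1%:R^-1) xi - 1)%:C * z).
    by rewrite ncM nc_real distrC.
  by rewrite rcB mulrBl mul1r.
rewrite -[X in _ --> X](mul0r (nc z)); apply: cvgMl.
apply/norm_cvg0P; rewrite -[X in _ --> X](subrr 1); apply: cvgB; first exact: cvg_cst.
exact: gam_cvg1.
Qed.

(** The transform of a box is in general not integrable, so it is approximated by its Abel means
    [pn]. These converge in L^2, hence so do their transforms, to [fourier phi]; at almost every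
    point the same transforms are Poisson averages of the box and converge to [K3 * bx p q]. Fatou's
    lemma identifies the two limits. *)
Lemma F_box p q : le3 p q ->
  {ae leb, forall x, fourier (fun xi => (FI (bxC p q) xi)^*%C) x = (K3 * bx p q x)%:C}.
Proof.
move=> pq; set b := bxC p q; pose phi := fun xi => (FI b xi)^*%C; rewrite -/phi.
have bi : cint leb b := cint_bx p q; have [a ba] := L2b_bx p q.
have [B bB] := cint_L1b bi.
have La : L2b leb phi (K * a) := L2b_conj (FI_bound bi ba).
have mphi := L2b_cmeas La.
pose en (n : nat) : R := n.+1%:R^-1.
have en0 n : 0 < en n by rewrite invr_gt0.
pose pn n xi := (gam (en n) xi)%:C * phi xi.
have mpn n : cmeas (pn n).
  by apply: cmeasM => //; apply: cmeas_real; exact: measurable_gam.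
have pn_le n xi : nc (pn n xi) <= nc (phi xi).
  by rewrite ncM (nc_real_ge0 (gam_ge0 _ _)) ler_piMl ?nc_ge0// gam_le1.
have Lpn n : L2b leb (pn n) (K * a) := L2b_dom La (mpn n) (pn_le n).
have ipn n : cint leb (pn n).
  rewrite /pn; under eq_fun do rewrite mulrC.
  apply: (cint_boundM (b := B) (cint_gam (en0 n)) mphi) => xi.
  by rewrite nc_conj FI_le.
have cpn : cvgL2 pn phi.
  move=> e e0; apply: (L2_dct (h := phi) mpn mphi La _ pn_le e0).
  by apply: aeW => xi; exact: gam_ccvg.
have EFI n x : FI (pn n) x = cnv (fun x => (poi (en n) x)%:C) b x.
  rewrite /pn FI_gam_cnv//; congr (cnv _ _ x); apply/funext => y.
  exact: conj_rc.
have mF := L2b_cmeas (F_norm La).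
have mK : cmeas (fun x => (K3 * bx p q x)%:C).
  by apply: cmeas_real; apply: measurable_funM; [exact: measurable_cst|exact: measurable_bx].
have cF : cvgL2 (fun n => FI (pn n)) (fourier phi).
  move=> e e0; have e1 : 0 < e / K by rewrite divr_gt0 ?K_gt0.
  apply: filterS (cpn _ e1) => n h.
  have := F_sub (Lpn n) La h; rewrite mulrC divfK ?gt_eqF ?K_gt0// => h'.
  apply: L2b_ae_eq h' _ _; first by apply: (cmeasB _ mF); exact: cmeas_FI.
  by apply: filterS (F_L1 (ipn n) (Lpn n)) => x ->.
have : L2b leb (fun x => (K3 * bx p q x)%:C - fourier phi x) 0.
  apply: L2b_inf; first exact: cmeasB mK mF.
  move=> e e0; apply: (@L2b_fatou _ _ _ leb (fun n x => FI (pn n) x - fourier phi x)).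
  - by move=> n; apply: (cmeasB _ mF); exact: cmeas_FI.
  - exact: cmeasB mK mF.
  - exact: cF.
  - apply: filterS (cnv_poi_bx_cvg pq) => x hx; rewrite /ccvg.
    under eq_fun do rewrite EFI opprB addrA subrK.
    exact: hx.
by move=> /L2b_eq0; apply: filterS => x /eqP; rewrite subr_eq0 => /eqP.
Qed.

Lemma bx_eq0 p q : ~ le3 p q -> forall x, bx p q x = 0.
Proof.
move=> npq x; have i0 a b t : b < a -> ind a b t = 0.
  move=> ba; rewrite indE; case: ltP => //= h; case: leP => //= h'.
  by have := lt_trans (lt_le_trans h h') ba; rewrite ltxx.
rewrite /bx; case: (leP p.1.1 q.1.1) => [h1|/i0->]; last by rewrite !mul0r.
case: (leP p.1.2 q.1.2) => [h2|/i0->]; last by rewrite mulr0 mul0r.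
case: (leP p.2 q.2) => [h3|/i0->]; last by rewrite mulr0.
by exfalso; apply: npq.
Qed.

(** Inversion in the weak sense: the two adjoint formulas move both transforms from f onto the box,
    where [F_box] evaluates them. *)
Lemma box_test f a p q : L2b leb f a ->
  IC leb (fun x => (bx p q x)%:C * (Fb (fourier f) x - K3%:C * f x)) = 0.
Proof.
move=> fa; have [|npq] := pselect (le3 p q); last first.
  by rewrite -[RHS](IC0 leb); apply: eq_IC => x; rewrite bx_eq0// mul0r.
move=> pq; have [b bb] := L2b_bx p q; have bi := cint_bx p q.
have Ff := F_norm fa; have FFf := Fb_norm Ff.
have i1 := L1b_cint (CS bb FFf); have i2 := L1b_cint (CS bb fa).
have La := L2b_conj (FI_bound bi bb).
rewrite (_ : IC _ _ = IC leb (fun x => (bx p q x)%:C * Fb (fourier f) x) -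
    IC leb (fun x => K3%:C * ((bx p q x)%:C * f x))); last first.
  by rewrite -ICB//; [apply: eq_IC => x; ring|exact: cintZ].
rewrite -(Fb_adjoint bb Ff) ICZ//.
have E1 : IC leb (fun x => Fb (bxC p q) x * fourier f x) =
    IC leb (fun x => (FI (bxC p q) x)^*%C * fourier f x).
  apply: ae_eq_IC.
  - by apply: cmeasM; [case: (Fb_norm bb)|case: Ff].
  - by apply: cmeasM; [case: La|case: Ff].
  - apply: filterS (F_L1 bi bb) => x E; rewrite /Fb.
    rewrite (_ : (fun x => _) = bxC p q); first by rewrite E.
    by apply/funext => y; rewrite conj_rc.
rewrite E1 -(F_adjoint La fa) -ICZ//.
apply/eqP; rewrite subr_eq0; apply/eqP; apply: ae_eq_IC.
- by apply: cmeasM; [case: (F_norm La)|case: fa].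
- by apply: cmeasM; [exact: cmeas_cst|case: i2].
- by apply: filterS (F_box pq) => x ->; rewrite rcM mulrA.
Qed.

(** Multiplication by a large box makes the function integrable. The sets allowed are then enlarged
    from intervals to Borel sets, in one coordinate after the other, and finally from products of
    Borel sets to all measurable sets. *)
Lemma zero_of_boxes k a : L2b leb k a ->
  (forall p q, IC leb (fun x => (bx p q x)%:C * k x) = 0) ->
  {ae leb, forall x, k x = 0}.
Proof.
move=> ka hk.
suff Hn n : {ae leb, forall x, (bx ((- n%:R, - n%:R), - n%:R) ((n%:R, n%:R), n%:R) x)%:C * k x = 0}.
  have := @ae_foralln _ _ _ leb _ Hn; apply: filterS => x hx.
  have [N Nx] : exists N : nat, norm3 x < N%:R.
    by exists (Num.truncn (norm3 x)).+1; exact: truncnS_gt.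
  have [x1 x2 x3] := norm3_coord x.
  have := hx N; rewrite (_ : bx _ _ x = 1) ?mul1r//.
  have i1 t : `|t| <= norm3 x -> ind (- N%:R) N%:R t = 1.
    move=> ht; have {}ht := le_lt_trans ht Nx.
    rewrite indE; move: ht; rewrite ltr_norml => /andP[-> h].
    by rewrite (ltW h).
  by rewrite /bx !i1// !mulr1.
set Q := bx _ _; pose I a b : set (measurableTypeR R) := `]a, b]%classic.
pose h x := (Q x)%:C * k x.
have [b Qb] := L2b_bx ((- n%:R, - n%:R), - n%:R) ((n%:R, n%:R), n%:R) : exists b, L2b leb (fun x => (Q x)%:C) b.
have hi : cint leb h := L1b_cint (CS Qb ka).
have [m1 m2 m3] := measurable_coord (@measurable_id _ (R3 R) setT).
have mI a' b' : measurable (I a' b') by exact: measurable_itv.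
have indid a' b' t : ind a' b' t * ind a' b' t = ind a' b' t by rewrite ind_I maxxx minxx.
have idm (i j k' : R) : j * j = j -> [/\ j * (j * i * k') = j * i * k', j * (i * j * k') = i * j * k'
    & j * (i * k' * j) = i * k' * j].
  by move=> jj; split; rewrite -[in RHS]jj; ring.
(* [Q] already contains the indicator of (-n, n] in each coordinate, so integrating over the whole
   line in that coordinate amounts to integrating over this interval. This provides the vanishing
   total integral that [dynkin_zero] requires. *)
have id1 x : (\1_(I (- n%:R) n%:R) x.1.1 : R)%:C * h x = h x.
  rewrite /h mulrA -rcM; congr (_%:C * _).
  by have [E _ _] := idm (ind (- n%:R) n%:R x.1.2) _ (ind (- n%:R) n%:R x.2) (indid (- n%:R) n%:R x.1.1).
have id2 x : (\1_(I (- n%:R) n%:R) x.1.2 : R)%:C * h x = h x.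
  rewrite /h mulrA -rcM; congr (_%:C * _).
  by have [_ E _] := idm (ind (- n%:R) n%:R x.1.1) _ (ind (- n%:R) n%:R x.2) (indid (- n%:R) n%:R x.1.2).
have id3 x : (\1_(I (- n%:R) n%:R) x.2 : R)%:C * h x = h x.
  rewrite /h mulrA -rcM; congr (_%:C * _).
  by have [_ _ E] := idm (ind (- n%:R) n%:R x.1.1) _ (ind (- n%:R) n%:R x.1.2) (indid (- n%:R) n%:R x.2).
(* [V0] holds because the intersection of a box with the large box is again a box, possibly
   empty. *)
pose V (A B C : set (measurableTypeR R)) := IC leb (fun x => (\1_A x.1.1 : R)%:C *
  ((\1_B x.1.2 : R)%:C * ((\1_C x.2 : R)%:C * h x))).
have V0 a1 b1 a2 b2 a3 b3 : V (I a1 b1) (I a2 b2) (I a3 b3) = 0.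
  rewrite -[RHS](hk ((Num.max a1 (- n%:R), Num.max a2 (- n%:R)), Num.max a3 (- n%:R))
    ((Num.min b1 n%:R, Num.min b2 n%:R), Num.min b3 n%:R)).
  apply: eq_IC => x; rewrite /h !mulrA -!rcM; congr (_%:C * _).
  rewrite /Q /bx /= -!ind_I -[\1_(I a1 _)]/(ind a1 b1) -[\1_(I a2 _)]/(ind a2 b2)
    -[\1_(I a3 _)]/(ind a3 b3); ring.
have V1 A a2 b2 a3 b3 : measurable A -> V A (I a2 b2) (I a3 b3) = 0.
  have i2 := cint_indic m2 (mI a2 b2) (cint_indic m3 (mI a3 b3) hi).
  move: A; apply: (dynkin_zero (G := @ocitv R) m1 i2) => //.
  - exact: ocitvI.
  - rewrite -[RHS](V0 (- n%:R) n%:R a2 b2 a3 b3); apply: eq_IC => x.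
    by rewrite [RHS]mulrCA; congr (_ * _); rewrite [RHS]mulrCA id1.
  - by move=> A [[a1 b1] /= _ <-]; exact: V0.
have V2 A B a3 b3 : measurable A -> measurable B -> V A B (I a3 b3) = 0.
  move=> mA; have i2 := cint_indic m1 mA (cint_indic m3 (mI a3 b3) hi).
  have D : forall B, measurable B -> IC leb (fun x => (\1_B x.1.2 : R)%:C *
      ((\1_A x.1.1 : R)%:C * ((\1_(I a3 b3) x.2 : R)%:C * h x))) = 0.
    apply: (dynkin_zero (G := @ocitv R) m2 i2) => //.
    - exact: ocitvI.
    - rewrite -[RHS](V1 A (- n%:R) n%:R a3 b3 mA); apply: eq_IC => x.
      by congr (_ * _); rewrite [RHS]mulrCA id2.
    - move=> C [[a2 b2] /= _ <-]; rewrite -[RHS](V1 A a2 b2 a3 b3 mA).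
      by apply: eq_IC => x; rewrite mulrCA.
  by move=> mB; rewrite -[RHS](D B mB); apply: eq_IC => x; rewrite mulrCA.
have V3 A B C : measurable A -> measurable B -> measurable C -> V A B C = 0.
  move=> mA mB; have i2 := cint_indic m1 mA (cint_indic m2 mB hi).
  have D : forall C, measurable C -> IC leb (fun x => (\1_C x.2 : R)%:C *
      ((\1_A x.1.1 : R)%:C * ((\1_B x.1.2 : R)%:C * h x))) = 0.
    apply: (dynkin_zero (G := @ocitv R) m3 i2) => //.
    - exact: ocitvI.
    - rewrite -[RHS](V2 A B (- n%:R) n%:R mA mB); apply: eq_IC => x.
      by rewrite id3.
    - move=> C' [[a2 b2] /= _ <-]; rewrite -[RHS](V2 A B a2 b2 mA mB).
      by apply: eq_IC => x; rewrite mulrCA; congr (_ * _); rewrite mulrCA.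
  move=> mC; rewrite -[RHS](D C mC); apply: eq_IC => x.
  by rewrite [RHS]mulrCA; congr (_ * _); rewrite mulrCA.
have indX (S1 S2 : Type) (A : set S1) (B : set S2) z :
    (\1_(A `*` B) z : R) = \1_A z.1 * \1_B z.2.
  by rewrite !indicE -natrM mulnb in_setX.
(* The sigma-algebra of R^3 is a product taken twice: rectangles are first extended in the pair of
   the first two coordinates, then in the whole space. *)
have V4 D C : measurable D -> measurable C ->
    IC leb (fun x => (\1_D x.1 : R)%:C * ((\1_C x.2 : R)%:C * h x)) = 0.
  move=> mD mC; move: D mD.
  apply: (dynkin_zero (G := [set A `*` B | A in @measurable _ (measurableTypeR R) &
    B in @measurable _ (measurableTypeR R)]) measurable_fst (cint_indic m3 mC hi)).
  - exact: measurable_prod_measurableType.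
  - move=> _ _ [A1 mA1 [B1 mB1 <-]] [A2 mA2 [B2 mB2 <-]].
    exists (A1 `&` A2); first exact: measurableI.
    by exists (B1 `&` B2); [exact: measurableI|rewrite setXI].
  - rewrite -[RHS](V3 setT setT C measurableT measurableT mC); apply: eq_IC => x.
    by rewrite !indicT !mul1r.
  - move=> _ [A mA [B mB <-]]; rewrite -[RHS](V3 A B C mA mB mC); apply: eq_IC => x.
    by rewrite indX rcM -mulrA.
apply: (ae0_of_indic hi).
have mid : measurable_fun [set: R3 R] (@id (R3 R)) by exact: measurable_id.
refine (@dynkin_zero _ _ _ _ _ _ id h [set A `*` B | A in
    @measurable _ (measurableTypeR R * measurableTypeR R)%type &
    B in @measurable _ (measurableTypeR R)] mid hi _ _ _ _).
- exact: measurable_prod_measurableType.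
- move=> _ _ [A1 mA1 [B1 mB1 <-]] [A2 mA2 [B2 mB2 <-]].
  exists (A1 `&` A2); first exact: measurableI.
  by exists (B1 `&` B2); [exact: measurableI|rewrite setXI].
- rewrite -[RHS](V4 setT setT measurableT measurableT); apply: eq_IC => x.
  by rewrite !indicT !mul1r.
- move=> _ [A mA [B mB <-]]; rewrite -[RHS](V4 A B mA mB); apply: eq_IC => x.
  by rewrite indX rcM -mulrA.
Qed.

Lemma F_inv f a : L2b leb f a -> {ae leb, forall x, Fb (fourier f) x = K3%:C * f x}.
Proof.
move=> fa; have := L2bB (Fb_norm (F_norm fa)) (L2bZ K3%:C fa).
move=> /zero_of_boxes/(_ (fun p q => box_test p q fa)).
by apply: filterS => x /eqP; rewrite subr_eq0 => /eqP.
Qed.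

Lemma F_inv' f a : L2b leb f a -> {ae leb, forall x, fourier (Fb f) x = K3%:C * f x}.
Proof.
move=> fa; apply: filterS (F_inv (L2b_conj fa)) => x.
by move=> /(congr1 (@conjc R)); rewrite /Fb conjcK conjM conj_rc conjcK.
Qed.

End Inversion.

(** * The convolution theorem *)

Lemma L1b_IC2 {R : realType} d1 d2 (S : measurableType d1) (T : measurableType d2)
  (mu : {sigma_finite_measure set S -> \bar R}) (nu : {sigma_finite_measure set T -> \bar R})
  (F : S * T -> R[i]) c : cmeas F ->
  (\int[nu]_t \int[mu]_s (nc (F (s, t)))%:E <= c%:E)%E ->
  L1b mu (fun s => IC nu (fun t => F (s, t))) c.
Proof.
move=> mF B; have mI : cmeas (fun s => IC nu (fun t => F (s, t))) := cmeas_IC2 nu mF.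
split => //; apply: le_trans (B); rewrite -(tonelli_nc mu nu mF)/=.
apply: ae_ge0_le_integral => //.
- exact: mnc mI.
- by move=> x _; rewrite integral_ge0// => y _; rewrite lee_fin nc_ge0.
- apply: (measurable_fun_fubini_tonelli_F (fun p => (nc (F p))%:E)); first exact: mnc.
  by move=> x; rewrite lee_fin nc_ge0.
- by apply: filterS (ae_cint mF (le_lt_trans B (ltry _))) => x hx _; exact: IC_le.
Qed.

Section ConvolutionTheorem.
Context {R : realType}.
Notation leb := (@leb3 R).
Notation K := (Num.sqrt (@K3 R)).
Implicit Types (f g h U V W : R3 R -> R[i]) (a b c : R).

Lemma cnv_L1_bound U V a b : L1b leb U a -> L1b leb V b ->
  (\int[leb]_y \int[leb]_x (nc (U (sub3 x y) * V y))%:E <= (a * b)%:E)%E.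
Proof.
move=> [mU Ua] [mV Vb].
have a0 : (0 <= a%:E)%E.
  by apply: le_trans Ua; rewrite integral_ge0// => y _; rewrite lee_fin nc_ge0.
rewrite (eq_integral (fun y => (\int[leb]_x (nc (U x))%:E) * (nc (V y))%:E)%E); last first.
  move=> y _; rewrite -(mpres_int (mpres_subr y) (mnc mU)).
    rewrite -ge0_integralZr//; last 3 first.
    - by apply: mnc; apply: (cmeas_comp (h := fun x => sub3 x y)) => //; exact: measurable_sub3.
    - by move=> x _; rewrite lee_fin nc_ge0.
    - by rewrite lee_fin nc_ge0.
    by apply: eq_integral => x _; rewrite ncM EFinM.
  by move=> x; rewrite lee_fin nc_ge0.
rewrite ge0_integralZl//; last 3 first.
- exact: mnc.
- by move=> y _; rewrite lee_fin nc_ge0.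
- by rewrite integral_ge0// => y _; rewrite lee_fin nc_ge0.
rewrite EFinM; apply: lee_pmul => //.
- by rewrite integral_ge0// => y _; rewrite lee_fin nc_ge0.
- by rewrite integral_ge0// => y _; rewrite lee_fin nc_ge0.
Qed.

Lemma cmeas_cnv2 U V : cmeas U -> cmeas V ->
  cmeas (fun p : R3 R * R3 R => U (sub3 p.1 p.2) * V p.2).
Proof.
move=> mU mV; apply: cmeasM; last exact: (cmeas_comp (h := snd)).
by apply: (cmeas_comp (h := fun p : R3 R * R3 R => sub3 p.1 p.2)) => //; exact: measurable_sub3.
Qed.

Lemma cnv_L1 U V a b : L1b leb U a -> L1b leb V b -> L1b leb (cnv U V) (a * b).
Proof.
move=> Ua Vb; have [mU _] := Ua; have [mV _] := Vb.
exact: (L1b_IC2 (cmeas_cnv2 mU mV) (cnv_L1_bound Ua Vb)).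
Qed.

Lemma FI_cnv U V a b xi : cint leb U -> cint leb V -> L2b leb U a -> L2b leb V b ->
  FI (cnv U V) xi = FI U xi * FI V xi.
Proof.
move=> Ui Vi Ua Vb; have [a' Ua'] := cint_L1b Ui; have [b' Vb'] := cint_L1b Vi.
have [mU _] := Ui; have [mV _] := Vi.
rewrite /FI; transitivity (IC leb (fun x => IC leb (fun y => ker x xi * (U (sub3 x y) * V y)))).
  by apply: eq_IC => x; rewrite ICZ//; exact: L1b_cint (cnv_cint x Ua Vb).
have mF : cmeas (fun p : R3 R * R3 R => ker p.1 xi * (U (sub3 p.1 p.2) * V p.2)).
  apply: cmeasM; last exact: cmeas_cnv2.
  exact: (cmeas_ker measurable_fst (measurable_cst xi)).
have B : (\int[leb]_y \int[leb]_x (nc (ker x xi * (U (sub3 x y) * V y)))%:E < +oo)%E.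
  apply: le_lt_trans (ltry (a' * b')).
  under eq_integral do under eq_integral do rewrite ncM nc_ker mul1r.
  exact: cnv_L1_bound.
apply: (eq_trans (IC_swap mF B)).
rewrite -ICZ/=; last exact: cint_ker.
apply: eq_IC => y.
have mk : cmeas (fun z => ker z xi * U z) by have [] := cint_ker xi Ui.
rewrite -(mpres_IC (mpres_subr y) mk).
have mk2 : cint leb (fun x => ker (sub3 x y) xi * U (sub3 x y)).
  exact: mpres_cint (mpres_subr y) (cint_ker xi Ui).
rewrite [RHS]mulrC -ICZ//; apply: eq_IC => x.
rewrite (kerC x xi) (kerC (sub3 x y) xi) ker_sub (kerC y xi).
have {1}-> : ker xi x = ker xi x * ((ker xi y)^*%C * ker xi y).
  by rewrite mul_conjC nc_ker expr1n mulr1.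
by ring.
Qed.

Definition invFT W x : R[i] := (K3^-1)%:C * Fb W x.

Lemma invFT_norm W a : L2b leb W a -> L2b leb (invFT W) (K^-1 * a).
Proof.
move=> Wa; apply: L2b_le (L2bZ _ (Fb_norm Wa)) _.
rewrite nc_real_ge0 ?invr_ge0 ?(ltW K3_gt0)// mulrA ler_wpM2r//; first exact: L2b_ge0 Wa.
have K0 := @K_gt0 R.
have {1}-> : @K3 R = K * K by rewrite -expr2 sqr_sqrtr// ltW// K3_gt0.
by rewrite invfM mulfVK ?gt_eqF.
Qed.

Lemma F_invFT W a : L2b leb W a -> {ae leb, forall xi, fourier (invFT W) xi = W xi}.
Proof.
move=> Wa.
apply: filterS (filterI (F_Z (K3^-1)%:C (Fb_norm Wa)) (F_inv' Wa)) => x [E1 E2].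
by rewrite [LHS]E1 E2 mulrA -rcM mulVf ?mul1r// gt_eqF ?K3_gt0.
Qed.

Lemma Fb_ext f g a : L2b leb f a -> cmeas g -> {ae leb, forall x, f x = g x} ->
  {ae leb, forall x, Fb f x = Fb g x}.
Proof.
move=> fa mg fg.
have fg' : {ae leb, forall x, (f x)^*%C = (g x)^*%C} by apply: filterS fg => x ->.
by apply: filterS (F_ext (L2b_conj fa) (cmeas_conj mg) fg') => x E; rewrite /Fb E.
Qed.

Lemma F_inj f g a b : L2b leb f a -> L2b leb g b ->
  {ae leb, forall x, fourier f x = fourier g x} -> {ae leb, forall x, f x = g x}.
Proof.
move=> fa gb fg.
have mg := L2b_cmeas (F_norm gb).
apply: filterS (filterI (filterI (F_inv fa) (F_inv gb)) (Fb_ext (F_norm fa) mg fg)).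
move=> x [[E1 E2] E3].
have : K3%:C * f x = K3%:C * g x by rewrite -E1 -E2.
apply: mulfI; apply/eqP => /(congr1 (@complex.Re R)) /= E.
by have := @K3_gt0 R; rewrite E ltxx.
Qed.

(** With integrable transforms U and V, inversion writes f and g as ordinary integrals ([rep]). The
    transform of a convolution is a product, so [invFT (cnv U V)] equals K3 f g; this puts f g in
    L^2, and applying [fourier] gives the formula. *)
Lemma F_mul f g U V a b c e : L2b leb f a -> L2b leb g b ->
  cint leb U -> cint leb V -> L2b leb U c -> L2b leb V e ->
  {ae leb, forall xi, fourier f xi = U xi} -> {ae leb, forall xi, fourier g xi = V xi} ->
  (exists m, L2b leb (fun x => f x * g x) m) /\
  {ae leb, forall xi, fourier (fun x => f x * g x) xi = (K3^-1)%:C * cnv U V xi}.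
Proof.
move=> fa gb Ui Vi Uc Ve fU gV.
have rep h W p q : L2b leb h p -> cint leb W -> L2b leb W q ->
    {ae leb, forall xi, fourier h xi = W xi} ->
    {ae leb, forall x, h x = (K3^-1)%:C * (FI (fun xi => (W xi)^*%C) x)^*%C}.
  move=> hp Wi Wq hW.
  have hf : {ae leb, forall xi, fourier h xi = fourier (invFT W) xi}.
    by apply: filterS (filterI hW (F_invFT Wq)) => x [-> ->].
  apply: filterS (filterI (F_inj hp (invFT_norm Wq) hf) (F_L1 (cint_conj Wi) (L2b_conj Wq))).
  by move=> x [-> E]; rewrite /invFT /Fb E.
have [c' Uc'] := cint_L1b Ui; have [e' Ve'] := cint_L1b Vi.
have Li := L1b_cint (cnv_L1 Uc' Ve'); have L2 := young Uc' Ve.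
have Ef := rep _ _ _ _ fa Ui Uc fU; have Eg := rep _ _ _ _ gb Vi Ve gV.
have mfg : cmeas (fun x => f x * g x) by apply: cmeasM; [case: fa|case: gb].
have Lf := L2bZ (K3^-1)%:C (invFT_norm L2).
have E : {ae leb, forall x, (K3^-1)%:C * invFT (cnv U V) x = f x * g x}.
  apply: filterS (filterI (filterI Ef Eg) (F_L1 (cint_conj Li) (L2b_conj L2))) => x [[-> ->] E].
  rewrite /invFT /Fb E.
  rewrite (_ : FI (fun xi => (cnv U V xi)^*%C) x = FI (fun xi => (U xi)^*%C) x * FI (fun xi => (V xi)^*%C) x).
    by rewrite conjM; ring.
  rewrite -(FI_cnv x (cint_conj Ui) (cint_conj Vi) (L2b_conj Uc) (L2b_conj Ve)).
  apply: eq_IC => xi; congr (_ * _).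
  rewrite /cnv -IC_conj; last exact: L1b_cint (cnv_cint xi Uc Ve).
  by apply: eq_IC => y; rewrite conjM.
split; first by eexists; apply: L2b_ae_eq Lf mfg _; apply: filterS E => x ->.
have E2 := F_ext Lf mfg E.
apply: filterS (filterI (filterI E2 (F_Z (K3^-1)%:C (invFT_norm L2))) (F_invFT L2)).
by move=> x [[<- ->] ->].
Qed.

End ConvolutionTheorem.

(** * Weighted norms and the algebra property *)

Section Phi.
Context {R : realType}.
Implicit Types s t : R.

(* The rates 3/4 and 5/4 are the powers 3 and 5 of phi. *)
Definition phi t : R := (1 + `|t|) `^ (- (1 / 4)).

Lemma phi_arg t : 0 < 1 + `|t|.
Proof. by rewrite ltr_wpDr. Qed.

Lemma phi_gt0 t : 0 < phi t.
Proof. by rewrite powR_gt0// phi_arg. Qed.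

Lemma phi_le1 t : phi t <= 1.
Proof.
by rewrite -[leRHS](powRr0 (1 + `|t|)) ler_powR ?lerDl//; lra.
Qed.

Lemma phi_X t n : phi t ^+ n = (1 + `|t|) `^ (- (n%:R / 4)).
Proof.
rewrite -powR_mulrn ?(ltW (phi_gt0 _))// /phi -powRrM; congr (_ `^ _); lra.
Qed.

Lemma phi4 t : phi t ^+ 4 = (1 + `|t|)^-1.
Proof.
rewrite phi_X -[RHS]powR_inv1; last exact: ltW (phi_arg t).
by congr (_ `^ _); lra.
Qed.

Lemma continuous_phi : continuous phi.
Proof.
move=> t; apply: (@continuous_comp _ _ _ (fun t => 1 + `|t|) (fun x => x `^ (- (1 / 4)))).
  by apply: contD; [exact: cont_cst|exact: norm_continuous].
have h := is_derive1_powR (- (1 / 4)) (phi_arg t).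
by apply/differentiable_continuous/derivable1_diffP; case: h.
Qed.

Lemma measurable_phi : measurable_fun setT (phi : measurableTypeR R -> R).
Proof. by apply: continuous_measurable_fun; exact: continuous_phi. Qed.

Lemma phi_even t : phi (- t) = phi t. Proof. by rewrite /phi normrN. Qed.

(** The exponent is 5/4 > 1: on the half-line -4 (1 + t)^(-1/4) is an antiderivative, which
    contributes 4 on each side of the origin. *)
Lemma int_phi5 : (\int[lebesgue_measure]_t (phi t ^+ 5)%:E = 8%:E)%E.
Proof.
have c5 : continuous (fun t : R => phi t ^+ 5).
  by move=> x; apply: (@continuous_comp _ _ _ phi (fun y => y ^+ 5));
    [exact: continuous_phi|exact: exprn_continuous].
have f0 t : 0 <= phi t ^+ 5 by rewrite exprn_ge0// ltW// phi_gt0.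
rewrite int_even//; last by move=> x; rewrite phi_even.
pose F (t : R) : R := - 4 * (1 + t) `^ (- (1 / 4)).
have dF t : 0 <= t -> is_derive t 1 F (phi t ^+ 5).
  move=> t0; have t1 : 0 < 1 + t by rewrite ltr_wpDr.
  have h1 : is_derive t 1 (fun y => 1 + y) 1.
    by have := is_derive_add (is_derive_cst (1 : R) t 1) (is_derive_id t 1); rewrite add0r.
  have := is_derive_scal (- 4) (is_derive1_comp (is_derive1_powR (- (1 / 4)) t1) h1).
  rewrite phi_X (ger0_norm t0) [X in is_derive _ _ _ X -> _](_ : _ = (1 + t) `^ (- (5%:R / 4))).
    by apply.
  rewrite mulr1 mulrA (_ : - 4 * - (1 / 4) = 1) ?mul1r; last by lra.
  by congr (_ `^ _); lra.
rewrite (@ge0_continuous_FTC2y _ (fun t => phi t ^+ 5) F 0 0).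
- by rewrite /F addr0 powR1 mulr1 -EFinB -EFinM; congr (_%:E); lra.
- by move=> x _.
- exact: continuous_subspaceT.
- rewrite -[X in _ --> X](mulr0 (- 4)); apply: cvgMr.
  apply/cvgrPdist_lt => e e0; near=> x.
  have x1 : e^-1 ^+ 4 < 1 + x.
    apply: (@lt_trans _ _ x); last by rewrite ltrDr.
    by near: x; apply: nbhs_pinfty_gt; exact: num_real.
  have e1 : 0 < e^-1 by rewrite invr_gt0.
  have x0 : 0 < 1 + x by apply: le_lt_trans x1; rewrite exprn_ge0// ltW.
  rewrite sub0r normrN ger0_norm ?powR_ge0// powRN -(invrK e) ltf_pV2 ?posrE ?powR_gt0//.
  have {1}-> : e^-1 = (e^-1 ^+ 4) `^ (1 / 4).
    rewrite -powR_mulrn ?ltW// -powRrM (_ : 4%:R * (1 / 4) = 1); last by lra.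
    by rewrite powRr1// ltW.
  by apply: gt0_ltr_powR => //; rewrite ?nnegrE ?exprn_ge0 ?ltW.
- by move=> x x0; have [] := dF x (ltW x0).
- apply/cvg_at_right_filter; apply: differentiable_continuous.
  by apply/derivable1_diffP; have [] := dF 0 (lexx _).
- move=> x; rewrite in_itv/= andbT => x0.
  by have := @derive_val _ _ _ _ _ _ _ (dF x (ltW x0)); rewrite derive1E.
Unshelve. all: by end_near. Qed.

End Phi.

Lemma IC_mono {R : realType} d (T : measurableType d) (mu : {measure set T -> \bar R})
  (f : T -> R[i]) (h : T -> R) : cmeas f -> cint mu (fun x => (h x)%:C) ->
  (forall x, nc (f x) <= h x) -> nc (IC mu f) <= nc (IC mu (fun x => (h x)%:C)).
Proof.
move=> mf hi fh; have [[mh _] hoo] := hi.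
have h0 x : 0 <= h x by apply: le_trans (fh x); exact: nc_ge0.
have fi : cint mu f.
  split => //; apply: le_lt_trans hoo; apply: ge0_le_integral => //.
  - by move=> x _; rewrite lee_fin nc_ge0.
  - exact: mnc.
  - by apply: mnc; case: hi.
  - by move=> x _; rewrite lee_fin nc_real_ge0.
rewrite -lee_fin; apply: le_trans (IC_le fi) _.
have hf : (\int[mu]_x (h x)%:E)%E \is a fin_num.
  by apply: integrable_fin_num => //; exact: cint_Re hi.
apply: (@le_trans _ _ (\int[mu]_x (h x)%:E)%E).
  apply: ge0_le_integral => //.
  - by move=> x _; rewrite lee_fin nc_ge0.
  - exact: mnc.
  - exact/measurable_EFinP.
  - by move=> x _; rewrite lee_fin.
rewrite -(fineK hf) lee_fin; apply: le_trans (Re_le_nc _).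
exact: ler_norm.
Qed.

Section Weights.
Context {R : realType}.
Notation leb := (@leb3 R).
Notation leb1 := (@lebesgue_measure R).
Implicit Types (x y xi eta : R3 R) (f g h U V : R3 R -> R[i]) (a b c N M : R).

Definition w N xi : R := (1 + norm3 xi ^+ 2) `^ (N / 2).

Lemma norm3_ge0 xi : 0 <= norm3 xi. Proof. exact: sqrtr_ge0. Qed.

Lemma dot3_ge0 xi : 0 <= dot3 xi xi.
Proof. by rewrite /dot3 -!expr2 !addr_ge0 ?sqr_ge0. Qed.

Lemma norm3_sqr xi : norm3 xi ^+ 2 = dot3 xi xi.
Proof. by rewrite sqr_sqrtr// dot3_ge0. Qed.

Lemma w_arg xi : 1 <= 1 + norm3 xi ^+ 2.
Proof. by rewrite lerDl sqr_ge0. Qed.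

Lemma w_gt0 N xi : 0 < w N xi.
Proof. by rewrite powR_gt0// (lt_le_trans ltr01)// w_arg. Qed.

Lemma w_ge0 N xi : 0 <= w N xi. Proof. exact: ltW (w_gt0 N xi). Qed.

Lemma w_le M N xi : M <= N -> w M xi <= w N xi.
Proof. by move=> MN; rewrite ler_powR ?w_arg// ler_wpM2r// invr_ge0. Qed.

Lemma w0 xi : w 0 xi = 1. Proof. by rewrite /w mul0r powRr0. Qed.

Lemma w_ge1 N xi : 0 <= N -> 1 <= w N xi.
Proof. by move=> N0; rewrite -(w0 xi) w_le. Qed.

Lemma w_sqr N xi : w N xi ^+ 2 = (1 + norm3 xi ^+ 2) `^ N.
Proof.
by rewrite -powR_mulrn ?w_ge0// -powRrM divfK// pnatr_eq0.
Qed.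

(** One factor |xi| costs one Sobolev index: this is why the time derivative lives in H^(N-1). *)
Lemma w_pred N xi : norm3 xi * w (N - 1) xi <= w N xi.
Proof.
have a0 : 0 < 1 + norm3 xi ^+ 2 := lt_le_trans ltr01 (w_arg xi).
rewrite -[leRHS]mul1r -(@ler_pXn2r _ 2) ?nnegrE ?mulr_ge0 ?norm3_ge0 ?w_ge0//.
have E : (1 + norm3 xi ^+ 2) `^ N = (1 + norm3 xi ^+ 2) `^ (N - 1) * (1 + norm3 xi ^+ 2).
  by rewrite -{1}(subrK 1 N) [LHS]powRD ?(gt_eqF a0) ?implybT// powRr1// ltW.
rewrite mul1r exprMn !w_sqr E.
by rewrite mulrC ler_wpM2l ?powR_ge0// lerDr.
Qed.

Lemma measurable_w N : measurable_fun setT (w N).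
Proof.
have h : measurable_fun setT (fun xi : R3 R => 1 + norm3 xi ^+ 2).
  apply: measurable_funD; first exact: measurable_cst.
  by apply: measurable_funX; exact: (measurable_norm3 (p := id)).
exact: (measurableT_comp (@measurable_powR R (N / 2)) h).
Qed.

Definition wP N : R := 4 `^ (N / 2).

Lemma wP_ge0 N : 0 <= wP N. Proof. exact: powR_ge0. Qed.

(** The base satisfies the inequality with a maximum and the factor 4, and taking the power N/2
    turns the factor into [wP N]. The maximum is finally bounded by the sum. *)
Lemma w_peetre N xi eta : 0 <= N -> w N xi <= wP N * (w N (sub3 xi eta) + w N eta).
Proof.
move=> N0; have N2 : 0 <= N / 2 by rewrite divr_ge0.
have pq : 1 + norm3 xi ^+ 2 <= 4 * Num.max (1 + norm3 (sub3 xi eta) ^+ 2) (1 + norm3 eta ^+ 2).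
  rewrite !norm3_sqr /dot3 /sub3/=.
  case: xi => [[x1 x2] x3]; case: eta => [[y1 y2] y3] /=.
  (* In each coordinate 2(x - y)^2 + 2y^2 - x^2 is the square of x - 2y. *)
  have := sqr_ge0 (x1 - 2 * y1); have := sqr_ge0 (x2 - 2 * y2).
  have := sqr_ge0 (x3 - 2 * y3).
  by rewrite /Num.max; case: ifPn; rewrite -?leNgt; nra.
move: pq; set p := 1 + norm3 (sub3 xi eta) ^+ 2; set q := 1 + norm3 eta ^+ 2 => pq.
have p1 : 1 <= p := w_arg _; have q1 : 1 <= q := w_arg _.
have m0 : 0 <= Num.max p q by rewrite le_max (le_trans ler01 p1).
apply: (@le_trans _ _ ((4 * Num.max p q) `^ (N / 2))).
  by apply: ge0_ler_powR => //; rewrite nnegrE ?mulr_ge0// (le_trans ler01)// w_arg.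
rewrite powRM// ler_wpM2l ?wP_ge0//.
rewrite /Num.max; case: ifP => _; first by rewrite lerDr w_ge0.
by rewrite lerDl w_ge0.
Qed.

Definition phi3 xi : R := phi xi.1.1 * phi xi.1.2 * phi xi.2.

Lemma int_phi3 : (\int[leb]_xi (phi3 xi ^+ 5)%:E = (8 * 8 * 8)%:E)%E.
Proof.
have m : measurable_fun setT (fun t : measurableTypeR R => phi t ^+ 5).
  by apply: measurable_funX; exact: measurable_phi.
have p0 (t : R) : 0 <= phi t ^+ 5 by rewrite exprn_ge0// ltW// phi_gt0.
have m12 : measurable_fun setT (fun x : measurableTypeR R * measurableTypeR R =>
    phi x.1 ^+ 5 * phi x.2 ^+ 5).
  by apply: measurable_funM; exact: (measurableT_comp m).
have p12 (x : measurableTypeR R * measurableTypeR R) : 0 <= phi x.1 ^+ 5 * phi x.2 ^+ 5.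
  exact: mulr_ge0.
have E12 := @int_prod _ _ _ _ _ leb1 leb1 _ _ m m p0 p0.
have E3 : (\int[leb]_x (phi x.1.1 ^+ 5 * phi x.1.2 ^+ 5 * phi x.2 ^+ 5)%:E = _)%E :=
  @int_prod _ _ _ _ _ _ leb1 _ _ m12 m p12 p0.
under eq_integral do rewrite !exprMn.
by rewrite E3 E12 int_phi5 -!EFinM.
Qed.

(** Integrability in R^3 by comparison with a product of one-variable functions, instead of polar
    coordinates. With q = 1 + |xi|^2, each (1 + |xi_j|)^2 is at most 2q, so [phi3 ^+ 5] is at least
    (2q)^(-15/8), and therefore at least (2q)^(-2), while N >= 2 gives q^(-N) <= q^(-2). *)
Lemma w_phi3 N xi : 2 <= N -> (w N xi)^-1 ^+ 2 <= 4 * phi3 xi ^+ 5.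
Proof.
move=> N2; set q := 1 + norm3 xi ^+ 2; have q1 : 1 <= q := w_arg xi.
have q0 : 0 < q := lt_le_trans ltr01 q1.
have p0 : 0 < phi3 xi by rewrite !mulr_gt0// phi_gt0.
have h (t : R) : t ^+ 2 <= norm3 xi ^+ 2 -> (phi t ^+ 8)^-1 <= 2 * q.
  move=> ht; rewrite (_ : phi t ^+ 8 = phi t ^+ 4 ^+ 2); last by rewrite -exprM.
  rewrite phi4 -exprVn invrK /q; have := sqr_ge0 (1 - `|t|).
  by have := real_normK (num_real t); nra.
have hp : (phi3 xi ^+ 8)^-1 <= (2 * q) ^+ 3.
  have n2 : norm3 xi ^+ 2 = xi.1.1 ^+ 2 + xi.1.2 ^+ 2 + xi.2 ^+ 2.
    by rewrite norm3_sqr /dot3 -!expr2.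
  have s1 := sqr_ge0 xi.1.1; have s2 := sqr_ge0 xi.1.2; have s3 := sqr_ge0 xi.2.
  have pV (t : R) : 0 <= (phi t ^+ 8)^-1 by rewrite invr_ge0 exprn_ge0// ltW// phi_gt0.
  rewrite (_ : (2 * q) ^+ 3 = 2 * q * (2 * q) * (2 * q)); last by ring.
  have invM3 (a b c : R) : (a * b * c)^-1 = a^-1 * b^-1 * c^-1 by rewrite !invfM.
  rewrite /phi3 !exprMn invM3.
  by rewrite !ler_pM ?mulr_ge0//; apply: h; rewrite n2; lra.
move: (phi3 xi) p0 hp => p p0 hp.
(* The exponent 15/8 is handled by comparing eighth powers: (2q)^15 <= (2q)^16, as 2q >= 1. *)
have h5 : (p ^+ 5)^-1 <= (2 * q) ^+ 2.
  rewrite -(@ler_pXn2r _ 8) ?nnegrE ?invr_ge0 ?exprn_ge0 ?(ltW p0) ?mulr_ge0 ?(ltW q0)//.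
  rewrite exprVn -exprM mulnC exprM -exprVn.
  apply: (@le_trans _ _ (((2 * q) ^+ 3) ^+ 5)).
    by rewrite lerXn2r// nnegrE ?exprn_ge0 ?invr_ge0 ?exprn_ge0 ?(ltW p0) ?mulr_ge0 ?(ltW q0).
  by rewrite -!exprM ler_weXn2l//; nra.
have qN : q ^+ 2 <= q `^ N by rewrite -(powR_mulrn 2 (ltW q0)) ler_powR.
rewrite exprVn w_sqr -/q invf_ple ?posrE ?powR_gt0 ?mulr_gt0 ?exprn_gt0//.
apply: le_trans qN; rewrite invfM.
by move: h5; rewrite exprMn; nra.
Qed.

Lemma measurable_winv N : measurable_fun setT (fun xi => (w N xi)^-1).
Proof.
under eq_fun do rewrite -powRN.
have := @measurable_w (- N); congr measurable_fun; apply/funext => xi.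
by rewrite /w mulNr.
Qed.

Definition wA : R := Num.sqrt (4 * (8 * 8 * 8)).

Lemma wA_ge0 : 0 <= wA. Proof. exact: sqrtr_ge0. Qed.

Lemma L2b_winv N : 2 <= N -> L2b leb (fun xi => ((w N xi)^-1)%:C) wA.
Proof.
move=> N2; split; [|exact: wA_ge0|].
  by apply: cmeas_real; exact: measurable_winv.
have mp : measurable_fun setT (fun xi => phi3 xi ^+ 5).
  have [m1 m2 m3] := measurable_coord (@measurable_id _ (R3 R) setT).
  apply: measurable_funX; apply: measurable_funM; first apply: measurable_funM.
  - exact: (measurableT_comp measurable_phi m1).
  - exact: (measurableT_comp measurable_phi m2).
  - exact: (measurableT_comp measurable_phi m3).
have p0 xi : 0 <= phi3 xi ^+ 5.
  by rewrite exprn_ge0// !mulr_ge0// ltW// phi_gt0.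
apply: (@le_trans _ _ (\int[leb]_xi (4 * phi3 xi ^+ 5)%:E)%E).
  apply: ge0_le_integral => //.
  - by move=> x _; rewrite lee_fin sqr_ge0.
  - by apply: mnc2; apply: cmeas_real; exact: measurable_winv.
  - by apply/measurable_EFinP; apply: measurable_funM => //; exact: measurable_cst.
  - by move=> x _; rewrite lee_fin nc_real_ge0 ?invr_ge0 ?w_ge0// w_phi3.
under eq_integral do rewrite EFinM.
rewrite ge0_integralZl//; last 2 first.
- exact/measurable_EFinP.
- by move=> x _; rewrite lee_fin.
by rewrite int_phi3 -EFinM lee_fin /wA sqr_sqrtr// !mulr_ge0.
Qed.

(* [f] is the Fourier transform of a function with H^N norm at most [a]. *)
Definition HB N f a := L2b leb (fun xi => (w N xi)%:C * f xi) a.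

Lemma wK N f : (fun xi => ((w N xi)^-1)%:C * ((w N xi)%:C * f xi)) = f.
Proof.
by apply/funext => xi; rewrite mulrA -rcM mulVf ?mul1r// gt_eqF// w_gt0.
Qed.

Lemma HB_cmeas N f a : HB N f a -> cmeas f.
Proof.
move=> [m _ _]; rewrite -(wK N f).
by apply: cmeasM m; apply: cmeas_real; exact: measurable_winv.
Qed.

Lemma HB_ge0 N f a : HB N f a -> 0 <= a. Proof. by case. Qed.

Lemma cmeas_wM N f : cmeas f -> cmeas (fun xi => (w N xi)%:C * f xi).
Proof. by move=> mf; apply: cmeasM mf; apply: cmeas_real; exact: measurable_w. Qed.

Lemma HB_L2 N f a : 0 <= N -> HB N f a -> L2b leb f a.
Proof.
move=> N0 fa; apply: (L2b_dom fa); first exact: HB_cmeas fa.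
move=> xi; rewrite ncM nc_real_ge0 ?w_ge0//.
by rewrite ler_peMl ?nc_ge0// w_ge1.
Qed.

(** Fourier form of the embedding of H^N in the bounded functions: the transform is integrable, by
    Cauchy-Schwarz against the inverse weight. *)
Lemma HB_L1 N f a : 2 <= N -> HB N f a -> L1b leb f (wA * a).
Proof. by move=> N2 fa; rewrite -(wK N f); exact: CS (L2b_winv N2) fa. Qed.

Lemma HB_le N f a b : HB N f a -> a <= b -> HB N f b.
Proof. exact: L2b_le. Qed.

Lemma HB_ae N f g a : HB N f a -> cmeas g -> {ae leb, forall x, nc (g x) <= nc (f x)} ->
  HB N g a.
Proof.
move=> fa mg fg; apply: (L2b_ae fa); first exact: cmeas_wM.
by apply: filterS fg => x h; rewrite !ncM ler_wpM2l// nc_ge0.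
Qed.

Lemma HB_dom N f g a : HB N f a -> cmeas g -> (forall x, nc (g x) <= nc (f x)) ->
  HB N g a.
Proof. by move=> fa mg fg; apply: (HB_ae fa mg); exact: aeW. Qed.

Lemma HB_mono M N f a : M <= N -> HB N f a -> HB M f a.
Proof.
move=> MN fa; apply: (L2b_dom fa); first by apply: cmeas_wM; exact: HB_cmeas fa.
by move=> x; rewrite !ncM ler_wpM2r ?nc_ge0// !nc_real_ge0 ?w_ge0// w_le.
Qed.

Lemma HB0 N : HB N (fun=> 0) 0.
Proof. by have := @L2b0 _ _ _ leb; congr L2b; apply/funext => x; rewrite mulr0. Qed.

Lemma HBD N f g a b : HB N f a -> HB N g b -> HB N (fun x => f x + g x) (a + b).
Proof.
by move=> fa gb; have := L2bD fa gb; congr L2b; apply/funext => x; rewrite mulrDr.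
Qed.

Lemma HBZ N f z a : HB N f a -> HB N (fun x => z * f x) (nc z * a).
Proof.
by move=> fa; have := L2bZ z fa; congr L2b; apply/funext => x; rewrite mulrCA.
Qed.

Lemma cnvC U V x : cmeas U -> cmeas V -> cnv U V x = cnv V U x.
Proof. by move=> mU mV; rewrite -cnv_flip//; apply: eq_IC => y; rewrite mulrC. Qed.

Lemma cnv_L2 N U V a b : 2 <= N -> HB N U a -> L2b leb V b ->
  L2b leb (cnv U V) (wA * a * b).
Proof. by move=> N2 Ua Vb; exact: young (HB_L1 N2 Ua) Vb. Qed.

Definition wC N : R := wP N * (2 * wA).

Lemma wC_ge0 N : 0 <= wC N.
Proof. by rewrite mulr_ge0 ?wP_ge0// mulr_ge0// wA_ge0. Qed.

(* Peetre's inequality distributes the weight over the two factors. *)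
Lemma HB_cnv N U V a b : 2 <= N -> HB N U a -> HB N V b ->
  HB N (cnv U V) (wC N * (a * b)).
Proof.
move=> N2 Ua Vb; have N0 : 0 <= N := le_trans (ler0n R 2) N2.
have mU := HB_cmeas Ua; have mV := HB_cmeas Vb.
(* Peetre's inequality acts on moduli under the integral, so Young's inequality is applied to the
   convolutions of the moduli. *)
pose nf f : R3 R -> R[i] := fun x => (nc (f x))%:C.
have Lnf f e : L2b leb f e -> L2b leb (nf f) e.
  move=> fe; apply: (L2b_dom fe) => [|x]; last by rewrite nc_real_ge0 ?nc_ge0.
  by apply: cmeas_real; apply: cmeas_nc; exact: L2b_cmeas fe.
have L1nf f e : L1b leb f e -> L1b leb (nf f) e.
  move=> [mf fe]; split; first by apply: cmeas_real; exact: cmeas_nc.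
  by under eq_integral do rewrite nc_real_ge0 ?nc_ge0//.
pose wU xi := (w N xi)%:C * U xi; pose wV xi := (w N xi)%:C * V xi.
have mnf f : cmeas f -> cmeas (nf f) by move=> mf; apply: cmeas_real; exact: cmeas_nc.
have U2 := HB_L2 N0 Ua; have V2 := HB_L2 N0 Vb.
have A1 := young (L1nf _ _ (HB_L1 N2 Ua)) (Lnf wV b Vb).
have A2 := young (L1nf _ _ (HB_L1 N2 Vb)) (Lnf wU a Ua).
have := L2bZ (wP N)%:C (L2bD A1 A2); rewrite nc_real_ge0 ?wP_ge0//.
rewrite (_ : wP N * (wA * a * b + wA * b * a) = wC N * (a * b)); last by rewrite /wC; ring.
move=> L; apply: (L2b_dom L) => [|x]; first by apply: cmeas_wM; exact: cmeas_cnv.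
rewrite -(cnvC x (mnf wU (L2b_cmeas Ua)) (mnf V mV)).
have i1 := L1b_cint (cnv_cint x (Lnf U a U2) (Lnf wV b Vb)).
have i2 := L1b_cint (cnv_cint x (Lnf wU a Ua) (Lnf V b V2)).
have i12 := cintZ (wP N)%:C (cintD i1 i2).
have i0 := L1b_cint (cnv_cint x U2 V2).
rewrite /cnv -(ICD i1 i2) -(ICZ _ (cintD i1 i2)) -(ICZ _ i0).
rewrite (_ : (fun y => (wP N)%:C * _) = fun y => (wP N *
  (nc (U (sub3 x y)) * nc (wV y) + nc (wU (sub3 x y)) * nc (V y)))%:C); last first.
  by apply/funext => y; rewrite rcM rcD !rcM.
apply: IC_mono.
- by case: (cintZ (w N x)%:C i0).
- by move: i12; congr cint; apply/funext => y; rewrite rcM rcD !rcM.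
- move=> y; rewrite !ncM !nc_real_ge0 ?w_ge0//.
  rewrite (_ : wP N * _ = wP N * (w N (sub3 x y) + w N y) * (nc (U (sub3 x y)) * nc (V y))).
    by rewrite ler_wpM2r ?mulr_ge0 ?nc_ge0// w_peetre.
  by ring.
Qed.

End Weights.

(** * Decay of the linear semigroup *)

Section Semigroup.
Context {R : realType}.
Implicit Types (k t m : R) (x y : R -> R).

Lemma nonincr (f df : R -> R) t : (forall t, is_derive t 1 f (df t)) ->
  (forall t, 0 <= t -> df t <= 0) -> 0 <= t -> f t <= f 0.
Proof.
move=> fd d0; rewrite le_eqVlt => /predU1P[<-//|t0].
have [] := MVT t0 (fun s _ => fd s).
  by apply: continuous_subspaceT; exact: is_derive_continuous fd.
move=> c; rewrite in_itv/= => /andP[c0 _] E.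
by rewrite -subr_le0 E mulr_le0_ge0 ?d0 ?ltW// subr_gt0.
Qed.

(* [- 1 / 2 + sqrt (pmu k)] and [- 1 / 2 - sqrt (pmu k)] are the eigenvalues of
   the linear part at the frequency [k]; [pc] and [ps] are the even and odd parts
   of [exp (sqrt (pmu k) t)], the latter divided by [sqrt (pmu k)]. *)
Definition pmu k : R := 1 / 4 - k ^+ 2.

Definition prt k : R := Num.sqrt `|pmu k|.

Definition pc k t : R :=
  if 0 < pmu k then (expR (prt k * t) + expR (- prt k * t)) / 2
  else if pmu k < 0 then cos (prt k * t) else 1.

Definition ps k t : R :=
  if 0 < pmu k then (prt k)^-1 * ((expR (prt k * t) - expR (- prt k * t)) / 2)
  else if pmu k < 0 then (prt k)^-1 * sin (prt k * t) else t.

Lemma pc0 k : pc k 0 = 1.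
Proof. by rewrite /pc !mulr0 expR0 cos0; case: ifP => _; [lra|case: ifP]. Qed.

Lemma ps0 k : ps k 0 = 0.
Proof. by rewrite /ps !mulr0 expR0 sin0 subrr mul0r !mulr0; case: ifP => // _; case: ifP. Qed.

Lemma prt_gt0 k : pmu k != 0 -> 0 < prt k.
Proof. by move=> m0; rewrite sqrtr_gt0 normr_gt0. Qed.

Lemma is_derive_pc k t : is_derive t 1 (pc k) (pmu k * ps k t).
Proof.
rewrite /pc /ps; case: ifPn => [m0|m0].
  have r0 := prt_gt0 (lt0r_neq0 m0).
  have rr : pmu k = prt k * prt k by rewrite -expr2 sqr_sqrtr// gtr0_norm.
  have h := is_derive_scal (2^-1) (is_derive_add (is_derive_expM (prt k) t)
    (is_derive_expM (- prt k) t)).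
  under eq_fun do rewrite mulrC.
  rewrite [X in is_derive _ _ _ X](_ : _ =
    2^-1 * (prt k * expR (prt k * t) + - prt k * expR (- prt k * t)))//.
  by rewrite rr -mulrA mulVKf ?gt_eqF//; ring.
case: ifPn => [m1|m1]; last first.
  by rewrite (_ : pmu k = 0) ?mul0r; [exact: is_derive_cst|lra].
have r0 := prt_gt0 (ltr0_neq0 m1).
have rr : pmu k = - (prt k * prt k) by rewrite -expr2 sqr_sqrtr// ltr0_norm// opprK.
have h := is_derive_cosM (prt k) t.
by rewrite rr mulNr -mulrA mulVKf ?gt_eqF.
Qed.

Lemma is_derive_ps k t : is_derive t 1 (ps k) (pc k t).
Proof.
rewrite /pc /ps; case: ifPn => [m0|m0].
  have r0 := prt_gt0 (lt0r_neq0 m0).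
  have h := is_derive_scal ((prt k)^-1 * 2^-1) (is_derive_add (is_derive_expM (prt k) t)
    (is_derive_scal (- 1) (is_derive_expM (- prt k) t))).
  rewrite [X in is_derive _ _ X](_ : _ = (fun z : R => (prt k)^-1 * 2^-1 *
      (expR (prt k * z) + -1 * expR (- prt k * z)))).
    rewrite [X in is_derive _ _ _ X](_ : _ = (prt k)^-1 / 2 *
      (prt k * expR (prt k * t) + -1 * (- prt k * expR (- prt k * t))))//.
    by field; rewrite gt_eqF.
  by apply/funext => z; ring.
case: ifPn => [m1|m1]; last exact: is_derive_id.
have r0 := prt_gt0 (ltr0_neq0 m1).
have h := is_derive_scal (prt k)^-1 (is_derive_sinM (prt k) t).
by rewrite mulKf ?gt_eqF// in h.
Qed.

(* For [u = x] and [v = - i y] the linear part is [x' = - k y], [y' = k x - y]; its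
   solutions from (1, 0) and (0, 1) are [(X1, Y1)] and [(- Y1, Y2)]. *)
Definition X1 k t : R := expR (- 2^-1 * t) * (pc k t + 2^-1 * ps k t).
Definition Y1 k t : R := expR (- 2^-1 * t) * (k * ps k t).
Definition Y2 k t : R := expR (- 2^-1 * t) * (pc k t + - 2^-1 * ps k t).

Lemma X1_0 k : X1 k 0 = 1.
Proof. by rewrite /X1 mulr0 expR0 pc0 ps0; lra. Qed.

Lemma Y1_0 k : Y1 k 0 = 0.
Proof. by rewrite /Y1 mulr0 expR0 ps0; lra. Qed.

Lemma Y2_0 k : Y2 k 0 = 1.
Proof. by rewrite /Y2 mulr0 expR0 pc0 ps0; lra. Qed.

Lemma is_derive_X1 k t : is_derive t 1 (X1 k) (- (k * Y1 k t)).
Proof.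
have := is_derive_prod (is_derive_expM (- 2^-1) t) (is_derive_add (is_derive_pc k t)
  (is_derive_scal 2^-1 (is_derive_ps k t))).
rewrite [X in is_derive _ _ _ X -> _](_ : _ = - (k * Y1 k t))//.
by rewrite /Y1 /pmu; field.
Qed.

Lemma is_derive_Y1 k t : is_derive t 1 (Y1 k) (k * X1 k t - Y1 k t).
Proof.
have := is_derive_prod (is_derive_expM (- 2^-1) t) (is_derive_scal k (is_derive_ps k t)).
rewrite [X in is_derive _ _ _ X -> _](_ : _ = k * X1 k t - Y1 k t)//.
by rewrite /Y1 /X1 /pmu; field.
Qed.

(** Both sides are the derivative of [Y1]: one is read off from the solution [(X1, Y1)], the other
    from [(- Y1, Y2)]. *)
Lemma Y1_alt k t : k * X1 k t - Y1 k t = k * Y2 k t.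
Proof. by rewrite /Y1 /X1 /Y2; field. Qed.

Lemma is_derive_Y2 k t : is_derive t 1 (Y2 k) (- (k * Y1 k t) - Y2 k t).
Proof.
have := is_derive_prod (is_derive_expM (- 2^-1) t) (is_derive_add (is_derive_pc k t)
  (is_derive_scal (- 2^-1) (is_derive_ps k t))).
rewrite [X in is_derive _ _ _ X -> _](_ : _ = - (k * Y1 k t) - Y2 k t)//.
by rewrite /Y1 /Y2 /pmu; field.
Qed.

Lemma is_derive_NY1 k t : is_derive t 1 (fun t => - Y1 k t) (- (k * Y2 k t)).
Proof. by rewrite -Y1_alt; exact: is_deriveN (is_derive_Y1 k t). Qed.

Section Lyapunov.
Variables (k : R) (x y : R -> R).
Hypothesis k0 : 0 <= k.
Hypothesis dx : forall t, is_derive t 1 x (- (k * y t)).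
Hypothesis dy : forall t, is_derive t 1 y (k * x t - y t).
Hypothesis xy0 : x 0 ^+ 2 + y 0 ^+ 2 = 1.

(** The decay rate of the amplitude: of order k^2 at low frequencies and of order 1 at high ones.
    The divisor 5 is fixed by the balance in [energy_decay]. *)
Definition lam : R := k ^+ 2 / (1 + k ^+ 2) / 5.

Let th : R := k / (1 + k ^+ 2).

(* The cross term makes the dissipation of y, which is the only one, act on x. *)
Lemma energy_decay t : 0 <= t -> x t ^+ 2 + y t ^+ 2 <= 4 * expR (- (2 * lam) * t).
Proof.
move=> t0; pose L t := x t * x t + (y t * y t + - th * (x t * y t)).
have dL s := is_derive_add (is_derive_prod (dx s) (dx s)) (is_derive_add
  (is_derive_prod (dy s) (dy s)) (is_derive_scal (- th) (is_derive_prod (dx s) (dy s)))).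
have dG s := is_derive_prod (is_derive_expM (2 * lam) s) (dL s).
have k1 : 0 < 1 + k ^+ 2 by rewrite ltr_wpDr ?sqr_ge0.
have thk : th * (1 + k ^+ 2) = k by rewrite divfK// gt_eqF.
have r_ : th * k = 5 * lam by rewrite /th /lam; field; rewrite gt_eqF.
have l0 : 0 <= lam by rewrite /lam !divr_ge0 ?sqr_ge0// ltW.
have th0 : 0 <= th by rewrite divr_ge0// ltW.
have th2 : 2 * th <= 1.
  by rewrite -(@ler_pM2r _ (1 + k ^+ 2))// -mulrA thk mul1r; have := sqr_ge0 (k - 1); nra.
have l1 : 5 * lam <= 1.
  by rewrite -r_ -(@ler_pM2r _ (1 + k ^+ 2))// mulrAC thk mul1r -expr2; lra.
have ths : th ^+ 2 <= 5 * lam.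
  rewrite -r_ expr2 ler_wpM2l// -[leRHS]thk mulrDr mulr1 lerDl.
  by rewrite mulr_ge0// sqr_ge0.
(* Since [2 * th <= 1], the cross term is at most a quarter of the energy, so L is equivalent to the
   energy. *)
have bL s : 3 / 4 * (x s ^+ 2 + y s ^+ 2) <= L s <= 5 / 4 * (x s ^+ 2 + y s ^+ 2).
  rewrite /L; have h1 := sqr_ge0 (x s - y s); have h2 := sqr_ge0 (x s + y s).
  by apply/andP; split; nra.
have := nonincr dG _ t0; rewrite mulr0 expR0 mul1r => /(_ _)h.
have {h} := h _; move=> h.
have {h} : expR (2 * lam * t) * L t <= L 0.
  apply: h => s s0; rewrite -/(L s).
  rewrite [leLHS](_ : _ = expR (2 * lam * s) * (2 * lam * L s + (2 * x s * (- (k * y s)) + 2 * y s * (k * x s - y s)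
     - th * (- (k * y s) * y s + x s * (k * x s - y s))))); last by rewrite /L; ring.
  rewrite pmulr_rle0 ?expR_gt0//.
  have /andP[_ b] := bL s.
  (* The cross term is split using th^2 <= 5 lam. In the final sum the coefficient of x^2 is lam (-5
     + 5/2 + 5/2) = 0, and that of y^2 is -2 + 5 lam + 1/2 + 5 lam/2, at most 0 since 5 lam <= 1. *)
  have e1 : th * (x s * y s) <= 5 * lam * x s ^+ 2 / 2 + y s ^+ 2 / 2.
    have q1 := sqr_ge0 (th * x s - y s).
    have q2 : th ^+ 2 * x s ^+ 2 <= 5 * lam * x s ^+ 2 by rewrite ler_wpM2r ?sqr_ge0.
    by nra.
  have e2 : 2 * lam * L s <= 2 * lam * (5 / 4 * (x s ^+ 2 + y s ^+ 2)) by apply: ler_wpM2l => //; exact: mulr_ge0.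
  have e3 : 5 * lam * y s ^+ 2 <= y s ^+ 2 by rewrite ler_piMl ?sqr_ge0.
  rewrite (_ : _ - th * _ = - 2 * y s ^+ 2 + th * k * y s ^+ 2 - th * k * x s ^+ 2 + th * (x s * y s)); last by ring.
  rewrite r_; have := sqr_ge0 (x s); have := sqr_ge0 (y s); nra.
move=> h; have /andP[_ b0] := bL 0; rewrite xy0 mulr1 in b0.
have /andP[bt _] := bL t.
rewrite mulNr expRN; have E := expR_gt0 (2 * lam * t).
rewrite ler_pdivlMr//; nra.
Qed.

Lemma lam_ge0 : 0 <= lam.
Proof. by rewrite /lam !divr_ge0 ?addr_ge0 ?sqr_ge0. Qed.

Lemma lam_le : 5 * lam <= 1.
Proof.
have k1 : 0 < 1 + k ^+ 2 by rewrite ltr_wpDr ?sqr_ge0.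
rewrite /lam mulrC divfK; last by rewrite pnatr_eq0.
by rewrite ler_pdivrMr// mul1r lerDr.
Qed.

Lemma energy_bound t : 0 <= t -> `|x t| <= 2 * expR (- lam * t) /\ `|y t| <= 2 * expR (- lam * t).
Proof.
move=> t0; have := energy_decay t0.
rewrite (_ : - (2 * lam) * t = - lam * t + - lam * t) ?expRD; last by ring.
set e := expR _; have e0 : 0 < e := expR_gt0 _ => h.
have q1 := sqr_ge0 (x t); have q2 := sqr_ge0 (y t).
by split; rewrite -(@ler_pXn2r _ 2) ?nnegrE ?mulr_ge0 ?(ltW e0)// real_normK ?num_real//; nra.
Qed.

(** Integrating y' + y = k x with |x| <= 2 exp(-lam t) produces the factor 2k/(1 - lam), and lam <=
    1/5 makes it at most 5k/2. This factor k is the low-frequency gain of the damped unknown. Both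
    signs of y are treated through a nonincreasing quantity. *)
Lemma slow_bound t : 0 <= t -> `|y t| <= expR (- t) * `|y 0| + 5 / 2 * k * expR (- lam * t).
Proof.
move=> t0.
have l0 := lam_ge0; have l1 := lam_le.
have key (sg : R) : `|sg| = 1 -> sg * y t <= expR (- t) * `|y 0| + 5 / 2 * k * expR (- lam * t).
  move=> sg1.
  have dg s := is_derive_add (is_derive_scal sg (is_derive_prod (is_derive_expM 1 s) (dy s)))
    (is_derive_scal (- (5 / 2 * k)) (is_derive_expM (1 - lam) s)).
  have := nonincr dg _ t0 => /(_ _)h.
  have {h} : sg * (expR (1 * t) * y t) + - (5 / 2 * k) * expR ((1 - lam) * t) <=
      sg * (expR (1 * 0) * y 0) + - (5 / 2 * k) * expR ((1 - lam) * 0).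
    apply: h => s s0.
    rewrite (_ : (1 - lam) * s = 1 * s + - lam * s) ?expRD; last by ring.
    rewrite [leLHS](_ : _ = expR (1 * s) * (k * (sg * x s - 5 / 2 * (1 - lam) * expR (- lam * s)))); last by ring.
    rewrite pmulr_rle0 ?expR_gt0// mulr_ge0_le0//.
    have [xs _] := energy_bound s0.
    have h1 : sg * x s <= `|x s| by rewrite -[leRHS]mul1r -sg1 -normrM ler_norm.
    have := expR_gt0 (- lam * s); nra.
  rewrite !mulr0 expR0 !mul1r mulr1 (_ : (1 - lam) * t = t + - lam * t) ?expRD; last by ring.
  have h1 : sg * y 0 <= `|y 0| by rewrite -[leRHS]mul1r -sg1 -normrM ler_norm.
  rewrite expRN; have E := expR_gt0 t => h.
  have {h} : expR t * (sg * y t) <= expR t * ((expR t)^-1 * `|y 0| + 5 / 2 * k * expR (- lam * t)).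
    rewrite mulrDr mulVKf ?gt_eqF//.
    rewrite (_ : expR t * (sg * y t) = sg * (expR t * y t)); last by ring.
    rewrite (_ : expR t * (5 / 2 * k * _) = 5 / 2 * k * (expR t * expR (- lam * t))); last by ring.
    have k5 : 0 <= 5 / 2 * k by rewrite mulr_ge0.
    lra.
  by rewrite ler_pM2l.
rewrite ler_norml; apply/andP; split.
  by have := key (- 1); rewrite normrN1 => /(_ erefl); rewrite mulN1r; lra.
by have := key 1; rewrite normr1 => /(_ erefl); rewrite mul1r.
Qed.

End Lyapunov.

End Semigroup.

(** * Decay of the propagator in H^N *)

Section MatrixSemigroup.
Context {R : realType}.
Notation leb := (@leb3 R).
Notation leb1 := (@lebesgue_measure R).
Implicit Types (b : bool) (xi : R3 R) (k t s m N : R).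

Lemma measurable_inv : measurable_fun setT (fun x : R => x^-1).
Proof.
rewrite (_ : (fun x => _) = fun x : R => if x == 0 then 0 else x `^ (-1) *
    (if 0 <= x then 1 else 0) + (- ((- x) `^ (-1))) * (if 0 <= x then 0 else 1)).
  have m0 : measurable_fun setT (fun x : R => 0 <= x).
    by apply: measurable_fun_ler => //; exact: measurable_cst.
  have mN : measurable_fun setT (fun x : R => - x) by exact: measurable_funN.
  have mp := @measurable_powR R (- 1).
  apply: measurable_fun_ifT; [apply: measurable_fun_eqr => //; exact: measurable_cst|exact: measurable_cst|].
  apply: measurable_funD; apply: measurable_funM.
  - exact: mp.
  - by apply: measurable_fun_ifT => //; exact: measurable_cst.
  - by apply: measurable_funN; exact: (measurableT_comp mp mN).
  - by apply: measurable_fun_ifT => //; exact: measurable_cst.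
apply/funext => x; case: eqP => [->|x0]; first by rewrite invr0.
case: ifPn => [h|]; first by rewrite powR_inv1// mulr1 mulr0 addr0.
rewrite -ltNge => h; rewrite mulr0 add0r mulr1 powR_inv1 ?oppr_ge0 ?ltW//.
by rewrite invrN opprK.
Qed.

Section Measurability.
Context d (T : measurableType d) (p q : T -> R).
Hypotheses (mp : measurable_fun setT p) (mq : measurable_fun setT q).

Let mmu : measurable_fun setT (fun z => pmu (p z)).
Proof.
by apply: measurable_funB; [exact: measurable_cst|exact: measurable_funX].
Qed.

Let mrt : measurable_fun setT (fun z => prt (p z)).
Proof.
have ms : measurable_fun setT (@Num.sqrt R).
  by apply: continuous_measurable_fun; exact: sqrt_continuous.
apply: (measurableT_comp ms).
exact: (measurableT_comp (@normr_measurable R setT) mmu).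
Qed.

Let mV : measurable_fun setT (fun z => (prt (p z))^-1).
Proof. exact: (measurableT_comp measurable_inv mrt). Qed.

Let mif (f g h : T -> R) : measurable_fun setT f -> measurable_fun setT g ->
  measurable_fun setT h -> measurable_fun setT (fun z =>
  if 0 < pmu (p z) then f z else if pmu (p z) < 0 then g z else h z).
Proof.
move=> mf mg mh; apply: measurable_fun_ifT => //.
  by apply: measurable_fun_ltr => //; exact: measurable_cst.
apply: measurable_fun_ifT => //.
by apply: measurable_fun_ltr => //; exact: measurable_cst.
Qed.

Let me1 : measurable_fun setT (fun z => expR (prt (p z) * q z)).
Proof. by apply: (measurableT_comp (@measurable_expR R)); exact: measurable_funM. Qed.

Let me2 : measurable_fun setT (fun z => expR (- prt (p z) * q z)).
Proof.
by apply: (measurableT_comp (@measurable_expR R)); apply: measurable_funM => //; exact: measurable_funN.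
Qed.

Let me3 : measurable_fun setT (fun z => expR (- 2^-1 * q z)).
Proof. by apply: (measurableT_comp (@measurable_expR R)); exact: measurable_funM. Qed.

Let mpc : measurable_fun setT (fun z => pc (p z) (q z)).
Proof.
apply: mif; last exact: measurable_cst.
- by apply: measurable_funM; [exact: measurable_funD|exact: measurable_cst].
- have mc : measurable_fun setT (@cos R).
    by apply: continuous_measurable_fun; exact: continuous_cos.
  by apply: (measurableT_comp mc); exact: measurable_funM.
Qed.

Let mps : measurable_fun setT (fun z => ps (p z) (q z)).
Proof.
apply: mif => //.
- apply: measurable_funM => //.
  by apply: measurable_funM; [exact: measurable_funB|exact: measurable_cst].
- have mc : measurable_fun setT (@sin R).
    by apply: continuous_measurable_fun; exact: continuous_sin.
  by apply: measurable_funM => //; apply: (measurableT_comp mc); exact: measurable_funM.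
Qed.

Lemma measurable_X1 : measurable_fun setT (fun z => X1 (p z) (q z)).
Proof.
by apply: measurable_funM => //; apply: measurable_funD => //; apply: measurable_funM.
Qed.

Lemma measurable_Y1 : measurable_fun setT (fun z => Y1 (p z) (q z)).
Proof. by apply: measurable_funM => //; apply: measurable_funM. Qed.

Lemma measurable_Y2 : measurable_fun setT (fun z => Y2 (p z) (q z)).
Proof.
by apply: measurable_funM => //; apply: measurable_funD => //; apply: measurable_funM.
Qed.

End Measurability.

(* The index [false] stands for u and [true] for v. *)
Definition propag b1 b2 k t : R[i] :=
  match b1, b2 with
  | false, false => (X1 k t)%:C
  | true, true => (Y2 k t)%:C
  | _, _ => - 'i%C * (Y1 k t)%:C
  end.

(** The matrix of the linear generator at frequency k, with the same indexing as [propag]. *)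
Definition symbol b1 b2 k : R[i] :=
  match b1, b2 with
  | false, false => 0
  | true, true => - 1
  | _, _ => - 'i%C * k%:C
  end.

Definition propag3 b1 b2 t xi : R[i] := propag b1 b2 (norm3 xi) t.

Lemma cmeas_propag b1 b2 d (T : measurableType d) (p q : T -> R) :
  measurable_fun setT p -> measurable_fun setT q ->
  cmeas (fun z => propag b1 b2 (p z) (q z)).
Proof.
move=> mp mq.
have h : cmeas (fun z => - 'i%C * (Y1 (p z) (q z))%:C).
  by apply: cmeasM; [exact: cmeas_cst|apply: cmeas_real; exact: measurable_Y1].
case: b1 b2 => [] [] //.
- by apply: cmeas_real; exact: measurable_Y2.
- by apply: cmeas_real; exact: measurable_X1.
Qed.

Lemma cmeas_sgr b1 b2 d (T : measurableType d) (p : T -> R) (q : T -> R3 R) :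
  measurable_fun setT p -> measurable_fun setT q ->
  cmeas (fun z => propag3 b1 b2 (p z) (q z)).
Proof. by move=> mp mq; apply: cmeas_propag => //; exact: measurable_norm3. Qed.

Lemma nc_sgk b1 b2 k t : nc (propag b1 b2 k t) =
  `|match b1, b2 with false, false => X1 k t | true, true => Y2 k t | _, _ => Y1 k t end|.
Proof. by case: b1 b2 => [] []; rewrite /propag ?ncM ?ncN ?nc_i ?mul1r nc_real. Qed.

Lemma init1 k : X1 k 0 ^+ 2 + Y1 k 0 ^+ 2 = 1.
Proof. by rewrite X1_0 Y1_0 expr1n expr0n addr0. Qed.

Lemma init2 k : (- Y1 k 0) ^+ 2 + Y2 k 0 ^+ 2 = 1.
Proof. by rewrite Y2_0 Y1_0 oppr0 expr1n expr0n add0r. Qed.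

Lemma is_derive_Y2' k t : is_derive t 1 (Y2 k) (k * - Y1 k t - Y2 k t).
Proof. by have := is_derive_Y2 k t; rewrite -mulrN. Qed.

Lemma propag_bound b1 b2 k t : 0 <= k -> 0 <= t -> nc (propag b1 b2 k t) <= 2 * expR (- lam k * t).
Proof.
move=> k0 t0.
have [h1 h2] := energy_bound k0 (is_derive_X1 k) (is_derive_Y1 k) (init1 k) t0.
have [_ h3] := energy_bound k0 (is_derive_NY1 k) (is_derive_Y2' k) (init2 k) t0.
by rewrite nc_sgk; case: b1 b2 => [] [].
Qed.

Lemma propag_slow b k t : 0 <= k -> 0 <= t ->
  nc (propag true b k t) <= expR (- t) + 5 / 2 * k * expR (- lam k * t).
Proof.
move=> k0 t0.
have := slow_bound k0 (is_derive_X1 k) (is_derive_Y1 k) (init1 k) t0.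
have := slow_bound k0 (is_derive_NY1 k) (is_derive_Y2' k) (init2 k) t0.
rewrite Y1_0 Y2_0 normr0 normr1 mulr0 mulr1 add0r nc_sgk; case: b => // _ h.
by rewrite (le_trans h)// lerDr expR_ge0.
Qed.

Lemma propag_le2 b1 b2 k t : 0 <= k -> 0 <= t -> nc (propag b1 b2 k t) <= 2.
Proof.
move=> k0 t0; apply: le_trans (propag_bound b1 b2 k0 t0) _.
rewrite ler_piMr// -(@expR0 R) ler_expR mulNr oppr_le0 mulr_ge0//.
by rewrite /lam !divr_ge0 ?addr_ge0 ?sqr_ge0.
Qed.

Lemma lam_low k : 0 <= k <= 1 -> k ^+ 2 / 10 <= lam k.
Proof.
move=> /andP[k0 k1].
have k2 : 1 + k ^+ 2 <= 2 by rewrite (_ : 2 = 1 + 1) ?lerD2l ?expr_le1//; lra.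
have k3 : 0 < 1 + k ^+ 2 by rewrite ltr_wpDr ?sqr_ge0.
rewrite /lam (_ : 10 = 2 * 5); last by lra.
rewrite invfM mulrA ler_pM2r ?invr_gt0// ler_wpM2l ?sqr_ge0//.
by rewrite lef_pV2 ?posrE.
Qed.

Lemma lam_high k : 1 <= k -> 1 / 10 <= lam k.
Proof.
move=> k1; have k3 : 0 < 1 + k ^+ 2 by rewrite ltr_wpDr ?sqr_ge0.
rewrite /lam ler_pdivlMr// ler_pdivlMr//.
have : 1 <= k ^+ 2 by rewrite exprn_ege1.
by lra.
Qed.

(** A heat factor cut to low frequencies. Its exponent k^2/20 is half of the k^2/10 available from
    [lam_low]; the other half absorbs the factor k for v. Having 1 + t instead of t avoids a
    singularity at t = 0, at the price of a factor 2 since k <= 1. *)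
Definition lo k t : R := (k <= 1)%R%:R * expR (- (k ^+ 2 / 20) * (1 + t)).

Lemma expR_bound1 k t : 0 <= k <= 1 -> 0 <= t ->
  expR (- lam k * t) <= 2 * expR (- (k ^+ 2 / 10) * (1 + t)).
Proof.
move=> k01 t0; have lk := lam_low k01; have /andP[k0 k1] := k01.
have k2 : k ^+ 2 <= 1 by rewrite expr_le1.
rewrite (_ : - (k ^+ 2 / 10) * (1 + t) = - (k ^+ 2 / 10) * t - k ^+ 2 / 10) ?expRD; last by ring.
rewrite expRN.
have E0 := expR_gt0 (k ^+ 2 / 10).
have E1 : expR (k ^+ 2 / 10) <= 2.
  rewrite -[X in expR X]opprK expRN invf_ple ?posrE ?expR_gt0//.
  apply: le_trans (expR_ge1Dx _); lra.
have E2 : expR (- lam k * t) <= expR (- (k ^+ 2 / 10) * t) by rewrite ler_expR; nra.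
rewrite mulrA ler_pdivlMr//.
have := expR_gt0 (- (k ^+ 2 / 10) * t); have := expR_gt0 (- lam k * t); nra.
Qed.

(** High frequencies give the exponential term. At low frequencies u has the plain heat factor,
    while for v the factor k is traded for [phi t ^+ 2], that is (1 + t)^(-1/2), against half of the
    heat exponent. *)
Lemma propag_decay b1 b2 k t : 0 <= k -> 0 <= t ->
  nc (propag b1 b2 k t) <= 2 * expR (- (t / 10)) + 20 * phi t ^+ (if b1 then 2 else 0) * lo k t.
Proof.
move=> k0 t0; have [k1|k1] := leP k 1; last first.
  rewrite /lo (leNgt k 1) k1 mul0r mulr0 addr0; apply: le_trans (propag_bound b1 b2 k0 t0) _.
  rewrite ler_wpM2l// ler_expR; have := lam_high (ltW k1); nra.
have k01 : 0 <= k <= 1 by rewrite k0.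
have E1 := expR_bound1 k01 t0.
have e0 := expR_gt0 (- (t / 10)).
have sq : - (k ^+ 2 / 10) * (1 + t) = - (k ^+ 2 / 20) * (1 + t) + - (k ^+ 2 / 20) * (1 + t) by field.
rewrite /lo k1 mul1r; move: E1; rewrite sq expRD.
have g1 : expR (- (k ^+ 2 / 20) * (1 + t)) <= 1.
  by rewrite -(@expR0 R) ler_expR mulNr oppr_le0 mulr_ge0 ?divr_ge0 ?sqr_ge0// addr_ge0.
case: b1; last first.
  move=> E1; apply: le_trans (propag_bound false b2 k0 t0) _; rewrite expr0 mulr1.
  have := expR_gt0 (- (k ^+ 2 / 20) * (1 + t)); nra.
move=> E1; apply: le_trans (propag_slow b2 k0 t0) _.
have E2 : expR (- t) <= expR (- (t / 10)) by rewrite ler_expR; lra.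
set g := expR (- (k ^+ 2 / 20) * (1 + t)) in E1 g1 *; have g0 : 0 < g := expR_gt0 _.
(* Squared, this bounds k^2 (1 + t) exp(-k^2 (1 + t)/10), which follows from exp(x) >= 1 + x. *)
have E3 : k * g <= 4 * phi t ^+ 2.
  have p0 := phi_gt0 t.
  rewrite -(@ler_pXn2r _ 2) ?nnegrE ?mulr_ge0 ?exprn_ge0 ?(ltW g0) ?(ltW p0)//.
  rewrite exprMn (_ : (4 * phi t ^+ 2) ^+ 2 = 16 * phi t ^+ 4); last by ring.
  rewrite phi4 ger0_norm// ler_pdivlMr ?ltr_wpDr//.
  rewrite (_ : g ^+ 2 = expR (- (k ^+ 2 / 10 * (1 + t)))); last first.
    by rewrite expr2 -expRD; congr expR; field.
  rewrite expRN mulrAC ler_pdivrMr ?expR_gt0//.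
  have := expR_ge1Dx (k ^+ 2 / 10 * (1 + t)); have := sqr_ge0 k; nra.
have : k * expR (- lam k * t) <= 8 * phi t ^+ 2 * g.
  have : k * expR (- lam k * t) <= k * (2 * (g * g)) by rewrite ler_wpM2l.
  nra.
nra.
Qed.

Lemma exp_phi t : 0 <= t -> expR (- (t / 10)) <= 20 ^+ 2 * phi t ^+ 8.
Proof.
move=> t0; rewrite (_ : - (t / 10) = - (t / 20) + - (t / 20)); last by field.
rewrite expRD -expr2 (_ : phi t ^+ 8 = phi t ^+ 4 ^+ 2); last by rewrite -exprM.
rewrite -exprMn; apply: lerXn2r; rewrite ?nnegrE ?expR_ge0//.
  by rewrite mulr_ge0// exprn_ge0// ltW// phi_gt0.
rewrite phi4 ger0_norm// expRN -[20]invrK -invfM lef_pV2 ?posrE ?expR_gt0//; last first.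
  by rewrite mulr_gt0// ltr_wpDr.
apply: le_trans (expR_ge1Dx _); lra.
Qed.

(** The squared Gaussian is a product of one-variable Gaussians, each at most the Lorentzian (1 +
    z^2/e^2)^(-1), which is [e / 2 * poi1 e z]. The known mass of the Poisson kernel then gives the
    correct scaling e^(3/2). *)
Lemma L2b_gauss (e : R) : 0 < e ->
  L2b leb (fun xi => (expR (- (norm3 xi ^+ 2 / (2 * e ^+ 2))))%:C) (Num.sqrt (e ^+ 3 * (@K3 R / 8))).
Proof.
move=> e0; have C0 : 0 <= e ^+ 3 * (@K3 R / 8).
  by rewrite mulr_ge0 ?exprn_ge0 ?ltW// divr_gt0// K3_gt0.
have mg : measurable_fun setT (fun xi : R3 R => expR (- (norm3 xi ^+ 2 / (2 * e ^+ 2)))).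
  apply: (measurableT_comp (@measurable_expR R)); apply: measurable_funN.
  apply: measurable_funM; last exact: measurable_cst.
  by apply: measurable_funX; exact: (measurable_norm3 (p := id)).
split; [exact: cmeas_real|exact: sqrtr_ge0|].
rewrite sqr_sqrtr//; have [mpoi ipoi] := poi_L1 e0.
apply: (@le_trans _ _ (\int[leb]_xi ((e ^+ 3 / 8)%:E * (nc (poi e xi)%:C)%:E))%E).
  apply: ge0_le_integral => //.
  - by move=> x _; rewrite lee_fin sqr_ge0.
  - by apply: mnc2; exact: cmeas_real.
  - by apply: emeasurable_funM; [exact: measurable_cst|exact: mnc].
  move=> x _; rewrite -EFinM lee_fin !nc_real_ge0 ?expR_ge0 ?poi_ge0//.
  rewrite expr2 -expRD norm3_sqr (_ : - _ + - _ = - (x.1.1 ^+ 2 / e ^+ 2) + - (x.1.2 ^+ 2 / e ^+ 2)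
    + - (x.2 ^+ 2 / e ^+ 2)); last by rewrite /dot3; field; rewrite gt_eqF.
  rewrite !expRD.
  have h z : expR (- (z ^+ 2 / e ^+ 2)) <= e / 2 * poi1 e z.
    rewrite /poi1 (_ : e / 2 * _ = (1 + z ^+ 2 / e ^+ 2)^-1); last first.
      have e1 : e != 0 by rewrite gt_eqF.
      have ez : e ^+ 2 + z ^+ 2 != 0 by rewrite gt_eqF// ltr_wpDr ?sqr_ge0// exprn_gt0.
      have -> : 1 + z ^+ 2 / e ^+ 2 = (e ^+ 2 + z ^+ 2) / e ^+ 2 by field.
      by rewrite invf_div; field.
    rewrite expRN lef_pV2 ?posrE ?expR_gt0 ?expR_ge1Dx//.
    by rewrite ltr_wpDr// divr_ge0 ?sqr_ge0.
  rewrite /poi (_ : e ^+ 3 / 8 * _ = (e / 2 * poi1 e x.1.1) * (e / 2 * poi1 e x.1.2) * (e / 2 * poi1 e x.2)).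
    by rewrite !ler_pM ?mulr_ge0 ?expR_ge0.
  by field.
rewrite ge0_integralZl//; last 3 first.
- exact: mnc.
- by move=> x _; rewrite lee_fin nc_ge0.
- by rewrite lee_fin divr_ge0// exprn_ge0// ltW.
have -> : e ^+ 3 * (@K3 R / 8) = (e ^+ 3 / 8) * K3 by ring.
by rewrite [leRHS]EFinM lee_wpmul2l// lee_fin divr_ge0// exprn_ge0// ltW.
Qed.

Definition gC : R := Num.sqrt (Num.sqrt 10 ^+ 3 * (@K3 R / 8)).

(** The width e = sqrt 10 [phi t ^+ 2] satisfies 2 e^2 = 20/(1 + t), and e^(3/2) is then
    proportional to [phi t ^+ 3]. *)
Lemma L2b_heat t : 0 <= t ->
  L2b leb (fun xi => (expR (- (norm3 xi ^+ 2 / 20) * (1 + t)))%:C) (gC * phi t ^+ 3).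
Proof.
move=> t0; have p0 := phi_gt0 t; have s0 : 0 < Num.sqrt 10 :> R by rewrite sqrtr_gt0.
have := L2b_gauss (mulr_gt0 s0 (exprn_gt0 2 p0)).
rewrite (_ : (_ * _) ^+ 3 * (K3 / 8) = Num.sqrt 10 ^+ 3 * (K3 / 8) * (phi t ^+ 3) ^+ 2); last by ring.
rewrite sqrtrM; last by rewrite mulr_ge0 ?exprn_ge0 ?(ltW s0)// divr_ge0// ltW// K3_gt0.
rewrite sqrtr_sqr (ger0_norm (exprn_ge0 3 (ltW p0))).
congr L2b; apply/funext => xi; congr ((expR _)%:C).
rewrite (_ : (Num.sqrt 10 * phi t ^+ 2) ^+ 2 = Num.sqrt 10 ^+ 2 * phi t ^+ 4); last by ring.
rewrite sqr_sqrtr// phi4 ger0_norm//.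
by field; rewrite gt_eqF// ltr_wpDr.
Qed.

(* u decays like [phi ^+ 3] and v like [phi ^+ 5]. *)
Definition rate b : nat := if b then 5 else 3.

Definition sC N : R := 2 * 20 ^+ 2 + 20 * (2 `^ (N / 2) * gC).

Lemma sC_ge0 N : 0 <= sC N.
Proof. by rewrite addr_ge0// mulr_ge0// ?exprn_ge0// mulr_ge0 ?powR_ge0// sqrtr_ge0. Qed.

(** The exponential term multiplies the H^N bound of g. The low-frequency term uses the pointwise
    bound of g and the L^2 norm of the heat factor, the weight being at most 2^(N/2) where |xi| <=
    1. *)
Lemma propag3_decay b1 b2 t N m (g : R3 R -> R[i]) : 0 <= t -> 0 <= N ->
  (forall xi, nc (g xi) <= m) -> HB N g m ->
  HB N (fun xi => propag3 b1 b2 t xi * g xi) (sC N * phi t ^+ rate b1 * m).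
Proof.
move=> t0 N0 gm Ng.
have p0 := phi_gt0 t; have m0 : 0 <= m := HB_ge0 Ng.
have H1 := L2bZ (2 * expR (- (t / 10)))%:C Ng.
have H2 := L2bZ (20 * phi t ^+ (if b1 then 2 else 0) * (2 `^ (N / 2) * m))%:C (L2b_heat t0).
pose h1 xi : R[i] := (nc ((2 * expR (- (t / 10)))%:C * ((w N xi)%:C * g xi)))%:C.
have H1' : L2b leb h1 (nc (2 * expR (- (t / 10)))%:C * m).
  apply: (L2b_dom H1) => [|xi]; last by rewrite nc_real_ge0 ?nc_ge0.
  by apply: cmeas_real; apply: cmeas_nc; case: H1.
have q0 : 0 <= 20 * phi t ^+ (if b1 then 2 else 0) * (2 `^ (N / 2) * m).
  by rewrite mulr_ge0 ?mulr_ge0 ?exprn_ge0 ?powR_ge0 ?(ltW p0).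
have e0 : 0 <= 2 * expR (- (t / 10)) by rewrite mulr_ge0// expR_ge0.
apply: (L2b_le (a := nc (2 * expR (- (t / 10)))%:C * m +
    nc (20 * phi t ^+ (if b1 then 2 else 0) * (2 `^ (N / 2) * m))%:C * (gC * phi t ^+ 3))); last first.
  rewrite !nc_real_ge0//.
  have E1 : expR (- (t / 10)) <= 20 ^+ 2 * phi t ^+ rate b1.
    apply: le_trans (exp_phi t0) _; rewrite ler_wpM2l ?exprn_ge0//.
    by apply: ler_wiXn2l; rewrite ?(ltW p0) ?phi_le1//; case: (b1).
  have E2 : phi t ^+ (if b1 then 2 else 0) * phi t ^+ 3 = phi t ^+ rate b1.
    by case: (b1); rewrite -exprD.
  rewrite (_ : 20 * _ * _ * (gC * _) = 20 * (2 `^ (N / 2) * gC) * (phi t ^+ (if b1 then 2 else 0) * phi t ^+ 3) * m); last by ring.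
  rewrite E2 /sC -mulrDl ler_wpM2r// (mulrDl _ _ (phi t ^+ _)) lerD2r.
  by rewrite -mulrA ler_wpM2l.
apply: (L2b_dom (L2bD H1' H2)).
  apply: cmeas_wM; apply: cmeasM; last exact: HB_cmeas Ng.
  by apply: cmeas_sgr => //; exact: measurable_cst.
move=> xi; rewrite /h1 -rcM -rcD nc_real_ge0; last first.
  by rewrite addr_ge0 ?nc_ge0// mulr_ge0// expR_ge0.
rewrite !ncM !nc_real_ge0 ?w_ge0//.
have D := propag_decay b1 b2 (norm3_ge0 xi) t0.
have wg0 : 0 <= w N xi * nc (g xi) by rewrite mulr_ge0 ?w_ge0 ?nc_ge0.
rewrite mulrCA; apply: le_trans (ler_wpM2r wg0 D) _; rewrite mulrDl lerD2l.
rewrite /lo; case: (leP (norm3 xi) 1) => k1; last first.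
  by rewrite mul0r mulr0 mul0r mulr_ge0// expR_ge0.
rewrite mul1r mulrAC ler_wpM2r ?expR_ge0// ler_wpM2l ?mulr_ge0 ?exprn_ge0 ?(ltW p0)//.
apply: ler_pM; rewrite ?w_ge0 ?nc_ge0//.
apply: ge0_ler_powR; rewrite ?nnegrE ?divr_ge0 ?addr_ge0 ?sqr_ge0//.
have : norm3 xi ^+ 2 <= 1 by rewrite expr_le1// norm3_ge0.
lra.
Qed.

End MatrixSemigroup.

(** * Integrals over a time interval and their primitives *)

Section TimeIntegrals.
Context {R : realType}.
Notation leb1 := (@lebesgue_measure R).
Notation T1 := (measurableTypeR R).
Implicit Types (t s r k M : R) (K B f : T1 -> R[i]) (b : bool).

Lemma rcN (x : R) : (- x)%:C = - x%:C.
Proof. by apply: complexP => /=; rewrite ?oppr0. Qed.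

(** The indicator of [0, t] as a complex factor: time integrals then run over the whole line, where
    Fubini, Minkowski and translation invariance apply directly, and they vanish for negative t. *)
Definition itv_ind t s : R[i] := ((0 <= s) && (s <= t))%:R.

Lemma itcE t s : itv_ind t s = if (0 <= s) && (s <= t) then 1 else 0.
Proof. by rewrite /itv_ind; case: ifP. Qed.

Lemma itv_ind_neg t s : t < 0 -> itv_ind t s = 0.
Proof.
move=> t0; rewrite itcE; case: ifP => // /andP[s0 st].
by have := le_lt_trans (le_trans s0 st) t0; rewrite ltxx.
Qed.

Lemma cmeas_itv_ind d (T : measurableType d) (p q : T -> R) :
  measurable_fun setT p -> measurable_fun setT q -> cmeas (fun z => itv_ind (p z) (q z)).
Proof.
move=> mp mq; under eq_fun do rewrite itcE.
apply: cmeas_if; [|exact: cmeas_cst|exact: cmeas_cst].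
apply: measurable_and; apply: measurable_fun_ler => //; exact: measurable_cst.
Qed.

Lemma itv_ind_le M t s (z : R[i]) : (0 <= s <= t -> nc z <= M) ->
  nc (itv_ind t s * z) <= M * \1_(`[0, t]%classic) s.
Proof.
rewrite itcE indicE mem_setE in_itv/=; case: ifP => _ h.
  by rewrite mul1r mulr1 h.
by rewrite mul0r nc0 mulr0.
Qed.

Lemma int_cst_itv M t : 0 <= t -> 0 <= M ->
  (\int[leb1]_s (M * \1_(`[0%R, t]%classic) s)%:E = (M * t)%:E)%E.
Proof.
move=> t0 M0; under eq_integral do rewrite EFinM.
have mi : measurable (`[0, t]%classic : set T1) by exact: measurable_itv.
rewrite ge0_integralZl//; last by apply/measurable_EFinP; exact: measurable_indic.
rewrite integral_indic// setIT.
have L : (leb1 (`[0%R, t]%classic : set T1) = t%:E)%E.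
  rewrite lebesgue_measure_itv/= lte_fin.
  by case: ltP => h; rewrite ?oppr0 ?adde0//; congr (_%:E); apply/eqP; rewrite eq_le t0 h.
by rewrite [X in (_ * X)%E](_ : _ = t%:E).
Qed.

Lemma itv_ind_L1 f M t : cmeas f -> 0 <= t -> 0 <= M -> (forall s, 0 <= s <= t -> nc (f s) <= M) ->
  L1b leb1 (fun s => itv_ind t s * f s) (M * t).
Proof.
move=> mf t0 M0 fM.
have mi : cmeas (fun s : T1 => itv_ind t s * f s).
  by apply: cmeasM mf; apply: cmeas_itv_ind => //; exact: measurable_cst.
split => //; rewrite -(int_cst_itv t0 M0); apply: ge0_le_integral => //.
- by move=> x _; rewrite lee_fin nc_ge0.
- exact: mnc.
- apply/measurable_EFinP; apply: measurable_funM; first exact: measurable_cst.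
  by apply: measurable_indic; exact: measurable_itv.
- by move=> s _; rewrite lee_fin itv_ind_le// => h; exact: fM.
Qed.

Lemma itv_ind_cint f M t : cmeas f -> (forall s, 0 <= s <= t -> nc (f s) <= M) ->
  cint leb1 (fun s => itv_ind t s * f s).
Proof.
move=> mf fM; have [t0|t0] := leP 0 t; last first.
  rewrite (_ : (fun s => itv_ind t s * f s) = fun=> 0); last first.
    by apply/funext => s; rewrite itv_ind_neg// mul0r.
  split; first exact: cmeas_cst.
  by under eq_integral do rewrite nc0; rewrite integral0 ltry.
apply: (L1b_cint (a := `|M| * t)); apply: itv_ind_L1 => // s /fM h.
exact: le_trans h (ler_norm _).
Qed.

Definition primitive K t : R[i] := IC leb1 (fun s => itv_ind t s * K s).

Definition time_cnv K B t : R[i] := IC leb1 (fun s => itv_ind t s * (K (t - s) * B s)).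

Lemma measurable_fst1 : measurable_fun setT (fun p : T1 * T1 => p.1).
Proof. exact: measurable_fst. Qed.

Lemma measurable_snd1 : measurable_fun setT (fun p : T1 * T1 => p.2).
Proof. exact: measurable_snd. Qed.

Lemma cmeas_pr K : cmeas K -> cmeas (primitive K : T1 -> R[i]).
Proof.
move=> mK; apply: (@cmeas_IC2 _ _ _ _ _ leb1 (fun p : T1 * T1 => itv_ind p.1 p.2 * K p.2)).
apply: cmeasM; first exact: cmeas_itv_ind measurable_fst1 measurable_snd1.
exact: cmeas_comp measurable_snd1 mK.
Qed.

Lemma cmeas_tcv K B : cmeas K -> cmeas B -> cmeas (time_cnv K B : T1 -> R[i]).
Proof.
move=> mK mB.
apply: (@cmeas_IC2 _ _ _ _ _ leb1 (fun p : T1 * T1 => itv_ind p.1 p.2 * (K (p.1 - p.2) * B p.2))).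
apply: cmeasM; first exact: cmeas_itv_ind measurable_fst1 measurable_snd1.
apply: cmeasM; last exact: cmeas_comp measurable_snd1 mB.
have m : measurable_fun setT (fun p : T1 * T1 => p.1 - p.2 : T1).
  exact: measurable_funB measurable_fst1 measurable_snd1.
exact: cmeas_comp m mK.
Qed.

Lemma mulr_bound (z u : R[i]) M M' : nc z <= M -> nc u <= M' -> nc (z * u) <= M * M'.
Proof. by move=> h1 h2; rewrite ncM ler_pM ?nc_ge0. Qed.

Lemma time_cnv_cint K B M M' t : cmeas K -> cmeas B -> (forall s, 0 <= s -> nc (K s) <= M) ->
  (forall s, 0 <= s -> nc (B s) <= M') -> cint leb1 (fun s => itv_ind t s * (K (t - s) * B s)).
Proof.
move=> mK mB KM BM.
have m : measurable_fun setT (fun s : T1 => t - s : T1).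
  by apply: measurable_funB; [exact: measurable_cst|exact: measurable_id].
apply: (itv_ind_cint (M := M * M')) => [|s /andP[s0 st]].
  by apply: cmeasM => //; exact: cmeas_comp m mK.
by apply: mulr_bound; [apply: KM; rewrite subr_ge0|exact: BM].
Qed.

Lemma primitive_bound K M t : cmeas K -> 0 <= t -> 0 <= M -> (forall s, 0 <= s <= t -> nc (K s) <= M) ->
  nc (primitive K t) <= M * t.
Proof. by move=> mK t0 M0 KM; apply: L1b_IC; exact: itv_ind_L1. Qed.

(** Fubini on the triangle 0 <= s <= r <= t, followed by the translation of r by s. The primitive is
    thereby carried by the kernel alone, so Duhamel's formula is never differentiated under the
    integral sign. *)
Lemma primitive_time_cnv K B M M' t : cmeas K -> cmeas B -> 0 <= t -> 0 <= M -> 0 <= M' ->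
  (forall s, 0 <= s -> nc (K s) <= M) -> (forall s, 0 <= s -> nc (B s) <= M') ->
  primitive (time_cnv K B) t = time_cnv (primitive K) B t.
Proof.
move=> mK mB t0 M0 M0' KM BM.
pose F (p : T1 * T1) : R[i] := itv_ind t p.1 * (itv_ind p.1 p.2 * (K (p.1 - p.2) * B p.2)).
have mF : cmeas F.
  apply: cmeasM; first exact: cmeas_itv_ind (measurable_cst t) measurable_fst1.
  apply: cmeasM; first exact: cmeas_itv_ind measurable_fst1 measurable_snd1.
  apply: cmeasM; last exact: cmeas_comp measurable_snd1 mB.
  have m : measurable_fun setT (fun p : T1 * T1 => p.1 - p.2 : T1).
    exact: measurable_funB measurable_fst1 measurable_snd1.
  exact: cmeas_comp m mK.
have bF r s : nc (F (r, s)) <= (M * M' * \1_(`[0, t]%classic) r) * \1_(`[0, t]%classic) s.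
  rewrite mulrAC; apply: itv_ind_le => /andP[r0 rt] /=.
  rewrite itcE; case: ifP => [/andP[s0 sr]|_]; last first.
    by rewrite mul0r nc0 !mulr_ge0// indicE ler0n.
  rewrite mul1r indicE mem_setE in_itv/= s0 (le_trans sr rt) mulr1.
  by apply: mulr_bound; [apply: KM; rewrite subr_ge0|exact: BM].
have F1 : (\int[leb1]_s \int[leb1]_r (nc (F (r, s)))%:E < +oo)%E.
  apply: (@le_lt_trans _ _ (M * M' * t * t)%:E); last exact: ltry.
  rewrite -int_cst_itv ?mulr_ge0//; apply: ge0_le_integral => //.
  - by move=> s _; apply: integral_ge0 => r _; rewrite lee_fin nc_ge0.
  - apply: (measurable_fun_fubini_tonelli_G (fun p => (nc (F p))%:E)); first exact: mnc.
    by move=> p; rewrite lee_fin nc_ge0.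
  - apply/measurable_EFinP; apply: measurable_funM; first exact: measurable_cst.
    by apply: measurable_indic; exact: measurable_itv.
  move=> s _; apply: (@le_trans _ _ (\int[leb1]_r ((M * M' * \1_(`[0%R, t]%classic) s) * \1_(`[0%R, t]%classic) r)%:E)%E).
    apply: ge0_le_integral => //.
    - by move=> r _; rewrite lee_fin nc_ge0.
    - by apply: mnc; exact: cmeas_pair1.
    - apply/measurable_EFinP; apply: measurable_funM; first exact: measurable_cst.
      by apply: measurable_indic; exact: measurable_itv.
    by move=> r _; rewrite lee_fin mulrAC bF.
  by rewrite int_cst_itv ?mulr_ge0// lee_fin mulrAC.
have iK s := itv_ind_cint (t := s) mK (fun r hr => KM r (andP hr).1).
transitivity (IC leb1 (fun r => IC leb1 (fun s => F (r, s)))).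
  apply: eq_IC => r; rewrite -ICZ//; exact: time_cnv_cint mK mB KM BM.
rewrite (IC_swap mF F1); apply: eq_IC => s; rewrite /F /=.
have sh : cmeas (fun r : T1 => itv_ind t s * (itv_ind (t - s) r * (K r * B s))).
  apply: cmeasM; first exact: cmeas_cst.
  apply: cmeasM; first exact: cmeas_itv_ind (measurable_cst _) (@measurable_id _ T1 setT).
  by apply: cmeasM => //; exact: cmeas_cst.
transitivity (IC leb1 (fun r => itv_ind t s * (itv_ind (t - s) (r - s) * (K (r - s) * B s)))).
  apply: eq_IC => r; rewrite !mulrA; congr (_ * _ * _).
  rewrite !itcE subr_ge0 lerD2r.
  case: (leP 0 r) => r0; case: (leP r t) => rt; case: (leP 0 s) => s0; case: (leP s r) => sr;
    case: (leP s t) => st; rewrite ?mul1r ?mul0r ?mulr0 ?mulr1//=; exfalso; lra.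
apply: (eq_trans (mpres_IC (mpres_shift1 (- s)) sh)).
rewrite ICZ; last first.
  by have := cintZ (B s) (iK (t - s)); congr cint; apply/funext => r; ring.
congr (_ * _); rewrite [RHS]mulrC -ICZ//.
by apply: eq_IC => r; ring.
Qed.

Lemma primitive_FTC (F f : R -> R) M t : (forall s, is_derive s 1 F (f s)) -> continuous f ->
  (forall s, 0 <= s <= t -> `|f s| <= M) -> 0 <= t ->
  primitive (fun s => (f s)%:C) t = (F t - F 0)%:C.
Proof.
move=> dF cf fM t0.
have mf : measurable_fun setT (f : T1 -> R) by exact: continuous_measurable_fun.
have E s : itv_ind t s * (f s)%:C = (\1_(`[0, t]%classic) s * f s)%:C.
  by rewrite itcE indicE mem_setE in_itv/=; case: ifP; rewrite ?mul1r ?mul0r.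
rewrite /primitive; under eq_IC do rewrite E.
apply: complexP => /=; last by rewrite Rintegral_cst// mul0r.
rewrite /Rintegral [X in fine X](_ : _ = (F t - F 0)%:E)//.
rewrite -(FTC_itv t0 cf dF) [RHS]integral_mkcond/=.
apply: eq_integral => s _; rewrite patchE indicE.
by case: ifP => _; rewrite ?mul1r ?mul0r.
Qed.

(** The equation satisfied by the propagator and its initial value, the identity matrix, in
    integrated form. [E1] to [E4] are the four real entries; the factors i combine through i^2 =
    -1. *)
Lemma propag_int b1 b2 k t : 0 <= k -> 0 <= t ->
  symbol b1 false k * primitive (propag false b2 k) t + symbol b1 true k * primitive (propag true b2 k) t =
  propag b1 b2 k t - (b1 == b2)%:R.
Proof.
move=> k0 t0.
have bd (b1' b2' : bool) s : 0 <= s <= t -> nc (propag b1' b2' k s) <= 2.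
  by move=> /andP[s0 _]; exact: propag_le2.
have rb (z : R) : nc z%:C <= 2 -> `|z| <= 2 by rewrite nc_real.
have bx s : 0 <= s <= t -> `|X1 k s| <= 2 by move=> /(bd false false)/rb.
have by1 s : 0 <= s <= t -> `|Y1 k s| <= 2.
  by move=> /(bd true false); rewrite nc_sgk.
have by2 s : 0 <= s <= t -> `|Y2 k s| <= 2 by move=> /(bd true true)/rb.
have ii : 'i%C * 'i%C = -1 :> R[i] by rewrite -expr2 sqr_i.
have cX := is_derive_continuous (is_derive_X1 k).
have cY := is_derive_continuous (is_derive_Y1 k).
have cY2 := is_derive_continuous (is_derive_Y2 k).
have ck z (G : R -> R) : continuous G -> continuous (fun s => z * G s).
  by move=> cG; exact: contM (@cont_cst _ _) cG.
have pX : cint leb1 (fun s : T1 => itv_ind t s * (X1 k s)%:C).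
  exact: itv_ind_cint (cmeas_propag false false (measurable_cst k) (@measurable_id _ T1 setT)) (bd false false).
have pY : cint leb1 (fun s : T1 => itv_ind t s * (Y1 k s)%:C).
  have h := itv_ind_cint (cmeas_propag true false (measurable_cst k) (@measurable_id _ T1 setT)) (bd true false).
  have := cintZ 'i%C h; congr cint; apply/funext => s /=.
  rewrite (_ : 'i%C * _ = - ('i%C * 'i%C) * (itv_ind t s * (Y1 k s)%:C)); last by ring.
  by rewrite ii opprK mul1r.
have pY2 : cint leb1 (fun s : T1 => itv_ind t s * (Y2 k s)%:C).
  exact: itv_ind_cint (cmeas_propag true true (measurable_cst k) (@measurable_id _ T1 setT)) (bd true true).
have prY : primitive (fun s => - 'i%C * (Y1 k s)%:C) t = - 'i%C * primitive (fun s => (Y1 k s)%:C) t.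
  by rewrite /primitive -ICZ//; apply: eq_IC => s; rewrite mulrCA.
have E1 : (- (k *+ 1))%:C * primitive (fun s => (Y1 k s)%:C) t = (X1 k t - 1)%:C.
  have := primitive_FTC (M := k * 2) (is_derive_X1 k) _ _ t0; rewrite X1_0 => <-.
  - by rewrite /primitive -ICZ//; apply: eq_IC => s; rewrite mulrCA -rcM mulr1n mulNr.
  - by under eq_fun do rewrite -mulNr; exact: ck.
  - by move=> s hs; rewrite normrN normrM ger0_norm// ler_wpM2l// by1.
have E2 : k%:C * primitive (fun s => (X1 k s)%:C) t - primitive (fun s => (Y1 k s)%:C) t = (Y1 k t)%:C.
  have := primitive_FTC (M := k * 2 + 2) (is_derive_Y1 k) _ _ t0; rewrite Y1_0 subr0 => <-.
  - rewrite /primitive -ICZ// -ICB//; last exact: cintZ.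
    by apply: eq_IC => s; rewrite rcB rcM mulrBr; congr (_ - _); rewrite mulrCA.
  - apply: contD; first exact: ck.
    by under eq_fun do rewrite -mulN1r; exact: ck.
  - move=> s hs; apply: le_trans (ler_normB _ _) _; rewrite lerD ?by1//.
    by rewrite normrM ger0_norm// ler_wpM2l// bx.
have E3 : k%:C * primitive (fun s => (Y2 k s)%:C) t = (Y1 k t)%:C.
  have dY s : is_derive s 1 (Y1 k) (k * Y2 k s) by rewrite -Y1_alt; exact: is_derive_Y1.
  have := primitive_FTC (M := k * 2) dY _ _ t0; rewrite Y1_0 subr0 => <-.
  - by rewrite /primitive -ICZ//; apply: eq_IC => s; rewrite mulrCA -rcM.
  - exact: ck.
  - by move=> s hs; rewrite normrM ger0_norm// ler_wpM2l// by2.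
have E4 : - (k%:C * primitive (fun s => (Y1 k s)%:C) t) - primitive (fun s => (Y2 k s)%:C) t = (Y2 k t - 1)%:C.
  have := primitive_FTC (M := k * 2 + 2) (is_derive_Y2 k) _ _ t0; rewrite Y2_0 => <-.
  - rewrite /primitive -(ICZ k%:C pY) -(ICN (cintZ k%:C pY)) -(ICB (cintN (cintZ k%:C pY)) pY2).
    apply: eq_IC => s; rewrite rcB rcN mulrBr mulrN; congr (- _ - _).
    by rewrite rcM mulrCA.
  - apply: contD; last by under eq_fun do rewrite -mulN1r; exact: ck.
    by under eq_fun do rewrite -mulNr; exact: ck.
  - move=> s hs; apply: le_trans (ler_normB _ _) _; rewrite lerD ?by2//.
    by rewrite normrN normrM ger0_norm// ler_wpM2l// by1.
have r1 : 1%:C = 1 :> R[i] by [].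
case: b1 b2 => [] []; rewrite /= ?prY ?mul0r ?add0r.
- rewrite -[primitive (propag true true k) t]/(primitive (fun s => (Y2 k s)%:C) t) -[in RHS]r1 -rcB -E4.
  rewrite (_ : - 'i%C * k%:C * _ = 'i%C * 'i%C * (k%:C * primitive (fun s => (Y1 k s)%:C) t)); last by ring.
  by rewrite ii; ring.
- rewrite -[primitive (propag false false k) t]/(primitive (fun s => (X1 k s)%:C) t).
  by rewrite subr0 -E2; ring.
- rewrite -[primitive (propag true true k) t]/(primitive (fun s => (Y2 k s)%:C) t).
  by rewrite subr0 -E3; ring.
- rewrite -[in RHS]r1 -rcB -E1 mulr1n.
  rewrite (_ : - 'i%C * k%:C * _ = 'i%C * 'i%C * (k%:C * primitive (fun s => (Y1 k s)%:C) t)); last by ring.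
  by rewrite ii mulN1r rcN mulNr.
Qed.

End TimeIntegrals.

(** * Duhamel estimates and the fixed point *)

Section Bilinear.
Context {R : realType}.
Notation leb := (@leb3 R).
Implicit Types (P Q V : bool -> R3 R -> R[i]) (b : bool) (N p q : R).
Variables al be ga : bool -> R[i].

Definition Bil b P Q xi : R[i] := (K3^-1)%:C *
  (al b * cnv (P false) (Q false) xi + be b * cnv (P true) (Q true) xi
   + ga b * cnv (P false) (Q true) xi).

Definition cb : R := K3^-1 * (nc (al false) + nc (be false) + nc (ga false)
  + (nc (al true) + nc (be true) + nc (ga true))).

(** The constants of the H^N bound, the pointwise bound and the L^2 bound are added, so that a
    single constant serves all of them. *)
Definition bC N : R := cb * (wC N + 1 + wA).

Lemma cb_ge0 : 0 <= cb.
Proof. by rewrite mulr_ge0 ?invr_ge0 ?(ltW K3_gt0)// !addr_ge0// nc_ge0. Qed.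

Lemma bC_ge0 N : 0 <= bC N.
Proof. by rewrite mulr_ge0 ?cb_ge0// !addr_ge0 ?wC_ge0 ?wA_ge0. Qed.

Lemma cb_b b : K3^-1 * (nc (al b) + nc (be b) + nc (ga b)) <= cb.
Proof.
rewrite /cb ler_wpM2l ?invr_ge0 ?(ltW K3_gt0)//.
by case: b; rewrite ?lerDl ?lerDr !addr_ge0 ?nc_ge0.
Qed.

Lemma bil_const N b c p q : 0 <= p -> 0 <= q -> 0 <= c -> c <= wC N + 1 + wA ->
  nc (K3^-1)%:C * (nc (al b) * (c * (p * q)) + nc (be b) * (c * (p * q)) +
    nc (ga b) * (c * (p * q))) <= bC N * (p * q).
Proof.
move=> p0 q0 c0 cN; rewrite nc_real_ge0 ?invr_ge0 ?(ltW K3_gt0)//.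
rewrite (_ : K3^-1 * _ = K3^-1 * (nc (al b) + nc (be b) + nc (ga b)) * c * (p * q)); last by ring.
rewrite ler_wpM2r ?mulr_ge0//.
by apply: ler_pM => //; [rewrite mulr_ge0 ?invr_ge0 ?(ltW K3_gt0) ?addr_ge0 ?nc_ge0|exact: cb_b].
Qed.

Lemma Bil_HB N b P Q p q : 2 <= N -> (forall b, HB N (P b) p) -> (forall b, HB N (Q b) q) ->
  HB N (Bil b P Q) (bC N * (p * q)).
Proof.
move=> N2 Pp Qq; have p0 := HB_ge0 (Pp true); have q0 := HB_ge0 (Qq true).
have h (c d : bool) := HB_cnv N2 (Pp c) (Qq d).
have := HBZ (K3^-1)%:C (HBD (HBD (HBZ (al b) (h false false)) (HBZ (be b) (h true true)))
  (HBZ (ga b) (h false true))).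
move=> /HB_le; apply; apply: bil_const => //; first exact: wC_ge0.
by rewrite -addrA lerDl addr_ge0// wA_ge0.
Qed.

Lemma Bil_bound N b P Q p q xi : 2 <= N -> (forall b, HB N (P b) p) -> (forall b, HB N (Q b) q) ->
  nc (Bil b P Q xi) <= bC N * (p * q).
Proof.
move=> N2 Pp Qq; have p0 := HB_ge0 (Pp true); have q0 := HB_ge0 (Qq true).
have N0 : 0 <= N := le_trans (ler0n R 2) N2.
have h (c d : bool) := cnv_bound xi (HB_L2 N0 (Pp c)) (HB_L2 N0 (Qq d)).
have hz (z u : R[i]) (r : R) : nc u <= r -> nc (z * u) <= nc z * (1 * r).
  by move=> ur; rewrite ncM mul1r ler_wpM2l ?nc_ge0.
apply: le_trans (bil_const b p0 q0 ler01 _).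
  rewrite ncM ler_wpM2l ?nc_ge0//; apply: le_trans (ncD _ _) _.
  apply: lerD; last exact: hz.
  by apply: le_trans (ncD _ _) _; apply: lerD; exact: hz.
by rewrite -addrA (addrC 1) addrA lerDr addr_ge0 ?wC_ge0 ?wA_ge0.
Qed.

Lemma Bil_L2l N b P Q p q : 2 <= N -> (forall b, HB N (P b) p) -> (forall b, L2b leb (Q b) q) ->
  L2b leb (Bil b P Q) (bC N * (p * q)).
Proof.
move=> N2 Pp Qq; have p0 := HB_ge0 (Pp true); have q0 := L2b_ge0 (Qq true).
have h (c d : bool) : L2b leb (cnv (P c) (Q d)) (wA * (p * q)).
  by rewrite mulrA; exact: cnv_L2 N2 (Pp c) (Qq d).
have := L2bZ (K3^-1)%:C (L2bD (L2bD (L2bZ (al b) (h false false)) (L2bZ (be b) (h true true)))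
  (L2bZ (ga b) (h false true))).
move=> /L2b_le; apply; apply: bil_const => //; first exact: wA_ge0.
by rewrite lerDr addr_ge0// wC_ge0.
Qed.

Lemma Bil_L2r N b P Q p q : 2 <= N -> (forall b, L2b leb (P b) p) -> (forall b, HB N (Q b) q) ->
  L2b leb (Bil b P Q) (bC N * (p * q)).
Proof.
move=> N2 Pp Qq; have p0 := L2b_ge0 (Pp true); have q0 := HB_ge0 (Qq true).
have h (c d : bool) : L2b leb (cnv (P c) (Q d)) (wA * (p * q)).
  rewrite (_ : cnv (P c) (Q d) = cnv (Q d) (P c)).
    by rewrite (mulrC p) mulrA; exact: cnv_L2 N2 (Qq d) (Pp c).
  by apply/funext => xi; apply: cnvC; [exact: L2b_cmeas (Pp c)|exact: HB_cmeas (Qq d)].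
have := L2bZ (K3^-1)%:C (L2bD (L2bD (L2bZ (al b) (h false false)) (L2bZ (be b) (h true true)))
  (L2bZ (ga b) (h false true))).
move=> /L2b_le; apply; apply: bil_const => //; first exact: wA_ge0.
by rewrite lerDr addr_ge0// wC_ge0.
Qed.

Lemma Bil_sub b P Q p q xi : (forall b, L2b leb (P b) p) -> (forall b, L2b leb (Q b) q) ->
  Bil b P P xi - Bil b Q Q xi =
  Bil b (fun c x => P c x - Q c x) P xi + Bil b Q (fun c x => P c x - Q c x) xi.
Proof.
move=> Pp Qq.
have h (c d : bool) : cnv (P c) (P d) xi - cnv (Q c) (Q d) xi =
    cnv (fun x => P c x - Q c x) (P d) xi + cnv (Q c) (fun x => P d x - Q d x) xi.
  have i1 := L1b_cint (cnv_cint xi (Pp c) (Pp d)).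
  have i2 := L1b_cint (cnv_cint xi (Qq c) (Pp d)).
  have i3 := L1b_cint (cnv_cint xi (Qq c) (Qq d)).
  have -> : cnv (fun x => P c x - Q c x) (P d) xi = cnv (P c) (P d) xi - cnv (Q c) (P d) xi.
    by rewrite /cnv -(ICB i1 i2); apply: eq_IC => y; rewrite mulrBl.
  have -> : cnv (Q c) (fun x => P d x - Q d x) xi = cnv (Q c) (P d) xi - cnv (Q c) (Q d) xi.
    by rewrite /cnv -(ICB i2 i3); apply: eq_IC => y; rewrite mulrBr.
  by rewrite addrA subrK.
have e (c d : bool) : cnv (P c) (P d) xi = cnv (Q c) (Q d) xi +
    (cnv (fun x => P c x - Q c x) (P d) xi + cnv (Q c) (fun x => P d x - Q d x) xi).
  by rewrite -h addrC subrK.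
by rewrite /Bil (e false false) (e true true) (e false true); ring.
Qed.

Lemma cnv_ext (U U' V V' : R3 R -> R[i]) xi : cmeas U -> cmeas U' -> cmeas V -> cmeas V' ->
  {ae leb, forall x, U x = U' x} -> {ae leb, forall x, V x = V' x} ->
  cnv U V xi = cnv U' V' xi.
Proof.
move=> mU mU' mV mV' UU VV.
have m (A B : R3 R -> R[i]) : cmeas A -> cmeas B -> cmeas (fun y => A (sub3 xi y) * B y).
  move=> mA mB; apply: cmeasM => //; apply: (cmeas_comp (h := sub3 xi)) => //.
  exact: measurable_sub3.
transitivity (cnv U V' xi).
  by apply: ae_eq_IC; [exact: m|exact: m|apply: filterS VV => y ->].
rewrite -!cnv_flip//.
have m' (A B : R3 R -> R[i]) : cmeas A -> cmeas B -> cmeas (fun y => A y * B (sub3 xi y)).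
  move=> mA mB; apply: cmeasM => //; apply: (cmeas_comp (h := sub3 xi)) => //.
  exact: measurable_sub3.
by apply: ae_eq_IC; [exact: m'|exact: m'|apply: filterS UU => y ->].
Qed.

(** A convolution is an integral and does not see null sets: equality almost everywhere of the
    arguments yields equality at every frequency. This is used to obtain a fixed point
    everywhere. *)
Lemma Bil_ext b P Q xi : (forall b, cmeas (P b)) -> (forall b, cmeas (Q b)) ->
  (forall b, {ae leb, forall x, P b x = Q b x}) -> Bil b P P xi = Bil b Q Q xi.
Proof.
move=> mP mQ PQ.
by rewrite /Bil (cnv_ext xi (mP false) (mQ false) (mP false) (mQ false) (PQ false) (PQ false))
  (cnv_ext xi (mP true) (mQ true) (mP true) (mQ true) (PQ true) (PQ true))
  (cnv_ext xi (mP false) (mQ false) (mP true) (mQ true) (PQ false) (PQ true)).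
Qed.

Notation T1 := (measurableTypeR R).
Implicit Types Z : bool -> T1 * R3 R -> R[i].

Definition quad b Z (z : T1 * R3 R) : R[i] :=
  Bil b (fun c xi => Z c (z.1, xi)) (fun c xi => Z c (z.1, xi)) z.2.

Lemma cmeas_quad b Z : (forall c, cmeas (Z c)) -> cmeas (quad b Z).
Proof.
move=> mZ.
have h (c d : bool) : cmeas (fun z : T1 * R3 R =>
    cnv (fun xi => Z c (z.1, xi)) (fun xi => Z d (z.1, xi)) z.2).
  have m1 : measurable_fun setT (fun p : (T1 * R3 R) * R3 R => (p.1.1, sub3 p.1.2 p.2)).
    apply: measurable_fun_pair.
      exact: (measurableT_comp measurable_fst measurable_fst).
    apply: measurable_sub3; last exact: measurable_snd.
    exact: (measurableT_comp measurable_snd measurable_fst).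
  have m2 : measurable_fun setT (fun p : (T1 * R3 R) * R3 R => (p.1.1, p.2)).
    apply: measurable_fun_pair; last exact: measurable_snd.
    exact: (measurableT_comp measurable_fst measurable_fst).
  exact: (cmeas_IC2 leb (cmeasM (cmeas_comp m1 (mZ c)) (cmeas_comp m2 (mZ d)))).
apply: cmeasM; first exact: cmeas_cst.
by apply: cmeasD; first apply: cmeasD; apply: cmeasM => //; exact: cmeas_cst.
Qed.

End Bilinear.

(** * Time convolution of decay rates *)

Section TimeDecay.
Context {R : realType}.
Notation leb1 := (@lebesgue_measure R).
Notation T1 := (measurableTypeR R).
Implicit Types (s t : R).

Lemma phi_mono s t : 0 <= s <= t -> phi t <= phi s.
Proof.
move=> /andP[s0 st].
rewrite -(@ler_pXn2r _ 4) ?nnegrE ?(ltW (phi_gt0 _))// !phi4.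
rewrite lef_pV2 ?posrE ?phi_arg// lerD2l !ger0_norm//; exact: le_trans st.
Qed.

Lemma phi_half s t : 0 <= s -> 0 <= t -> t <= 2 * s -> phi s <= 2 * phi t.
Proof.
move=> s0 t0 ts; rewrite -(@ler_pXn2r _ 4) ?nnegrE ?mulr_ge0 ?(ltW (phi_gt0 _))//.
rewrite exprMn !phi4 !ger0_norm// ler_pdivlMr; last by rewrite ltr_wpDr.
rewrite mulrC ler_pdivrMr ?ltr_wpDr//.
have : 2 <= 2 ^+ 4 :> R by rewrite -[leLHS]expr1 ler_weXn2l//; lra.
nra.
Qed.

(** The interval is split at t/2. On each half one of s and t - s is at least t/2 and yields the
    rate of t up to a power of 2, while the remaining factors leave an integrable fifth power. *)
Lemma phi_conv b s t : 0 <= s <= t ->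
  phi (t - s) ^+ rate b * phi s ^+ 6 <=
  2 ^+ 5 * phi t ^+ rate b * (phi s ^+ 5 + phi (t - s) ^+ 5).
Proof.
move=> /andP[s0 st]; have t0 := le_trans s0 st; have ts0 : 0 <= t - s by rewrite subr_ge0.
have ps := phi_gt0 s; have pt := phi_gt0 t; have pts := phi_gt0 (t - s).
have ps1 := phi_le1 s; have pts1 := phi_le1 (t - s).
have X0 (x : R) n : 0 < x -> 0 <= x ^+ n by move=> x0; rewrite exprn_ge0// ltW.
have c5 : 2 ^+ rate b <= 2 ^+ 5 :> R.
  by rewrite ler_weXn2l//; [lra|case: b].
have dbl (x : R) : 0 < x -> x <= 2 * phi t -> x ^+ rate b <= 2 ^+ 5 * phi t ^+ rate b.
  move=> x0 h; apply: (@le_trans _ _ ((2 * phi t) ^+ rate b)).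
    by apply: lerXn2r; rewrite ?nnegrE ?mulr_ge0 ?(ltW x0) ?(ltW pt).
  by rewrite exprMn ler_wpM2r ?X0.
have [h|h] := leP s (t - s).
  have hm : phi (t - s) <= 2 * phi t by apply: phi_half => //; lra.
  apply: ler_pM; rewrite ?X0 ?dbl//.
  apply: (@le_trans _ _ (phi s ^+ 5)); last by rewrite lerDl X0.
  by rewrite exprSr ler_piMr ?X0.
have hm : phi s <= 2 * phi t by apply: phi_half => //; lra.
have hp : phi s <= phi (t - s) by apply: phi_mono; rewrite ts0 ltW.
have pb : (rate b <= 6)%N by case: (b).
(* On the second half [rate b] of the six factors [phi s] supply the decay in t; the other ones are
   bounded by [phi (t - s)] and complete its power to 6. *)
rewrite mulrC -{1}(subnKC pb) exprD -[leLHS]mulrA; apply: ler_pM; rewrite ?mulr_ge0 ?X0 ?dbl//.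
apply: (@le_trans _ _ (phi (t - s) ^+ 5)); last by rewrite lerDr X0.
apply: (@le_trans _ _ (phi (t - s) ^+ 6)); last by rewrite exprSr ler_piMr ?X0.
rewrite -[in leRHS](subnK pb) exprD ler_wpM2r ?X0//.
by apply: lerXn2r; rewrite ?nnegrE ?(ltW ps) ?(ltW pts).
Qed.

Lemma measurable_phi_sub t : measurable_fun setT (fun s : T1 => phi (t - s)).
Proof.
apply: (measurableT_comp measurable_phi).
by apply: measurable_funB; [exact: measurable_cst|exact: measurable_id].
Qed.

Lemma int_phi_conv t : (\int[leb1]_s (phi s ^+ 5 + phi (t - s) ^+ 5)%:E = 16%:E)%E.
Proof.
have p0 s : 0 <= phi s ^+ 5 by rewrite exprn_ge0// ltW// phi_gt0.
have m1 : measurable_fun setT (fun s : T1 => phi s ^+ 5).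
  by apply: measurable_funX; exact: measurable_phi.
have m2 : measurable_fun setT (fun s : T1 => phi (t - s) ^+ 5).
  by apply: measurable_funX; exact: measurable_phi_sub.
under eq_integral do rewrite EFinD.
rewrite ge0_integralD//; try (by move=> x _; rewrite lee_fin); try exact/measurable_EFinP.
have m1' : measurable_fun setT (fun s : T1 => (phi s ^+ 5)%:E) by exact/measurable_EFinP.
have h := mpres_int (mpres_shift1 (- t)) m1' (fun s => _ : (0 <= (phi s ^+ 5)%:E)%E).
rewrite [X in (_ + X)%E](_ : _ = 8%:E)%E; last first.
  rewrite -int_phi5 -h => [|s]; last by rewrite lee_fin.
  by apply: eq_integral => s _; rewrite -phi_even opprB.
by rewrite int_phi5 -EFinD; congr (_%:E); lra.
Qed.

Lemma int_conv_bound b t c : 0 <= c ->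
  (\int[leb1]_s (\1_(`[0%R, t]%classic) s * (c * (phi (t - s) ^+ rate b * phi s ^+ 6)))%:E
   <= (c * (2 ^+ 5 * phi t ^+ rate b) * 16)%:E)%E.
Proof.
move=> c0; have p0 s n : 0 <= phi s ^+ n by rewrite exprn_ge0// ltW// phi_gt0.
have m1 n : measurable_fun setT (fun s : T1 => phi s ^+ n).
  by apply: measurable_funX; exact: measurable_phi.
have m2 n : measurable_fun setT (fun s : T1 => phi (t - s) ^+ n).
  by apply: measurable_funX; exact: measurable_phi_sub.
have m3 : measurable_fun setT (fun s : T1 => phi s ^+ 5 + phi (t - s) ^+ 5).
  by apply: measurable_funD.
have c1 : 0 <= c * (2 ^+ 5 * phi t ^+ rate b) by rewrite !mulr_ge0.
apply: (@le_trans _ _ (\int[leb1]_s ((c * (2 ^+ 5 * phi t ^+ rate b))%:E *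
    (phi s ^+ 5 + phi (t - s) ^+ 5)%:E))%E).
  apply: ge0_le_integral => //.
  - move=> s _; rewrite lee_fin indicE; apply: mulr_ge0; first exact: ler0n.
    by apply: mulr_ge0 => //; exact: mulr_ge0.
  - apply/measurable_EFinP; apply: measurable_funM.
      by apply: measurable_indic; exact: measurable_itv.
    by apply: measurable_funM; [exact: measurable_cst|exact: measurable_funM].
  - by apply/measurable_EFinP; apply: measurable_funM; [exact: measurable_cst|].
  move=> s _; rewrite -EFinM lee_fin indicE mem_setE in_itv/=.
  case: (boolP (0 <= s <= t)) => h; last by rewrite mul0r mulr_ge0// addr_ge0.
  by rewrite mul1r -mulrA ler_wpM2l// phi_conv.
rewrite ge0_integralZl//; last by move=> s _; rewrite lee_fin addr_ge0.
  by rewrite int_phi_conv.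
exact/measurable_EFinP.
Qed.

End TimeDecay.

(** * Duhamel's integral and the linear flow in H^N *)

Section Duhamel.
Context {R : realType}.
Notation leb := (@leb3 R).
Notation leb1 := (@lebesgue_measure R).
Notation T1 := (measurableTypeR R).
Implicit Types (F G Z : bool -> T1 * R3 R -> R[i]) (b : bool) (s t m N : R) (xi : R3 R).

Definition duhamel1 (b b' : bool) F (z : T1 * R3 R) : R[i] :=
  time_cnv (propag b b' (norm3 z.2)) (fun s => F b' (s, z.2)) z.1.

Definition duhamel b F z : R[i] := duhamel1 b false F z + duhamel1 b true F z.

Lemma cmeas_duhamel1_integrand b b' F : cmeas (F b') ->
  cmeas (fun p : (T1 * R3 R) * T1 => itv_ind p.1.1 p.2 *
    (propag b b' (norm3 p.1.2) (p.1.1 - p.2) * F b' (p.2, p.1.2))).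
Proof.
move=> mF.
have m11 : measurable_fun setT (fun p : (T1 * R3 R) * T1 => p.1.1).
  exact: (measurableT_comp measurable_fst measurable_fst).
have m12 : measurable_fun setT (fun p : (T1 * R3 R) * T1 => p.1.2).
  exact: (measurableT_comp measurable_snd measurable_fst).
have m2 : measurable_fun setT (fun p : (T1 * R3 R) * T1 => p.2) by exact: measurable_snd.
apply: cmeasM; first exact: cmeas_itv_ind m11 m2.
apply: cmeasM.
  apply: cmeas_propag; first exact: measurable_norm3 m12.
  exact: measurable_funB m11 m2.
exact: (cmeas_comp (measurable_fun_pair m2 m12) mF).
Qed.

Lemma cmeas_duhamel b F : (forall c, cmeas (F c)) -> cmeas (duhamel b F).
Proof.
by move=> mF; apply: cmeasD; exact: (cmeas_IC2 leb1 (cmeas_duhamel1_integrand b (mF _))).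
Qed.

(* A product of two factors decaying like [phi ^+ 3] decays like [phi ^+ 6]. *)
Definition forced N m F : Prop := [/\ 0 <= m, forall c, cmeas (F c),
  forall c s, 0 <= s -> HB N (fun xi => F c (s, xi)) (m * phi s ^+ 6) &
  forall c s xi, 0 <= s -> nc (F c (s, xi)) <= m * phi s ^+ 6].

Lemma cmeas_slice (f : T1 * R3 R -> R[i]) xi : cmeas f -> cmeas (fun s : T1 => f (s, xi)).
Proof. exact: cmeas_pair1. Qed.

Lemma duhamel1_cint b b' N m F t xi : forced N m F ->
  cint leb1 (fun s => itv_ind t s * (propag b b' (norm3 xi) (t - s) * F b' (s, xi))).
Proof.
move=> [m0 mF _ Fm].
apply: (time_cnv_cint (M := 2) (M' := m)).
- exact: cmeas_propag (measurable_cst _) (@measurable_id _ T1 setT).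
- exact: cmeas_slice.
- by move=> s s0; apply: propag_le2; rewrite ?norm3_ge0.
- move=> s s0; apply: le_trans (Fm b' s xi s0) _; rewrite ler_piMr//.
  by rewrite exprn_ile1 ?phi_le1 ?ltW ?phi_gt0.
Qed.

Definition dC N : R := sC N * 2 ^+ 5 * 16.

Lemma dC_ge0 N : 0 <= dC N.
Proof. by rewrite !mulr_ge0 ?exprn_ge0 ?sC_ge0. Qed.

(** Minkowski's integral inequality moves the H^N norm inside the time integral, where the decay of
    the propagator and of the forcing leave the convolution estimated in [int_conv_bound]. *)
Lemma duhamel1_HB b b' N m F t : 0 <= N -> forced N m F ->
  HB N (fun xi => duhamel1 b b' F (t, xi)) (dC N * m * phi t ^+ rate b).
Proof.
move=> N0 fF; have [m0 mF FN Fm] := fF.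
pose H (p : T1 * R3 R) : R[i] := (w N p.2)%:C * (itv_ind t p.1 *
  (propag b b' (norm3 p.2) (t - p.1) * F b' p)).
have m1 : measurable_fun setT (fun p : T1 * R3 R => p.1) by exact: measurable_fst.
have m2 : measurable_fun setT (fun p : T1 * R3 R => p.2) by exact: measurable_snd.
have mH : cmeas H.
  apply: cmeasM; first by apply: cmeas_real; exact: (measurableT_comp (measurable_w N) m2).
  apply: cmeasM; first exact: cmeas_itv_ind (measurable_cst t) m1.
  apply: cmeasM; last exact: mF.
  apply: cmeas_propag; first exact: measurable_norm3 m2.
  by apply: measurable_funB; [exact: measurable_cst|exact: m1].
pose n s := \1_(`[0%R, t]%classic) s * (sC N * m * (phi (t - s) ^+ rate b * phi s ^+ 6)).
have mn : measurable_fun setT (n : T1 -> R).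
  apply: measurable_funM; first by apply: measurable_indic; exact: measurable_itv.
  apply: measurable_funM; first exact: measurable_cst.
  apply: measurable_funM; apply: measurable_funX; first exact: measurable_phi_sub.
  exact: measurable_phi.
have Hn s : L2b leb (fun xi => H (s, xi)) (n s).
  rewrite /H /n /= itcE indicE mem_setE in_itv/=.
  case: (boolP (0 <= s <= t)) => [/andP[s0 st]|_]; last first.
    rewrite mul0r; have := @L2b0 _ _ _ leb; congr L2b; apply/funext => xi.
    by rewrite mul0r mulr0.
  have ts0 : 0 <= t - s by rewrite subr_ge0.
  have := propag3_decay b b' ts0 N0 (fun xi => Fm b' s xi s0) (FN b' s s0).
  rewrite (_ : sC N * _ * (m * _) = 1%:R * (sC N * m * (phi (t - s) ^+ rate b * phi s ^+ 6))); last by ring.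
  by congr L2b; apply/funext => xi; rewrite mul1r.
have c0 : 0 <= sC N * m by rewrite mulr_ge0// sC_ge0.
have [_ M] := minkowski_int mH mn Hn (int_conv_bound b t c0).
move: M; rewrite (_ : sC N * m * _ * 16 = dC N * m * phi t ^+ rate b); last by rewrite /dC; ring.
congr L2b; apply/funext => xi.
by rewrite /H /= ICZ//; exact: duhamel1_cint fF.
Qed.

Lemma duhamel_HB b N m F t : 0 <= N -> forced N m F ->
  HB N (fun xi => duhamel b F (t, xi)) (2 * dC N * m * phi t ^+ rate b).
Proof.
move=> N0 fF; have := HBD (duhamel1_HB b false t N0 fF) (duhamel1_HB b true t N0 fF).
by rewrite (_ : _ + _ = 2 * dC N * m * phi t ^+ rate b)//; ring.
Qed.

Lemma duhamel_sub b N m m' F G z : forced N m F -> forced N m' G ->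
  duhamel b F z - duhamel b G z = duhamel b (fun c p => F c p - G c p) z.
Proof.
move=> fF fG; case: z => t xi.
have h b' : duhamel1 b b' (fun c p => F c p - G c p) (t, xi) = duhamel1 b b' F (t, xi) - duhamel1 b b' G (t, xi).
  rewrite /duhamel1 /time_cnv /= -(ICB (duhamel1_cint b b' t xi fF) (duhamel1_cint b b' t xi fG)).
  by apply: eq_IC => s; rewrite !mulrBr.
by rewrite /duhamel !h; ring.
Qed.

Lemma duhamel_ext b F G t xi : (forall c s, 0 <= s -> F c (s, xi) = G c (s, xi)) ->
  duhamel b F (t, xi) = duhamel b G (t, xi).
Proof.
move=> FG; rewrite /duhamel /duhamel1 /time_cnv /=; congr (_ + _); apply: eq_IC => s;
  rewrite itcE; case: ifP => [/andP[s0 _]|_]; rewrite ?mul0r// FG//.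
Qed.

Definition linear_flow b (z0 : bool -> R3 R -> R[i]) (z : T1 * R3 R) : R[i] :=
  propag b false (norm3 z.2) z.1 * z0 false z.2 + propag b true (norm3 z.2) z.1 * z0 true z.2.

Lemma cmeas_linear_flow b z0 : (forall c, cmeas (z0 c)) -> cmeas (linear_flow b z0).
Proof.
move=> mz.
have m1 : measurable_fun setT (fun p : T1 * R3 R => p.1) by exact: measurable_fst.
have m2 : measurable_fun setT (fun p : T1 * R3 R => p.2) by exact: measurable_snd.
have h c : cmeas (fun z : T1 * R3 R => propag b c (norm3 z.2) z.1 * z0 c z.2).
  apply: cmeasM; last exact: cmeas_comp m2 (mz c).
  by apply: cmeas_propag; first exact: measurable_norm3 m2.
by apply: cmeasD; exact: h.
Qed.

Lemma linear_flow_HB b N z0 E t : 0 <= N -> 0 <= t -> (forall c xi, nc (z0 c xi) <= E) ->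
  (forall c, HB N (z0 c) E) ->
  HB N (fun xi => linear_flow b z0 (t, xi)) (2 * sC N * E * phi t ^+ rate b).
Proof.
move=> N0 t0 zE zN.
have := HBD (propag3_decay b false t0 N0 (zE false) (zN false))
  (propag3_decay b true t0 N0 (zE true) (zN true)).
by rewrite (_ : _ + _ = 2 * sC N * E * phi t ^+ rate b)//; ring.
Qed.

End Duhamel.

Lemma sub_add_same (V : zmodType) (x y z : V) : y - z = x + y - (x + z).
Proof. by rewrite opprD addrACA subrr add0r. Qed.

Lemma sub_sub_mid (V : zmodType) (x y z : V) : x - y - (z - y) = x - z.
Proof. by rewrite opprB addrA subrK. Qed.

(** * Picard iteration *)

Section Picard.
Context {R : realType}.
Notation leb := (@leb3 R).
Notation T1 := (measurableTypeR R).
Implicit Types (F G Z : bool -> T1 * R3 R -> R[i]) (b : bool) (s t m : R) (xi : R3 R).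
Variables (al be ga : bool -> R[i]) (N : R).
Hypothesis N2 : 2 <= N.
Notation quad b Z := (quad al be ga b Z).
Notation Bil := (Bil al be ga).
Notation bC := (bC al be ga N).

Let N0 : 0 <= N. Proof. exact: le_trans (ler0n R 2) N2. Qed.
Let b0 : 0 <= bC. Proof. exact: bC_ge0. Qed.
Let d2 : 0 <= 2 * dC N. Proof. exact: mulr_ge0 (ler0n R 2) (dC_ge0 N). Qed.

(** The contraction space, with the rate of u imposed on both unknowns: this already makes the
    quadratic terms of order [phi ^+ 6]. The faster rate of v reappears in [picard_step_HB]. *)
Definition decaying m Z : Prop := [/\ 0 <= m, forall c, cmeas (Z c) &
  forall c t, 0 <= t -> HB N (fun xi => Z c (t, xi)) (m * phi t ^+ 3)].

Lemma phi_rate_le b t : phi t ^+ rate b <= phi t ^+ 3.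
Proof. by apply: ler_wiXn2l; rewrite ?phi_le1 ?(ltW (phi_gt0 _))//; case: b. Qed.

Lemma forced_quad m Z : decaying m Z -> forced N (bC * m ^+ 2) (fun c => quad c Z).
Proof.
move=> [m0 mZ Zm]; split.
- exact: mulr_ge0 b0 (sqr_ge0 m).
- by move=> c; exact: cmeas_quad.
- move=> c s s0; have := Bil_HB al be ga c N2 (fun c => Zm c s s0) (fun c => Zm c s s0).
  by congr (HB _ _ _); ring.
- move=> c s xi s0; have := Bil_bound al be ga c xi N2 (fun c => Zm c s s0) (fun c => Zm c s s0).
  by congr (_ <= _); ring.
Qed.

Lemma forced_NL_sub m d Z Z' : decaying m Z -> decaying m Z' -> 0 <= d ->
  (forall c t, 0 <= t -> HB N (fun xi => Z c (t, xi) - Z' c (t, xi)) (d * phi t ^+ 3)) ->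
  forced N (2 * bC * m * d) (fun c z => quad c Z z - quad c Z' z).
Proof.
move=> [m0 mZ Zm] [_ mZ' Zm'] d0 ZZ.
have E c s xi : 0 <= s -> quad c Z (s, xi) - quad c Z' (s, xi) =
    Bil c (fun c x => Z c (s, x) - Z' c (s, x)) (fun c x => Z c (s, x)) xi +
    Bil c (fun c x => Z' c (s, x)) (fun c x => Z c (s, x) - Z' c (s, x)) xi.
  by move=> s0; apply: Bil_sub => b; [exact: HB_L2 N0 (Zm b s s0)|exact: HB_L2 N0 (Zm' b s s0)].
have cE (p : R) : bC * (d * p ^+ 3 * (m * p ^+ 3)) + bC * (m * p ^+ 3 * (d * p ^+ 3)) =
  2 * bC * m * d * p ^+ 6 by ring.
split.
- exact: mulr_ge0 (mulr_ge0 (mulr_ge0 (ler0n R 2) b0) m0) d0.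
- by move=> c; apply: cmeasB; exact: cmeas_quad.
- move=> c s s0.
  have := HBD (Bil_HB al be ga c N2 (fun c => ZZ c s s0) (fun c => Zm c s s0))
    (Bil_HB al be ga c N2 (fun c => Zm' c s s0) (fun c => ZZ c s s0)).
  by rewrite cE; congr (HB _ _ _); apply/funext => xi; rewrite -E.
- move=> c s xi s0; rewrite E// -cE; apply: le_trans (ncD _ _) _.
  have h1 := Bil_bound al be ga c xi N2 (fun c => ZZ c s s0) (fun c => Zm c s s0).
  have h2 := Bil_bound al be ga c xi N2 (fun c => Zm' c s s0) (fun c => ZZ c s s0).
  exact: lerD.
Qed.

Section Iteration.
Variables (E M : R) (z0 : bool -> R3 R -> R[i]).
Hypothesis zm : forall c, cmeas (z0 c).
Hypothesis zE : forall c xi, nc (z0 c xi) <= E.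
Hypothesis zN : forall c, HB N (z0 c) E.
Hypothesis ME : M = 4 * sC N * E.
Hypothesis small : 16 * dC N * bC * M <= 1.

Let E0 : 0 <= E. Proof. exact: HB_ge0 (zN true). Qed.
Let M0 : 0 <= M. Proof. by rewrite ME; exact: mulr_ge0 (mulr_ge0 (ler0n R 4) (sC_ge0 N)) E0. Qed.
Let M2 : M <= 2 * M. Proof. by have := M0; lra. Qed.
Let small' c : 0 <= c -> 8 * dC N * bC * M * c <= c / 2.
Proof.
move=> c0; have := ler_wpM2r c0 small; rewrite mul1r.
set x := dC N * bC * M * c.
rewrite (_ : 16 * dC N * bC * M * c = 16 * x); last by rewrite /x; ring.
by rewrite (_ : 8 * dC N * bC * M * c = 8 * x); [lra|rewrite /x; ring].
Qed.

Definition picard_step Z : bool -> T1 * R3 R -> R[i] :=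
  fun b z => linear_flow b z0 z + duhamel b (fun c => quad c Z) z.

Lemma cmeas_pstep Z b : (forall c, cmeas (Z c)) -> cmeas (picard_step Z b).
Proof.
move=> mZ; apply: cmeasD; first exact: cmeas_linear_flow.
by apply: cmeas_duhamel => c; exact: cmeas_quad.
Qed.

Lemma picard_step_HB m Z b t : decaying m Z -> m <= 2 * M -> 0 <= t ->
  HB N (fun xi => picard_step Z b (t, xi)) (M * phi t ^+ rate b).
Proof.
move=> Zm mM t0; have [m0 _ _] := Zm.
have := HBD (linear_flow_HB b N0 t0 zE zN) (duhamel_HB b t N0 (forced_quad Zm)).
move=> /HB_le; apply.
rewrite -mulrDl ler_wpM2r ?exprn_ge0 ?(ltW (phi_gt0 _))//.
have h : 2 * dC N * (bC * m ^+ 2) <= 8 * dC N * bC * M * M.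
  rewrite (_ : 8 * dC N * bC * M * M = 2 * dC N * (bC * (2 * M) ^+ 2)); last by ring.
  apply: (ler_wpM2l d2); apply: (ler_wpM2l b0).
  by apply: lerXn2r => //; rewrite nnegrE// mulr_ge0.
have := small' M0; have := M0; have := ME; lra.
Qed.

Lemma decaying_picard_step m Z : decaying m Z -> m <= 2 * M -> decaying M (picard_step Z).
Proof.
move=> Zm mM; have [m0 mZ _] := Zm; split => //.
  by move=> c; exact: cmeas_pstep.
move=> c t t0; apply: HB_le (picard_step_HB c Zm mM t0) _.
by rewrite ler_wpM2l// phi_rate_le.
Qed.

Lemma picard_step_sub d Z Z' b t : decaying (2 * M) Z -> decaying (2 * M) Z' -> 0 <= d ->
  (forall c t, 0 <= t -> HB N (fun xi => Z c (t, xi) - Z' c (t, xi)) (d * phi t ^+ 3)) ->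
  0 <= t ->
  HB N (fun xi => picard_step Z b (t, xi) - picard_step Z' b (t, xi)) (d / 2 * phi t ^+ 3).
Proof.
move=> Zm Zm' d0 ZZ t0.
have := duhamel_HB b t N0 (forced_NL_sub Zm Zm' d0 ZZ).
rewrite (_ : 2 * dC N * (2 * bC * (2 * M) * d) = 8 * dC N * bC * M * d); last by ring.
move=> /HB_le h; have {h} := h (d / 2 * phi t ^+ 3) _.
have -> : (fun xi => duhamel b (fun c z => quad c Z z - quad c Z' z) (t, xi)) =
    (fun xi => picard_step Z b (t, xi) - picard_step Z' b (t, xi)).
  apply/funext => xi; rewrite -(duhamel_sub b (t, xi) (forced_quad Zm) (forced_quad Zm')) /picard_step.
  exact: sub_add_same.
apply; apply: ler_pM; rewrite ?small' ?phi_rate_le//.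
- exact: mulr_ge0 (mulr_ge0 (mulr_ge0 (mulr_ge0 (ler0n R 8) (dC_ge0 N)) b0) M0) d0.
- by rewrite exprn_ge0 ?(ltW (phi_gt0 _)).
Qed.

Fixpoint picard_it n : bool -> T1 * R3 R -> R[i] :=
  if n is n'.+1 then picard_step (picard_it n') else fun _ _ => 0.

Lemma decaying_picard_it n : decaying M (picard_it n).
Proof.
elim: n => [|n IH]; last by exact: decaying_picard_step IH M2.
split => [|c|c t t0]; [exact: M0|exact: cmeas_cst|].
apply: HB_le (HB0 N) _.
by rewrite mulr_ge0 ?exprn_ge0 ?(ltW (phi_gt0 _)).
Qed.

Lemma decaying_le m m' Z : decaying m Z -> m <= m' -> decaying m' Z.
Proof.
move=> [m0 mZ Zm] mm; split => //; first exact: le_trans mm.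
move=> c t t0; apply: HB_le (Zm c t t0) _.
by rewrite ler_wpM2r ?exprn_ge0 ?(ltW (phi_gt0 _)).
Qed.

Lemma picard_it_sub n b t : 0 <= t ->
  HB N (fun xi => picard_it n.+1 b (t, xi) - picard_it n b (t, xi)) (M / 2 ^+ n * phi t ^+ 3).
Proof.
elim: n b t => [|n IH] b t t0.
  rewrite expr0 divr1; have [_ _ h] := decaying_picard_it 1.
  by have := h b t t0; congr (HB _ _ _); apply/funext => xi; rewrite subr0.
have := picard_step_sub b (decaying_le (decaying_picard_it n.+1) M2) (decaying_le (decaying_picard_it n) M2) _ IH t0.
have -> : M / 2 ^+ n.+1 = M / 2 ^+ n / 2 by rewrite exprSr invfM mulrA.
apply.
by rewrite divr_ge0 ?exprn_ge0.
Qed.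

(** The limit is taken pointwise in (t, xi), so it is jointly measurable; at each fixed t >= 0 the
    convergence holds for almost every xi. *)
Definition picard_lim b : T1 * R3 R -> R[i] := clim (fun n => picard_it n b).

Lemma cmeas_picard_it n b : cmeas (picard_it n b). Proof. by have [_ + _] := decaying_picard_it n; apply. Qed.

Lemma picard_lim_sub n b t : 0 <= t ->
  HB N (fun xi => picard_lim b (t, xi) - picard_it n b (t, xi)) (2 * M / 2 ^+ n * phi t ^+ 3).
Proof.
move=> t0; pose f n xi := (w N xi)%:C * picard_it n b (t, xi).
have mf : cmeas (f 0%N) by apply: cmeas_wM; exact: cmeas_cst.
have h k : L2b leb (fun xi => f k.+1 xi - f k xi) (M * phi t ^+ 3 / 2 ^+ k).
  have := picard_it_sub k b t0; rewrite mulrAC.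
  by congr L2b; apply/funext => xi; rewrite mulrBr.
have [cf Lf] := riesz_fischer mf h.
have := Lf n; rewrite (_ : 2 * (M * _) / _ = 2 * M / 2 ^+ n * phi t ^+ 3); last by ring.
move=> /L2b_ae_eq; apply.
  apply: cmeas_wM; apply: cmeasB; apply: cmeas_pair2; last exact: cmeas_picard_it.
  by apply: cmeas_clim => k; exact: cmeas_picard_it.
(* [riesz_fischer] produces the limit of the weighted iterates; dividing by the positive weight
   identifies it with the weighted [picard_lim]. *)
apply: filterS cf => xi hx; rewrite mulrBr; congr (_ - _).
have w1 : ((w N xi)^-1)%:C * (w N xi)%:C = 1 :> R[i].
  by rewrite -rcM mulVf// gt_eqF// w_gt0.
have hy : ccvg (fun k => picard_it k b (t, xi)) (((w N xi)^-1)%:C * clim f xi).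
  apply: (@ccvg_le _ _ _ (fun k => nc ((w N xi)^-1)%:C * nc (f k xi - clim f xi))).
    by move=> k; rewrite -ncM mulrBr /f mulrA w1 mul1r.
  by rewrite -[X in _ --> X](mulr0 (nc ((w N xi)^-1)%:C)); apply: cvgMr.
rewrite /picard_lim (clim_cvg (f := fun n => picard_it n b) hy) mulrA -rcM mulfV ?mul1r//.
by rewrite gt_eqF// w_gt0.
Qed.

Lemma decaying_picard_lim : decaying (2 * M) picard_lim.
Proof.
split; [by rewrite mulr_ge0|by move=> c; apply: cmeas_clim => n; exact: cmeas_picard_it|].
move=> c t t0; have := picard_lim_sub 0 c t0; rewrite expr0 divr1.
by congr (HB _ _ _); apply/funext => xi; rewrite subr0.
Qed.

(* One more step turns the limit, a fixed point up to null sets, into a fixed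
   point at every point (t, xi). *)
Definition picard_sol : bool -> T1 * R3 R -> R[i] := picard_step picard_lim.

(** Both functions are close to the iterate of rank n + 1: the step applied to the limit by
    contraction, the limit itself by [picard_lim_sub]. The rank n is arbitrary, so the difference
    vanishes in L^2. *)
Lemma picard_sol_lim b t : 0 <= t -> {ae leb, forall xi, picard_sol b (t, xi) = picard_lim b (t, xi)}.
Proof.
move=> t0; have [_ ml _] := decaying_picard_lim.
have mp : cmeas (picard_sol b) by exact: cmeas_pstep.
suff : L2b leb (fun xi => picard_sol b (t, xi) - picard_lim b (t, xi)) 0.
  by move=> /L2b_eq0; apply: filterS => xi /eqP; rewrite subr_eq0 => /eqP.
apply: L2b_inf; first exact: cmeasB (cmeas_pair2 t mp) (cmeas_pair2 t (ml b)).
move=> e e0.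
have [n hn] : exists n : nat, 4 * M <= e * 2 ^+ n.
  exists (Num.truncn (4 * M / e)).+1; rewrite -ler_pdivrMl// mulrC.
  apply: le_trans (ltW (truncnS_gt _)) _; rewrite -natrX ler_nat.
  by rewrite ltnW// ltn_expl.
have p2 : 0 < 2 ^+ n :> R by rewrite exprn_gt0.
have d0 k : 0 <= 2 * M / 2 ^+ k by rewrite divr_ge0 ?mulr_ge0 ?exprn_ge0.
have h1 := picard_step_sub b decaying_picard_lim (decaying_le (decaying_picard_it n) M2) (d0 n) (fun c t => picard_lim_sub n c (t := t)) t0.
have h2 : HB N (fun xi => picard_lim b (t, xi) - picard_step (picard_it n) b (t, xi)) _ := picard_lim_sub n.+1 b t0.
apply: (L2b_le (a := 2 * M / 2 ^+ n / 2 * phi t ^+ 3 + 2 * M / 2 ^+ n.+1 * phi t ^+ 3)).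
  have := L2bB (HB_L2 N0 h1) (HB_L2 N0 h2).
  by congr L2b; apply/funext => xi; exact: sub_sub_mid.
rewrite -mulrDl; apply: (@le_trans _ _ (4 * M / 2 ^+ n)).
  have p1 : phi t ^+ 3 <= 1 by rewrite exprn_ile1 ?phi_le1 ?(ltW (phi_gt0 _)).
  apply: (@le_trans _ _ (2 * M / 2 ^+ n / 2 + 2 * M / 2 ^+ n.+1)).
    by rewrite ler_piMr// addr_ge0// divr_ge0.
  rewrite exprSr invfM mulrA -!mulrA.
  have : 0 <= M * (2 ^+ n)^-1 by rewrite mulr_ge0// invr_ge0 ltW.
  nra.
by rewrite ler_pdivrMr.
Qed.

Lemma picard_sol_HB b t : 0 <= t -> HB N (fun xi => picard_sol b (t, xi)) (M * phi t ^+ rate b).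
Proof. by move=> t0; exact: picard_step_HB decaying_picard_lim (lexx _) t0. Qed.

Lemma cmeas_picard_sol b : cmeas (picard_sol b).
Proof. by have [_ ml _] := decaying_picard_lim; exact: cmeas_pstep. Qed.

Lemma picard_sol_fix b t xi : 0 <= t ->
  picard_sol b (t, xi) = linear_flow b z0 (t, xi) + duhamel b (fun c => quad c picard_sol) (t, xi).
Proof.
move=> t0; have [_ ml _] := decaying_picard_lim.
have -> : picard_sol b (t, xi) = linear_flow b z0 (t, xi) + duhamel b (fun c => quad c picard_lim) (t, xi) by [].
(* The quadratic term does not distinguish the limit from [picard_sol], at any frequency, because
   [Bil] ignores null sets. *)
suff e c s : 0 <= s -> quad c picard_lim (s, xi) = quad c picard_sol (s, xi).
  by rewrite (@duhamel_ext _ b (fun c => quad c picard_lim) (fun c => quad c picard_sol) t xi (fun c s => e c s)).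
move=> s0; apply/esym.
have mA d := cmeas_pair2 s (cmeas_picard_sol d); have mB d := cmeas_pair2 s (ml d).
exact: (Bil_ext al be ga c xi mA mB (fun d => picard_sol_lim d s0)).
Qed.

End Iteration.

End Picard.

(** * Regularity in time *)

Section ScalarDuhamel.
Context {R : realType}.
Notation leb1 := (@lebesgue_measure R).
Notation T1 := (measurableTypeR R).
Implicit Types (b c : bool) (s t : R).

Lemma symbol_le b1 b2 (k : R) : 0 <= k -> nc (symbol b1 b2 k) <= 1 + k.
Proof.
by move=> k0; case: b1 b2 => [] []; rewrite /symbol ?ncM ?ncN ?nc_i ?nc0 ?ComplexField.Normc.normc1
  ?mul1r ?nc_real ?ger0_norm//; lra.
Qed.

Lemma cmeas_symbol b1 b2 d (T : measurableType d) (p : T -> R) : measurable_fun setT p ->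
  cmeas (fun x => symbol b1 b2 (p x)).
Proof.
move=> mp; have h : cmeas (fun x => - 'i%C * (p x)%:C).
  by apply: cmeasM; [exact: cmeas_cst|exact: cmeas_real].
by case: b1 b2 => [] [] //; exact: cmeas_cst.
Qed.

Lemma time_cnv_cint_itv (K G : T1 -> R[i]) (p q : R) t : cmeas K -> cmeas G ->
  (forall s, 0 <= s <= t -> nc (K s) <= p) -> (forall s, 0 <= s <= t -> nc (G s) <= q) ->
  cint leb1 (fun s => itv_ind t s * (K (t - s) * G s)).
Proof.
move=> mK mG Ka Gc.
have mt : measurable_fun setT (fun s : T1 => t - s : T1).
  by apply: measurable_funB; [exact: measurable_cst|exact: measurable_id].
apply: (itv_ind_cint (M := p * q)) => [|s /andP[s0 st]].
  by apply: cmeasM => //; exact: cmeas_comp mt mK.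
apply: mulr_bound; last by apply: Gc; rewrite s0.
by apply: Ka; rewrite subr_ge0 st lerBlDr lerDl.
Qed.

Variables (k B E : R) (G : bool -> T1 -> R[i]) (a0 : bool -> R[i]) (y : bool -> R -> R[i]).
Hypotheses (k0 : 0 <= k) (B0 : 0 <= B).
Hypothesis mG : forall c, cmeas (G c).
Hypothesis GB : forall c s, 0 <= s -> nc (G c s) <= B.
Hypothesis aE : forall c, nc (a0 c) <= E.
Hypothesis yfix : forall b t, 0 <= t -> y b t =
  propag b false k t * a0 false + propag b true k t * a0 true +
  (time_cnv (propag b false k) (G false) t + time_cnv (propag b true k) (G true) t).

Let msg b1 b2 : cmeas (propag b1 b2 k : T1 -> R[i]).
Proof. exact: cmeas_propag (measurable_cst k) (@measurable_id _ T1 setT). Qed.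

Let sg2 b1 b2 t s : 0 <= s <= t -> nc (propag b1 b2 k s) <= 2.
Proof. by move=> /andP[s0 _]; exact: propag_le2. Qed.

Let isg b1 b2 t : cint leb1 (fun s => itv_ind t s * propag b1 b2 k s).
Proof. exact: (itv_ind_cint (msg b1 b2) (@sg2 b1 b2 t)). Qed.

Let iG c t : cint leb1 (fun s => itv_ind t s * G c s).
Proof. by apply: (itv_ind_cint (M := B) (mG c)) => s /andP[s0 _]; exact: GB. Qed.

Lemma time_cnv_propag_le b c s : 0 <= s -> nc (time_cnv (propag b c k) (G c) s) <= 2 * B * s.
Proof.
move=> s0.
have mi : cmeas (fun r : T1 => propag b c k (s - r) * G c r).
  apply: cmeasM; last exact: mG.
  have mt : measurable_fun setT (fun r : T1 => s - r : T1).
    by apply: measurable_funB; [exact: measurable_cst|exact: measurable_id].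
  exact: cmeas_comp mt (msg b c).
apply: (primitive_bound mi s0) => [|r /andP[r0 rs]]; first by rewrite mulr_ge0.
by apply: mulr_bound; [apply: propag_le2; rewrite ?subr_ge0|exact: GB].
Qed.

Lemma duhamel_le b t s : 0 <= s <= t -> nc (y b s) <= 4 * E + 4 * B * t.
Proof.
move=> /andP[s0 st]; rewrite yfix//.
have h1 c : nc (propag b c k s * a0 c) <= 2 * E.
  by apply: mulr_bound => //; exact: propag_le2.
have h2 c : nc (time_cnv (propag b c k) (G c) s) <= 2 * B * t.
  apply: le_trans (time_cnv_propag_le b c s0) _; last by rewrite ler_wpM2l// mulr_ge0.
have := h1 false; have := h1 true; have := h2 false; have := h2 true.
move: (time_cnv _ _ _) (time_cnv _ _ _) (propag _ _ _ _ * _) (propag _ _ _ _ * _) => z1 z2 z3 z4.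
have := ncD (z3 + z4) (z1 + z2); have := ncD z3 z4; have := ncD z1 z2; lra.
Qed.

Lemma duhamel_pr b t : 0 <= t -> primitive (y b : T1 -> R[i]) t =
  primitive (propag b false k) t * a0 false + primitive (propag b true k) t * a0 true +
  (time_cnv (primitive (propag b false k)) (G false) t + time_cnv (primitive (propag b true k)) (G true) t).
Proof.
move=> t0.
have T c : primitive (time_cnv (propag b c k) (G c)) t = time_cnv (primitive (propag b c k)) (G c) t.
  apply: (@primitive_time_cnv R (propag b c k) (G c) 2 B t (msg b c) (mG c) t0 (ler0n R 2) B0) => [s s0|].
    exact: propag_le2.
  exact: GB.
have iT c : cint leb1 (fun s => itv_ind t s * time_cnv (propag b c k) (G c) s).
  apply: (itv_ind_cint (M := 2 * B * t)); first exact: cmeas_tcv.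
  move=> s /andP[s0 st]; apply: le_trans (time_cnv_propag_le b c s0) _.
  by rewrite ler_wpM2l// mulr_ge0.
have iS c : cint leb1 (fun s => itv_ind t s * (propag b c k s * a0 c)).
  have := cintZ (a0 c) (isg b c t); congr cint; apply/funext => s; ring.
have pS c : primitive (fun s => propag b c k s * a0 c) t = primitive (propag b c k) t * a0 c.
  by rewrite /primitive [RHS]mulrC -(ICZ _ (isg b c t)); apply: eq_IC => s; ring.
rewrite -!T -!pS /primitive -(ICD (iS false) (iS true)) -(ICD (iT false) (iT true)).
rewrite -(ICD (cintD (iS false) (iS true)) (cintD (iT false) (iT true))).
apply: eq_IC => s; rewrite itcE; case: ifP => [/andP[s0 _]|_]; last by rewrite !mul0r !addr0.
by rewrite !mul1r yfix.
Qed.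

(** From the mild form to the integrated differential equation at a fixed frequency. The primitive
    of the mild formula has the same shape with primitives of the propagator as kernels; applying
    the symbol and [propag_int], at t and at t - s, recovers the mild formula minus the data and the
    forcing. *)
Lemma duhamel_int b t : 0 <= t -> y b t =
  a0 b + (symbol b false k * primitive (y false : T1 -> R[i]) t + symbol b true k * primitive (y true : T1 -> R[i]) t
    + primitive (G b) t).
Proof.
move=> t0; rewrite !duhamel_pr//.
have re_inner c b2 : cint leb1 (fun s => itv_ind t s * (primitive (propag c b2 k) (t - s) * G b2 s)).
  apply: (time_cnv_cint_itv (p := 2 * t) (q := B)) => //.
  - exact: cmeas_pr (msg c b2).
  - move=> s /andP[s0 st]; apply: (@le_trans _ _ (2 * s)); last by rewrite ler_wpM2l.
    by apply: (primitive_bound (msg c b2) s0) => // r; exact: sg2.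
  - by move=> s /andP[s0 _]; exact: GB.
have it c b2 : cint leb1 (fun s => itv_ind t s * (propag c b2 k (t - s) * G b2 s)).
  by apply: (time_cnv_cint_itv (p := 2) (q := B)) => // s; [exact: sg2|move=> /andP[s0 _]; exact: GB].
have T b2 : symbol b false k * time_cnv (primitive (propag false b2 k)) (G b2) t +
    symbol b true k * time_cnv (primitive (propag true b2 k)) (G b2) t =
    time_cnv (propag b b2 k) (G b2) t - (b == b2)%:R * primitive (G b2) t.
  rewrite /time_cnv -(ICZ (symbol b false k) (re_inner false b2)) -(ICZ (symbol b true k) (re_inner true b2)).
  rewrite -(ICD (cintZ (symbol b false k) (re_inner false b2)) (cintZ (symbol b true k) (re_inner true b2))).
  rewrite {3}/primitive -(ICZ _ (iG b2 t)) -(ICB (it b b2) (cintZ _ (iG b2 t))).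
  apply: eq_IC => s; rewrite itcE; case: ifP => [/andP[s0 st]|_]; last first.
    by rewrite !mul0r !mulr0 addr0 subr0.
  have ts0 : 0 <= t - s by rewrite subr_ge0.
  have S := propag_int b b2 k0 ts0.
  by rewrite !mul1r -mulrBl -S; ring.
have S b2 := propag_int b b2 k0 t0.
have E1 b2 : symbol b false k * (primitive (propag false b2 k) t * a0 b2) + symbol b true k * (primitive (propag true b2 k) t * a0 b2)
    = (propag b b2 k t - (b == b2)%:R) * a0 b2 by rewrite -S; ring.
have alg (A1 A2 p1 p2 q1 q2 w0 w1 x1 x2 z1 z2 g : R[i]) :
    A1 * (p1 * w0) + A2 * (q1 * w0) + (A1 * (p2 * w1) + A2 * (q2 * w1)) +
    ((A1 * x1 + A2 * z1) + (A1 * x2 + A2 * z2)) + g =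
    A1 * (p1 * w0 + p2 * w1 + (x1 + x2)) + A2 * (q1 * w0 + q2 * w1 + (z1 + z2)) + g by ring.
rewrite yfix//.
transitivity (a0 b + ((((propag b false k t - (b == false)%:R) * a0 false +
  (propag b true k t - (b == true)%:R) * a0 true) +
  ((time_cnv (propag b false k) (G false) t - (b == false)%:R * primitive (G false) t) +
  (time_cnv (propag b true k) (G true) t - (b == true)%:R * primitive (G true) t))) + primitive (G b) t)).
  by case: (b) => /=; ring.
congr (_ + _); rewrite -(T false) -(T true) -(E1 false) -(E1 true); exact: alg.
Qed.

End ScalarDuhamel.

Section PrimitiveBounds.
Context {R : realType}.
Notation leb1 := (@lebesgue_measure R).
Notation T1 := (measurableTypeR R).
Implicit Types (a c s t r M : R).

Lemma ind_itv a c s : \1_(`[a, c]%classic) s = ((a <= s <= c)%R)%:R :> R.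
Proof. by rewrite indicE mem_setE in_itv. Qed.

Lemma int_cst_itv2 M a c : a <= c -> 0 <= M ->
  (\int[leb1]_s (M * \1_(`[a, c]%classic) s)%:E = (M * (c - a))%:E)%E.
Proof.
move=> ac M0; under eq_integral do rewrite EFinM.
have mi : measurable (`[a, c]%classic : set T1) by exact: measurable_itv.
rewrite ge0_integralZl//; last by apply/measurable_EFinP; exact: measurable_indic.
rewrite integral_indic// setIT.
have L : (leb1 (`[a, c]%classic : set T1) = (c - a)%:E)%E.
  rewrite lebesgue_measure_itv/= lte_fin.
  by case: ltP => h; rewrite -?EFinB//; congr (_%:E); apply/esym/eqP; rewrite subr_eq0 eq_le ac h.
by rewrite [X in (_ * X)%E](_ : _ = (c - a)%:E).
Qed.

Lemma itcB_le M a c r (z : R[i]) : 0 <= a -> a <= c -> (a <= r <= c -> nc z <= M) ->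
  nc ((itv_ind c r - itv_ind a r) * z) <= M * \1_(`[a, c]%classic) r.
Proof.
move=> a0 ac h; rewrite ind_itv.
have [rc|rc] := boolP (a <= r <= c); last first.
  rewrite mulr0 (_ : itv_ind c r - itv_ind a r = 0) ?mul0r ?nc0// !itcE.
  move: rc; rewrite negb_and -!ltNge => /orP[ra|cr].
    by rewrite (le_trans (ltW ra) ac) (ltW ra) !andbT subrr.
  by rewrite !(leNgt r) cr (le_lt_trans ac cr) !andbF subrr.
rewrite mulr1; apply: le_trans (h rc); rewrite ncM ler_piMl ?nc_ge0// !itcE.
move: rc => /andP[ar rc]; rewrite (le_trans a0 ar) rc /=.
by case: ifP => _; rewrite ?subrr ?subr0 ?nc0 ?ComplexField.Normc.normc1.
Qed.

Lemma primitive_lip (f : T1 -> R[i]) M t a c : cmeas f -> 0 <= M ->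
  (forall s, 0 <= s <= t -> nc (f s) <= M) -> 0 <= a -> a <= c -> c <= t ->
  nc (primitive f c - primitive f a) <= M * (c - a).
Proof.
move=> mf M0 fM a0 ac ct.
have i x : x <= t -> cint leb1 (fun s => itv_ind x s * f s).
  move=> xt; apply: (itv_ind_cint (M := M) mf) => s /andP[s0 sx].
  by apply: fM; rewrite s0 (le_trans sx).
rewrite /primitive -ICB; [|exact: i|exact: i (le_trans ac ct)].
apply: L1b_IC; split; first by case: (cintD (i c ct) (cintN (i a (le_trans ac ct)))).
rewrite -(int_cst_itv2 ac M0); apply: ge0_le_integral => //.
- by move=> x _; rewrite lee_fin nc_ge0.
- by apply: mnc; case: (cintD (i c ct) (cintN (i a (le_trans ac ct)))).
- apply/measurable_EFinP; apply: measurable_funM; first exact: measurable_cst.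
  by apply: measurable_indic; exact: measurable_itv.
- move=> s _; rewrite lee_fin -mulrBl; apply: itcB_le => // /andP[as_ sc].
  by apply: fM; rewrite (le_trans a0 as_) (le_trans sc).
Qed.

End PrimitiveBounds.

Section Regularity.
Context {R : realType}.
Notation leb := (@leb3 R).
Notation leb1 := (@lebesgue_measure R).
Notation T1 := (measurableTypeR R).
Implicit Types (b c : bool) (s t h e : R) (xi : R3 R).
Variables (al be ga : bool -> R[i]) (N : R).
Hypothesis N2 : 2 <= N.
Notation quad b Z := (quad al be ga b Z).
Notation bC := (bC al be ga N).
Variables (E m : R) (z0 : bool -> R3 R -> R[i]) (Y : bool -> T1 * R3 R -> R[i]).
Hypothesis zE : forall c xi, nc (z0 c xi) <= E.
Hypothesis zN : forall c, HB N (z0 c) E.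
Hypothesis Yd : decaying N m Y.
Hypothesis Yfix : forall b t xi, 0 <= t ->
  Y b (t, xi) = linear_flow b z0 (t, xi) + duhamel b (fun c => quad c Y) (t, xi).

Let N0 : 0 <= N. Proof. exact: le_trans (ler0n R 2) N2. Qed.
Let E0 : 0 <= E. Proof. exact: HB_ge0 (zN true). Qed.
Let m0 : 0 <= m. Proof. by case: Yd. Qed.
Let mY c : cmeas (Y c). Proof. by case: Yd. Qed.
Let fN : forced N (bC * m ^+ 2) (fun c => quad c Y). Proof. exact: forced_quad. Qed.

Definition nlB : R := bC * m ^+ 2.
Notation B := nlB.
Let B0 : 0 <= B. Proof. by case: fN. Qed.

Lemma quad_le c s xi : 0 <= s -> nc (quad c Y (s, xi)) <= B.
Proof.
move=> s0; have [_ _ _ h] := fN; apply: le_trans (h c s xi s0) _.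
by rewrite ler_piMr// exprn_ile1 ?phi_le1 ?(ltW (phi_gt0 _)).
Qed.

Lemma quad_HB c s : 0 <= s -> HB N (fun xi => quad c Y (s, xi)) B.
Proof.
move=> s0; have [_ _ h _] := fN; apply: HB_le (h c s s0) _.
by rewrite ler_piMr// exprn_ile1 ?phi_le1 ?(ltW (phi_gt0 _)).
Qed.

Lemma Y_HB c s : 0 <= s -> HB N (fun xi => Y c (s, xi)) m.
Proof.
move=> s0; have [_ _ h] := Yd; apply: HB_le (h c s s0) _.
by rewrite ler_piMr// exprn_ile1 ?phi_le1 ?(ltW (phi_gt0 _)).
Qed.

Let mNLj c : cmeas (quad c Y). Proof. exact: cmeas_quad. Qed.

Let mNL c xi : cmeas (fun s : T1 => quad c Y (s, xi)).
Proof. exact: cmeas_slice xi (mNLj c). Qed.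

Let Yfix' xi b t : 0 <= t -> Y b (t, xi) =
  propag b false (norm3 xi) t * z0 false xi + propag b true (norm3 xi) t * z0 true xi +
  (time_cnv (propag b false (norm3 xi)) (fun s => quad false Y (s, xi)) t +
   time_cnv (propag b true (norm3 xi)) (fun s => quad true Y (s, xi)) t).
Proof. by move=> t0; rewrite Yfix. Qed.

Lemma Y_le b t s xi : 0 <= s <= t -> nc (Y b (s, xi)) <= 4 * E + 4 * B * t.
Proof.
exact: (@duhamel_le R (norm3 xi) B E (fun c s => quad c Y (s, xi)) (fun c => z0 c xi)
  (fun c s => Y c (s, xi)) (norm3_ge0 xi) B0 (mNL^~ xi) (fun c s => @quad_le c s xi)
  (fun c => zE c xi) (Yfix' xi) b t s).
Qed.

Definition rhs b (z : T1 * R3 R) : R[i] :=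
  symbol b false (norm3 z.2) * Y false z + symbol b true (norm3 z.2) * Y true z + quad b Y z.

Lemma rhs_le b t s xi : 0 <= s <= t ->
  nc (rhs b (s, xi)) <= 2 * ((1 + norm3 xi) * (4 * E + 4 * B * t)) + B.
Proof.
move=> st; have /andP[s0 _] := st; have k0 := norm3_ge0 xi.
have h c : nc (symbol b c (norm3 xi) * Y c (s, xi)) <= (1 + norm3 xi) * (4 * E + 4 * B * t).
  by apply: mulr_bound; [exact: symbol_le|exact: Y_le].
apply: le_trans (ncD _ _) _; apply: lerD; last exact: quad_le.
apply: le_trans (ncD _ _) _; rewrite mulrDl mul1r; apply: lerD; exact: h.
Qed.

Lemma cmeas_rhs b : cmeas (rhs b).
Proof.
have mn : measurable_fun setT (fun z : T1 * R3 R => norm3 z.2).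
  by apply: measurable_norm3; exact: measurable_snd.
have h c : cmeas (fun z => symbol b c (norm3 z.2) * Y c z).
  exact: cmeasM (cmeas_symbol b c mn) (mY c).
exact: cmeasD (cmeasD (h false) (h true)) (mNLj b).
Qed.

Lemma rhs_cint b t xi : cint leb1 (fun s => itv_ind t s * rhs b (s, xi)).
Proof.
exact: (itv_ind_cint (cmeas_slice xi (cmeas_rhs b)) (fun s => @rhs_le b t s xi)).
Qed.

Lemma Y_int b t xi : 0 <= t -> Y b (t, xi) = z0 b xi + primitive (fun s => rhs b (s, xi)) t.
Proof.
move=> t0; have iY c : cint leb1 (fun s => itv_ind t s * Y c (s, xi)).
  exact: (itv_ind_cint (cmeas_slice xi (mY c)) (fun s => @Y_le c t s xi)).
have iN c : cint leb1 (fun s => itv_ind t s * quad c Y (s, xi)).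
  by apply: (itv_ind_cint (M := B) (mNL c xi)) => s /andP[s0 _]; exact: quad_le.
have D := @duhamel_int R (norm3 xi) B (fun c s => quad c Y (s, xi)) (fun c => z0 c xi)
  (fun c s => Y c (s, xi)) (norm3_ge0 xi) B0 (mNL^~ xi) (fun c s => @quad_le c s xi)
  (Yfix' xi) b t t0.
apply: (etrans D); congr (_ + _).
rewrite /primitive -(ICZ (symbol b false (norm3 xi)) (iY false)) -(ICZ (symbol b true (norm3 xi)) (iY true)).
rewrite -(ICD (cintZ _ (iY false)) (cintZ _ (iY true))).
rewrite -(ICD (cintD (cintZ _ (iY false)) (cintZ _ (iY true))) (iN b)).
by apply: eq_IC => s; rewrite /rhs /= !mulrDr; congr (_ + _ + _); rewrite mulrCA.
Qed.

(** The Lipschitz constant grows with |xi|: this gives continuity at each frequency, not uniformly,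
    which is why a dominating function is also needed. *)
Lemma Y_lip b T xi s t : 0 <= s <= T -> 0 <= t <= T ->
  nc (Y b (s, xi) - Y b (t, xi)) <=
  (2 * ((1 + norm3 xi) * (4 * E + 4 * B * T)) + B) * `|s - t|.
Proof.
set M := 2 * _ + B => hs ht; have /andP[s0 sT] := hs; have /andP[t0 tT] := ht.
have M0 : 0 <= M by apply: le_trans (rhs_le true xi hs); exact: nc_ge0.
have key (a r : R) : 0 <= a -> a <= r -> r <= T -> nc (Y b (r, xi) - Y b (a, xi)) <= M * (r - a).
  move=> a0 ac cT; rewrite !Y_int ?(le_trans a0 ac)// opprD addrACA subrr add0r.
  exact: (primitive_lip (cmeas_slice xi (cmeas_rhs b)) M0 (fun r => @rhs_le b T r xi)).
case: (leP s t) => h; last by rewrite (gtr0_norm (_ : 0 < s - t)) ?subr_gt0// key// ltW.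
by rewrite nc_distC ler0_norm ?subr_le0// opprB key.
Qed.

(* A dominating function in H^N, uniform over [0, T]. *)
Definition dom T c xi : R[i] :=
  IC leb1 (fun s => (\1_(`[0, T]%classic) s * (2 * nc (quad c Y (s, xi))))%:C).

Let mdom T c : cmeas (fun z : T1 * R3 R => (\1_(`[0, T]%classic) z.1 * (2 * nc (quad c Y z)))%:C).
Proof.
apply: cmeas_real; apply: measurable_funM.
  apply: (measurableT_comp (f := fun s : T1 => \1_(`[0, T]%classic) s : R)).
    by apply: measurable_indic; exact: measurable_itv.
  exact: measurable_fst.
by apply: measurable_funM; [exact: measurable_cst|exact: cmeas_nc].
Qed.

Let dom_cint T c xi : 0 <= T ->
  cint leb1 (fun s => (\1_(`[0, T]%classic) s * (2 * nc (quad c Y (s, xi))))%:C).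
Proof.
move=> T0; have B2 : 0 <= 2 * B by rewrite mulr_ge0.
apply: (cint_dom (h := fun s : T1 => 2 * B * \1_(`[0, T]%classic) s) (cmeas_slice xi (mdom T c))).
- apply: measurable_funM; first exact: measurable_cst.
  by apply: measurable_indic; exact: measurable_itv.
- by rewrite (int_cst_itv T0 B2) ltry.
- move=> s; rewrite -[(s, xi).1]/s ind_itv; have [/andP[s0 _]|_] := boolP (0 <= s <= T).
    by rewrite mul1r mulr1 nc_real_ge0 ?mulr_ge0 ?nc_ge0// ler_wpM2l// quad_le.
  by rewrite mul0r mulr0 nc0.
Qed.

Lemma dom_HB T c : 0 <= T -> HB N (dom T c) (2 * B * T).
Proof.
move=> T0; have B2 : 0 <= 2 * B by rewrite mulr_ge0.
pose H (p : T1 * R3 R) : R[i] := (w N p.2)%:C * (\1_(`[0, T]%classic) p.1 * (2 * nc (quad c Y p)))%:C.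
have mH : cmeas H.
  apply: cmeasM (mdom T c); apply: cmeas_real.
  exact: (measurableT_comp (measurable_w N) measurable_snd).
pose n s := 2 * B * \1_(`[0%R, T]%classic) s.
have mn : measurable_fun setT (n : T1 -> R).
  apply: measurable_funM; first exact: measurable_cst.
  by apply: measurable_indic; exact: measurable_itv.
have Hn s : L2b leb (fun xi => H (s, xi)) (n s).
  rewrite /H /n /= ind_itv; have [/andP[s0 _]|_] := boolP (0 <= s <= T).
    have := HBZ 2%:C (quad_HB c s0); rewrite nc_real_ge0 // mulr1 => h.
    have : HB N (fun xi => (2 * nc (quad c Y (s, xi)))%:C) (2 * B).
      apply: (HB_dom h).
        apply: cmeas_real; apply: measurable_funM; first exact: measurable_cst.
        by apply: cmeas_nc; exact: cmeas_pair2 s (mNLj c).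
      by move=> xi; rewrite ncM !nc_real_ge0 ?mulr_ge0 ?nc_ge0.
    by congr L2b; apply/funext => xi; rewrite mul1r.
  rewrite mulr0; have := @L2b0 _ _ _ leb; congr L2b; apply/funext => xi.
  by rewrite mul0r mulr0.
have c0 : (\int[leb1]_s (n s)%:E <= (2 * B * T)%:E)%E by rewrite (int_cst_itv T0 B2).
have [_ M] := minkowski_int mH mn Hn c0.
move: M; congr L2b; apply/funext => xi.
by rewrite /H /= ICZ//; exact: dom_cint.
Qed.

Definition domY T xi : R[i] := (2 * nc (z0 false xi) + 2 * nc (z0 true xi) +
  (nc (dom T false xi) + nc (dom T true xi)))%:C.

Lemma Y_domY b T s xi : 0 <= s <= T -> nc (Y b (s, xi)) <= nc (domY T xi).
Proof.
move=> /andP[s0 sT]; have T0 := le_trans s0 sT.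
have k0 := norm3_ge0 xi.
have h1 c : nc (propag b c (norm3 xi) s * z0 c xi) <= 2 * nc (z0 c xi).
  by rewrite ncM ler_wpM2r ?nc_ge0// propag_le2.
have h2 c : nc (time_cnv (propag b c (norm3 xi)) (fun s => quad c Y (s, xi)) s) <= nc (dom T c xi).
  have [mt _] := duhamel1_cint b c s xi fN.
  apply: (IC_mono mt (dom_cint c xi T0)) => r.
  rewrite itcE ind_itv; case: ifP => [/andP[r0 rs]|_]; last first.
    by rewrite mul0r nc0 !mulr_ge0 ?nc_ge0.
  rewrite r0 (le_trans rs sT) !mul1r ncM ler_wpM2r ?nc_ge0// propag_le2 ?subr_ge0//.
rewrite nc_real_ge0 ?addr_ge0 ?mulr_ge0 ?nc_ge0// Yfix'//.
apply: le_trans (ncD _ _) _; apply: lerD; apply: le_trans (ncD _ _) _; exact: lerD.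
Qed.

Lemma domY_HB T : 0 <= T -> exists a, HB N (domY T) a.
Proof.
move=> T0.
have key (f : R3 R -> R[i]) a : HB N f a -> HB N (fun xi => (nc (f xi))%:C) a.
  move=> fa; apply: (HB_dom fa); first by apply: cmeas_real; apply: cmeas_nc; exact: HB_cmeas fa.
  by move=> xi; rewrite nc_real_ge0 ?nc_ge0.
have D := HBD (HBD (HBZ 2%:C (key _ _ (zN false))) (HBZ 2%:C (key _ _ (zN true))))
  (HBD (key _ _ (dom_HB false T0)) (key _ _ (dom_HB true T0))).
eexists; move: D; congr (HB _ _ _); apply/funext => xi.
by rewrite /domY -!rcM -!rcD.
Qed.

(** Continuity at each frequency ([Y_lip]) and domination in H^N ([domY]) on [0, t + 1]. Dominated
    convergence is about sequences, so a failure is assumed and a sequence of bad times tending to t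
    is extracted. *)
Lemma Y_cont b t e : 0 <= t -> 0 < e -> exists2 d, 0 < d & forall s, 0 <= s ->
  `|s - t| < d -> HB N (fun xi => Y b (s, xi) - Y b (t, xi)) e.
Proof.
move=> t0 e0; apply: contrapT => nd.
have ex n : exists s, [/\ 0 <= s, `|s - t| < n.+1%:R^-1 &
    ~ HB N (fun xi => Y b (s, xi) - Y b (t, xi)) e].
  apply: contrapT => ns; apply: nd; exists (n.+1%:R^-1); first by rewrite invr_gt0.
  by move=> s s0 sd; apply: contrapT => nH; apply: ns; exists s.
have [f fP] := choice ex.
have fT n : 0 <= f n <= t + 1.
  have [-> h _] := fP n; rewrite /= -lerBlDl (le_trans (ler_norm _))// (le_trans (ltW h))//.
  by rewrite invf_le1// ler1n.
have tT : 0 <= t <= t + 1 by rewrite t0 lerDl ler01.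
have [a Ha] := domY_HB (addr_ge0 t0 ler01).
have mw s : cmeas (fun xi => (w N xi)%:C * Y b (s, xi)).
  by apply: cmeas_wM; exact: cmeas_pair2 s (mY b).
have [K _ hK] : \forall n \near \oo, L2b leb (fun xi =>
    (w N xi)%:C * Y b (f n, xi) - (w N xi)%:C * Y b (t, xi)) e.
  apply: (L2_dct (fun n => mw (f n)) (mw t) Ha _ _ e0) => [|n xi]; last first.
    by rewrite !ncM ler_wpM2l ?nc_ge0// Y_domY.
  apply: aeW => xi; set M := 2 * ((1 + norm3 xi) * (4 * E + 4 * B * (t + 1))) + B.
  apply: (@ccvg_le _ _ _ (fun n => (nc (w N xi)%:C * M) * n.+1%:R^-1)).
    move=> n; rewrite -mulrBr ncM -mulrA ler_wpM2l ?nc_ge0//.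
    apply: le_trans (Y_lip b xi (fT n) tT) _; have [_ h _] := fP n.
    rewrite -/M ler_wpM2l ?(ltW h)//.
    by apply: le_trans (rhs_le true xi tT); exact: nc_ge0.
  rewrite -[X in _ --> X](mulr0 (nc (w N xi)%:C * M)); apply: cvgMr.
  exact: cvg_harmonic.
have [_ _] := fP K; apply; have := hK K (leqnn K).
by congr L2b; apply/funext => xi; rewrite mulrBr.
Qed.

End Regularity.

Lemma cintB {R : realType} d (T : measurableType d) (mu : {measure set T -> \bar R})
  (f g : T -> R[i]) : cint mu f -> cint mu g -> cint mu (fun x => f x - g x).
Proof. by move=> fi gi; exact: cintD fi (cintN gi). Qed.

Section Derivative.
Context {R : realType}.
Notation leb := (@leb3 R).
Notation leb1 := (@lebesgue_measure R).
Notation T1 := (measurableTypeR R).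
Implicit Types (b c : bool) (s t h e : R) (xi : R3 R).

Lemma primitive_one t : 0 <= t -> primitive (fun=> 1 : R[i]) t = t%:C.
Proof.
move=> t0; have := @primitive_FTC R id (fun=> 1) 1 t (fun s => is_derive_id s 1) (@cont_cst R 1) _ t0.
rewrite subr0 => <-//; by move=> s _; rewrite normr1.
Qed.

Lemma HB_symbol b c N (f : R3 R -> R[i]) (a : R) : HB N f a ->
  HB (N - 1) (fun xi => symbol b c (norm3 xi) * f xi) (2 * a).
Proof.
move=> fa; have mf := HB_cmeas fa.
have := L2bZ 2%:C fa; rewrite nc_real_ge0// => L.
have ma : cmeas (fun xi : R3 R => symbol b c (norm3 xi)).
  by apply: cmeas_symbol; exact: (measurable_norm3 (p := id)).
apply: (L2b_dom L); first exact: cmeas_wM (cmeasM ma mf).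
move=> xi; rewrite !ncM !nc_real_ge0 ?w_ge0// mulrA (mulrA 2) ler_wpM2r ?nc_ge0//.
have k0 := norm3_ge0 xi; have w0 := w_ge0 (N - 1) xi.
apply: (@le_trans _ _ (w (N - 1) xi * (1 + norm3 xi))).
  by rewrite ler_wpM2l// symbol_le.
have h1 := w_pred N xi; have h2 : w (N - 1) xi <= w N xi by apply: w_le; rewrite gerBl.
by rewrite mulrDr mulr1 [leRHS]mulrDl mul1r lerD// mulrC.
Qed.

Variables (al be ga : bool -> R[i]) (N : R).
Hypothesis N2 : 2 <= N.
Notation quad b Z := (quad al be ga b Z).
Notation bC := (bC al be ga N).
Notation rhs := (rhs al be ga).
Variables (E m : R) (z0 : bool -> R3 R -> R[i]) (Y : bool -> T1 * R3 R -> R[i]).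
Hypothesis zE : forall c xi, nc (z0 c xi) <= E.
Hypothesis zN : forall c, HB N (z0 c) E.
Hypothesis Yd : decaying N m Y.
Hypothesis Yfix : forall b t xi, 0 <= t ->
  Y b (t, xi) = linear_flow b z0 (t, xi) + duhamel b (fun c => quad c Y) (t, xi).

Let N0 : 0 <= N. Proof. exact: le_trans (ler0n R 2) N2. Qed.
Let m0 : 0 <= m. Proof. by case: Yd. Qed.
Let mY c : cmeas (Y c). Proof. by case: Yd. Qed.
Let b0 : 0 <= bC. Proof. exact: bC_ge0. Qed.
Let mDY c : cmeas (rhs Y c). Proof. exact: cmeas_rhs Yd c. Qed.

Lemma quad_cont b t e : 0 <= t -> 0 < e -> exists2 d, 0 < d & forall s, 0 <= s ->
  `|s - t| < d -> (forall c, HB N (fun xi => Y c (s, xi) - Y c (t, xi)) e) /\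
    HB N (fun xi => quad b Y (s, xi) - quad b Y (t, xi)) e.
Proof.
move=> t0 e0; pose K := 2 * bC * m + 1.
have bm : 0 <= 2 * bC * m by exact: mulr_ge0 (mulr_ge0 (ler0n R 2) b0) m0.
have K1 : 1 <= K by rewrite lerDr.
have K0 : 0 < K := lt_le_trans ltr01 K1.
have eK : 0 < e / K by rewrite divr_gt0.
have eKe : e / K <= e by rewrite ler_pdivrMr// ler_peMr// ltW.
have [d1 d10 h1] := Y_cont N2 zE zN Yd Yfix false t0 eK.
have [d2 d20 h2] := Y_cont N2 zE zN Yd Yfix true t0 eK.
exists (Num.min d1 d2); first by rewrite lt_min d10.
move=> s s0; rewrite lt_min => /andP[sd1 sd2].
have hh c : HB N (fun xi => Y c (s, xi) - Y c (t, xi)) (e / K).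
  by case: c; [exact: h2|exact: h1].
split; first by move=> c; exact: HB_le (hh c) eKe.
have Ys c := Y_HB Yd c s0; have Yt c := Y_HB Yd c t0.
have := HBD (Bil_HB al be ga b N2 hh Ys) (Bil_HB al be ga b N2 Yt hh).
rewrite (_ : bC * _ + bC * _ = 2 * bC * m * (e / K)); last by ring.
move=> H; have {H} := HB_le H (_ : _ <= e).
rewrite (_ : (fun x => _) = fun xi => quad b Y (s, xi) - quad b Y (t, xi)); last first.
  apply/funext => xi; apply/esym.
  exact: (Bil_sub al be ga b xi (fun c => HB_L2 N0 (Ys c)) (fun c => HB_L2 N0 (Yt c))).
apply; rewrite mulrA ler_pdivrMr// (mulrC _ e) ler_wpM2l ?(ltW e0)//.
by rewrite lerDl.
Qed.

Lemma rhs_HB b t : 0 <= t -> HB (N - 1) (fun xi => rhs Y b (t, xi)) (4 * m + nlB al be ga N m).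
Proof.
move=> t0.
have := HBD (HBD (HB_symbol b false (Y_HB Yd false t0)) (HB_symbol b true (Y_HB Yd true t0)))
  (HB_mono (_ : N - 1 <= N) (quad_HB al be ga N2 Yd b t0)).
rewrite (_ : 2 * m + 2 * m = 4 * m); last by ring.
by apply; rewrite gerBl.
Qed.

Lemma rhs_cont b t e : 0 <= t -> 0 < e -> exists2 d, 0 < d & forall s, 0 <= s ->
  `|s - t| < d -> HB (N - 1) (fun xi => rhs Y b (s, xi) - rhs Y b (t, xi)) e.
Proof.
move=> t0 e0; have e5 : 0 < e / 5 by rewrite divr_gt0.
have [d d0 hd] := quad_cont b t0 e5.
exists d => // s s0 sd; have [hY hN] := hd s s0 sd.
have NN : N - 1 <= N by rewrite gerBl.
have := HBD (HBD (HB_symbol b false (hY false)) (HB_symbol b true (hY true))) (HB_mono NN hN).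
rewrite (_ : 2 * (e / 5) + 2 * (e / 5) + e / 5 = e); last by field.
congr (HB _ _ _); apply/funext => xi; rewrite /rhs /=.
move: (quad b Y _) (quad b Y _) => n1 n2; ring.
Qed.

(** By [Y_int] the error of the difference quotient is the average of [rhs] at s minus [rhs] at t,
    for s between t and t + h. Minkowski's integral inequality and the continuity of [rhs] in
    H^(N-1) make it small. *)
Lemma rhs_deriv b t e : 0 <= t -> 0 < e -> exists2 d, 0 < d & forall h, h != 0 ->
  0 <= t + h -> `|h| < d ->
  HB (N - 1) (fun xi => (h^-1)%:C * (Y b (t + h, xi) - Y b (t, xi)) - rhs Y b (t, xi)) e.
Proof.
move=> t0 e0; have [d d0 hd] := rhs_cont b t0 e0.
exists d => // h h0 th hdlt.
pose a := Num.min t (t + h); pose c := Num.max t (t + h).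
have ac : a <= c by rewrite /a /c le_max ge_min lexx.
have a0 : 0 <= a by rewrite /a le_min t0.
have ca : c - a = `|h|.
  rewrite /a /c; have [h1|h1] := leP 0 h.
    rewrite max_r ?min_l ?lerDl// ger0_norm//; ring.
  rewrite max_l ?min_r ?gerDl ?(ltW h1)// ltr0_norm//; ring.
(* The averaging kernel, written so that one formula covers both signs of h; its modulus is at most
   1/|h| on [a, c] and zero elsewhere. *)
pose kap s : R[i] := (h^-1)%:C * (itv_ind (t + h) s - itv_ind t s).
have kap_le s : nc (kap s) <= `|h|^-1 * \1_(`[a, c]%classic) s.
  rewrite /kap ncM nc_real normfV ler_wpM2l ?invr_ge0//.
  have n1 : nc (1 : R[i]) <= 1 by rewrite ComplexField.Normc.normc1.
  have [h1|h1] := leP 0 h.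
    have := itcB_le (r := s) (z := 1) t0 (_ : t <= t + h) (fun _ => n1).
    rewrite mulr1 mul1r /a /c max_r ?min_l ?lerDl//; exact.
  have := itcB_le (r := s) (z := 1) th (_ : t + h <= t) (fun _ => n1).
  rewrite mulr1 mul1r nc_distC /a /c max_l ?min_r ?gerDl ?(ltW h1)//; exact.
have mkap : cmeas (kap : T1 -> R[i]).
  apply: cmeasM; first exact: cmeas_cst.
  have mi x : cmeas (fun s : T1 => itv_ind x s).
    exact: cmeas_itv_ind (measurable_cst x) (@measurable_id _ T1 setT).
  exact: cmeasB (mi _) (mi _).
pose H (p : T1 * R3 R) : R[i] := (w (N - 1) p.2)%:C * (kap p.1 * (rhs Y b p - rhs Y b (t, p.2))).
have m1 : measurable_fun setT (fun p : T1 * R3 R => p.1) by exact: measurable_fst.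
have m2 : measurable_fun setT (fun p : T1 * R3 R => p.2) by exact: measurable_snd.
have mH : cmeas H.
  apply: cmeasM; first by apply: cmeas_real; exact: (measurableT_comp (measurable_w _) m2).
  apply: cmeasM; first exact: cmeas_comp m1 mkap.
  apply: cmeasB; first exact: mDY.
  exact: (cmeas_comp m2 (cmeas_pair2 t (mDY b))).
pose n s := e * `|h|^-1 * \1_(`[a, c]%classic) s.
have mn : measurable_fun setT (n : T1 -> R).
  apply: measurable_funM; first exact: measurable_cst.
  by apply: measurable_indic; exact: measurable_itv.
have Hn s : L2b leb (fun xi => H (s, xi)) (n s).
  have [sac|sac] := boolP (a <= s <= c); last first.
    have kz : kap s = 0.
      by apply: nc_eq0; apply/eqP; rewrite eq_le nc_ge0 andbT (le_trans (kap_le s))// ind_itv (negbTE sac) mulr0.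
    rewrite /n ind_itv (negbTE sac) mulr0; have := @L2b0 _ _ _ leb; congr L2b.
    by apply/funext => xi; rewrite /H /= kz mul0r mulr0.
  have /andP[as_ sc] := sac; have s0 := le_trans a0 as_.
  have sd : `|s - t| < d.
    apply: le_lt_trans hdlt; rewrite -ca.
    have ta : a <= t by rewrite /a ge_min lexx.
    have tc : t <= c by rewrite /c le_max lexx.
    rewrite ler_norml; apply/andP; split; lra.
  have := HBZ (kap s) (hd s s0 sd) => L; apply: (L2b_le L).
  by rewrite /n -mulrA (mulrC e) ler_wpM2r ?(ltW e0)// kap_le.
have C : (\int[leb1]_s (n s)%:E <= e%:E)%E.
  rewrite (int_cst_itv2 ac); last by rewrite mulr_ge0 ?(ltW e0)// invr_ge0.
  by rewrite ca mulfVK ?normr_eq0.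
have [_ M] := minkowski_int mH mn Hn C.
move: M; congr L2b; apply/funext => xi.
have iD x : cint leb1 (fun s => itv_ind x s * rhs Y b (s, xi)).
  exact: (rhs_cint N2 zE Yd Yfix b x xi).
have i1 x : cint leb1 (fun s => itv_ind x s * (1 : R[i])).
  by apply: (itv_ind_cint (M := 1)) => [|s _]; [exact: cmeas_cst|rewrite ComplexField.Normc.normc1].
have Ek : IC leb1 (fun s => H (s, xi)) = (w (N - 1) xi)%:C * ((h^-1)%:C *
    ((primitive (fun s => rhs Y b (s, xi)) (t + h) - primitive (fun s => rhs Y b (s, xi)) t) -
     rhs Y b (t, xi) * (primitive (fun=> 1) (t + h) - primitive (fun=> 1) t))).
  rewrite /primitive -(ICB (iD (t + h)) (iD t)) -(ICB (i1 (t + h)) (i1 t)).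
  have iA := cintB (iD (t + h)) (iD t); have iB := cintZ (rhs Y b (t, xi)) (cintB (i1 (t + h)) (i1 t)).
  rewrite -(ICZ _ (cintB (i1 (t + h)) (i1 t))) -(ICB iA iB).
  rewrite -(ICZ _ (cintB iA iB)) -(ICZ _ (cintZ _ (cintB iA iB))).
  apply: eq_IC => s; rewrite /H /kap /=.
  move: (rhs Y b (s, xi)) (rhs Y b (t, xi)) => d1 d2; ring.
rewrite Ek !primitive_one// (Y_int N2 zE Yd Yfix b xi t0) (Y_int N2 zE Yd Yfix b xi th).
rewrite -rcB (_ : t + h - t = h); last by ring.
have hh : (h^-1)%:C * h%:C = 1 :> R[i] by rewrite -rcM mulVf.
congr (_ * _); rewrite mulrBr; congr (_ - _); first by congr (_ * _); ring.
by rewrite mulrCA hh mulr1.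
Qed.

End Derivative.

(** * From weighted transforms back to Sobolev spaces *)

Section SobolevBridge.
Context {R : realType}.
Notation leb := (@leb3 R).
Implicit Types (f g : R3 R -> R[i]) (W dW : R -> R3 R -> R[i]) (s t h e a : R).

Lemma near_distP t (P : R -> Prop) :
  (\forall s \near t, P s) <-> exists2 d, 0 < d & forall s, `|s - t| < d -> P s.
Proof.
split=> [/nbhs_ballP[d /= d0 hd]|[d d0 hd]].
  by exists d => // s sd; apply: hd; rewrite /ball/= distrC.
by apply/nbhs_ballP; exists d => //= s; rewrite /ball/= distrC; exact: hd.
Qed.

Lemma near0P (P : R -> Prop) :
  (\forall h \near 0^', P h) <-> exists2 d, 0 < d & forall h, h != 0 -> `|h| < d -> P h.
Proof.
split=> [|[d d0 hd]]; rewrite /dnbhs near_withinE.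
  move=> /near_distP[d d0 hd]; exists d => // h h0 hlt.
  by apply: hd => //; rewrite subr0.
apply/near_distP; exists d => // h; rewrite subr0 => hlt h0; exact: hd.
Qed.

Lemma sob_le N f a b : L2b leb f b -> 0 <= a ->
  (sobolev_norm N f <= a%:E)%E <-> HB N (fourier f) a.
Proof.
by move=> fb a0; apply: LnormC2_le => //; apply: cmeas_wM; exact: L2b_cmeas (F_norm fb).
Qed.

Lemma sob_ge0 N f : (0 <= sobolev_norm N f)%E.
Proof. exact: LnormC2_ge0. Qed.

Lemma in_sobolevP N f : in_sobolev N f <-> (exists b, L2b leb f b) /\
  exists a, HB N (fourier f) a.
Proof.
split=> [[/in_L2P[b fb] foo]|[[b fb] [a fa]]].
  have ff : (sobolev_norm N f \is a fin_num)%E by rewrite ge0_fin_numE ?sob_ge0.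
  split; first by exists b.
  exists (fine (sobolev_norm N f)); apply/(sob_le N fb); first by rewrite fine_ge0 ?sob_ge0.
  by rewrite fineK.
split; first by apply/in_L2P; exists b.
by apply: le_lt_trans (ltry a); apply/(sob_le N fb) => //; exact: HB_ge0 fa.
Qed.

Lemma HB_F_invFT N f a : 0 <= N -> HB N f a -> HB N (fourier (invFT f)) a.
Proof.
move=> N0 fa; have f2 := HB_L2 N0 fa.
apply: (HB_ae fa); first exact: L2b_cmeas (F_norm (invFT_norm f2)).
by apply: filterS (F_invFT f2) => x ->.
Qed.

Lemma in_sobolev_invFT N f a : 0 <= N -> HB N f a -> in_sobolev N (invFT f).
Proof.
move=> N0 fa; apply/in_sobolevP; split; last by exists a; exact: HB_F_invFT.
by eexists; exact: invFT_norm (HB_L2 N0 fa).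
Qed.

Lemma cont_sob s W : 0 <= s -> (forall t, 0 <= t -> exists a, HB s (W t) a) ->
  (forall t e, 0 <= t -> 0 < e -> exists2 d, 0 < d & forall r, 0 <= r -> `|r - t| < d ->
    HB s (fun xi => W r xi - W t xi) e) ->
  continuous_in_sobolev s (fun t => invFT (W t)).
Proof.
move=> s0 WB Wc t t0; have [a Wa] := WB t t0; have at2 := invFT_norm (HB_L2 s0 Wa).
split; first exact: in_sobolev_invFT Wa.
have L r : 0 <= r -> exists b, L2b leb (invFT (W r) \- invFT (W t)) b.
  move=> r0; have [b Wb] := WB r r0.
  by eexists; exact: L2bB (invFT_norm (HB_L2 s0 Wb)) at2.
apply/(LnormC2_cvg0 _ (h := fun r xi => (w s xi)%:C * fourier (invFT (W r) \- invFT (W t)) xi)).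
  rewrite near_withinE; apply: nearW => r r0; have [b Lb] := L r r0.
  by apply: cmeas_wM; exact: L2b_cmeas (F_norm Lb).
move=> e e0; rewrite near_withinE; apply/near_distP; have [d d0 hd] := Wc t e t0 e0.
exists d => // r rd r0; have [b Lb] := L r r0; have [c Wc'] := WB r r0.
apply: (HB_ae (hd r r0 rd)); first exact: L2b_cmeas (F_norm Lb).
have rc := HB_L2 s0 Wc'.
apply: filterS (filterI (filterI (F_invFT rc) (F_invFT (HB_L2 s0 Wa))) (F_B (invFT_norm rc) at2)).
by move=> x [[<- <-] E]; rewrite -[X in nc X <= _]/(fourier (fun x => invFT (W r) x - invFT (W t) x) x) E.
Qed.

Lemma deriv_sob s W dW : 0 <= s -> (forall t, 0 <= t -> exists a, HB s (W t) a) ->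
  (forall t, 0 <= t -> exists a, HB s (dW t) a) ->
  (forall t e, 0 <= t -> 0 < e -> exists2 d, 0 < d & forall h, h != 0 -> 0 <= t + h ->
    `|h| < d -> HB s (fun xi => (h^-1)%:C * (W (t + h) xi - W t xi) - dW t xi) e) ->
  derivative_in_sobolev s (fun t => invFT (W t)) (fun t => invFT (dW t)).
Proof.
move=> s0 WB dWB Wd t t0; have [a Wa] := WB t t0; have [c dWc] := dWB t t0.
have at2 := invFT_norm (HB_L2 s0 Wa); have ct2 := invFT_norm (HB_L2 s0 dWc).
pose q h x := (h^-1)%:C * (invFT (W (t + h)) x - invFT (W t) x) - invFT (dW t) x.
have L h : 0 <= t + h -> exists b, L2b leb (q h) b.
  move=> h0; have [b Wb] := WB _ h0.
  by eexists; exact: L2bB (L2bZ _ (L2bB (invFT_norm (HB_L2 s0 Wb)) at2)) ct2.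
apply/(LnormC2_cvg0 _ (h := fun h xi => (w s xi)%:C * fourier (q h) xi)).
  rewrite near_withinE; apply/near0P; exists 1 => // h _ _ h0; have [b Lb] := L h h0.
  by apply: cmeas_wM; exact: L2b_cmeas (F_norm Lb).
move=> e e0; rewrite near_withinE; apply/near0P; have [d d0 hd] := Wd t e t0 e0.
exists d => // h hn hlt h0; have [b Lb] := L h h0; have [r Wr] := WB _ h0.
apply: (HB_ae (hd h hn h0 hlt)); first exact: L2b_cmeas (F_norm Lb).
have rr := invFT_norm (HB_L2 s0 Wr).
have F1 := F_B (L2bZ (h^-1)%:C (L2bB rr at2)) ct2.
have F2 := F_Z (h^-1)%:C (L2bB rr at2).
have F3 := F_B rr at2.
apply: filterS (filterI (filterI (F_invFT (HB_L2 s0 Wr)) (F_invFT (HB_L2 s0 Wa)))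
  (filterI (F_invFT (HB_L2 s0 dWc)) (filterI F1 (filterI F2 F3)))).
by move=> x [[<- <-] [<- [E1 [E2 E3]]]]; rewrite E1 E2 E3.
Qed.

Lemma fourier_prod N f g a b p q : 2 <= N -> L2b leb f p -> L2b leb g q ->
  HB N (fourier f) a -> HB N (fourier g) b ->
  (exists r, L2b leb (f \* g) r) /\
  {ae leb, forall xi, fourier (f \* g) xi = (K3^-1)%:C * cnv (fourier f) (fourier g) xi}.
Proof.
move=> N2 fp gq fa gb; have N0 := le_trans (ler0n R 2) N2.
apply: (F_mul fp gq (L1b_cint (HB_L1 N2 fa)) (L1b_cint (HB_L1 N2 gb)) (HB_L2 N0 fa) (HB_L2 N0 gb));
  exact: aeW.
Qed.

Definition coef2 (x y : R[i]) (b : bool) : R[i] := if b then y else x.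

Lemma fourier_quadratic_Bil (au bu cu av bv cv : R[i]) (b : bool) N (F : bool -> R3 R -> R[i])
    (p : bool -> R) (a : bool -> R) : 2 <= N ->
  (forall c, L2b leb (F c) (p c)) -> (forall c, HB N (fourier (F c)) (a c)) ->
  {ae leb, forall xi, fourier_quadratic (coef2 au av b) (coef2 bu bv b) (coef2 cu cv b) (F false) (F true) xi =
    Bil (coef2 au av) (coef2 bu bv) (coef2 cu cv) b (fun c => fourier (F c)) (fun c => fourier (F c)) xi}.
Proof.
move=> N2 Fp Fa.
have h c d := (fourier_prod N2 (Fp c) (Fp d) (Fa c) (Fa d)).2.
apply: filterS (filterI (filterI (h false false) (h true true)) (h false true)) => x [[E1 E2] E3].
have alg (k a1 a2 a3 x1 x2 x3 : R[i]) :
  a1 * (k * x1) + a2 * (k * x2) + a3 * (k * x3) = k * (a1 * x1 + a2 * x2 + a3 * x3) by ring.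
by rewrite /fourier_quadratic /Bil E1 E2 E3; exact: alg.
Qed.

End SobolevBridge.

(** * Existence and decay *)

Section Existence.
Context {R : realType}.
Notation leb := (@leb3 R).
Notation T1 := (measurableTypeR R).
Variables (au bu cu av bv cv : R[i]) (N E : R) (u0 v0 : R3 R -> R[i]).
Let al := coef2 au av.
Let be := coef2 bu bv.
Let ga := coef2 cu cv.
Hypothesis N2 : 2 <= N.
Hypotheses (E0 : 0 <= E) (small : 16 * dC N * bC al be ga N * (4 * sC N * E) <= 1).
Hypotheses (u0N : in_sobolev N u0) (v0N : in_sobolev N v0).
Hypothesis u0E : (LnormC 1%:E u0 <= E%:E)%E.
Hypothesis v0E : (LnormC 1%:E v0 <= E%:E)%E.
Hypothesis u0S : (sobolev_norm N u0 <= E%:E)%E.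
Hypothesis v0S : (sobolev_norm N v0 <= E%:E)%E.

Let N0 : 0 <= N. Proof. exact: le_trans (ler0n R 2) N2. Qed.
Let N1 : 0 <= N - 1. Proof. by have := N2; lra. Qed.

Let ini (b : bool) := if b then v0 else u0.
(** The Fourier integral is taken rather than [fourier], so that the L^1 norm bounds the data at
    every frequency and not merely at almost every one. *)
Let z0 b := FI (ini b).

Let ini2 b : exists a, L2b leb (ini b) a.
Proof. by case: b; [case/in_sobolevP: v0N|case/in_sobolevP: u0N]. Qed.

Let iniL1 b : L1b leb (ini b) E.
Proof.
have [a ia] := ini2 b; split; first by case: ia.
have : (LnormC 1%:E (ini b) <= E%:E)%E by case: b ia.
rewrite /LnormC Lnorm1; apply: le_trans.
rewrite le_eqVlt; apply/orP; left; apply/eqP; apply: eq_integral => x _.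
by rewrite gee0_abs// lee_fin nc_ge0.
Qed.

Let F_ini b : {ae leb, forall xi, fourier (ini b) xi = z0 b xi}.
Proof. by have [a ia] := ini2 b; exact: F_L1 (L1b_cint (iniL1 b)) ia. Qed.

Let zm b : cmeas (z0 b). Proof. by apply: cmeas_FI; case: (iniL1 b). Qed.

Let zE b xi : nc (z0 b xi) <= E. Proof. exact: FI_le (iniL1 b). Qed.

Let zN b : HB N (z0 b) E.
Proof.
have [a ia] := ini2 b.
have S : (sobolev_norm N (ini b) <= E%:E)%E by case: (b); [exact: v0S|exact: u0S].
have h := (sob_le N ia E0).1 S.
by apply: (HB_ae h (zm b)); apply: filterS (F_ini b) => x ->.
Qed.

Let Y := picard_sol al be ga z0.
Let m : R := 4 * sC N * E.

Let Yb b t : 0 <= t -> HB N (fun xi => Y b (t, xi)) (m * phi t ^+ rate b).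
Proof. exact: (picard_sol_HB N2 zm zE zN erefl small). Qed.

Let m0 : 0 <= m. Proof. exact: mulr_ge0 (mulr_ge0 (ler0n R 4) (sC_ge0 N)) E0. Qed.

Let Yd : decaying N m Y.
Proof.
split; [exact: m0|exact: (cmeas_picard_sol N2 zm zE zN erefl small)|].
move=> c t t0; apply: (HB_le (Yb c t0)).
by rewrite ler_wpM2l// phi_rate_le.
Qed.

Let Yfix b t xi : 0 <= t ->
  Y b (t, xi) = linear_flow b z0 (t, xi) + duhamel b (fun c => quad al be ga c Y) (t, xi).
Proof. exact: (picard_sol_fix N2 zm zE zN erefl small). Qed.

Definition sol b t : R3 R -> R[i] := invFT (fun xi => picard_sol al be ga z0 b (t, xi)).

Let dsol b t : R3 R -> R[i] := invFT (fun xi => rhs al be ga Y b (t, xi)).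

Let Y0 b xi : Y b (0, xi) = z0 b xi.
Proof.
rewrite (Y_int N2 zE Yd Yfix b xi (lexx 0)) (_ : primitive _ 0 = 0) ?addr0//.
apply: nc_eq0; apply/eqP; rewrite eq_le nc_ge0 andbT.
have B : forall s, 0 <= s <= 0 -> nc (rhs al be ga Y b (s, xi)) <= _ :=
  fun s => @rhs_le _ al be ga N N2 E m z0 Y zE Yd Yfix b 0 s xi.
have B0 : 0 <= 2 * ((1 + norm3 xi) * (4 * E + 4 * nlB al be ga N m * 0)) + nlB al be ga N m.
  by apply: le_trans (B 0 _); rewrite ?nc_ge0// lexx.
have := primitive_bound (cmeas_slice xi (cmeas_rhs al be ga Yd b)) (lexx 0) B0 B.
by rewrite mulr0.
Qed.

Lemma sol_init b : {ae leb, forall x, sol b 0 x = ini b x}.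
Proof.
have [a ia] := ini2 b; have Y2 := HB_L2 N0 (Yb b (lexx 0)).
apply: (F_inj (invFT_norm Y2) ia).
by apply: filterS (filterI (F_invFT Y2) (F_ini b)) => x [-> ->]; rewrite Y0.
Qed.

Lemma sol_bound b t : 0 <= t -> (sobolev_norm N (sol b t) <= (m * phi t ^+ rate b)%:E)%E.
Proof.
move=> t0; have Y2 := HB_L2 N0 (Yb b t0).
apply/(sob_le N (invFT_norm Y2)); first by rewrite mulr_ge0 ?exprn_ge0 ?(ltW (phi_gt0 _)).
by apply: HB_F_invFT (Yb b t0).
Qed.

Let solc b : continuous_in_sobolev N (sol b).
Proof.
apply: (cont_sob (W := fun t xi => Y b (t, xi)) N0) => [t t0|t e t0 e0].
  by eexists; exact: Yb.
exact: (Y_cont N2 zE zN Yd Yfix b t0 e0).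
Qed.

Let NN : N - 1 <= N. Proof. by rewrite gerBl. Qed.

Let solC1 b : C1_in_sobolev (N - 1) (sol b) (dsol b).
Proof.
have YB t : 0 <= t -> exists a, HB (N - 1) (fun xi => Y b (t, xi)) a.
  by move=> t0; eexists; exact: HB_mono NN (Yb b t0).
have DB t : 0 <= t -> exists a, HB (N - 1) (fun xi => rhs al be ga Y b (t, xi)) a.
  by move=> t0; eexists; exact: (rhs_HB al be ga N2 Yd b t0).
split.
- apply: (cont_sob (W := fun t xi => Y b (t, xi)) N1 YB) => t e t0 e0.
  have [d d0 hd] := Y_cont N2 zE zN Yd Yfix b t0 e0; exists d; [exact: d0|move=> r r0 rd].
  exact: HB_mono NN (hd r r0 rd).
- apply: (cont_sob (W := fun t xi => rhs al be ga Y b (t, xi)) N1 DB) => t e t0 e0.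
  exact: (rhs_cont N2 zE zN Yd Yfix b t0 e0).
- apply: (deriv_sob (W := fun t xi => Y b (t, xi)) (dW := fun t xi => rhs al be ga Y b (t, xi)) N1 YB DB)
    => t e t0 e0.
  exact: (rhs_deriv N2 zE zN Yd Yfix b t0 e0).
Qed.

Let sys : solves_system au bu cu av bv cv (sol false) (sol true) (dsol false) (dsol true).
Proof.
move=> t t0; have Y2 c := HB_L2 N0 (Yb c t0).
have FY c := F_invFT (Y2 c).
have FD c := F_invFT (HB_L2 N1 (rhs_HB al be ga N2 Yd c t0)).
have Q b := fourier_quadratic_Bil au bu cu av bv cv b N2 (F := fun c => sol c t)
  (fun c => invFT_norm (Y2 c)) (fun c => HB_F_invFT N0 (Yb c t0)).
have BE b xi : Bil al be ga b (fun c => fourier (sol c t)) (fun c => fourier (sol c t)) xi =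
    quad al be ga b Y (t, xi).
  apply: (Bil_ext al be ga b xi (fun c => L2b_cmeas (F_norm (invFT_norm (Y2 c))))
    (fun c => L2b_cmeas (Y2 c)) FY).
apply: filterS (filterI (filterI (FY false) (FY true)) (filterI (filterI (FD false) (FD true))
  (filterI (Q false) (Q true)))) => xi [[E1 E2] [[E3 E4] [E5 E6]]].
(* The linear part of [rhs] is the opposite of the linear terms of the system, so only the quadratic
   term survives. *)
have alg1 (k p q n : R[i]) : 0 * p + - 'i%C * k * q + n + 'i%C * k * q = n by ring.
have alg2 (k p q n : R[i]) : - 'i%C * k * p + - 1 * q + n + 'i%C * k * p + q = n by ring.
have G1 : rhs al be ga Y false (t, xi) + 'i%C * (norm3 xi)%:C * Y true (t, xi) =
  quad al be ga false Y (t, xi) := alg1 _ _ _ _.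
have G2 : rhs al be ga Y true (t, xi) + 'i%C * (norm3 xi)%:C * Y false (t, xi) + Y true (t, xi) =
  quad al be ga true Y (t, xi) := alg2 _ _ _ _.
split.
  apply: (etrans (congr2 (fun x y => x + 'i%C * (norm3 xi)%:C * y) E3 E2)).
  exact: (etrans G1 (etrans (esym (BE false xi)) (esym E5))).
apply: (etrans (congr2 +%R (congr2 (fun x y => x + 'i%C * (norm3 xi)%:C * y) E4 E1) E2)).
exact: (etrans G2 (etrans (esym (BE true xi)) (esym E6))).
Qed.

Lemma sol_cauchy : cauchy_solution au bu cu av bv cv N u0 v0 (sol false) (sol true).
Proof.
split; [exact: solc|exact: solc| |].
  by apply: filterS (filterI (sol_init false) (sol_init true)) => x [-> ->].
by exists (dsol false), (dsol true); split; [exact: solC1|exact: solC1|exact: sys].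
Qed.

End Existence.

(** * Uniqueness *)

Section InnerProduct.
Context {R : realType} d (T : measurableType d) (mu : {measure set T -> \bar R}).
Implicit Types (f g k : T -> R[i]) (a b : R).

Definition re_inner f g : R := complex.Re (IC mu (fun x => f x * (g x)^*%C)).

Lemma re_inner_cint f g a b : L2b mu f a -> L2b mu g b -> cint mu (fun x => f x * (g x)^*%C).
Proof. by move=> fa gb; exact: L1b_cint (CS fa (L2b_conj gb)). Qed.

Lemma re_inner_le f g a b : L2b mu f a -> L2b mu g b -> `|re_inner f g| <= a * b.
Proof.
move=> fa gb; apply: le_trans (Re_le_nc _) _.
exact: L1b_IC (CS fa (L2b_conj gb)).
Qed.

Lemma ipC f g a b : L2b mu f a -> L2b mu g b -> re_inner f g = re_inner g f.
Proof.
move=> fa gb; rewrite /re_inner -cRe_conj -(IC_conj (re_inner_cint fa gb)).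
by congr complex.Re; apply: eq_IC => x; rewrite conjM conjcK mulrC.
Qed.

Lemma ipD f g k a b c : L2b mu f a -> L2b mu g b -> L2b mu k c ->
  re_inner (fun x => f x + g x) k = re_inner f k + re_inner g k.
Proof.
move=> fa gb kc; rewrite /re_inner -cReD -(ICD (re_inner_cint fa kc) (re_inner_cint gb kc)).
by congr complex.Re; apply: eq_IC => x; rewrite mulrDl.
Qed.

Lemma ipZ (h : R) f g a b : L2b mu f a -> L2b mu g b ->
  re_inner (fun x => h%:C * f x) g = h * re_inner f g.
Proof.
move=> fa gb; rewrite /re_inner (_ : IC mu _ = h%:C * IC mu (fun x => f x * (g x)^*%C)).
  by rewrite cReM mul0r subr0.
by rewrite -(ICZ _ (re_inner_cint fa gb)); apply: eq_IC => x; rewrite mulrA.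
Qed.

Lemma re_inner_sq f a : L2b mu f a -> 0 <= re_inner f f /\ L2b mu f (Num.sqrt (re_inner f f)).
Proof.
move=> fa; have i := re_inner_cint fa fa.
have E x : complex.Re (f x * (f x)^*%C) = nc (f x) ^+ 2 by rewrite mulrC mul_conjC.
have E2 : re_inner f f = \int[mu]_x (nc (f x) ^+ 2).
  by rewrite /re_inner /IC; apply: eq_Rintegral => x _; exact: E.
have [mf _ fb] := fa.
have i0 : (0 <= \int[mu]_x (nc (f x) ^+ 2)%:E)%E.
  by apply: integral_ge0 => x _; rewrite lee_fin sqr_ge0.
have p0 : 0 <= re_inner f f by rewrite E2 fine_ge0.
split; first exact: p0.
split; [exact: mf|exact: sqrtr_ge0|].
rewrite sqr_sqrtr// E2 /Rintegral fineK// ge0_fin_numE//.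
by apply: le_lt_trans fb _; rewrite ltry.
Qed.

Lemma re_inner_expand f k (h : R) a b : L2b mu f a -> L2b mu k b ->
  re_inner (fun x => f x + h%:C * k x) (fun x => f x + h%:C * k x) =
  re_inner f f + 2 * h * re_inner k f + h ^+ 2 * re_inner k k.
Proof.
move=> fa kb; have hk := L2bZ h%:C kb; have s := L2bD fa hk.
rewrite (ipD fa hk s) (ipZ h kb s) (ipC fa s) (ipC kb s).
rewrite (ipD fa hk fa) (ipZ h kb fa) (ipD fa hk kb) (ipZ h kb kb) (ipC fa kb).
ring.
Qed.

(** Differentiability in L^2 gives D(h) = D(0) + h k with k close to G, and the square is expanded.
    The predicate P keeps the increments in the domain, which makes the derivative one-sided at time
    0. *)
Lemma re_inner_deriv (P : R -> Prop) (D : R -> T -> R[i]) (G : T -> R[i]) a c :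
  L2b mu (D 0) a -> L2b mu G c ->
  (forall e, 0 < e -> exists2 r, 0 < r & forall h, h != 0 -> P h -> `|h| < r ->
    L2b mu (fun x => (h^-1)%:C * (D h x - D 0 x) - G x) e) ->
  forall e, 0 < e -> exists2 r, 0 < r & forall h, h != 0 -> P h -> `|h| < r ->
    `|h^-1 * (re_inner (D h) (D h) - re_inner (D 0) (D 0)) - 2 * re_inner G (D 0)| <= e.
Proof.
move=> Da Gc Dd e e0; have a0 := L2b_ge0 Da; have c0 := L2b_ge0 Gc.
(* The error is at most 2 e1 a + |h| (c + 1)^2; [e1] makes the first term at most e/2 and [c2] the
   second. *)
pose e1 := Num.min 1 (e / (4 * (a + 1))).
have e10 : 0 < e1 by rewrite lt_min ltr01 divr_gt0// mulr_gt0// ltr_wpDl.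
have e11 : e1 <= 1 by rewrite ge_min lexx.
have e1e : 4 * (e1 * a) <= e.
  apply: (@le_trans _ _ (e / (4 * (a + 1)) * (4 * (a + 1)))).
    rewrite mulrCA; apply: ler_pM; rewrite ?mulr_ge0 ?(ltW e10)//.
      by rewrite ge_min lexx orbT.
    by rewrite ler_wpM2l// lerDl.
  by rewrite divfK// gt_eqF// mulr_gt0// ltr_wpDl.
have [r r0 hr] := Dd e1 e10.
pose c2 := 2 * (c + 1) ^+ 2.
have c20 : 0 < c2 by rewrite mulr_gt0// exprn_gt0// ltr_wpDl.
exists (Num.min r (e / c2)); first by rewrite lt_min r0 divr_gt0.
move=> h h0 Ph; rewrite lt_min => /andP[hr' he].
have rb := hr h h0 Ph hr'; set r1 := (fun x => _) in rb.
pose k x := G x + r1 x.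
have kb : L2b mu k (c + e1) := L2bD Gc rb.
have hh : h%:C * (h^-1)%:C = 1 :> R[i] by rewrite -rcM mulfV.
have DE : D h = fun x => D 0 x + h%:C * k x.
  apply/funext => x; rewrite /k /r1 (addrC (G x)) subrK mulrA hh mul1r.
  by rewrite addrC subrK.
rewrite DE (re_inner_expand h Da kb) (ipD Gc rb Da).
have -> : h^-1 * (re_inner (D 0) (D 0) + 2 * h * (re_inner G (D 0) + re_inner r1 (D 0)) + h ^+ 2 * re_inner k k
    - re_inner (D 0) (D 0)) - 2 * re_inner G (D 0) = 2 * re_inner r1 (D 0) + h * re_inner k k by field.
apply: le_trans (ler_normD _ _) _; rewrite !normrM (ger0_norm (ler0n _ 2)).
have i1 := re_inner_le rb Da; have i2 := re_inner_le kb kb.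
have i3 : `|re_inner k k| <= (c + 1) ^+ 2.
  apply: le_trans i2 _; rewrite -expr2; apply: lerXn2r; rewrite ?nnegrE ?addr_ge0 ?(ltW e10)//.
  by rewrite lerD2l.
have i4 : `|h| * `|re_inner k k| <= e / 2.
  apply: (@le_trans _ _ (e / c2 * (c + 1) ^+ 2)); first by apply: ler_pM => //; exact: ltW.
  have cn : c + 1 != 0 by rewrite gt_eqF// ltr_wpDl.
  rewrite le_eqVlt; apply/orP; left; apply/eqP; rewrite /c2; field.
  by rewrite cn.
by move: i1 i4 e1e; move: (`|re_inner r1 _|) (`|h| * _) (e1 * a) => x1 x2 x3; lra.
Qed.

End InnerProduct.

(** * Gronwall's inequality and the energy of a difference *)

Section Gronwall.
Context {R : realType}.
Implicit Types (y z : R -> R) (t h e K : R).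

Lemma is_derive_eps y l t :
  (forall e, 0 < e -> exists2 r, 0 < r & forall h, h != 0 -> `|h| < r ->
    `|h^-1 * (y (t + h) - y t) - l| <= e) -> is_derive t 1 y l.
Proof.
move=> H.
have C : h^-1 *: (y (h *: (1 : R^o) + t) - y t) @[h --> 0^'] --> l.
  apply/cvgrPdist_le => e e0; apply/near0P; have [r r0 hr] := H e e0.
  exists r => // h h0 hlt; rewrite distrC (_ : h *: (1 : R^o) = h) ?(addrC h)//.
    exact: hr.
  by rewrite /GRing.scale /= mulr1.
by split; [apply/cvg_ex; exists l|exact/cvg_lim].
Qed.

(** The function exp(-K x) y(x) is nonincreasing on ]0, s[. Differentiability is assumed at positive
    times, so the vanishing at time 0 is expressed by smallness to the right of 0. *)
Lemma gronwall0 y z K s : 0 <= K -> (forall t, 0 < t -> is_derive t 1 y (z t)) ->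
  (forall t, 0 < t < s -> z t <= K * y t) -> (forall t, 0 <= y t) ->
  (forall e, 0 < e -> exists2 r, 0 < r & forall t, 0 < t < r -> y t <= e) ->
  forall t, 0 < t < s -> y t <= 0.
Proof.
move=> K0 yd zK y0 yr t /andP[t0 ts].
pose f (x : R) : R := expR (- K * x) * y x.
have fd (x : R) : 0 < x -> is_derive x 1 f (expR (- K * x) * (z x - K * y x)).
  move=> x0; have dy := yd x x0.
  have h : is_derive x 1 (fun x : R => expR (- K * x)) (- K * expR (- K * x)).
    by apply: is_derive_eq; rewrite /GRing.scale /= mulr1 mulrC.
  apply: (is_derive_eq (is_deriveM h dy)); rewrite /GRing.scale /=; ring.
have mono (x : R) : 0 < x -> x <= t -> f t <= f x.
  move=> x0 xt.
  have xs := le_lt_trans xt ts.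
  apply: (@ler0_derive1_le_oo _ f 0 s); rewrite ?in_itv/= ?x0 ?t0 ?xs ?ts//.
  - by move=> u; rewrite in_itv/= => /andP[u0 _]; have := fd u u0; case.
  - move=> u; rewrite in_itv/= => /andP[u0 us]; rewrite derive1E.
    have [_ ->] := fd u u0; rewrite pmulr_rle0 ?expR_gt0// subr_le0 zK//.
    by rewrite u0.
  - move=> u; rewrite inE/= in_itv/= => /andP[u0 us].
    by apply: differentiable_continuous; apply/derivable1_diffP; have := fd u u0; case.
have ft e : 0 < e -> f t <= e.
  move=> e0; have [r r0 hr] := yr e e0.
  pose x := Num.min t (r / 2).
  have x0 : 0 < x by rewrite lt_min t0 divr_gt0.
  have xt : x <= t by rewrite ge_min lexx.
  apply: le_trans (mono x x0 xt) _.
  have xr : x < r by rewrite gt_min (_ : r / 2 < r) ?orbT//; lra.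
  apply: (@le_trans _ _ (1 * y x)); last by rewrite mul1r hr// x0.
  by rewrite ler_wpM2r// -expR0 ler_expR mulNr oppr_le0 mulr_ge0// ltW.
have : f t <= 0 by apply/ler_addgt0Pr => e e0; rewrite add0r; exact: ft.
by rewrite /f pmulr_rle0 ?expR_gt0.
Qed.

End Gronwall.

Section Uniqueness.
Context {R : realType}.
Notation leb := (@leb3 R).
Implicit Types (f g : R3 R -> R[i]) (W dW : R -> R3 R -> R[i]) (s t h e : R).

(** Continuity bounds the norm near each time by its value there plus 1; compactness of [0, s] makes
    the bound uniform. No decay of the solution is assumed. *)
Lemma sob_bounded N W s : 0 <= s -> continuous_in_sobolev N W ->
  exists m, forall t, 0 <= t <= s -> HB N (fourier (W t)) m.
Proof.
move=> s0 Wc.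
have W2 t : 0 <= t -> (exists b, L2b leb (W t) b) /\ exists a, HB N (fourier (W t)) a.
  by move=> t0; apply/in_sobolevP; have [] := Wc t t0.
have cov := (compact_near_coveringP _).1 (@segment_compact R 0 s).
have h (t : R) : `[0, s]%classic t -> \forall t' \near t & m \near +oo%R,
    0 <= t' -> HB N (fourier (W t')) m.
  rewrite /= in_itv/= => /andP[t0 _]; have [[b tb] [a ta]] := W2 t t0.
  have [_ /fine_cvgP[]] := Wc t t0.
  rewrite near_withinE => /near_distP[r1 r10 h1] /cvgrPdist_lt/(_ 1 ltr01).
  rewrite near_withinE => /near_distP[r2 r20 h2].
  have H : exists2 r, 0 < r & forall t', `|t' - t| < r -> forall m, a + 1 <= m -> 0 <= t' ->
      HB N (fourier (W t')) m.
    exists (Num.min r1 r2); first by rewrite lt_min r10.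
    move=> t'; rewrite lt_min => /andP[d1 d2] m am t'0.
    have [[b' tb'] _] := W2 t' t'0; have db := L2bB tb' tb.
    have fn := h1 t' d1 t'0; have := h2 t' d2 t'0 => /=.
    rewrite sub0r normrN ger0_norm ?fine_ge0 ?sob_ge0// => /ltW le1.
    have D : HB N (fourier (W t' \- W t)) 1.
      by apply/(sob_le N db) => //; rewrite -(fineK fn) lee_fin.
    apply: HB_le am; apply: (HB_ae (HBD ta D)); first exact: L2b_cmeas (F_norm tb').
    by apply: filterS (F_B tb' tb) => x E; rewrite [fourier (W t' \- W t) x]E addrC subrK.
  have [r r0 hr] := H; exists ([set t' | `|t' - t| < r], [set m | a + 1 <= m]).
    split; first by apply/near_distP; exists r.
    by apply: nbhs_pinfty_ge; exact: num_real.
  by move=> [t' m] [/= h3 h4]; exact: hr.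
have [m hm] := filter_ex (cov _ _ _ _ h).
by exists m => t t0s; apply: hm; [rewrite /= in_itv|case/andP: t0s].
Qed.

Lemma deriv_L2 s W dW : 0 <= s -> (forall t, 0 <= t -> exists b, L2b leb (W t) b) ->
  (forall t, 0 <= t -> exists b, L2b leb (dW t) b) -> derivative_in_sobolev s W dW ->
  forall t e, 0 <= t -> 0 < e -> exists2 r, 0 < r & forall h, h != 0 -> 0 <= t + h -> `|h| < r ->
    L2b leb (fun xi => (h^-1)%:C * (fourier (W (t + h)) xi - fourier (W t) xi) - fourier (dW t) xi) e.
Proof.
move=> s0 W2 dW2 Wd t e t0 e0; have [a ta] := W2 t t0; have [c tc] := dW2 t t0.
pose q h x := (h^-1)%:C * (W (t + h) x - W t x) - dW t x.
have L h : 0 <= t + h -> exists b, L2b leb (q h) b.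
  by move=> h0; have [b tb] := W2 _ h0; eexists; exact: L2bB (L2bZ _ (L2bB tb ta)) tc.
have := Wd t t0.
have M : \forall h \near within [set h | 0 <= t + h] 0^',
    cmeas (fun xi => (w s xi)%:C * fourier (q h) xi).
  rewrite near_withinE; apply/near0P; exists 1 => // h _ _ h0; have [b Lb] := L h h0.
  by apply: cmeas_wM; exact: L2b_cmeas (F_norm Lb).
move=> /(LnormC2_cvg0 _ M)/(_ e e0); rewrite near_withinE => /near0P[r r0 hr].
exists r => // h h0 th hlt; have [b hb] := W2 _ th; have [l Lb] := L h th.
have := HB_L2 s0 (hr h h0 hlt th) => Q; apply: (L2b_ae_eq Q).
  apply: cmeasB; last exact: L2b_cmeas (F_norm tc).
  apply: cmeasM; first exact: cmeas_cst.
  exact: cmeasB (L2b_cmeas (F_norm hb)) (L2b_cmeas (F_norm ta)).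
apply: filterS (filterI (F_B (L2bZ (h^-1)%:C (L2bB hb ta)) tc)
  (filterI (F_Z (h^-1)%:C (L2bB hb ta)) (F_B hb ta))).
move=> x [E1 [E2 E3]]; apply: esym.
have alg (k p p' p1 r1 r2 c1 : R[i]) : p = p1 - c1 -> p1 = k * r1 -> r1 = r2 -> p' = c1 ->
  p = k * r2 - p' by move=> -> -> -> ->.
exact: (alg _ _ _ _ _ _ _ E1 E2 E3 (erefl _)).
Qed.

Variables (au bu cu av bv cv : R[i]) (N : R).
Let al := coef2 au av.
Let be := coef2 bu bv.
Let ga := coef2 cu cv.
Hypothesis N2 : 2 <= N.

Let N0 : 0 <= N. Proof. exact: le_trans (ler0n R 2) N2. Qed.
Let N1 : 0 <= N - 1. Proof. by have := N2; lra. Qed.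

Definition sol_pair (U dU : bool -> R -> R3 R -> R[i]) : Prop :=
  [/\ forall b, continuous_in_sobolev N (U b), forall b, C1_in_sobolev (N - 1) (U b) (dU b)
    & solves_system au bu cu av bv cv (U false) (U true) (dU false) (dU true)].

Lemma cauchy_sol_pair u0 v0 u v : cauchy_solution au bu cu av bv cv N u0 v0 u v ->
  exists dU, sol_pair (fun b => if b then v else u) dU.
Proof.
move=> [uc vc _ [du [dv [u1 v1 S]]]]; exists (fun b => if b then dv else du).
by split; [case|case|exact: S].
Qed.

Lemma sol_pair_L2 U dU b t : sol_pair U dU -> 0 <= t ->
  [/\ exists a, L2b leb (U b t) a, exists a, HB N (fourier (U b t)) a
    & exists a, L2b leb (dU b t) a].
Proof.
move=> [Uc U1 _] t0; have [/in_sobolevP[h1 h2] _] := Uc b t t0.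
by have [_ Dc _] := U1 b; have [/in_sobolevP[h3 _] _] := Dc t t0.
Qed.

Lemma sol_pair_eq U dU t : sol_pair U dU -> 0 <= t ->
  {ae leb, forall xi,
    fourier (dU false t) xi = - ('i%C * (norm3 xi)%:C * fourier (U true t) xi)
      + Bil al be ga false (fun c => fourier (U c t)) (fun c => fourier (U c t)) xi /\
    fourier (dU true t) xi = - ('i%C * (norm3 xi)%:C * fourier (U false t) xi)
      - fourier (U true t) xi
      + Bil al be ga true (fun c => fourier (U c t)) (fun c => fourier (U c t)) xi}.
Proof.
move=> S t0; have h b := sol_pair_L2 b S t0.
have [p Up] : exists p, forall b, L2b leb (U b t) (p b).
  have [[p0 ?] _ _] := h false; have [[p1 ?] _ _] := h true.
  by exists (fun b => if b then p1 else p0); case.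
have [a Ua] : exists a, forall b, HB N (fourier (U b t)) (a b).
  have [_ [p0 ?] _] := h false; have [_ [p1 ?] _] := h true.
  by exists (fun b => if b then p1 else p0); case.
have Q b := fourier_quadratic_Bil au bu cu av bv cv b N2 (F := fun c => U c t) Up Ua.
have [_ _ /(_ t t0) sys] := S.
apply: filterS (filterI sys (filterI (Q false) (Q true))) => xi [[E1 E2] [E3 E4]].
have alg1 (x y z : R[i]) : x + y = z -> x = - y + z by move=> <-; rewrite addrC addrK.
have alg2 (x y z q : R[i]) : x + y + q = z -> x = - y - q + z by move=> <-; ring.
by split; [exact: (alg1 _ _ _ (etrans E1 E3))|exact: (alg2 _ _ _ _ (etrans E2 E4))].
Qed.

Section Energy.
Variables (U dU U' dU' : bool -> R -> R3 R -> R[i]).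
Hypotheses (S : sol_pair U dU) (S' : sol_pair U' dU').

Let D b t xi : R[i] := fourier (U b t) xi - fourier (U' b t) xi.
Let G b t xi : R[i] := fourier (dU b t) xi - fourier (dU' b t) xi.
Let y t : R := re_inner leb (D false t) (D false t) + re_inner leb (D true t) (D true t).
Let z t : R := 2 * (re_inner leb (G false t) (D false t) + re_inner leb (G true t) (D true t)).

Let D2 b t : 0 <= t -> exists a, L2b leb (D b t) a.
Proof.
move=> t0; have [[a ha] _ _] := sol_pair_L2 b S t0; have [[c hc] _ _] := sol_pair_L2 b S' t0.
by eexists; exact: L2bB (F_norm ha) (F_norm hc).
Qed.

Let G2 b t : 0 <= t -> exists a, L2b leb (G b t) a.
Proof.
move=> t0; have [_ _ [a ha]] := sol_pair_L2 b S t0; have [_ _ [c hc]] := sol_pair_L2 b S' t0.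
by eexists; exact: L2bB (F_norm ha) (F_norm hc).
Qed.

Let D_deriv b t e : 0 <= t -> 0 < e -> exists2 r, 0 < r & forall h, h != 0 -> 0 <= t + h ->
  `|h| < r -> L2b leb (fun xi => (h^-1)%:C * (D b (t + h) xi - D b t xi) - G b t xi) e.
Proof.
move=> t0 e0; have e2 : 0 < e / 2 by rewrite divr_gt0.
have H V dV : sol_pair V dV -> exists2 r, 0 < r & forall h, h != 0 -> 0 <= t + h -> `|h| < r ->
    L2b leb (fun xi => (h^-1)%:C * (fourier (V b (t + h)) xi - fourier (V b t) xi)
      - fourier (dV b t) xi) (e / 2).
  move=> SV; have [_ V1 _] := SV; have [_ _ Vd] := V1 b.
  apply: (deriv_L2 N1 _ _ Vd t0 e2) => r r0; by have [] := sol_pair_L2 b SV r0.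
have [r1 r10 h1] := H _ _ S; have [r2 r20 h2] := H _ _ S'.
exists (Num.min r1 r2); first by rewrite lt_min r10.
move=> h h0 th; rewrite lt_min => /andP[d1 d2].
have := L2bB (h1 h h0 th d1) (h2 h h0 th d2); rewrite -splitr; congr L2b.
apply/funext => xi.
have alg (k a1 a2 a3 b1 b2 b3 : R[i]) :
  (k * (a1 - a2) - a3) - (k * (b1 - b2) - b3) = k * ((a1 - b1) - (a2 - b2)) - (a3 - b3) by ring.
exact: alg.
Qed.

Let y_deriv t e : 0 <= t -> 0 < e -> exists2 r, 0 < r & forall h, h != 0 -> 0 <= t + h ->
  `|h| < r -> `|h^-1 * (y (t + h) - y t) - z t| <= e.
Proof.
move=> t0 e0; have e2 : 0 < e / 2 by rewrite divr_gt0.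
have H b : exists2 r, 0 < r & forall h, h != 0 -> 0 <= t + h -> `|h| < r ->
    `|h^-1 * (re_inner leb (D b (t + h)) (D b (t + h)) - re_inner leb (D b t) (D b t))
      - 2 * re_inner leb (G b t) (D b t)| <= e / 2.
  have [a Da] := D2 b t0; have [c Gc] := G2 b t0.
  have := @re_inner_deriv _ _ _ leb (fun h => 0 <= t + h) (fun h => D b (t + h)) (G b t) a c.
  rewrite addr0 => /(_ Da Gc)/(_ _ (e / 2) e2); apply=> e' e'0; exact: D_deriv.
have [r1 r10 h1] := H false; have [r2 r20 h2] := H true.
exists (Num.min r1 r2); first by rewrite lt_min r10.
move=> h h0 th; rewrite lt_min => /andP[d1 d2].
have alg (k a1 a2 a3 b1 b2 b3 : R) : `|k * (a1 - a2) - 2 * a3| <= e / 2 ->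
    `|k * (b1 - b2) - 2 * b3| <= e / 2 -> `|k * ((a1 + b1) - (a2 + b2)) - 2 * (a3 + b3)| <= e.
  move=> l1 l2; have := lerD l1 l2; rewrite -splitr; apply: le_trans.
  apply: le_trans (ler_normD _ _).
  by rewrite le_eqVlt; apply/orP; left; apply/eqP; congr (`|_|); ring.
exact: (alg _ _ _ _ _ _ _ (h1 h h0 th d1) (h2 h h0 th d2)).
Qed.

Let y0 t : 0 <= t -> 0 <= y t.
Proof.
move=> t0; have [a ha] := D2 false t0; have [c hc] := D2 true t0.
exact: (addr_ge0 (re_inner_sq ha).1 (re_inner_sq hc).1).
Qed.

Let Dy b t : 0 <= t -> L2b leb (D b t) (Num.sqrt (y t)).
Proof.
move=> t0; have [a ha] := D2 b t0; apply: L2b_le (re_inner_sq ha).2 _.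
rewrite ler_sqrt; last exact: y0.
have [c hc] := D2 (~~ b) t0; have := (re_inner_sq hc).1.
by rewrite /y; case: (b) => h; [rewrite lerDr|rewrite lerDl].
Qed.

(** In the real part the off-diagonal terms in i|xi| cancel and the damping is nonpositive. There
    remains the difference of the quadratic terms, bounded in L^2 with the difference in one slot
    and an H^N bound in the other. *)
Let z_le m t : 0 <= t -> (forall b, HB N (fourier (U b t)) m) ->
  (forall b, HB N (fourier (U' b t)) m) -> z t <= 8 * bC al be ga N * m * y t.
Proof.
have algle (x1 x2 x3 x4 : R) : x1 <= x4 -> x2 <= x4 -> 0 <= x3 -> 2 * (x1 + x2 - x3) <= 2 * (2 * x4).
  lra.
move=> t0 Um Um'; set q := Num.sqrt (y t).
have qq : q * q = y t by rewrite -expr2 sqr_sqrtr ?y0.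
have Dq c : L2b leb (D c t) q by exact: Dy.
pose P c := fourier (U c t); pose P' c := fourier (U' c t).
pose n b xi := Bil al be ga b (fun c => D c t) P xi + Bil al be ga b P' (fun c => D c t) xi.
have nb b : L2b leb (n b) (2 * bC al be ga N * m * q).
  have := L2bD (Bil_L2r al be ga b N2 Dq Um) (Bil_L2l al be ga b N2 Um' Dq).
  by rewrite (_ : _ + _ = 2 * bC al be ga N * m * q); last by ring.
have nE b xi : Bil al be ga b P P xi - Bil al be ga b P' P' xi = n b xi.
  exact: (Bil_sub al be ga b xi (fun c => HB_L2 N0 (Um c)) (fun c => HB_L2 N0 (Um' c))).
have [g0 hg0] := G2 false t0; have [g1 hg1] := G2 true t0.
have iG0 := re_inner_cint hg0 (Dq false); have iG1 := re_inner_cint hg1 (Dq true).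
have in0 := re_inner_cint (nb false) (Dq false); have in1 := re_inner_cint (nb true) (Dq true).
have iD := re_inner_cint (Dq true) (Dq true).
have E : re_inner leb (G false t) (D false t) + re_inner leb (G true t) (D true t) =
  re_inner leb (n false) (D false t) + re_inner leb (n true) (D true t) - re_inner leb (D true t) (D true t).
  have iA := cintD iG0 iG1; have iB := cintB (cintD in0 in1) iD.
  (* Only the real part of the integrand vanishes, so the integrand is replaced by its real part
     before the system is used pointwise. *)
  have : complex.Re (IC leb (fun xi =>
      (G false t xi * (D false t xi)^*%C + G true t xi * (D true t xi)^*%C) -
      (n false xi * (D false t xi)^*%C + n true xi * (D true t xi)^*%C
        - D true t xi * (D true t xi)^*%C))) = 0.
    have iC := cintB iA iB; have [mC _] := iC.
    transitivity (complex.Re (IC leb (fun xi : R3 R => (0 : R[i])))); last by rewrite IC0.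
    transitivity (complex.Re (IC leb (fun xi => (complex.Re (
      (G false t xi * (D false t xi)^*%C + G true t xi * (D true t xi)^*%C) -
      (n false xi * (D false t xi)^*%C + n true xi * (D true t xi)^*%C
        - D true t xi * (D true t xi)^*%C)))%:C))); first by [].
    congr complex.Re; apply: ae_eq_IC; [by apply: cmeas_real; case: mC|exact: cmeas_cst|].
    apply: filterS (filterI (sol_pair_eq S t0) (sol_pair_eq S' t0)) => xi [[E1 E2] [E3 E4]].
    have alg (k : R) (f0 f1 h0 h1 B0 B1 C0 C1 n0 n1 d0 d1 a1 a2 a3 a4 : R[i]) :
        f0 = - ('i%C * k%:C * a2) + B0 -> f1 = - ('i%C * k%:C * a1) - a2 + B1 ->
        h0 = - ('i%C * k%:C * a4) + C0 -> h1 = - ('i%C * k%:C * a3) - a4 + C1 ->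
        B0 - C0 = n0 -> B1 - C1 = n1 -> a1 - a3 = d0 -> a2 - a4 = d1 ->
        (complex.Re (((f0 - h0) * d0^*%C + (f1 - h1) * d1^*%C) -
          (n0 * d0^*%C + n1 * d1^*%C - d1 * d1^*%C)))%:C = 0 :> R[i].
      move=> -> -> -> -> <- <- <- <-.
      case: a1 a2 a3 a4 B0 B1 C0 C1 => [r1 i1] [r2 i2] [r3 i3] [r4 i4] [x1 y1] [x2 y2] [x3 y3] [x4 y4].
      rewrite (_ : complex.Re _ = 0)//=; ring.
    exact: (alg _ _ _ _ _ _ _ _ _ _ _ _ _ _ _ _ _ E1 E2 E3 E4 (nE false xi) (nE true xi)
      (erefl _) (erefl _)).
  rewrite (ICB iA iB) (ICD iG0 iG1) (ICB (cintD in0 in1) iD) (ICD in0 in1).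
  by rewrite cReD cReN cReD (cReD (_ + _)) cReD cReN => /eqP; rewrite subr_eq0 => /eqP.
rewrite /z E.
have i0 := le_trans (ler_norm _) (re_inner_le (nb false) (Dq false)).
have i1 := le_trans (ler_norm _) (re_inner_le (nb true) (Dq true)).
have i2 := (re_inner_sq (Dq true)).1.
rewrite (_ : 8 * _ * m * y t = 2 * (2 * (2 * bC al be ga N * m * q * q))); last first.
  by rewrite -qq; ring.
exact: (algle _ _ _ _ i0 i1 i2).
Qed.

(** The energy [y] is the squared L^2 norm of the difference of the transforms; once it vanishes,
    injectivity of [fourier] concludes. *)
Lemma sol_pair_unique : (forall b, {ae leb, forall x, U b 0 x = U' b 0 x}) ->
  forall b t, 0 <= t -> {ae leb, forall x, U b t x = U' b t x}.
Proof.
move=> U0 b t t0.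
have y00 : y 0 = 0.
  have Dz c : re_inner leb (D c 0) (D c 0) = 0.
    have [[p Up] _ _] := sol_pair_L2 c S (lexx 0); have [[p' Up'] _ _] := sol_pair_L2 c S' (lexx 0).
    have [a Da] := D2 c (lexx 0).
    have L : L2b leb (D c 0) 0.
      apply: (L2b_ae_eq (@L2b0 _ _ _ leb)); first exact: L2b_cmeas Da.
      by apply: filterS (F_ext Up (L2b_cmeas Up') (U0 c)) => x E; rewrite /D E subrr.
    by apply/eqP; rewrite -normr_eq0 eq_le normr_ge0 (le_trans (re_inner_le L L))// mulr0.
  exact: (etrans (congr2 +%R (Dz false) (Dz true)) (addr0 0)).
suff yt : y t <= 0.
  have y_0 : y t = 0 by apply/eqP; rewrite eq_le yt y0.
  have := Dy b t0; rewrite y_0 sqrtr0 => /L2b_eq0 H.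
  have [[p Up] _ _] := sol_pair_L2 b S t0; have [[p' Up'] _ _] := sol_pair_L2 b S' t0.
  by apply: (F_inj Up Up'); apply: filterS H => x /eqP; rewrite subr_eq0 => /eqP.
move: t0; rewrite le_eqVlt => /orP[/eqP<-|t0]; first by rewrite y00.
(* The bounds are taken up to t + 1 because Gronwall's lemma concludes on an open interval, which
   has to contain t. *)
have t10 : 0 <= t + 1 by rewrite addr_ge0// ltW.
have [m [m0 Um Um']] : exists m, [/\ 0 <= m, forall c r, 0 <= r <= t + 1 -> HB N (fourier (U c r)) m
    & forall c r, 0 <= r <= t + 1 -> HB N (fourier (U' c r)) m].
  have alg (m1 m2 m3 m4 : R) : 0 <= m1 -> 0 <= m2 -> 0 <= m3 -> 0 <= m4 ->
      [/\ m1 <= m1 + m2 + m3 + m4, m2 <= m1 + m2 + m3 + m4, m3 <= m1 + m2 + m3 + m4,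
        m4 <= m1 + m2 + m3 + m4 & 0 <= m1 + m2 + m3 + m4] by move=> *; split; lra.
  have [Uc _ _] := S; have [Uc' _ _] := S'.
  have [m1 h1] := sob_bounded t10 (Uc false); have [m2 h2] := sob_bounded t10 (Uc true).
  have [m3 h3] := sob_bounded t10 (Uc' false); have [m4 h4] := sob_bounded t10 (Uc' true).
  have r0 : (0 : R) <= 0 <= t + 1 := introT andP (conj (lexx 0) t10).
  have m10 := HB_ge0 (h1 _ r0); have m20 := HB_ge0 (h2 _ r0).
  have m30 := HB_ge0 (h3 _ r0); have m40 := HB_ge0 (h4 _ r0).
  have [l1 l2 l3 l4 l0] := alg _ _ _ _ m10 m20 m30 m40.
  exists (m1 + m2 + m3 + m4); split; first exact: l0.
    by case=> r hr; [exact: HB_le (h2 r hr) l2|exact: HB_le (h1 r hr) l1].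
  by case=> r hr; [exact: HB_le (h4 r hr) l4|exact: HB_le (h3 r hr) l3].
(* Truncation at negative times makes [y] nonnegative everywhere. *)
pose yy r := if 0 <= r then y r else 0.
have -> : y t = yy t by rewrite /yy ltW.
apply: (@gronwall0 _ yy z (8 * bC al be ga N * m) (t + 1)).
- by rewrite mulr_ge0// mulr_ge0// bC_ge0.
- move=> r r0; apply: is_derive_eps => e e0; have [d d0 hd] := y_deriv (ltW r0) e0.
  exists (Num.min d r); first by rewrite lt_min d0.
  move=> h h0; rewrite lt_min => /andP[hd1 hr].
  have rh : 0 <= r + h by move: hr; rewrite ltr_norml => /andP[] h1 _; lra.
  by rewrite /yy rh (ltW r0); exact: hd.
- move=> r /andP[r0 rt]; rewrite /yy (ltW r0).
  have ri : 0 <= r <= t + 1 by rewrite (ltW r0) (ltW rt).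
  apply: z_le; [exact: ltW|by move=> c; exact: Um|by move=> c; exact: Um'].
- by move=> r; rewrite /yy; case: ifP => // ?; exact: y0.
(* Near 0 the one-sided derivative gives y(r) <= (|z(0)| + 1) r, as y(0) = 0. *)
- move=> e e0; have [d d0 hd] := y_deriv (lexx 0) ltr01.
  have z0 : 0 < `|z 0| + 1 by rewrite ltr_wpDl.
  exists (Num.min d (e / (`|z 0| + 1))); first by rewrite lt_min d0 divr_gt0.
  move=> r /andP[r0]; rewrite lt_min => /andP[rd]; rewrite ltr_pdivlMr// => re.
  rewrite /yy (ltW r0); have := hd r (lt0r_neq0 r0).
  rewrite add0r y00 subr0 (ltW r0) (gtr0_norm r0) => /(_ isT rd) H.
  have : r^-1 * y r <= `|z 0| + 1.
    rewrite addrC -lerBlDr; exact: le_trans (le_trans (lerB (ler_norm _) (lexx _)) (lerB_dist _ _)) H.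
  by rewrite mulrC ler_pdivrMr// => /le_trans; apply; rewrite mulrC ltW.
- by rewrite t0/= ltrDl ltr01.
Qed.

End Energy.

Lemma cauchy_unique u0 v0 u v u' v' :
  cauchy_solution au bu cu av bv cv N u0 v0 u v ->
  cauchy_solution au bu cu av bv cv N u0 v0 u' v' ->
  forall t, 0 <= t -> {ae leb, forall x, u' t x = u t x /\ v' t x = v t x}.
Proof.
move=> C C' t t0; have [dU S] := cauchy_sol_pair C; have [dU' S'] := cauchy_sol_pair C'.
have [_ _ I _] := C; have [_ _ I' _] := C'.
have H b : {ae leb, forall x, (if b then v' else u') 0 x = (if b then v else u) 0 x}.
  by apply: filterS (filterI I I') => x [[E1 E2] [E3 E4]]; case: (b); rewrite ?E1 ?E2 ?E3 ?E4.
have h b := sol_pair_unique S' S H b t0.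
by apply: filterS (filterI (h false) (h true)) => x [].
Qed.

End Uniqueness.

Lemma phi_rate (R : realType) (t : R) n : 0 < t -> phi t ^+ n <= t `^ (- (n%:R / 4)).
Proof.
move=> t0; rewrite phi_X ger0_norm ?(ltW t0)// !powRN lef_pV2 ?posrE ?powR_gt0 ?addr_gt0//.
by apply: ge0_ler_powR; rewrite ?nnegrE ?addr_ge0 ?divr_ge0 ?(ltW t0)// lerDr.
Qed.

Close Scope classical_set_scope.
Unset Implicit Arguments.
Set Strict Implicit.

Theorem theorem2p14 (R : realType) (au bu cu av bv cv : R[i]) (N : R) (hN : 5 / 2 < N) :
  exists eps C : R, [/\ 0 < eps, 0 < C &
    forall u0 v0 : R3 R -> R[i],
      in_sobolev N u0 -> in_sobolev N v0 ->
      (data_size N u0 v0 <= eps%:E)%E ->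
      exists u v : R -> R3 R -> R[i],
        [/\ cauchy_solution au bu cu av bv cv N u0 v0 u v,
            forall u' v' : R -> R3 R -> R[i],
              cauchy_solution au bu cu av bv cv N u0 v0 u' v' ->
              forall t : R, 0 <= t ->
                {ae lebesgue3 R, forall x : R3 R, u' t x = u t x /\ v' t x = v t x}
          & forall t : R, 0 < t ->
              (sobolev_norm N (u t) <= (C * t `^ (- (3 / 4)))%:E * data_size N u0 v0)%E /\
              (sobolev_norm N (v t) <= (C * t `^ (- (5 / 4)))%:E * data_size N u0 v0)%E]].
Proof.
have N2 : 2 <= N by lra.
(* The smallness condition of the iteration reads k E <= 1, with E the size of the data. *)
set k := 16 * dC N * bC (coef2 au av) (coef2 bu bv) (coef2 cu cv) N * (4 * sC N).
have s0 : 0 <= 4 * sC N := mulr_ge0 (ler0n R 4) (sC_ge0 N).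
have k0 : 0 <= k :=
  mulr_ge0 (mulr_ge0 (mulr_ge0 (ler0n R 16) (dC_ge0 N)) (bC_ge0 _ _ _ N)) s0.
have k1 : 0 < k + 1 by rewrite ltr_wpDl.
(* Adding 1 keeps both constants positive; [4 * sC N] is the amplitude that the iteration gives per
   unit of data. *)
exists (k + 1)^-1, (4 * sC N + 1); split; [by rewrite invr_gt0|by rewrite ltr_wpDl|].
move=> u0 v0 hu hv hE.
have L0 (f : R3 R -> R[i]) : (0 <= LnormC 1%:E f)%E by exact: Lnorm_ge0.
have S0 f : (0 <= sobolev_norm N f)%E := sob_ge0 N f.
have D0 : (0 <= data_size N u0 v0)%E by rewrite le_max adde_ge0 ?L0.
have Df : (data_size N u0 v0 \is a fin_num)%E.
  by rewrite ge0_fin_numE// (le_lt_trans hE)// ltry.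
set E := fine (data_size N u0 v0).
have DE : data_size N u0 v0 = E%:E by rewrite fineK.
have E0 : 0 <= E by rewrite fine_ge0.
have EE : E <= (k + 1)^-1 by rewrite -lee_fin -DE.
have h1 : (LnormC 1%:E u0 + LnormC 1%:E v0 <= E%:E)%E by rewrite -DE le_max lexx.
have h2 : (sobolev_norm N u0 + sobolev_norm N v0 <= E%:E)%E by rewrite -DE le_max lexx orbT.
have u0E : (LnormC 1%:E u0 <= E%:E)%E by apply: le_trans h1; rewrite leeDl.
have v0E : (LnormC 1%:E v0 <= E%:E)%E by apply: le_trans h1; rewrite leeDr.
have u0S : (sobolev_norm N u0 <= E%:E)%E by apply: le_trans h2; rewrite leeDl.
have v0S : (sobolev_norm N v0 <= E%:E)%E by apply: le_trans h2; rewrite leeDr.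
have small : 16 * dC N * bC (coef2 au av) (coef2 bu bv) (coef2 cu cv) N * (4 * sC N * E) <= 1.
  rewrite mulrA -/k; apply: (@le_trans _ _ (k * (k + 1)^-1)); first by rewrite ler_wpM2l.
  by rewrite ler_pdivrMr// mul1r lerDl.
have cs := sol_cauchy N2 E0 small hu hv u0E v0E u0S v0S.
exists (sol au bu cu av bv cv u0 v0 false), (sol au bu cu av bv cv u0 v0 true).
split; [exact: cs|by move=> u' v'; exact: cauchy_unique N2 _ _ _ _ _ _ cs|].
move=> t t0.
(* The two bounds are one statement, since [rate b] is 3 for u and 5 for v; [phi_rate] replaces 1 +
   t by t. *)
have B b : (sobolev_norm N (sol au bu cu av bv cv u0 v0 b t) <=
    ((4 * sC N + 1) * t `^ (- ((rate b)%:R / 4)))%:E * data_size N u0 v0)%E.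
  apply: le_trans (sol_bound N2 E0 small hu hv u0E v0E u0S v0S b (ltW t0)) _.
  rewrite DE -EFinM lee_fin -[leLHS]mulrA (mulrC E) mulrA ler_wpM2r//.
  by apply: ler_pM; rewrite ?exprn_ge0 ?(ltW (phi_gt0 _)) ?lerDl ?phi_rate.
exact: (conj (B false) (B true)).
Qed.
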